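(* Let $1\le d<n$, $\Omega=\mathbb{T}^d\times\mathbb{R}^{n-d}$, let $a\in S^m(\Omega)$ with $m<0$, and let $A$ be the pseudo-differential operator $$Au(x)=\int_{\Omega^*}\int_\Omega a(x,y,\xi)e^{i(x-y)\cdot\xi}u(y)\,dy\,d\xi .$$ Suppose that for all $R>0$, $$\lim_{x,y\to\infty,\ |x-y|<R}\ \ \sup_{\xi\in\mathbb{R}^n,\ |\alpha|\le n+1}(1+|\xi|)^{|\alpha|+m}\,|\partial_\xi^\alpha a(x,y,\xi)|=0 .$$ Then $A:L^2(\Omega)\to L^2(\Omega)$ is compact.
   Context: $\mathbb{T}$ is the circle of period $2\pi$; $dy$ is the product of normalized Lebesgue measure on $\mathbb{T}^d$ and Lebesgue measure on $\mathbb{R}^{n-d}$. $\Omega^*=\mathbb{Z}^d\times\mathbb{R}^{n-d}$ is the dual group, with $d\xi$ the product of counting measure on $\mathbb{Z}^d$ and Lebesgue measure on $\mathbb{R}^{n-d}$. $|x-y|$ is the distance on $\Omega$, and $x\to\infty$ means that the $\mathbb{R}^{n-d}$ component goes to infinity; the limit means that for each $R$ the supremum of the displayed quantity over $x,y$ with $|x|,|y|\ge\varrho$ and $|x-y|<R$ tends to $0$ as $\varrho\to\infty$. An amplitude $a=a(x,y,\xi)\in C^\infty(\Omega\times\Omega\times\mathbb{R}^n)$ belongs to $S^m(\Omega)$ if for all multi-indices with $|\alpha|,|\beta|,|\gamma|\le n+1$, $$\sup_{x,y\in\Omega,\ \xi\in\mathbb{R}^n}(1+|\xi|)^{|\gamma|-m}|\partial_x^\alpha\partial_y^\beta\partial_\xi^\gamma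 a(x,y,\xi)|<\infty .$$ The operator $A$ is understood as $Au(x)=\int_\Omega K(x,y)u(y)\,dy$ with kernel $K(x,y)=\int_{\Omega^*}a(x,y,\xi)e^{i(x-y)\cdot\xi}\,d\xi$, an oscillatory sum-integral defined as a distribution on $\mathcal{S}(\Omega\times\Omega)$ (writing $e^{i(x-y)\cdot\xi}=(1+|\xi|^2)^{-N}(1-\Delta_x)^Ne^{i(x-y)\cdot\xi}$ with $N>n/2$ and transferring the $x$-derivatives to $a$ and the test function).
   Formalization: The kernel of A is regularized with N=(n+1)/2 for odd n but N=n/2 for even n, instead of N>n/2: for even n, N>n/2 needs n+2 x-derivatives of a, which S^m does not control; with N=n/2 the integral converges absolutely since m<0, and no case is lost. *)

(* Defs.v *)
From HB Require Import structures.
From mathcomp Require Import all_boot all_order all_algebra.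
From mathcomp Require Import complex.
From mathcomp Require Import all_classical all_reals all_analysis.

Set Implicit Arguments.
Unset Strict Implicit.
Unset Printing Implicit Defensive.
Import Order.TTheory GRing.Theory Num.Theory.
Import numFieldNormedType.Exports.
Local Open Scope classical_set_scope.
Local Open Scope ring_scope.
Local Open Scope complex_scope.

(* 'rV[R]_n carries the product Borel sigma-algebra, and [product_measure mu n]
   is the product of the sigma-finite measures mu 0, ..., mu (n - 1) on R. *)

Definition measure_rV_display : measure_display -> measure_display.
Proof. exact. Qed.

Section measurable_rV.
Variables (R : realType) (n : nat).

Let coords : 'I_n -> 'rV[R]_n -> measurableTypeR R := fun i x => x ord0 i.

Let rV_set0 : g_sigma_preimage coords set0.
Proof. exact: sigma_algebra0. Qed.

Let rV_setC A : g_sigma_preimage coords A -> g_sigma_preimage coords (~` A).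
Proof. exact: sigma_algebraC. Qed.

Let rV_bigcup (F : (set 'rV[R]_n)^nat) :
  (forall i, g_sigma_preimage coords (F i)) ->
  g_sigma_preimage coords (\bigcup_i (F i)).
Proof. exact: sigma_algebra_bigcup. Qed.

HB.instance Definition _ :=
  @isMeasurable.Build (measure_rV_display default_measure_display)
    'rV[R]_n (g_sigma_preimage coords) rV_set0 rV_setC rV_bigcup.

Lemma measurable_coord (i : 'I_n) :
  measurable_fun setT (fun x : 'rV[R]_n => x ord0 i : measurableTypeR R).
Proof.
move=> _ Y mY; rewrite setTI; apply: sub_sigma_algebra => /=.
rewrite -bigcup_seq/=; exists i => /=; first by rewrite mem_index_enum.
by exists Y => //; rewrite setTI.
Qed.

Lemma measurable_fun_rV d (T : measurableType d) (f : T -> 'rV[R]_n) :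
  (forall i, measurable_fun setT (fun t => f t ord0 i : measurableTypeR R)) ->
  measurable_fun setT f.
Proof.
move=> mf _ A mA; rewrite setTI.
have H : preimage_set_system setT f (g_sigma_preimage coords) `<=`
    (@measurable d T).
  rewrite -(g_sigma_preimage_comp coords f).
  apply: smallest_sub; first exact: sigma_algebra_measurable.
  rewrite -bigcup_seq => B [i _ [C mC <-]].
  exact: mf.
by apply: H; exists A => //; rewrite setTI.
Qed.

End measurable_rV.

Lemma sigma_finite_product d1 d2 (T1 : measurableType d1)
    (T2 : measurableType d2) (R : realType)
    (m1 : {sigma_finite_measure set T1 -> \bar R})
    (m2 : {sigma_finite_measure set T2 -> \bar R}) :
  sigma_finite setT (m1 \x m2)%E.
Proof.
have /sigma_finiteP[F [TF ndF Foo]] := sigma_finiteT m1.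
have /sigma_finiteP[G [TG ndG Goo]] := sigma_finiteT m2.
exists (fun n => F n `*` G n).
  rewrite -setXTT TF TG predeqE => -[x y]; split.
    move=> [/= [n _ Fnx] [k _ Gky]]; exists (maxn n k) => //; split.
    - by move: x Fnx; exact/subsetPset/ndF/leq_maxl.
    - by move: y Gky; exact/subsetPset/ndG/leq_maxr.
  by move=> [n _ []/= ? ?]; split; exists n.
move=> k; have [? ?] := Foo k; have [? ?] := Goo k.
split; first exact: measurableX.
by rewrite product_measure1E// lte_mul_pinfty// ge0_fin_numE.
Qed.

Section product_measure.
Variable R : realType.
Local Notation bR := (measurableTypeR R).

Definition rV_cons n (p : bR * 'rV[R]_n) : 'rV[R]_n.+1 :=
  row_mx (const_mx p.1 : 'rV_1) p.2.

Lemma rV_cons_head n (p : bR * 'rV[R]_n) : rV_cons p ord0 ord0 = p.1.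
Proof.
rewrite (_ : ord0 = @lshift 1 n ord0); last exact/val_inj.
by apply: etrans (row_mxEl _ _ _ _) _; rewrite mxE.
Qed.

Lemma rV_cons_tail n (p : bR * 'rV[R]_n) (j : 'I_n) :
  rV_cons p ord0 (lift ord0 j) = p.2 ord0 j.
Proof.
rewrite (_ : lift ord0 j = @rshift 1 n j); last exact/val_inj.
exact: row_mxEr.
Qed.

Lemma measurable_rV_cons n : measurable_fun setT (@rV_cons n).
Proof.
apply: measurable_fun_rV => i; case: (unliftP ord0 i) => [j|] ->.
- under eq_fun do rewrite rV_cons_tail.
  exact: measurableT_comp (measurable_coord j) measurable_snd.
- under eq_fun do rewrite rV_cons_head.
  exact: measurable_fst.
Qed.

Lemma measurable_rV_uncons n :
  measurable_fun setT
    (fun x : 'rV[R]_n.+1 => (x ord0 ord0 : bR, \row_j x ord0 (lift ord0 j))).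
Proof.
apply: measurable_fun_pair; first exact: measurable_coord.
apply: measurable_fun_rV => j.
rewrite (_ : (fun _ => _) = fun x : 'rV[R]_n.+1 => x ord0 (lift ord0 j) : bR).
  exact: measurable_coord.
by apply/funext => x /=; rewrite mxE.
Qed.

Section step.
Variables (n : nat) (m1 : {sigma_finite_measure set bR -> \bar R})
  (m2 : {sigma_finite_measure set 'rV[R]_n -> \bar R}).

Definition rV_cons_measure := pushforward (m1 \x m2)%E (@rV_cons n).

Let step0 : rV_cons_measure set0 = 0%E.
Proof. by rewrite /rV_cons_measure /pushforward preimage_set0 measure0. Qed.

Let step_ge0 A : (0 <= rV_cons_measure A)%E.
Proof. exact: (measure_ge0 (m1 \x m2)%E). Qed.

Let step_sigma_additive : semi_sigma_additive rV_cons_measure.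
Proof.
move=> F mF tF mUF; rewrite /rV_cons_measure /pushforward preimage_bigcup.
have mcons A : measurable A -> measurable (@rV_cons n @^-1` A).
  by move=> mA; rewrite -[X in measurable X]setTI; exact: measurable_rV_cons.
apply: measure_semi_sigma_additive.
- by move=> k; exact: mcons.
- apply/trivIsetP => i j _ _ ij; rewrite -preimage_setI.
  by move/trivIsetP : tF => /(_ _ _ _ _ ij) ->//; rewrite preimage_set0.
- by rewrite -preimage_bigcup; exact: mcons.
Qed.

HB.instance Definition _ := isMeasure.Build _ _ _ rV_cons_measure
  step0 step_ge0 step_sigma_additive.

Let step_sigma_finite : sigma_finite setT rV_cons_measure.
Proof.
have [F FT mF] := sigma_finite_product m1 m2.
pose u (x : 'rV[R]_n.+1) : bR * 'rV[R]_n :=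
  (x ord0 ord0, \row_j x ord0 (lift ord0 j)).
exists (fun k => u @^-1` F k).
  by rewrite -preimage_bigcup -FT preimage_setT.
move=> k; have [mFk Fk] := mF k; split.
  by rewrite -[X in measurable X]setTI; exact: measurable_rV_uncons.
rewrite /rV_cons_measure /pushforward -comp_preimage.
rewrite (_ : u \o _ = id)//; apply/funext => -[x y].
rewrite /u /comp rV_cons_head; congr pair.
by apply/rowP => j; rewrite mxE rV_cons_tail.
Qed.

HB.instance Definition _ := Measure_isSigmaFinite.Build _ _ _ rV_cons_measure
  step_sigma_finite.

End step.

Fixpoint product_measure n (mu : nat -> {sigma_finite_measure set bR -> \bar R})
    : {sigma_finite_measure set 'rV[R]_n -> \bar R} :=
  match n with
  | 0 => \d_ (0 : 'rV[R]_0)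
  | k.+1 => rV_cons_measure (mu 0) (product_measure k (fun i => mu i.+1))
  end.

End product_measure.

Section coordinate_measures.
Variable R : realType.
Local Notation bR := (measurableTypeR R).

Let inv2pi_ge0 : 0 <= ((2 * pi)^-1 : R).
Proof. by rewrite invr_ge0 mulr_ge0// pi_ge0. Qed.

(* Normalized Lebesgue measure on the circle of period 2 pi, carried by the
   fundamental domain [0, 2 pi). *)
Definition circle_measure : set bR -> \bar R :=
  mscale (NngNum inv2pi_ge0)
    (mrestr (@lebesgue_measure R) (measurable_itv `[0, 2 * pi[)).

HB.instance Definition _ := Measure.on circle_measure.

Let circle_sigma_finite : sigma_finite setT circle_measure.
Proof.
apply: fin_num_fun_sigma_finite; first by rewrite measure0.
apply: lty_fin_num_fun; pose I : set R := [set` `[0%R, 2 * pi[].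
have : (((2 * pi)^-1 : R)%:E * lebesgue_measure (setT `&` I) < +oo)%E by
  rewrite setTI lebesgue_measure_itv /=; case: ifPn => _;
  rewrite ?mule0// -EFinB -EFinM ltry.
exact.
Qed.

HB.instance Definition _ := Measure_isSigmaFinite.Build _ _ _ circle_measure
  circle_sigma_finite.

Definition integers : set bR := range (fun z : int => z%:~R : R).

Lemma measurable_integers : measurable integers.
Proof.
apply: countable_measurable => [x|]; first exact: measurable_set1.
by apply: sub_countable (card_image_le _ _) _; exact: countableP.
Qed.

(* Counting measure on Z, as a measure on R. *)
Definition integer_measure : set bR -> \bar R :=
  mrestr (@counting bR R) measurable_integers.

HB.instance Definition _ := Measure.on integer_measure.

Let integer_sigma_finite : sigma_finite setT integer_measure.
Proof.
exists (fun k => ~` integers `|`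
  (if unpickle k is Some z then [set (z : int)%:~R : R] else set0)).
  apply/esym; rewrite -subTset => x _.
  have [[z _ <-]|xZ] := pselect (integers x); last by exists 0%N => //; left.
  by exists (pickle z) => //; right; rewrite pickleK.
move=> k; split.
  apply: measurableU; first exact: measurableC measurable_integers.
  by case: unpickle => // z; exact: measurable_set1.
rewrite /integer_measure /mrestr /counting asboolT ?ltry//.
rewrite setIUl setICl set0U; apply: finite_setIl.
by case: unpickle => [z|]; [exact: finite_set1|exact: finite_set0].
Qed.

HB.instance Definition _ := Measure_isSigmaFinite.Build _ _ _ integer_measure
  integer_sigma_finite.

End coordinate_measures.

Section calculus.
Context {R : realType} {V : normedModType R}.

Definition cderive (v : V) (f : V -> R[i]) : V -> R[i] :=
  fun p => 'D_v (@complex.Re R \o f) p +i* 'D_v (@complex.Im R \o f) p.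

(* C^oo (for finite-dimensional V): all iterated directional derivatives exist
   and are continuous. *)
Definition smooth (f : V -> R[i]) : Prop :=
  forall s : seq V, let g := foldr cderive f s in
  [/\ continuous (@complex.Re R \o g), continuous (@complex.Im R \o g) &
      forall v p, derivable (@complex.Re R \o g) p v /\
                  derivable (@complex.Im R \o g) p v].

(* The partial derivative of multi-index alpha in the directions e_0, e_1, ... *)
Definition mderive n (e : 'I_n -> V) (alpha : 'I_n -> nat) (f : V -> R[i]) :
    V -> R[i] :=
  foldr (fun i => iter (alpha i) (cderive (e i))) f (enum 'I_n).

Definition laplacian n (e : 'I_n -> V) (f : V -> R[i]) : V -> R[i] :=
  fun p => \sum_i cderive (e i) (cderive (e i) f) p.

Definition periodic_along n (d : nat) (e : 'I_n -> V) (f : V -> R[i]) : Prop :=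
  forall (i : 'I_n), (i < d)%N -> forall p, f (p + (2 * pi) *: e i) = f p.

End calculus.

Definition mlength n (alpha : 'I_n -> nat) : nat := (\sum_i alpha i)%N.

Definition cintegral d (T : measurableType d) (R : realType)
    (mu : {measure set T -> \bar R}) (f : T -> R[i]) : R[i] :=
  (\int[mu]_x complex.Re (f x)) +i* (\int[mu]_x complex.Im (f x)).

(* A function on Omega = T^d x R^(n-d) is a function on R^n that is 2 pi-periodic
   in its first d coordinates.  Integration over Omega only sees the fundamental
   domain [0, 2 pi)^d x R^(n-d), where [Omega_measure] is concentrated.
   Likewise the dual group Z^d x R^(n-d) is a subset of R^n, where [dual_measure]
   is concentrated. *)
Section Omega.
Context {R : realType} (d : nat) {n : nat}.
Local Notation E := 'rV[R]_n.
Implicit Types x y xi : E.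

Definition Omega_measure : {sigma_finite_measure set E -> \bar R} :=
  product_measure n (fun i =>
    if (i < d)%N as _
    return {sigma_finite_measure set (measurableTypeR R) -> \bar R}
    then @circle_measure R else @lebesgue_measure R).

Definition dual_measure : {sigma_finite_measure set E -> \bar R} :=
  product_measure n (fun i =>
    if (i < d)%N as _
    return {sigma_finite_measure set (measurableTypeR R) -> \bar R}
    then @integer_measure R else @lebesgue_measure R).

Definition dotp x y : R := \sum_i x ord0 i * y ord0 i.

(* The norm of the library on row vectors is the maximum norm. *)
Definition enorm x : R := Num.sqrt (dotp x x).

Definition period (k : 'I_n -> int) : E :=
  \row_i (if (i < d)%N then (k i)%:~R * (2 * pi) else 0).

Definition Omega_dist x y : R :=
  inf (range (fun k => enorm (x - y + period k))).

(* The size of the R^(n-d) component of x. *)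
Definition height x : R :=
  Num.sqrt (\sum_(i < n | (d <= i)%N) x ord0 i ^+ 2).

Definition std_basis (i : 'I_n) : E := delta_mx ord0 i.
Definition dx (i : 'I_n) : E * E * E := (std_basis i, 0, 0).
Definition dy (i : 'I_n) : E * E * E := (0, std_basis i, 0).
Definition dxi (i : 'I_n) : E * E * E := (0, 0, std_basis i).

Definition schwartz (u : E -> R[i]) : Prop :=
  [/\ smooth u, periodic_along d std_basis u &
      forall (j : nat) (alpha : 'I_n -> nat),
        (ereal_sup (range (fun x =>
           ((1 + height x) ^+ j * Normc.normc (mderive std_basis alpha u x))%:E))
         < +oo)%E].

Definition symbol_class (m : R) (a : E * E * E -> R[i]) : Prop :=
  [/\ smooth a, periodic_along d dx a, periodic_along d dy a &
      forall alpha beta gamma : 'I_n -> nat,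
        (mlength alpha <= n.+1)%N -> (mlength beta <= n.+1)%N ->
        (mlength gamma <= n.+1)%N ->
        (ereal_sup (range (fun p : E * E * E =>
           ((1 + enorm p.2) `^ ((mlength gamma)%:R - m) *
            Normc.normc (mderive dx alpha (mderive dy beta
                     (mderive dxi gamma a)) p))%:E))
         < +oo)%E].

Definition symbol_size (m : R) (a : E * E * E -> R[i]) x y : \bar R :=
  ereal_sup [set ((1 + enorm q.1) `^ ((mlength q.2)%:R + m) *
                  Normc.normc (mderive dxi q.2 a (x, y, q.1)))%:E
            | q in [set q : E * ('I_n -> nat) | (mlength q.2 <= n.+1)%N]].

Definition vanishes_at_infinity (F : E -> E -> \bar R) : Prop :=
  forall r : R, 0 < r ->
    ereal_sup [set F z.1 z.2
              | z in [set z : E * E | [/\ rho <= height z.1, rho <= height z.2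
                                        & Omega_dist z.1 z.2 < r]]]
      @[rho --> +oo] --> 0%E.

(* The distribution kernel K of the pseudo-differential operator of amplitude a,
   evaluated at a test function phi on Omega x Omega: the integral of
     e^(i (x - y).xi) (1 + |xi|^2)^(-N) (1 - Delta_x)^N (a phi) (x, y, xi).
   The x-derivatives of a are only controlled up to order n + 1, whence the choice
   of N as the integer with n <= 2 N <= n + 1; for an amplitude of negative order
   the integral then converges absolutely. *)
Definition amplitude_kernel (a : E * E * E -> R[i]) (phi : E * E -> R[i]) : R[i] :=
  let N := uphalf n in
  cintegral ((Omega_measure \x Omega_measure) \x dual_measure)%E
    (fun p : E * E * E =>
       let theta := dotp (p.1.1 - p.1.2) p.2 in
       (cos theta +i* sin theta) * ((1 + enorm p.2 ^+ 2) ^- N)%:C *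
       iter N (fun f q => f q - laplacian dx f q)
         (fun q => a q * phi q.1) p).

(* L^2(Omega), as functions up to Omega_measure-almost everywhere equality. *)
Definition L2 (u : E -> R[i]) : Prop :=
  (@complex.Re R \o u \in Lfun Omega_measure 2%:E) /\
  (@complex.Im R \o u \in Lfun Omega_measure 2%:E).

Definition L2norm (u : E -> R[i]) : \bar R :=
  Lnorm Omega_measure 2%:E (fun x => (Normc.normc (u x))%:E).

Definition bounded_operator (T : (E -> R[i]) -> E -> R[i]) : Prop :=
  [/\ forall u, L2 u -> L2 (T u),
      forall u v, L2 u -> L2 v -> {ae Omega_measure, forall x, u x = v x} ->
        {ae Omega_measure, forall x, T u x = T v x},
      forall (c : R[i]) u v, L2 u -> L2 v ->
        {ae Omega_measure, forall x,
          T (fun z => c * u z + v z) x = c * T u x + T v x} &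
      exists C : R, forall u, L2 u -> (L2norm (T u) <= C%:E * L2norm u)%E].

Definition compact_operator (T : (E -> R[i]) -> E -> R[i]) : Prop :=
  bounded_operator T /\
  forall u : nat -> E -> R[i],
    (forall k, L2 (u k)) ->
    (exists C : R, forall k, (L2norm (u k) <= C%:E)%E) ->
    exists (s : nat -> nat) (w : E -> R[i]),
      [/\ {homo s : i j / (i < j)%N}, L2 w &
          L2norm (fun x => T (u (s k)) x - w x) @[k --> \oo] --> 0%E].

(* T is the operator u |-> Au of amplitude a: its distribution kernel is K.
   As Schwartz functions are dense, this determines a bounded T. *)
Definition has_amplitude (a : E * E * E -> R[i])
    (T : (E -> R[i]) -> E -> R[i]) : Prop :=
  forall u v, schwartz u -> schwartz v ->
    cintegral Omega_measure (fun x => T u x * v x) =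
    amplitude_kernel a (fun z => v z.1 * u z.2).

End Omega.

(* Main.v *)
Require Import Defs.
From HB Require Import structures.
From mathcomp Require Import all_boot all_order all_algebra.
From mathcomp Require Import complex ring lra zify finmap.
From mathcomp Require Import all_classical all_reals all_analysis.
From mathcomp Require Import measurable_realfun.

(** Write [K (x, y)] for the formal kernel of the operator, the integral in [xi] of
    [a (x, y, xi)] times the exponential of [i (x - y).xi]. The order [m] is negative,
    so [K] is less singular on the diagonal than the power [- n] of the distance, and
    it decays like the power [- n - 1] of the distance at infinity: it is an integrable
    kernel, and the proof consists in showing that it is a limit, in a norm that
    controls the operator norm, of kernels of finite rank.

    Kernel estimates. Fix [s > 0] with [2 s <= - m], and let [b] be a symbol of order
    [- s] in [xi]. If [h] is a translation of the dual group in a direction [j], then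
    multiplying the oscillatory integral of [b] at [t = x - y] by the exponential of
    [i h t_j], minus [1], amounts to replacing [b] by a difference of step [h]. One can
    choose [h] of the size of the inverse of the distance on Omega between [x] and [y],
    an integer when [j] is a direction of the torus, such that this factor has modulus
    at least [1]. Taking [n + 1] differences bounds the kernel at distance [r] by the
    minimum of [r ^ (s - n)] and [r ^ (- n - 1)], up to a constant ([osc_bound]).
    Differences replace the integrations by parts in [xi], which make no sense in the
    discrete directions. Such a kernel is integrable in each variable, by a
    decomposition into dyadic shells ([integral_two_scale], [schur_of_bound]), so it
    defines a bounded operator by Schur's test ([schur_test]).

    Compactness. Multiply the amplitude by cutoffs at frequencies of size [M]. The
    truncated kernels converge to [K] with rate [M ^ (- s)] in Schur norm, because one
    can afford to lose [s] orders ([symbol_kernel_cauchy], [limit_kernel_schur]). For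
    fixed [M] the truncated kernel is small in Schur norm outside of a large slab: near
    the diagonal by the hypothesis at infinity, whose growth in the frequency the
    cutoff compensates, and far from the diagonal by the decay of kernels
    ([good_slab_schur]). Inside the slab it is Lipschitz, so rounding its first
    variable to a fine grid gives a kernel of finite rank close to it
    ([good_step_kernel]). The images of a bounded sequence under operators of finite
    rank are Cauchy along an ultrafilter; this property passes to limits in Schur norm
    ([schur_limit_ultra_compact]), and a fast Cauchy subsequence converges by the
    Riesz-Fischer theorem ([riesz_fischer], [kernel_op_compact]).

    Identification. The truncated kernels, paired with test functions, are absolutely
    convergent triple integrals. Green's formula in [x] moves the factor
    [(1 + xi.xi) ^ N] to the other side ([bessel_iter_parts]), after which the integrals
    converge uniformly in [M]; the limit is the integral that defines the distribution
    kernel ([regularized_cvg], [kernel_pairing], [kernel_op_has_amplitude]). *)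

Set Implicit Arguments.
Unset Strict Implicit.
Unset Printing Implicit Defensive.
Import Order.TTheory GRing.Theory Num.Theory.
Import numFieldNormedType.Exports.
Local Open Scope classical_set_scope.
Local Open Scope ring_scope.

(** * Kernels with one singularity at zero and another decay at infinity *)

Section two_scale.
Context {R : realType}.
Implicit Types al be r : R.

(** The profile of the kernels of this file: singular like [r ^ (- al)] at [0] and
    decaying like [r ^ (- be)] at infinity, when [al < be]. *)
Definition two_scale al be r : R := Num.min (r `^ (- al)) (r `^ (- be)).

Lemma two_scale_ge0 al be r : 0 <= two_scale al be r.
Proof. by rewrite /two_scale le_min !powR_ge0. Qed.

Lemma measurable_two_scale al be :
  measurable_fun setT (two_scale al be).
Proof. by apply: measurable_minr; exact: measurable_powR. Qed.

Lemma gt1_ltr_powR (a x y : R) : 1 < a -> x < y -> a `^ x < a `^ y.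
Proof.
move=> a1 xy; have a0 : 0 < a by rewrite (lt_trans _ a1).
by rewrite /powR !gt_eqF// ltr_expR ltr_pM2r// ln_gt0.
Qed.

(** Sum of the two geometric series over dyadic shells. *)
Definition two_scale_const al be (n : nat) : R :=
  2 `^ al / (1 - 2 `^ al / 2 ^+ n) + 2 ^+ n / (1 - 2 ^+ n * 2 `^ (- be)).

Lemma two_scale_ratios al be (n : nat) : 0 < al -> al < n%:R -> n%:R < be ->
  0 < 2 `^ al / 2 ^+ n < 1 /\ 0 < 2 ^+ n * 2 `^ (- be) < 1.
Proof.
move=> al0 aln nbe; have n0 : 0 < 2 ^+ n :> R by rewrite exprn_gt0.
have p0 x : 0 < 2 `^ x :> R by rewrite powR_gt0.
split; apply/andP; split; rewrite ?divr_gt0 ?mulr_gt0//.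
  by rewrite ltr_pdivrMr// mul1r -powR_mulrn// gt1_ltr_powR// ltr1n.
by rewrite powRN ltr_pdivrMr// mul1r -powR_mulrn// gt1_ltr_powR// ltr1n.
Qed.

Lemma two_scale_const_gt0 al be (n : nat) : 0 < al -> al < n%:R ->
  n%:R < be -> 0 < two_scale_const al be n.
Proof.
move=> al0 aln nbe; have [/andP[_ a1] /andP[_ b1]] := two_scale_ratios al0 aln nbe.
by rewrite addr_gt0// divr_gt0 ?powR_gt0 ?exprn_gt0 ?subr_gt0.
Qed.

Let shell al be r (l : nat) : R :=
  (2 `^ al) ^+ l.+1 * \1_[set t | t <= 2^-1 ^+ l] r +
  (2 `^ (- be)) ^+ l * \1_[set t | t <= 2 ^+ l.+1] r.

Let shell_ge0 al be r l : 0 <= shell al be r l.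
Proof.
by rewrite addr_ge0// mulr_ge0 ?exprn_ge0 ?powR_ge0// indicE ler0n.
Qed.

Let two_scale_le_shell al be r : 0 < al -> 0 < be -> 0 <= r ->
  exists l, two_scale al be r <= shell al be r l.
Proof.
move=> al0 be0; rewrite le_eqVlt => /predU1P[<-|r0].
  exists 0%N; rewrite /two_scale !powR0 ?oppr_eq0 ?gt_eqF//.
  by rewrite minxx; exact: shell_ge0.
have pow2 (x : R) k : (2 `^ x) ^+ k = (2 ^+ k) `^ x.
  by rewrite -powR_mulrn ?powR_ge0// -powRrM mulrC powRrM powR_mulrn.
(* A radius [r <= 1] lies in the first shell [2 ^ (- l - 1) < r <= 2 ^ (- l)], where the
   first summand of [shell] bounds [r ^ (- al)]; a radius [r > 1] in [2 ^ l < r <= 2 ^ (l +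
   1)], where the second bounds [r ^ (- be)]. *)
have [r1|r1] := leP r 1.
  have exl : exists l, 2^-1 ^+ l.+1 < r.
    have /cvgrPdist_lt/(_ _ r0)[k _ kr] : (2^-1 : R) ^+ n @[n --> \oo] --> 0.
      by apply: cvg_expr; rewrite ger0_norm ?invf_lt1 ?ltr1n.
    exists k; have /= := kr k.+1 (leqnSn k).
    by rewrite sub0r normrN ger0_norm// exprn_ge0.
  have [l lr lmin] := ex_minnP exl.
  exists l; rewrite /shell indicE mem_set/=; last first.
    case: l lr lmin => [|l] lr lmin; first by rewrite expr0.
    by rewrite leNgt; apply/negP => /lmin; rewrite ltnn.
  rewrite mulr1; apply: ler_wpDr.
    by rewrite mulr_ge0 ?exprn_ge0 ?powR_ge0// indicE ler0n.
  rewrite /two_scale ge_min; apply/orP; left.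
  rewrite pow2 powRN -[leLHS]mul1r -ler_pdivlMr ?invr_gt0 ?powR_gt0// invrK.
  rewrite -powRM ?exprn_ge0 ?(ltW r0)//.
  rewrite -[X in X <= _](_ : 1 `^ al = 1); last by rewrite powR1.
  rewrite ge0_ler_powR ?nnegrE ?mulr_ge0 ?exprn_ge0 ?(ltW al0) ?(ltW r0)//.
  apply: ltW; rewrite mulrC -ltr_pdivrMr ?exprn_gt0// mul1r -exprVn; exact: lr.
have exl : exists l, r <= 2 ^+ l.+1.
  exists (Num.trunc r); rewrite ltW// (lt_le_trans (truncnS_gt r))//.
  by rewrite -natrX ler_nat ltnW// ltn_expl.
have [l lr lmin] := ex_minnP exl.
exists l; rewrite /shell [X in _ <= _ + _ * X]indicE mem_set//= mulr1.
apply: ler_wpDl.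
  by rewrite mulr_ge0 ?exprn_ge0 ?powR_ge0// indicE ler0n.
rewrite /two_scale ge_min; apply/orP; right.
rewrite pow2 !powRN lef_pV2 ?posrE ?powR_gt0 ?exprn_gt0//.
rewrite ge0_ler_powR ?nnegrE ?exprn_ge0 ?ltW//.
case: l lr lmin => [|l] lr lmin; first by rewrite expr0.
by rewrite ltNge; apply/negP => /lmin; rewrite ltnn.
Qed.

Lemma geometric_psum_le (c q : R) k : 0 <= c -> 0 < q < 1 ->
  \sum_(0 <= l < k) c * q ^+ l <= c / (1 - q).
Proof.
move=> c0 /andP[q0 q1]; have := geometric_le_lim k c0 q0.
by rewrite ger0_norm; [exact|exact: ltW].
Qed.

(** Each dyadic shell contributes a term of a geometric series: the small
    shells converge because [al < n], the large ones because [n < be]. *)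
Lemma integral_two_scale d (T : measurableType d)
    (mu : {measure set T -> \bar R}) (rho : T -> R) (C al be : R) (n : nat) :
  0 < al -> al < n%:R -> n%:R < be -> 0 <= C ->
  measurable_fun setT rho -> (forall x, 0 <= rho x) ->
  (forall r, 0 < r -> (mu [set x | (rho x <= r)%R] <= (C * r ^+ n)%:E)%E) ->
  (\int[mu]_x (two_scale al be (rho x))%:E <=
     (C * two_scale_const al be n)%:E)%E.
Proof.
move=> al0 aln nbe C0 mrho rho0 vol.
have be0 : 0 < be by rewrite (le_lt_trans _ nbe).
have [q0 p0] := two_scale_ratios al0 aln nbe.
have mle r : measurable [set x | rho x <= r].
  by rewrite -[X in measurable X]setTI; apply: measurable_fun_ler => //.
have mind r : measurable_fun setT (fun x => \1_[set t | t <= r] (rho x) : R).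
  by apply: measurableT_comp mrho; apply/measurable_indicP; rewrite -set_itvE.
have mshell l : measurable_fun setT (fun x => (shell al be (rho x) l)%:E).
  by apply/measurable_EFinP; apply: measurable_funD; apply: measurable_funM.
apply: (@le_trans _ _ (\int[mu]_x \sum_(0 <= l <oo) (shell al be (rho x) l)%:E)%E).
  apply: ge0_le_integral => //.
  - by move=> x _; rewrite lee_fin two_scale_ge0.
  - apply/measurable_EFinP; apply: measurableT_comp mrho.
    exact: measurable_two_scale.
  - by apply: ge0_emeasurable_sum => // l x _ _; rewrite lee_fin shell_ge0.
  - move=> x _; have [l hl] := two_scale_le_shell al0 be0 (rho0 x).
    apply: (@le_trans _ _ (shell al be (rho x) l)%:E); first by rewrite lee_fin.
    rewrite (nneseries_split 0 l.+1); last by move=> k _; rewrite lee_fin shell_ge0.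
    rewrite add0n; apply: le_trans (leeDl _ _).
      by rewrite sumEFin lee_fin big_nat_recr//= lerDr sumr_ge0.
    by apply: nneseries_ge0 => *; rewrite lee_fin shell_ge0.
rewrite integral_nneseries//; last by move=> *; rewrite lee_fin shell_ge0.
apply: lime_le.
  apply: is_cvg_nneseries => *; apply: integral_ge0 => x _.
  by rewrite lee_fin shell_ge0.
apply: nearW => k.
apply: (@le_trans _ _ (\sum_(0 <= l < k) (C * (2 `^ al * (2 `^ al / 2 ^+ n) ^+ l
    + 2 ^+ n * (2 ^+ n * 2 `^ (- be)) ^+ l))%:E)%E).
  apply: lee_sum => l _.
  under eq_integral do rewrite EFinD.
  have scaled c r : 0 <= c -> 0 < r ->
      (\int[mu]_x (c * \1_[set t | t <= r] (rho x))%:E <= (C * (c * r ^+ n))%:E)%E.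
    move=> c0 r0; under eq_integral do rewrite EFinM.
    rewrite ge0_integralZl_EFin//=; last by apply/measurable_EFinP; exact: mind.
    rewrite (integral_indic mu measurableT (mle r)) setIT mulrCA EFinM.
    by rewrite lee_wpmul2l ?lee_fin// vol.
  rewrite ge0_integralD//=; first last.
  - by apply/measurable_EFinP; apply: measurable_funM => //; exact: mind.
  - by apply/measurable_EFinP; apply: measurable_funM => //; exact: mind.
  rewrite mulrDr EFinD; apply: leeD.
    rewrite (le_trans (scaled _ _ _ _)) ?exprn_ge0 ?exprn_gt0 ?powR_ge0//.
    rewrite lee_fin ler_wpM2l// exprS -mulrA ler_wpM2l ?powR_ge0//.
    by rewrite exprMn -[X in _ <= _ * X ^+ _]exprVn exprAC.
  rewrite (le_trans (scaled _ _ _ _)) ?exprn_ge0 ?exprn_gt0 ?powR_ge0//.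
  rewrite lee_fin ler_wpM2l//.
  by rewrite exprAC exprS exprMn mulrCA [X in _ * X <= _]mulrC.
rewrite sumEFin lee_fin -mulr_sumr ler_wpM2l// big_split/= lerD//.
  by apply: geometric_psum_le => //; exact: powR_ge0.
by apply: geometric_psum_le => //; exact: exprn_ge0.
Qed.

End two_scale.

(** * Square-integrable functions and Schur's test *)

Section real_integral.
Context d (T : measurableType d) (R : realType) (mu : {measure set T -> \bar R}).
Implicit Types f g : T -> R.

Lemma normr_Rintegral_le f : measurable_fun setT f ->
  (`|\int[mu]_x f x|%R%:E <= \int[mu]_x `|f x|%:E)%E.
Proof.
move=> mf; have [fy|] := ltP (\int[mu]_x `|f x|%:E)%E +oo%E; last first.
  by rewrite leye_eq => /eqP ->; rewrite leey.
have fi : mu.-integrable setT (EFin \o f).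
  by apply/integrableP; split => //; exact/measurable_EFinP.
rewrite EFin_normr_Rintegral//; apply: le_abse_integral => //.
exact: measurable_int fi.
Qed.

Definition sqint f : \bar R := (\int[mu]_x ((f x) ^+ 2)%:E)%E.

Lemma sqint_ge0 f : (0 <= sqint f)%E.
Proof. by apply: integral_ge0 => x _; rewrite lee_fin sqr_ge0. Qed.

Lemma measurable_sqr f : measurable_fun setT f ->
  measurable_fun setT (fun x => (f x ^+ 2)%:E).
Proof. by move=> mf; apply/measurable_EFinP; exact: measurable_funX. Qed.

Lemma le_sqint f g : measurable_fun setT f -> measurable_fun setT g ->
  {ae mu, forall x, `|f x| <= `|g x|} -> (sqint f <= sqint g)%E.
Proof.
move=> mf mg fg; apply: ae_ge0_le_integral => //.
- by move=> x _; rewrite lee_fin sqr_ge0.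
- exact: measurable_sqr.
- by move=> x _; rewrite lee_fin sqr_ge0.
- exact: measurable_sqr.
- apply: filterS fg => x fg _; rewrite lee_fin.
  by rewrite -[_ ^+ 2]real_normK ?num_real// -[leRHS]real_normK ?num_real// lerXn2r ?nnegrE.
Qed.

Lemma sqintD f g : measurable_fun setT f -> measurable_fun setT g ->
  (sqint (fun x => f x + g x)%R <= 2%:E * sqint f + 2%:E * sqint g)%E.
Proof.
move=> mf mg; have s0 h x : setT x -> (0 <= (h x ^+ 2)%:E :> \bar R)%E.
  by move=> _; rewrite lee_fin sqr_ge0.
rewrite /sqint -!ge0_integralZl_EFin//; do ?exact: s0; do ?exact: measurable_sqr.
rewrite -ge0_integralD//; last 4 first.
- by move=> x _; rewrite -EFinM lee_fin mulr_ge0 ?sqr_ge0.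
- by apply: measurable_funeM; exact: measurable_sqr.
- by move=> x _; rewrite -EFinM lee_fin mulr_ge0 ?sqr_ge0.
- by apply: measurable_funeM; exact: measurable_sqr.
apply: ge0_le_integral => //; first exact: s0.
- by apply: measurable_sqr; exact: measurable_funD.
- by apply: emeasurable_funD; apply: measurable_funeM; exact: measurable_sqr.
- move=> x _; rewrite -!EFinM -EFinD lee_fin.
  have := sqr_ge0 (f x - g x); nra.
Qed.

Lemma sqintB f g : measurable_fun setT f -> measurable_fun setT g ->
  (sqint (fun x => f x - g x)%R <= 2%:E * sqint f + 2%:E * sqint g)%E.
Proof.
move=> mf mg; have := sqintD mf (measurable_funN mg).
rewrite /= (_ : sqint (\- g) = sqint g)//; apply: eq_integral => x _.
by rewrite sqrrN.
Qed.

(** The Cauchy-Schwarz inequality in the measure of density [`|p|]. *)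
Lemma weighted_cauchy_schwarz (p g : T -> R) (B : R) : 0 < B ->
  measurable_fun setT p -> measurable_fun setT g ->
  (\int[mu]_x `|p x|%:E <= B%:E)%E ->
  ((\int[mu]_x `|p x * g x|%:E) * (\int[mu]_x `|p x * g x|%:E) <=
     B%:E * \int[mu]_x (`|p x| * g x ^+ 2)%:E)%E.
Proof.
move=> B0 mp mg pB; set I := (\int[mu]_x `|p x * g x|%:E)%E.
set Q := (\int[mu]_x (`|p x| * g x ^+ 2)%:E)%E.
have mpa : measurable_fun setT (fun x => `|p x|%:E).
  by apply/measurable_EFinP; exact: measurableT_comp.
have mpg : measurable_fun setT (fun x => (`|p x| * g x ^+ 2)%:E).
  apply/measurable_EFinP; apply: measurable_funM; first exact: measurableT_comp.
  exact: measurable_funX.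
have Q0 : (0 <= Q)%E by apply: integral_ge0 => x _; rewrite lee_fin mulr_ge0 ?sqr_ge0.
have I0 : (0 <= I)%E by apply: integral_ge0 => x _; rewrite lee_fin.
have [Qy|] := ltP Q +oo%E; last first.
  by rewrite leye_eq => /eqP ->; rewrite gt0_muley ?lte_fin// leey.
(* Integrating [|p g| <= t / 2 |p| + |p| g ^ 2 / (2 t)] bounds [I] for all [t > 0]; the
   bound is optimal at [t = I / B]. *)
have amgm t : 0 < t -> (I <= (t / 2 * B)%:E + (2 * t)^-1%:E * Q)%E.
  move=> t0; apply: (@le_trans _ _
    ((t / 2)%:E * (\int[mu]_x `|p x|%:E) + (2 * t)^-1%:E * Q)%E); last first.
    apply: leeD => //; rewrite (EFinM (t / 2) B); apply: lee_wpmul2l => //.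
    by rewrite lee_fin divr_ge0// ltW.
  have t2 : 0 <= t / 2 by rewrite divr_ge0// ltW.
  have t3 : 0 <= (2 * t)^-1 by rewrite invr_ge0 mulr_ge0// ltW.
  rewrite -!ge0_integralZl_EFin//; last by move=> x _; rewrite lee_fin mulr_ge0 ?sqr_ge0.
  rewrite -ge0_integralD//; last 4 first.
  - by move=> x _; rewrite -EFinM lee_fin mulr_ge0.
  - exact: measurable_funeM.
  - by move=> x _; rewrite -EFinM lee_fin; do 2?apply: mulr_ge0 => //; exact: sqr_ge0.
  - exact: measurable_funeM.
  apply: ge0_le_integral => //.
  - by apply/measurable_EFinP/measurableT_comp => //; exact: measurable_funM.
  - by apply: emeasurable_funD; exact: measurable_funeM.
  - move=> x _; rewrite -!EFinM -EFinD lee_fin normrM.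
    rewrite -[g x ^+ 2]real_normK ?num_real//.
    have := mulr_ge0 (normr_ge0 (p x)) (mulr_ge0 t3 (sqr_ge0 (t - `|g x|))).
    rewrite [X in 0 <= X](_ : _ = t / 2 * `|p x| +
      (2 * t)^-1 * (`|p x| * `|g x| ^+ 2) - `|p x| * `|g x|) ?subr_ge0//.
    by field; rewrite gt_eqF.
have Ify : (I < +oo)%E.
  apply: le_lt_trans (amgm _ ltr01) _.
  by rewrite lte_add_pinfty// ?ltry// lte_mul_pinfty// lee_fin invr_ge0.
move: I0 Ify Q0 Qy amgm; case: I => [i| |]//; case: Q => [q| |]// I0 _ Q0 _ amgm.
rewrite -!EFinM lee_fin; move: I0 Q0; rewrite !lee_fin le_eqVlt.
case/predU1P => [<- q0|i0 q0]; first by rewrite mul0r mulr_ge0// ltW.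
have := amgm (i / B) (divr_gt0 i0 B0).
rewrite -EFinM -EFinD lee_fin => h.
have : i * i <= i * (i / B / 2 * B + (2 * (i / B))^-1 * q) by rewrite ler_wpM2l// ltW.
rewrite [X in _ <= X](_ : _ = i * i / 2 + B * q / 2); last first.
  by field; rewrite !gt_eqF.
lra.
Qed.

End real_integral.

Section kernel_operator.
Context d (T : measurableType d) (R : realType)
  (mu : {sigma_finite_measure set T -> \bar R}).
Implicit Types (k : T * T -> R) (f g : T -> R).

Lemma measurable_Rintegral_snd d' (T' : measurableType d') (h : T' * T -> R) :
  measurable_fun setT h ->
  measurable_fun setT (fun x => \int[mu]_y h (x, y)).
Proof.
move=> mh; apply: measurableT_comp => //.
pose e : T' * T -> \bar R := EFin \o h.
have me : measurable_fun setT e by exact/measurable_EFinP.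
rewrite (_ : (fun x => _) = (fun x => \int[mu]_y e^\+ (x, y) - \int[mu]_y e^\- (x, y))%E).
  apply: emeasurable_funB.
    exact: (measurable_fun_fubini_tonelli_F _ (measurable_funepos me) (funepos_ge0 e)).
  exact: (measurable_fun_fubini_tonelli_F _ (measurable_funeneg me) (funeneg_ge0 e)).
apply/funext => x; rewrite integralE; congr (_ - _)%E.
  by apply: eq_integral => y _; rewrite !funeposE.
by apply: eq_integral => y _; rewrite !funenegE.
Qed.

Definition kernel_op k f x : R := \int[mu]_y (k (x, y) * f y).

Definition schur_bounded k (B : R) := [/\ measurable_fun setT k,
  {ae mu, forall x, (\int[mu]_y `|k (x, y)|%:E <= B%:E)%E} &
  {ae mu, forall y, (\int[mu]_x `|k (x, y)|%:E <= B%:E)%E}].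

Lemma measurable_kernel_prod k f : measurable_fun setT k ->
  measurable_fun setT f -> measurable_fun setT (fun z => k z * f z.2).
Proof.
by move=> mk mf; apply: measurable_funM => //; exact: measurableT_comp.
Qed.

Lemma measurable_kernel_op k f : measurable_fun setT k ->
  measurable_fun setT f -> measurable_fun setT (kernel_op k f).
Proof.
move=> mk mf.
exact: (@measurable_Rintegral_snd _ _ _ (measurable_kernel_prod mk mf)).
Qed.

(** Schur's test.  The Cauchy-Schwarz inequality in the measure [`|k (x, y)| dy]
    bounds the square of the operator by [B] times the integral of
    [`|k (x, y)| f y ^+ 2], whose integral in [x] is at most [B f y ^+ 2]. *)
Lemma schur_test k B f : 0 < B -> schur_bounded k B ->
  measurable_fun setT f -> (sqint mu f < +oo)%E ->
  {ae mu, forall x, mu.-integrable setT (fun y => (k (x, y) * f y)%:E)} /\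
  (sqint mu (kernel_op k f) <= (B ^+ 2)%:E * sqint mu f)%E.
Proof.
move=> B0 [mk kx ky] mf fy.
have mkx x : measurable_fun setT (fun y => k (x, y)) by exact: measurableT_comp.
have mky y : measurable_fun setT (fun x => k (x, y)) by exact: measurableT_comp.
pose Q x := (\int[mu]_y (`|k (x, y)| * f y ^+ 2)%:E)%E.
have mq : measurable_fun setT (fun z => (`|k z| * f z.2 ^+ 2)%:E).
  apply/measurable_EFinP/measurable_funM; first exact: measurableT_comp.
  by apply: measurable_funX; exact: measurableT_comp.
have q0 z : (0 <= (`|k z| * f z.2 ^+ 2)%:E)%E by rewrite lee_fin mulr_ge0 ?sqr_ge0.
have mQ : measurable_fun setT Q by exact: (measurable_fun_fubini_tonelli_F _ mq q0).
have Q0 x : (0 <= Q x)%E by apply: integral_ge0 => y _; exact: (q0 (x, y)).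
have QB : (\int[mu]_x Q x <= B%:E * sqint mu f)%E.
  rewrite (fubini_tonelli (fun z => (`|k z| * f z.2 ^+ 2)%:E) mq q0)/=.
  rewrite -ge0_integralZl_EFin ?(ltW B0)//; last 2 first.
  - by move=> y _; rewrite lee_fin sqr_ge0.
  - exact: measurable_sqr.
  apply: ae_ge0_le_integral => //.
  - by move=> y _; apply: integral_ge0 => x _; exact: (q0 (x, y)).
  - exact: (measurable_fun_fubini_tonelli_G _ mq q0).
  - by move=> y _; rewrite -EFinM lee_fin mulr_ge0 ?sqr_ge0// ltW.
  - by apply: measurable_funeM; exact: measurable_sqr.
  apply: filterS ky => y ky _.
  under eq_integral do rewrite EFinM muleC.
  rewrite ge0_integralZl_EFin ?sqr_ge0//.
  - by rewrite muleC lee_wpmul2r// lee_fin sqr_ge0.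
  - by apply/measurable_EFinP; exact: measurableT_comp.
have Qi : mu.-integrable setT Q.
  apply/integrableP; split=> //; under eq_integral do rewrite gee0_abs//.
  by apply: le_lt_trans QB _; rewrite lte_mul_pinfty// lee_fin ltW.
have Qfin := integrable_ae measurableT Qi.
have kf : {ae mu, forall x, (\int[mu]_y `|k (x, y) * f y|%:E) *
    (\int[mu]_y `|k (x, y) * f y|%:E) <= B%:E * Q x}%E.
  by apply: filterS kx => x kx; exact: weighted_cauchy_schwarz.
split.
  apply: filterS2 kf Qfin => x kf /(_ I) Qfin; apply/integrableP; split.
    by apply/measurable_EFinP; exact: measurable_funM.
  rewrite ltNge leye_eq; apply/negP => /eqP E; move: kf.
  rewrite /= in E; rewrite E mulyy leye_eq => /eqP E'.
  by case: (Q x) Qfin E'.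
apply: (@le_trans _ _ (\int[mu]_x (B%:E * Q x))%E); last first.
  rewrite ge0_integralZl_EFin ?(ltW B0)// expr2 EFinM -muleA.
  by rewrite lee_wpmul2l// lee_fin ltW.
apply: ae_ge0_le_integral => //.
- by move=> x _; rewrite lee_fin sqr_ge0.
- by apply: measurable_sqr; exact: measurable_kernel_op.
- by move=> x _; rewrite mule_ge0// lee_fin ltW.
- exact: measurable_funeM.
apply: filterS kf => x kf _; apply: le_trans kf.
rewrite -[_ ^+ 2]real_normK ?num_real// expr2 EFinM.
have h := normr_Rintegral_le mu (measurable_funM (mkx x) mf).
by apply: lee_pmul.
Qed.

Lemma schur_boundedD k1 k2 B1 B2 : schur_bounded k1 B1 -> schur_bounded k2 B2 ->
  schur_bounded (fun z => k1 z + k2 z) (B1 + B2).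
Proof.
have tri (h1 h2 : T -> R) : measurable_fun setT h1 -> measurable_fun setT h2 ->
    (\int[mu]_x `|h1 x|%:E <= B1%:E)%E -> (\int[mu]_x `|h2 x|%:E <= B2%:E)%E ->
    (\int[mu]_x `|h1 x + h2 x|%:E <= (B1 + B2)%:E)%E.
  move=> mh1 mh2 l1 l2.
  have a1 : measurable_fun setT (fun x => `|h1 x|%:E).
    by apply/measurable_EFinP; exact: measurableT_comp.
  have a2 : measurable_fun setT (fun x => `|h2 x|%:E).
    by apply/measurable_EFinP; exact: measurableT_comp.
  apply: (@le_trans _ _ (\int[mu]_x (`|h1 x|%:E + `|h2 x|%:E))%E).
    apply: ge0_le_integral => //.
    - by apply/measurable_EFinP/measurableT_comp => //; exact: measurable_funD.
    - exact: emeasurable_funD.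
    - by move=> x _; rewrite -EFinD lee_fin ler_normD.
  by rewrite ge0_integralD// EFinD leeD.
move=> [m1 x1 y1] [m2 x2 y2]; split; first exact: measurable_funD.
- by apply: filterS2 x1 x2 => x ? ?; apply: tri => //; exact: measurableT_comp.
- by apply: filterS2 y1 y2 => x ? ?; apply: tri => //; exact: measurableT_comp.
Qed.

Lemma schur_bounded_le k B B' : B <= B' -> schur_bounded k B -> schur_bounded k B'.
Proof.
move=> BB [mk x1 y1]; split=> //.
  by apply: filterS x1 => x /le_trans; apply; rewrite lee_fin.
by apply: filterS y1 => x /le_trans; apply; rewrite lee_fin.
Qed.

End kernel_operator.

(** * Compactness along an ultrafilter *)

Section ultrafilter_on_nat.
Context (U : set_system nat) (UU : UltraFilter U).

Lemma ultra_fiber (h : nat -> nat) (N : nat) :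
  U [set k | (h k < N)%N] -> exists i, U [set k | h k = i].
Proof.
elim: N => [|N IH] UN.
  by exfalso; apply: (filter_not_empty U); apply: filterS UN.
have [UhN|UhN] := in_ultra_setVsetC [set k | h k = N] UU; first by exists N.
apply: IH; apply: filterS2 UN UhN => k /=.
by rewrite ltnS leq_eqVlt => /predU1P[].
Qed.

(** Bounded real sequences converge along an ultrafilter: cut the range into
    finitely many intervals of length [e]. *)
Lemma ultra_bounded_cauchy (R : realType) (c : nat -> R) (B e : R) :
  (forall k, `|c k| <= B) -> 0 < e ->
  exists2 A, U A & forall i j, A i -> A j -> `|c i - c j| <= e.
Proof.
move=> cB e0; pose h k := Num.trunc ((c k + B) / e).
have c0 k : 0 <= (c k + B) / e.
  rewrite divr_ge0 ?(ltW e0)// addrC -lerBlDr sub0r.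
  by have := cB k; rewrite ler_norml => /andP[+ _]; rewrite lerNl.
have [i Ui] : exists i, U [set k | h k = i].
  apply: (@ultra_fiber _ (Num.trunc (2 * B / e)).+1).
  apply: filterS filterT => k _ /=; rewrite ltnS; apply: le_truncn.
  rewrite ler_pM2r ?invr_gt0// mulr2n mulrDl !mul1r lerD2r.
  by have := cB k; rewrite ler_norml => /andP[].
exists [set k | h k = i] => // j k /= hj hk.
have lo l : h l = i -> i%:R * e <= c l + B < i.+1%:R * e.
  move=> hl; rewrite -ler_pdivlMr// -ltr_pdivrMr// -hl.
  exact: truncn_itv.
have := lo _ hj; have := lo _ hk; rewrite -natr1 ler_norml; nra.
Qed.

(** Large sets of an ultrafilter finer than the Frechet filter are infinite, so
    a diagonal subsequence enters each of countably many large sets. *)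
Lemma ultra_subsequence (P : nat -> set nat) : \oo `<=` U ->
  (forall k, U (P k)) ->
  exists s : nat -> nat, {homo s : i j / (i < j)%N} /\
    forall k j, (k <= j)%N -> P k (s j).
Proof.
move=> oU UP.
have UQ k : U [set m | forall l, (l <= k)%N -> P l m].
  elim: k => [|k IH].
    by apply: filterS (UP 0%N) => m Pm l; rewrite leqn0 => /eqP ->.
  apply: filterS2 IH (UP k.+1) => m IH Pm l.
  by rewrite leq_eqVlt => /predU1P[->//|]; rewrite ltnS; exact: IH.
have pick k n : exists m, (n < m)%N /\ forall l, (l <= k)%N -> P l m.
  have Un : U [set m | (n < m)%N] by apply: oU; exact: nbhs_infty_gt.
  have [m [? ?]] := filter_ex (filterI Un (UQ k)).
  by exists m.
have [f fP] := choice (fun kn => pick kn.1 kn.2).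
pose s := fix s k := if k is k'.+1 then f (k, s k') else f (0%N, 0%N).
have Ps k : forall l, (l <= k)%N -> P l (s k).
  by case: k => [|k] /=; [have [_] := fP (0, 0)%N|have [_] := fP (k.+1, s k)].
exists s; split; last by move=> k j kj; exact: Ps.
apply: homo_ltn; first exact: ltn_trans.
by move=> k /=; have [] := fP (k.+1, s k).
Qed.

End ultrafilter_on_nat.

Section square_integrable.
Context d (T : measurableType d) (R : realType) (mu : {measure set T -> \bar R}).
Implicit Types f g : T -> R.

Lemma integrable_prod_sqint f g : measurable_fun setT f -> measurable_fun setT g ->
  (sqint mu f < +oo -> sqint mu g < +oo ->
   mu.-integrable setT (fun x => (f x * g x)%R%:E))%E.
Proof.
move=> mf mg fy gy; apply/integrableP; split.
  by apply/measurable_EFinP; exact: measurable_funM.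
apply: (@le_lt_trans _ _ (\int[mu]_x ((f x ^+ 2)%:E + (g x ^+ 2)%:E))%E).
  apply: ge0_le_integral => //.
  - apply/measurable_EFinP; apply: measurableT_comp => //; exact: measurable_funM.
  - by apply: emeasurable_funD; exact: measurable_sqr.
  - move=> x _; rewrite -EFinD lee_fin normrM.
    rewrite -[f x ^+ 2]real_normK ?num_real// -[g x ^+ 2]real_normK ?num_real//.
    have := sqr_ge0 (`|f x| - `|g x|); have := mulr_ge0 (normr_ge0 (f x)) (normr_ge0 (g x)).
    nra.
rewrite ge0_integralD//; last 4 first.
- by move=> x _; rewrite lee_fin sqr_ge0.
- exact: measurable_sqr.
- by move=> x _; rewrite lee_fin sqr_ge0.
- exact: measurable_sqr.
by rewrite lte_add_pinfty.
Qed.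

Lemma normr_Rintegral_prod_le f g (A B : R) : measurable_fun setT f ->
  measurable_fun setT g -> (sqint mu f <= A%:E)%E -> (sqint mu g <= B%:E)%E ->
  `|\int[mu]_x (f x * g x)| <= A + B.
Proof.
move=> mf mg fA gB; rewrite -lee_fin.
apply: le_trans (normr_Rintegral_le mu (measurable_funM mf mg)) _.
apply: (@le_trans _ _ (\int[mu]_x ((f x ^+ 2)%:E + (g x ^+ 2)%:E))%E).
  apply: ge0_le_integral => //.
  - apply/measurable_EFinP; apply: measurableT_comp => //; exact: measurable_funM.
  - by apply: emeasurable_funD; exact: measurable_sqr.
  - move=> x _; rewrite -EFinD lee_fin normrM.
    rewrite -[f x ^+ 2]real_normK ?num_real// -[g x ^+ 2]real_normK ?num_real//.
    have := sqr_ge0 (`|f x| - `|g x|); have := mulr_ge0 (normr_ge0 (f x)) (normr_ge0 (g x)).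
    nra.
rewrite ge0_integralD//; last 4 first.
- by move=> x _; rewrite lee_fin sqr_ge0.
- exact: measurable_sqr.
- by move=> x _; rewrite lee_fin sqr_ge0.
- exact: measurable_sqr.
by rewrite EFinD leeD.
Qed.

(** The increments of a fast Cauchy sequence are summable almost everywhere, so
    the sequence converges almost everywhere, and Fatou's lemma gives the
    distance to the limit. *)
Lemma riesz_fischer (f : nat -> T -> R) :
  (forall k, measurable_fun setT (f k)) ->
  (forall k l, (k <= l)%N ->
    (sqint mu (fun x => f k x - f l x)%R <= (4^-1 ^+ k)%:E)%E) ->
  exists2 w : T -> R, measurable_fun setT w &
    forall k, (sqint mu (fun x => f k x - w x)%R <= (4^-1 ^+ k)%:E)%E.
Proof.
move=> mf fC; pose u k x := 2 ^+ k * (f k x - f k.+1 x) ^+ 2.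
have mu_ k : measurable_fun setT (fun x => (u k x)%:E).
  apply/measurable_EFinP; apply: measurable_funM => //.
  by apply: measurable_funX; exact: measurable_funB.
have u0 k x : 0 <= u k x by apply: mulr_ge0; [exact: exprn_ge0|exact: sqr_ge0].
have Sy : (\int[mu]_x (\sum_(0 <= k <oo) (u k x)%:E) < +oo)%E.
  rewrite integral_nneseries//; last by move=> k x _; rewrite lee_fin u0.
  apply: (@le_lt_trans _ _ 2%:E); last exact: ltry.
  apply: lime_le.
    by apply: is_cvg_nneseries => k _ _; apply: integral_ge0 => x _; rewrite lee_fin u0.
  apply: nearW => k.
  apply: (@le_trans _ _ (\sum_(0 <= l < k) (1 * 2^-1 ^+ l)%:E)%E).
    apply: lee_sum => l _; under eq_integral do rewrite EFinM.
    rewrite ge0_integralZl_EFin ?exprn_ge0//; last 2 first.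
    - by move=> x _; rewrite lee_fin sqr_ge0.
    - by apply: measurable_sqr; exact: measurable_funB.
    apply: le_trans (lee_wpmul2l _ (fC l l.+1 (leqnSn l))) _.
      by rewrite lee_fin exprn_ge0.
    rewrite -EFinM lee_fin mul1r.
    have -> : (4^-1 : R) = 2^-1 * 2^-1 by rewrite -invfM -natrM.
    by rewrite exprMn mulrA -exprMn divff ?expr1n ?mul1r// lexx.
  rewrite sumEFin lee_fin; apply: le_trans (geometric_psum_le _ _ _) _ => //.
    by rewrite invr_gt0 ltr0n invf_lt1 ?ltr1n.
  by rewrite (_ : 1 - 2^-1 = 2^-1) ?invrK ?mul1r//; field.
have aecvg : {ae mu, forall x, cvgn (fun k => f k x)}.
  have Si : mu.-integrable setT (fun x => (\sum_(0 <= k <oo) (u k x)%:E)%E).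
    apply/integrableP; split.
      by apply: ge0_emeasurable_sum => // l x _ _; rewrite lee_fin u0.
    rewrite (_ : integral _ _ _ = \int[mu]_x (\sum_(0 <= k <oo) (u k x)%:E))%E//.
    apply: eq_integral => x _; rewrite gee0_abs// nneseries_ge0// => *.
    by rewrite lee_fin u0.
  have := integrable_ae measurableT Si; apply: filterS => x /(_ I) Sx.
  have cu : cvgn (series (fun k => u k x)).
    apply: nondecreasing_is_cvgn.
      apply/nondecreasing_seqP => k; rewrite /series/= big_nat_recr//=.
      by rewrite lerDl u0.
    exists (fine (\sum_(0 <= k <oo) (u k x)%:E)%E) => _ [k _ <-].
    rewrite -lee_fin fineK// /series/= -sumEFin.
    by apply: nneseries_lim_ge => *; rewrite lee_fin u0.
  have cg : cvgn (series (geometric 1 (2^-1 : R))).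
    apply: is_cvg_geometric_series; rewrite ger0_norm ?invr_ge0//.
    by rewrite invf_lt1 ?ltr1n.
  have ca : cvgn (series (fun k => `|f k.+1 x - f k x|)).
    apply: (@series_le_cvg _ _ (fun k => geometric 1 2^-1 k + u k x)) => //.
    - by move=> k; rewrite addr_ge0// geometric_ge0.
    - move=> k; rewrite /= /u mul1r distrC.
      set t := `|_|; have t0 : 0 <= t by exact: normr_ge0.
      rewrite -[(f k x - _) ^+ 2]real_normK ?num_real// -/t exprVn.
      have p0 : 0 < 2 ^+ k :> R by rewrite exprn_gt0.
      rewrite -subr_ge0 (_ : _ - t = (2 ^+ k)^-1 * (2 ^+ k * t - 1) ^+ 2 + t).
        by rewrite addr_ge0// mulr_ge0 ?sqr_ge0// invr_ge0 ltW.
      by field; rewrite gt_eqF.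
    - rewrite (_ : series _ = (series (geometric 1 2^-1) \+ series (fun k => u k x))).
        exact: is_cvgD.
      by apply/funext => k; rewrite /series/= big_split.
  have := normed_cvg ca; rewrite seriesEnat => ct.
  have tele : (fun k => f k x) = (fun k => f 0%N x + \sum_(0 <= i < k) (f i.+1 x - f i x)).
    by apply/funext => k; rewrite telescope_sumr// addrC subrK.
  by rewrite tele; apply: is_cvgD => //; exact: is_cvg_cst.
pose w x := fine (limn_esup (fun k => (f k x)%:E)).
have mw : measurable_fun setT w.
  apply: measurableT_comp => //; apply: measurable_fun_limn_esup => k.
  exact/measurable_EFinP.
exists w => // k.
have fw x : cvgn (fun k => f k x) -> f k x @[k --> \oo] --> w x.
  move=> cf; have ce : (f k x)%:E @[k --> \oo] --> (limn (fun k => f k x))%:E.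
    by apply: cvg_EFin; [exact: nearW|exact: cf].
  by rewrite /w (cvg_limn_einf_sup ce).2.
pose g l x := ((f k x - f l x) ^+ 2)%:E.
have mg l : measurable_fun setT (g l) by apply: measurable_sqr; exact: measurable_funB.
have mlim : measurable_fun setT (fun x => limn_einf (g^~ x)).
  rewrite (_ : (fun x => _) = (fun x => - limn_esup (fun l => - g l x))%E).
    apply: measurableT_comp => //; apply: measurable_fun_limn_esup => l.
    exact: measurableT_comp.
  by apply/funext => x; rewrite (limn_esupN (g^~ x)) oppeK.
apply: (@le_trans _ _ (\int[mu]_x limn_einf (g^~ x))%E).
  apply: ae_ge0_le_integral => //.
  - by move=> x _; rewrite lee_fin sqr_ge0.
  - by apply: measurable_sqr; exact: measurable_funB.
  - move=> x _; rewrite limn_einf_lim; apply: lime_ge; first exact: is_cvg_einfs.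
    by apply: nearW => n; apply: le_ereal_inf_tmp => _ [m _ <-]; rewrite lee_fin sqr_ge0.
  apply: filterS aecvg => x /fw cf _.
  have cg : g l x @[l --> \oo] --> ((f k x - w x) ^+ 2)%:E.
    apply: cvg_EFin; first by apply: nearW.
    apply: (@cvg_comp _ _ _ (fun l => f k x - f l x) (fun t => t ^+ 2) _ (nbhs (f k x - w x))).
      by apply: cvgB => //; exact: cvg_cst.
    exact: exprn_continuous.
  by rewrite (cvg_limn_einf_sup cg).1.
apply: le_trans (fatou mu measurableT mg _) _.
  by move=> l x _; rewrite lee_fin sqr_ge0.
rewrite limn_einf_lim; apply: lime_le; first exact: is_cvg_einfs.
apply: nearW => n; apply: le_trans (fC k (maxn k n) (leq_maxl _ _)).
by apply: ereal_inf_lbound; exists (maxn k n) => //=; exact: leq_maxr.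
Qed.

End square_integrable.

Section compactness_along_ultrafilter.
Context d (T : measurableType d) (R : realType)
  (mu : {sigma_finite_measure set T -> \bar R}).
Context (U : set_system nat) (UU : UltraFilter U).

(** The operator of such a kernel has finite rank: its range lies in the span of the
    indicator functions of the [N] sets [B `&` r @^-1` [set q]]. *)
Definition step_kernel (k : T * T -> R) := exists (N : nat) (r : T -> nat)
    (B : set T) (g : nat -> T -> R),
  [/\ measurable B, (mu B < +oo)%E, forall x, B x -> (r x < N)%N,
      forall q, measurable_fun setT (g q) /\ (sqint mu (g q) < +oo)%E &
      forall x y, k (x, y) = \1_B x * g (r x) y].

(** Compactness of the integral operator of [k], phrased as the Cauchy property of
    the images along the ultrafilter [U]. Since [U] is fixed, several operators can be
    treated at once without extracting successive subsequences. *)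
Definition ultra_compact (k : T * T -> R) := forall (f : nat -> T -> R) (C : R),
  (forall i, measurable_fun setT (f i)) ->
  (forall i, sqint mu (f i) <= C%:E)%E ->
  forall e : R, 0 < e -> exists2 A, U A &
    forall i j, A i -> A j ->
      (sqint mu (kernel_op mu k (fun y => f i y - f j y)%R) <= e%:E)%E.

(** The images of [f i] are determined by the finitely many bounded numerical
    sequences [\int g q y * f i y], which are Cauchy along [U]. *)
Lemma step_kernel_ultra_compact k : measurable_fun setT k -> step_kernel k ->
  ultra_compact k.
Proof.
move=> mk [N [r [B [g [mB Boo rN gL2 kE]]]]] f C mf fC e e0.
have [b Bb] : exists b, mu B = b%:E.
  by exists (fine (mu B)); rewrite fineK// ge0_fin_numE.
have b0 : 0 <= b by rewrite -lee_fin -Bb.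
pose c i q := \int[mu]_y (g q y * f i y).
pose e' := Num.sqrt (e / (b + 1)).
have e'0 : 0 < e' by rewrite sqrtr_gt0 divr_gt0// ltr_wpDl.
have [A UA Ac] : exists2 A, U A & forall i j, A i -> A j ->
    forall q, (q < N)%N -> `|c i q - c j q| <= e'.
  elim: N {rN} => [|N [A UA Ac]]; first by exists setT => //; exact: filterT.
  have [mg gy] := gL2 N.
  have gf : sqint mu (g N) = (fine (sqint mu (g N)))%:E.
    by rewrite fineK// ge0_fin_numE ?sqint_ge0.
  have cb i : `|c i N| <= fine (sqint mu (g N)) + C.
    by apply: normr_Rintegral_prod_le; rewrite -?gf.
  have [A' UA' Ac'] := ultra_bounded_cauchy UU cb e'0.
  exists (A `&` A'); first exact: filterI.
  move=> i j [Ai A'i] [Aj A'j] q; rewrite ltnS leq_eqVlt => /predU1P[->|].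
    exact: Ac'.
  exact: Ac.
exists A => // i j Ai Aj.
have fy l : (sqint mu (f l) < +oo)%E by rewrite (le_lt_trans (fC l)) ?ltry.
have opE x : kernel_op mu k (fun y => f i y - f j y) x =
    \1_B x * (c i (r x) - c j (r x)).
  have [mg gy] := gL2 (r x).
  have gi l : mu.-integrable setT (EFin \o (fun y => g (r x) y * f l y)).
    exact: integrable_prod_sqint.
  have gd := integrableB measurableT (gi i) (gi j).
  rewrite /c -RintegralB// /kernel_op -RintegralZl//.
  by apply: eq_Rintegral => y _; rewrite kE; ring.
apply: (@le_trans _ _ (\int[mu]_x ((e' ^+ 2)%:E * (\1_B x)%:E))%E).
  apply: ge0_le_integral => //.
  - by move=> x _; rewrite lee_fin sqr_ge0.
  - by apply: measurable_sqr; apply: measurable_kernel_op => //; exact: measurable_funB.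
  - by apply: measurable_funeM; exact/measurable_EFinP/measurable_indicP.
  move=> x _; rewrite opE -EFinM lee_fin indicE.
  have [Bx|Bx] := boolP (x \in B); last by rewrite !(mul0r, mulr0) expr0n.
  rewrite mul1r mulr1 -[leLHS]real_normK ?num_real// lerXn2r ?nnegrE ?(ltW e'0)//.
  by apply: Ac => //; apply: rN; rewrite inE in Bx.
rewrite ge0_integralZl_EFin ?sqr_ge0//; last exact/measurable_EFinP/measurable_indicP.
have -> : (\int[mu]_x (\1_B x)%:E)%E = b%:E by rewrite integral_indic// setIT -Bb.
rewrite -EFinM lee_fin /e' sqr_sqrtr; last first.
  by rewrite divr_ge0// ?(ltW e0)// addr_ge0.
rewrite mulrAC ler_pdivrMr ?ltr_wpDl// ler_wpM2l ?(ltW e0)//.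
by rewrite lerDl.
Qed.

(** The difference of [k] and a step kernel [k'] is small in Schur norm, hence in
    operator norm: compact operators are closed under limits in operator norm. *)
Lemma schur_limit_ultra_compact (k : T * T -> R) : measurable_fun setT k ->
  (forall e : R, 0 < e -> exists2 k' : T * T -> R, measurable_fun setT k' /\ step_kernel k' &
     schur_bounded mu (fun z => k z - k' z) e) ->
  ultra_compact k.
Proof.
move=> mk kS f C mf fC e e0.
have C0 : 0 <= C by rewrite -lee_fin (le_trans (sqint_ge0 mu (f 0%N))).
pose e1 := Num.sqrt (e / (16 * (C + 1))).
have C1 : 0 < C + 1 by rewrite ltr_wpDl.
have e10 : 0 < e1 by rewrite sqrtr_gt0 divr_gt0// mulr_gt0.
have [k' [mk' sk'] kk'] := kS _ e10.
have [A UA Ac] := step_kernel_ultra_compact mk' sk' mf fC (divr_gt0 e0 (ltr0n R 4 : 0 < 4)).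
exists A => // i j Ai Aj; pose h y := f i y - f j y.
have mh : measurable_fun setT h by exact: measurable_funB.
have hC : (sqint mu h <= (4 * C)%:E)%E.
  apply: le_trans (sqintB mu (mf i) (mf j)) _.
  rewrite (_ : 4 * C = 2 * C + 2 * C); last by ring.
  by rewrite (EFinD (2 * C)) (EFinM 2 C); apply: leeD; apply: lee_wpmul2l => //; exact: fC.
have hy : (sqint mu h < +oo)%E by rewrite (le_lt_trans hC) ?ltry.
have [inth opk] := schur_test e10 kk' mh hy.
move: sk' => [N [r [B [g [mB Boo rN gL2 kE]]]]].
have inth' x : mu.-integrable setT (fun y => (k' (x, y) * h y)%:E).
  have [mg gy] := gL2 (r x).
  have gh : mu.-integrable setT (fun y => (g (r x) y * h y)%:E).
    exact: integrable_prod_sqint.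
  have := integrableZl measurableT (\1_B x) gh; apply: eq_integrable => // y _.
  by rewrite kE -EFinM mulrA.
have mop' : measurable_fun setT (kernel_op mu k' h) by exact: measurable_kernel_op.
have mopd : measurable_fun setT (kernel_op mu (fun z => k z - k' z) h).
  by apply: measurable_kernel_op => //; exact: measurable_funB.
apply: (@le_trans _ _ (sqint mu (fun x => kernel_op mu (fun z => k z - k' z) h x +
    kernel_op mu k' h x)%R)).
  apply: le_sqint; [exact: measurable_kernel_op|exact: measurable_funD|].
  apply: filterS inth => x ix; rewrite /kernel_op -RintegralD//; last exact: inth'.
  rewrite [X in `|X| <= _](_ : _ = \int[mu]_y ((k (x, y) - k' (x, y)) * h y + k' (x, y) * h y))//.
  by apply: eq_Rintegral => y _; rewrite /h; ring.
apply: le_trans (sqintD mu mopd mop') _.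
rewrite [X in (_ <= X%:E)%E](splitr e) (EFinD (e / 2)); apply: leeD.
  apply: (@le_trans _ _ (2%:E * ((e1 ^+ 2)%:E * (4 * C)%:E))%E).
    rewrite lee_wpmul2l ?lee_fin//; apply: le_trans opk _.
    by rewrite lee_wpmul2l// lee_fin sqr_ge0.
  rewrite -!EFinM lee_fin /e1 sqr_sqrtr; last by rewrite divr_ge0 ?(ltW e0)// mulr_ge0 ?(ltW C1).
  rewrite [leLHS](_ : _ = e / 2 * (C / (C + 1))); last by field; rewrite gt_eqF.
  by rewrite ger_pMr ?divr_gt0// ler_pdivrMr// mul1r lerDl.
rewrite (_ : e / 2 = 2 * (e / 4)); last by field.
by rewrite EFinM lee_wpmul2l// ?lee_fin//; exact: Ac.
Qed.

End compactness_along_ultrafilter.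

(** * Functions with symbol estimates, and their finite differences *)

Section difference.
Context {R : realType} {V : normedModType R}.
Implicit Types (v p : V) (f g : V -> R) (D : set V) (lam w : V -> R).

Definition diff_op v f : V -> R := fun p => f (p + v) - f p.

(** The class of functions whose directional derivatives along [D] satisfy
    symbol estimates up to order [k]: each derivative improves the bound [w] by
    a factor [lam]. *)
Fixpoint jet (k : nat) D lam w f : Prop :=
  [/\ continuous f, forall p, `|f p| <= w p &
   if k is k'.+1 then forall v, D v ->
     (forall p, derivable f p v) /\ jet k' D lam (fun p => w p / lam p) ('D_v f)
   else True].

Lemma jet_continuous k D lam w f : jet k D lam w f -> continuous f.
Proof. by case: k => [|k] []. Qed.

Lemma jet_le k D lam w f : jet k D lam w f -> forall p, `|f p| <= w p.
Proof. by case: k => [|k] []. Qed.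

Lemma jetS k D lam w f : jet k.+1 D lam w f -> jet k D lam w f.
Proof.
elim: k w f => [|k IH] w f [cf fw]; first by split.
by move=> df; split=> // v Dv; have [? ?] := df v Dv; split=> //; exact: IH.
Qed.

Lemma jet_leq k l D lam w f : (l <= k)%N -> jet k D lam w f -> jet l D lam w f.
Proof.
by move=> /subnK <-; elim: (k - l)%N => // m IH /jetS.
Qed.

Lemma jet_mono k D lam w w' f : (forall p, 0 < lam p) ->
  (forall p, w p <= w' p) -> jet k D lam w f -> jet k D lam w' f.
Proof.
move=> lam0; elim: k w w' f => [|k IH] w w' f ww [cf fw df].
  by split=> // p; exact: le_trans (ww p).
split=> // [p|v Dv]; first exact: le_trans (ww p).
have [? jf] := df v Dv; split=> //; apply: IH jf => p.
by rewrite ler_pM2r ?invr_gt0.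
Qed.

Lemma jetD k D lam w w' f g : jet k D lam w f -> jet k D lam w' g ->
  jet k D lam (fun p => w p + w' p) (fun p => f p + g p).
Proof.
elim: k w w' f g => [|k IH] w w' f g [cf fw df] [cg gw dg].
  split=> // [p|p]; first exact: cvgD (cf p) (cg p).
  exact: le_trans (ler_normD _ _) (lerD (fw p) (gw p)).
split=> [p|p|v Dv]; first exact: cvgD (cf p) (cg p).
  exact: le_trans (ler_normD _ _) (lerD (fw p) (gw p)).
have [df1 jf] := df v Dv; have [dg1 jg] := dg v Dv; split.
  by move=> p; exact: derivableD.
have -> : 'D_v (fun p => f p + g p) = (fun p => 'D_v f p + 'D_v g p).
  by apply/funext => p; exact: deriveD.
have -> : (fun p => (w p + w' p) / lam p) = (fun p => w p / lam p + w' p / lam p).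
  by apply/funext => p; rewrite mulrDl.
exact: IH.
Qed.

Lemma jetN k D lam w f : jet k D lam w f -> jet k D lam w (fun p => - f p).
Proof.
elim: k w f => [|k IH] w f [cf fw df].
  by split=> // [p|p]; [exact: cvgN (cf p)|rewrite normrN].
split=> [p|p|v Dv]; [exact: cvgN (cf p)|by rewrite normrN|].
have [df1 jf] := df v Dv; split; first by move=> p; exact: derivableN.
have -> : 'D_v (fun p => - f p) = (fun p => - 'D_v f p).
  by apply/funext => p; exact: deriveN.
exact: IH.
Qed.

Lemma jetB k D lam w w' f g : jet k D lam w f -> jet k D lam w' g ->
  jet k D lam (fun p => w p + w' p) (fun p => f p - g p).
Proof. by move=> jf jg; apply: jetD => //; exact: jetN. Qed.

Lemma jet_cst k D lam w (c : R) : (forall p, 0 < lam p) ->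
  (forall p, `|c| <= w p) -> jet k D lam w (fun=> c).
Proof.
move=> lam0; elim: k c w => [|k IH] c w cw.
  by split=> // p; exact: cvg_cst.
split=> // [p|v Dv]; first exact: cvg_cst.
split; first by move=> p; exact: derivable_cst.
have -> : 'D_v (fun=> c : R) = (fun=> 0).
  by apply/funext => p; exact: derive_cst.
apply: IH => p; rewrite normr0 divr_ge0 ?(ltW (lam0 p))//.
exact: le_trans (cw p).
Qed.

(** Leibniz rule; the factor [2 ^+ k] counts its terms. *)
Lemma jetM k D lam w w' f g : jet k D lam w f -> jet k D lam w' g ->
  jet k D lam (fun p => 2 ^+ k * (w p * w' p)) (fun p => f p * g p).
Proof.
elim: k w w' f g => [|k IH] w w' f g jf jg; have [cf fw df] := jf; have [cg gw dg] := jg.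
  split=> // [p|p]; first exact: cvgM (cf p) (cg p).
  by rewrite expr0 mul1r normrM ler_pM.
split=> [p|p|v Dv]; first exact: cvgM (cf p) (cg p).
  rewrite normrM; apply: le_trans (ler_pM _ _ (fw p) (gw p)) _ => //.
  rewrite ler_peMl ?exprn_ege1 ?ler1n// mulr_ge0//.
    by rewrite (le_trans _ (fw p)).
  by rewrite (le_trans _ (gw p)).
have [df1 jdf] := df v Dv; have [dg1 jdg] := dg v Dv; split.
  by move=> p; exact: derivableM.
have -> : 'D_v (fun p => f p * g p) = (fun p => f p * 'D_v g p + 'D_v f p * g p).
  apply/funext => p; rewrite (deriveM (df1 p) (dg1 p)).
  by rewrite /GRing.scale/= [g p * _]mulrC.
have -> : (fun p => 2 ^+ k.+1 * (w p * w' p) / lam p) =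
    (fun p => 2 ^+ k * (w p * (w' p / lam p)) + 2 ^+ k * (w p / lam p * w' p)).
  by apply/funext => p; rewrite exprS; ring.
by apply: jetD; [apply: IH (jetS jf) jdg|apply: IH jdf (jetS jg)].
Qed.

Lemma jetX k D lam w f q : (forall p, 0 < lam p) -> jet k D lam w f ->
  jet k D lam (fun p => (2 ^+ k) ^+ q * w p ^+ q) (fun p => f p ^+ q).
Proof.
move=> lam0 jf; elim: q => [|q IH].
  by apply: jet_cst => // p; rewrite !expr0 mulr1 normr1.
have := jetM jf IH.
rewrite (_ : (fun p => f p * f p ^+ q) = (fun p => f p ^+ q.+1)); last first.
  by apply/funext => p; rewrite exprS.
by apply: jet_mono => // p; rewrite !exprS [leRHS](_ : _ = 2 ^+ k * (w p * ((2 ^+ k) ^+ q * w p ^+ q))) //; ring.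
Qed.

Lemma jetZ k D lam w f c : jet k D lam w f ->
  jet k D lam (fun p => `|c| * w p) (fun p => c * f p).
Proof.
elim: k w f => [|k IH] w f [cf fw df].
  split=> // [p|p]; first by apply: cvgM (cf p); exact: cvg_cst.
  by rewrite normrM ler_wpM2l.
split=> // [p|p|v Dv]; first by apply: cvgM (cf p); exact: cvg_cst.
  by rewrite normrM ler_wpM2l.
have [df1 jf] := df v Dv; split; first by move=> p; exact: derivableZ.
have -> : 'D_v (fun p => c * f p) = (fun p => c * 'D_v f p).
  by apply/funext => p; exact: deriveZ.
have -> : (fun p => `|c| * w p / lam p) = (fun p => `|c| * (w p / lam p)).
  by apply/funext => p; rewrite mulrA.
exact: IH.
Qed.

Lemma derivable_line f p v (t : R) : derivable f (p + t *: v) v ->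
  is_derive t 1 (fun t => f (p + t *: v)) ('D_v f (p + t *: v)).
Proof.
move=> df; have E : (fun h : R => h^-1 *: ((fun t => f (p + t *: v)) (h *: 1 + t) -
    f (p + t *: v))) = (fun h => h^-1 *: (f (h *: v + (p + t *: v)) - f (p + t *: v))).
  apply/funext => h; congr (_ *: (f _ - _)).
  transitivity (p + (h + t) *: v); last by rewrite scalerDl addrCA.
  by congr (p + _ *: v); congr (_ + _); exact: mulr1.
by split; rewrite /derivable /derive /= E.
Qed.

Lemma diff_op_mvt f p v (h : R) : 0 < h -> (forall q, derivable f q v) ->
  exists2 c, 0 <= c <= h & diff_op (h *: v) f p = h * 'D_v f (p + c *: v).
Proof.
move=> h0 df; pose F t := f (p + t *: v).
have dF (t : R) : is_derive t 1 F ('D_v f (p + t *: v)) by exact: derivable_line.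
have [|c ch] := @MVT R F (fun t => 'D_v f (p + t *: v)) 0 h h0 (fun t _ => dF t).
  apply: continuous_subspaceT => t.
  by apply: differentiable_continuous; apply/derivable1_diffP; have [] := dF t.
rewrite /F scale0r addr0 subr0 mulrC => E; exists c => //.
by move: ch; rewrite in_itv/= => /andP[/ltW -> /ltW ->].
Qed.

Fixpoint kdiff k v f := if k is k'.+1 then kdiff k' v (diff_op v f) else f.

Lemma diff_op_kdiff k v f : diff_op v (kdiff k v f) = kdiff k v (diff_op v f).
Proof. by elim: k f => //= k IH f; rewrite IH. Qed.

Lemma derive_diff_op v u f : (forall q, derivable f q v) ->
  (forall q, derivable (diff_op u f) q v) /\
  'D_v (diff_op u f) = diff_op u ('D_v f).
Proof.
move=> df; have dfu q : is_derive q v (fun p => f (p + u)) ('D_v f (q + u)).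
  have E : (fun h : R => h^-1 *: ((fun p => f (p + u)) (h *: v + q) - f (q + u))) =
      (fun h => h^-1 *: (f (h *: v + (q + u)) - f (q + u))).
    by apply/funext => h; rewrite addrA.
  have := df (q + u); rewrite /derivable -E => dq.
  by split => //; rewrite /derive -E.
split=> [q|]; first by apply: derivableB => //; have [] := dfu q.
apply/funext => q; have [d e] := dfu q.
by transitivity ('D_v (fun p => f (p + u)) q - 'D_v f q); [exact: (deriveB d (df q))|rewrite e].
Qed.

Lemma derive_kdiff k v u f : (forall q, derivable f q v) ->
  (forall q, derivable (kdiff k u f) q v) /\
  'D_v (kdiff k u f) = kdiff k u ('D_v f).
Proof.
elim: k f => [|k IH] f df; first by split.
have [d1 e1] := derive_diff_op u df.
by have [d2 e2] := IH _ d1; split=> //=; rewrite e2 e1.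
Qed.

(** A finite difference of order [k] is a derivative of order [k] at an
    intermediate point. *)
Lemma normr_kdiff_le k v D lam w f (h B : R) p : 0 < h -> D v ->
  jet k D lam w f ->
  (forall t, 0 <= t <= k%:R * h ->
     w (p + t *: v) / lam (p + t *: v) ^+ k <= B) ->
  `|kdiff k (h *: v) f p| <= h ^+ k * B.
Proof.
move=> h0 Dv; elim: k w f p B => [|k IH] w f p B /=.
  move=> [_ fw _] wB; rewrite expr0 mul1r (le_trans (fw p))//.
  by have := wB 0; rewrite mul0r lexx scale0r addr0 expr0 divr1; exact.
move=> jf wB; have [df jdf] := (let: And3 _ _ d := jf in d) v Dv.
have [d1 e1] := derive_kdiff k (h *: v) df.
rewrite -diff_op_kdiff; have [c /andP[c0 ch] ->] := diff_op_mvt p h0 d1.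
have /= -> := congr1 (@^~ (p + c *: v)) e1.
rewrite normrM (gtr0_norm h0) exprS -mulrA ler_pM2l//.
apply: IH jdf _ => t /andP[t0 tk].
have := wB (c + t); rewrite exprS invfM mulrA -!addrA -!scalerDl.
apply; rewrite addr_ge0//= -natr1 mulrDl mul1r addrC lerD//.
Qed.

End difference.

(** * Translations and boxes for the product measures *)

Section coordinate_shift.
Context {R : realType}.
Local Notation bR := (measurableTypeR R).

Definition shift_invariant d (T : measurableType d) (mu : {measure set T -> \bar R})
    (s : T -> T) := forall f : T -> \bar R, measurable_fun setT f ->
  (forall x, 0 <= f x)%E -> (\int[mu]_x f (s x) = \int[mu]_x f x)%E.

Lemma shift_invariant_set d (T : measurableType d) (mu : {measure set T -> \bar R})
    (s : T -> T) : measurable_fun setT s ->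
  (forall A, measurable A -> mu (s @^-1` A) = mu A) -> shift_invariant mu s.
Proof.
move=> ms muA f mf f0.
have := @ge0_integral_pushforward _ _ T T R s ms mu setT f measurableT.
rewrite preimage_setT => <-//.
by apply: eq_measure_integral => A mA _; exact: muA.
Qed.

(** Shift invariance restricted to the functions that are invariant under
    another shift [t]; with [t] the translation by the period, it holds on a
    circle represented by a fundamental domain. *)
Definition shift_invariant_periodic d (T : measurableType d)
    (mu : {measure set T -> \bar R}) (s t : T -> T) :=
  forall f : T -> \bar R, measurable_fun setT f -> (forall x, 0 <= f x)%E ->
  (forall x, f (t x) = f x) -> (\int[mu]_x f (s x) = \int[mu]_x f x)%E.

Lemma lebesgue_measure_shift (h : R) (A : set bR) : measurable A ->
  @lebesgue_measure R ((fun t : bR => t + h : bR) @^-1` A) = lebesgue_measure A.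
Proof.
move=> mA; have ms : measurable_fun setT (fun t : bR => t + h : bR).
  exact: measurable_funD.
apply/esym/(@lebesgue_measure_unique _ (pushforward lebesgue_measure (fun t : bR => t + h : bR))) => // _ [[a b]] _ <-.
transitivity (@lebesgue_measure R `]a - h, b - h]); last first.
  rewrite /pushforward/=; congr lebesgue_measure.
  by apply/seteqP; split=> t /=; rewrite !in_itv/= ltrBlDr lerBrDr.
rewrite !lebesgue_measure_itv/= !lte_fin ltrBlDr subrK.
by case: ifPn => // _; rewrite -!EFinB; congr EFin; ring.
Qed.

Lemma lebesgue_shift_invariant (h : R) :
  shift_invariant (@lebesgue_measure R) (fun t : bR => t + h : bR).
Proof.
apply: shift_invariant_set => [|A mA]; first exact: measurable_funD.
exact: lebesgue_measure_shift.
Qed.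

(** A periodic function does not distinguish the translation by [h] from the
    rotation, which exchanges two intervals of the fundamental domain. *)
Lemma circle_shift_periodic (h : R) : 0 <= h <= 2 * pi ->
  shift_invariant_periodic (@circle_measure R) (fun t : bR => t + h : bR)
    (fun t : bR => t + 2 * pi : bR).
Proof.
move=> /andP[h0 h2] f mf f0 fp.
pose s (t : bR) : bR := if t + h < 2 * pi then t + h else t + (h - 2 * pi).
have fs t : f (t + h) = f (s t).
  rewrite /s; case: ifP => // _; rewrite -[in LHS](subrK (2 * pi) (t + h)) fp.
  by rewrite addrA.
have ms : measurable_fun setT s.
  apply: measurable_fun_ifT; try exact: measurable_funD.
  by apply: measurable_fun_ltr => //; exact: measurable_funD.
under eq_integral do rewrite fs.
apply: (shift_invariant_set ms _ mf f0) => A mA.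
pose I (a b : R) : set bR := `[a, b[%classic.
have mI a b : measurable (I a b) by exact: measurable_itv.
suff E : @lebesgue_measure R ((s @^-1` A) `&` I 0 (2 * pi)) = lebesgue_measure (A `&` I 0 (2 * pi)).
  exact: (congr1 (fun x => ((2 * pi)^-1%:E * x)%E) E).
have -> : (s @^-1` A) `&` I 0 (2 * pi) =
    ((fun t : bR => t + h : bR) @^-1` (A `&` I h (2 * pi))) `|`
    ((fun t : bR => t + (h - 2 * pi) : bR) @^-1` (A `&` I 0 h)).
  apply/seteqP; split => t; rewrite /I /s /= !in_itv/=.
    by case: ifP => th [At /andP[t0 t1]]; [left|right]; split=> //; apply/andP; split; move: th; lra.
  case => -[At /andP[t0 t1]].
    by case: ifP => th; [split=> //; apply/andP; split; lra|move: th; lra].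
  by case: ifP => th; [move: th; lra|split=> //; apply/andP; split; lra].
have -> : A `&` I 0 (2 * pi) = (A `&` I h (2 * pi)) `|` (A `&` I 0 h).
  apply/seteqP; split => t; rewrite /I /= !in_itv/=.
    move=> [At /andP[t0 t1]]; have [th|th] := ltP t h; [right|left]; split=> //; apply/andP; split; lra.
  by case => -[At /andP[t0 t1]]; split=> //; apply/andP; split; lra.
have mp h' (B : set bR) : measurable B -> measurable ((fun t : bR => t + h' : bR) @^-1` B).
  by move=> mB; rewrite -[X in measurable X]setTI; apply: measurable_funD.
rewrite !measureU; try by [apply: mp; exact: measurableI|exact: measurableI].
- by congr (_ + _)%E; apply: lebesgue_measure_shift; exact: measurableI.
- apply/seteqP; split => // t; rewrite /I /= !in_itv/= => -[[_ /andP[a b]] [_ /andP[c e]]]; lra.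
- apply/seteqP; split => // t; rewrite /I /= !in_itv/= => -[[_ /andP[a b]] [_ /andP[c e]]]; lra.
Qed.

Lemma counting_image (T : choiceType) (f : T -> T) (A : set T) :
  injective f -> @counting T R (f @` A) = counting A.
Proof.
move=> fi; rewrite /counting.
have AE : (f @` A #= A)%card by apply: inj_card_eq => x y _ _; exact: fi.
have [fA|/asboolPn fA] := pselect (finite_set A); last first.
  rewrite asboolF; last by rewrite (eq_finite_set AE); exact/asboolPn.
  by rewrite asboolF//; exact/asboolPn.
rewrite !asboolT//; last exact: finite_image.
by rewrite fset_set_image// card_imfset.
Qed.

Lemma integer_shift_invariant (z : int) :
  shift_invariant (@integer_measure R) (fun t : bR => t + z%:~R : bR).
Proof.
have ms : measurable_fun setT (fun t : bR => t + z%:~R : bR).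
  exact: measurable_funD.
apply: shift_invariant_set => // A mA; transitivity (@counting bR R (((fun t : bR => t + z%:~R : bR) @^-1` A) `&` @integers R)) => //.
transitivity (@counting bR R (A `&` @integers R)) => //.
rewrite -(@counting_image bR (fun t : R => t + z%:~R)); last exact: addIr.
congr counting; apply/seteqP; split => [_ [x [Ax [k _ kx]] <-]|x [Ax [k _ kx]]].
  by split; [exact: Ax|exists (k + z) => //; rewrite rmorphD/= kx].
exists (x - z%:~R); last by rewrite subrK.
split; first by rewrite /= subrK.
by exists (k - z) => //; rewrite rmorphB/= kx.
Qed.

Section product.
Implicit Types mu : nat -> {sigma_finite_measure set bR -> \bar R}.

Lemma integral_rV_cons mu n (f : 'rV[R]_n.+1 -> \bar R) :
  measurable_fun setT f -> (forall x, 0 <= f x)%E ->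
  (\int[product_measure n.+1 mu]_x f x =
   \int[mu 0%N]_t \int[product_measure n (fun i => mu i.+1)]_x f (rV_cons (t, x)))%E.
Proof.
move=> mf f0.
have := @ge0_integral_pushforward _ _ _ _ R (@rV_cons R n) (@measurable_rV_cons R n)
  (mu 0%N \x product_measure n (fun i => mu i.+1))%E setT f measurableT.
rewrite preimage_setT => E; rewrite [LHS]E//.
have mc : measurable_fun setT (f \o @rV_cons R n).
  exact: measurableT_comp (@measurable_rV_cons R n).
exact: (fubini_tonelli1 _ mc (fun z => f0 (rV_cons z))).
Qed.

Lemma measurable_shift n (v : 'rV[R]_n) : measurable_fun setT (fun x : 'rV[R]_n => x + v).
Proof.
apply: measurable_fun_rV => i.
rewrite (_ : (fun t => _) = (fun t : 'rV[R]_n => t ord0 i + v ord0 i : bR)).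
  by apply: measurable_funD => //; exact: measurable_coord.
by apply/funext => x; rewrite mxE.
Qed.

Lemma rV_cons_shift_head n t (x : 'rV[R]_n) (h : R) :
  rV_cons (t, x) + h *: std_basis ord0 = rV_cons (t + h, x).
Proof.
apply/rowP => i; rewrite mxE [X in _ + X]mxE [X in _ + _ * X]mxE eqxx/=.
case: (unliftP ord0 i) => [j|] ->.
  by rewrite !rV_cons_tail/= mulr0 addr0.
by rewrite !rV_cons_head/= mulr1.
Qed.

Lemma rV_cons_shift_tail n t (x : 'rV[R]_n) (h : R) (j : 'I_n) :
  rV_cons (t, x) + h *: std_basis (lift ord0 j) = rV_cons (t, x + h *: std_basis j).
Proof.
apply/rowP => i; rewrite mxE [X in _ + X]mxE [X in _ + _ * X]mxE eqxx/=.
case: (unliftP ord0 i) => [k|] ->.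
  by rewrite !rV_cons_tail/= mxE [X in _ = _ + X]mxE [X in _ = _ + _ * X]mxE eqxx (inj_eq lift_inj).
by rewrite !rV_cons_head/= mulr0 addr0.
Qed.

Lemma product_shift_periodic mu n (j : 'I_n) (h P : R) :
  shift_invariant_periodic (mu j) (fun t : bR => t + h : bR) (fun t : bR => t + P : bR) ->
  shift_invariant_periodic (product_measure n mu) (fun x => x + h *: std_basis j)
    (fun x => x + P *: std_basis j).
Proof.
elim: n mu j => [|n IH] mu j muj f mf f0; first by case: j muj.
have mfs := measurableT_comp mf (measurable_shift (h *: std_basis j)).
rewrite (integral_rV_cons mu mf f0) (integral_rV_cons mu mfs (fun x => f0 _)).
have mc : measurable_fun setT (fun z => f (rV_cons z)).
  exact: measurableT_comp (@measurable_rV_cons R n).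
move: muj; case: (unliftP ord0 j) => [k|] -> muj fP.
  apply: eq_integral => t _.
  under eq_integral do rewrite /= rV_cons_shift_tail.
  have := IH (fun i => mu i.+1) k _ (fun x => f (rV_cons (t, x))); apply => //.
    exact: (measurableT_comp mc (pair1_measurable t)).
  by move=> x; rewrite -rV_cons_shift_tail fP.
under eq_integral do under eq_integral do rewrite /= rV_cons_shift_head.
have mF := @measurable_fun_fubini_tonelli_F _ _ _ _ _ (product_measure n (fun i => mu i.+1)) _ mc (fun z => f0 (rV_cons z)).
rewrite (muj _ mF)// => t; first exact: integral_ge0.
by apply: eq_integral => x _; rewrite -rV_cons_shift_head fP.
Qed.

Lemma product_shift_invariant mu n (j : 'I_n) (h : R) :
  shift_invariant (mu j) (fun t : bR => t + h : bR) ->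
  shift_invariant (product_measure n mu) (fun x => x + h *: std_basis j).
Proof.
move=> muj f mf f0; apply: (@product_shift_periodic mu n j h 0) => //.
  by move=> g mg g0 _; exact: muj.
by move=> x; rewrite scale0r addr0.
Qed.

Lemma measurable_box n (B : nat -> set bR) : (forall i, measurable (B i)) ->
  measurable [set x : 'rV[R]_n | forall i : 'I_n, B i (x ord0 i)].
Proof.
move=> mB; rewrite (_ : [set _ | _] = \bigcap_(i in [set: 'I_n]) ((fun x : 'rV[R]_n => x ord0 i : bR) @^-1` B i)).
  apply: fin_bigcap_measurable => // i _.
  by rewrite -[X in measurable X]setTI; exact: measurable_coord.
by apply/seteqP; split => x /= Bx i; [move=> _|]; exact: Bx.
Qed.

Lemma product_measure_box mu n (B : nat -> set bR) : (forall i, measurable (B i)) ->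
  product_measure n mu [set x : 'rV[R]_n | forall i : 'I_n, B i (x ord0 i)] =
  (\prod_(i < n) mu i (B i))%E.
Proof.
elim: n mu B => [|n IH] mu B mB.
  by rewrite big_ord0 /= diracE mem_set//= => -[].
rewrite [LHS](_ : _ = (mu 0%N \x product_measure n (fun i => mu i.+1))%E
   (B 0%N `*` [set x : 'rV[R]_n | forall i : 'I_n, B i.+1 (x ord0 i)])); last first.
  rewrite /= /rV_cons_measure /pushforward; congr (_ _).
  apply/seteqP; split=> [[t x] /= H|[t x] /= [H0 H] i].
    split; first by have := H ord0; rewrite rV_cons_head.
    by move=> i; have := H (lift ord0 i); rewrite rV_cons_tail.
  case: (unliftP ord0 i) => [k|] ->; first by rewrite rV_cons_tail; exact: H.
  by rewrite rV_cons_head.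
rewrite product_measure1E//; last by apply: (measurable_box (B := fun i => B i.+1)).
by rewrite big_ord_recl/= (IH (fun i => mu i.+1) (fun i => B i.+1)).
Qed.

Lemma product_measure_box_le mu n (B : nat -> set bR) (c : R) :
  0 <= c -> (forall i, measurable (B i)) ->
  (forall i, (i < n)%N -> mu i (B i) <= c%:E)%E ->
  (product_measure n mu [set x : 'rV[R]_n | forall i : 'I_n, B i (x ord0 i)]
    <= (c ^+ n)%:E)%E.
Proof.
move=> c0 mB; rewrite product_measure_box//.
elim: n mu B mB => [|n IH] mu B mB muB; first by rewrite big_ord0.
rewrite big_ord_recl exprS EFinM lee_pmul//.
- by apply: prode_ge0 => i _.
- exact: muB.
by apply: (IH (fun i => mu i.+1) (fun i => B i.+1)) => // i ni; exact: muB.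
Qed.

End product.

Lemma lebesgue_ball (c r : R) : 0 <= r ->
  @lebesgue_measure R [set t | `|t - c| <= r] = (2 * r)%:E.
Proof.
move=> r0; rewrite (_ : [set _ | _] = `[c - r, c + r]%classic).
  rewrite lebesgue_measure_itv/= lte_fin; case: ltP => h.
    by rewrite -EFinD; congr EFin; ring.
  by congr EFin; lra.
apply/seteqP; split=> t /=; rewrite in_itv/= ler_distl; lra.
Qed.

Lemma measurable_ball_le (c r : R) : measurable [set t : bR | `|t - c| <= r].
Proof.
rewrite (_ : [set _ | _] = `[c - r, c + r]%classic)//.
by apply/seteqP; split=> t /=; rewrite in_itv/= ler_distl; lra.
Qed.

(** The normalization of the circle: [4 <= 2 * pi]. *)
Lemma circle_measure_le (A : set bR) (c : R) : 0 <= c ->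
  measurable A -> (lebesgue_measure A <= (4 * c)%:E)%E -> (circle_measure A <= c%:E)%E.
Proof.
move=> c0 mA Ac; rewrite /circle_measure /mscale /mrestr/=.
have p2 : 2 <= pi :> R by exact: pi_ge2.
have i0 : 0 <= (2 * pi : R)^-1 by rewrite invr_ge0; lra.
apply: (@le_trans _ _ ((2 * pi)^-1%:E * (4 * c)%:E)%E).
  rewrite lee_wpmul2l//; apply: le_trans Ac; apply: le_measure; rewrite ?inE//.
  exact: measurableI.
rewrite -EFinM lee_fin ler_pdivrMl; last lra.
nra.
Qed.

Lemma circle_measure_le1 (A : set bR) : measurable A -> (circle_measure A <= 1%:E)%E.
Proof.
move=> mA; rewrite /circle_measure /mscale /mrestr/=.
have p0 : 0 < 2 * pi :> R by rewrite mulr_gt0// pi_gt0.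
apply: (@le_trans _ _ ((2 * pi)^-1%:E * (2 * pi)%:E)%E); last first.
  by rewrite -EFinM mulVf ?gt_eqF.
rewrite lee_wpmul2l ?lee_fin ?invr_ge0 ?(ltW p0)//.
apply: (@le_trans _ _ (lebesgue_measure [set` `[0%R, 2 * pi[])).
  by apply: le_measure; rewrite ?inE//; exact: measurableI.
by rewrite lebesgue_measure_itv/= lte_fin p0 -EFinD subr0.
Qed.

Lemma integer_ball_le (r : R) : 1 <= r ->
  (@integer_measure R [set t | (`|t| <= r)%R] <= (3 * r)%:E)%E.
Proof.
move=> r1; have r0 : 0 <= r by rewrite (le_trans _ r1).
pose k := Num.trunc r.
(* There are [2 k + 1 <= 3 r] integers in [-r, r], with [k] the integer part of [r]. *)
pose s := [seq ((i%:Z - k%:Z)%:~R : R) | i <- iota 0 (k.*2).+1].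
have sub : [set t : R | `|t| <= r] `&` @integers R `<=` [set` s].
  move=> t [/= + [z _ zt]]; rewrite -{t}zt => zr.
  have zk : (absz z <= k)%N.
    by rewrite -ltnS -(ltr_nat R) (le_lt_trans _ (truncnS_gt r))// natr_absz intr_norm.
  apply/mapP; exists (absz (z + k%:Z)); last by congr (_%:~R); lia.
  by rewrite mem_iota /= add0n; lia.
rewrite /integer_measure /mrestr /counting asboolT; last first.
  exact: sub_finite_set (finite_seq s).
rewrite lee_fin; apply: (@le_trans _ _ (size s)%:R).
  rewrite ler_nat; apply: (@leq_trans #|` [fset x in s]%fset|).
    apply: fsubset_leq_card; apply/fsubsetP => x.
    rewrite (in_fset_set (sub_finite_set sub (finite_seq s))) inE => /sub /= xs.
    by rewrite !inE.
  by rewrite card_fseq size_undup.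
rewrite size_map size_iota -natr1 -muln2 natrM.
have := truncn_itv r0; rewrite -/k; nra.
Qed.

End coordinate_shift.

(** * Continuous functions are Borel measurable for the product sigma-algebra *)

Section continuous_arithmetic.
Context {R : realType} {T : topologicalType}.
Implicit Types f g : T -> R.

Lemma contC (c : R) : continuous (fun _ : T => c).
Proof. by move=> x; exact: cvg_cst. Qed.

Lemma contD f g : continuous f -> continuous g -> continuous (fun x => f x + g x).
Proof. by move=> cf cg x; exact: cvgD (cf x) (cg x). Qed.

Lemma contN f : continuous f -> continuous (fun x => - f x).
Proof. by move=> cf x; exact: cvgN (cf x). Qed.

Lemma contM f g : continuous f -> continuous g -> continuous (fun x => f x * g x).
Proof. by move=> cf cg x; exact: cvgM (cf x) (cg x). Qed.

Lemma cont_comp (T' : topologicalType) (g : T' -> R) (f : T -> T') :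
  continuous f -> continuous g -> continuous (fun x => g (f x)).
Proof. by move=> cf cg x; apply: (@continuous_comp _ _ _ f g); [exact: cf|exact: cg]. Qed.

End continuous_arithmetic.

Section measurable_continuous.
Context {R : realType} {n : nat}.
Local Notation E := 'rV[R]_n.

(** Every preimage is a countable union of fibers of [phi]. *)
Lemma measurable_countable_factor d d' (T : measurableType d)
    (T' : measurableType d') (C : countType) (phi : T -> C) (psi : C -> T') :
  (forall z, measurable [set x | phi x = z]) ->
  measurable_fun setT (fun x => psi (phi x)).
Proof.
move=> mphi _ Y mY; rewrite setTI.
rewrite (_ : _ @^-1` _ = \bigcup_(k in [set: nat])
    (if @choice.unpickle C k is Some z then
       if psi z \in Y then [set x | phi x = z] else set0 else set0)).
  apply: bigcup_measurable => k _; case: choice.unpickle => // z.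
  by case: ifP => // _; exact: mphi.
apply/seteqP; split=> [x Yx|x [k _]].
  by exists (choice.pickle (phi x)) => //=; rewrite choice.pickleK mem_set.
by case: choice.unpickle => // z; case: ifPn => // /set_mem Yz /= E; rewrite /= E.
Qed.

Definition grid (k : nat) (x : E) : 'rV[int]_n :=
  \row_i Num.floor (x ord0 i * k.+1%:R).
Definition of_grid (k : nat) (z : 'rV[int]_n) : E :=
  \row_i ((z ord0 i)%:~R / k.+1%:R).

Lemma measurable_grid_fiber k z : measurable [set x : E | grid k x = z].
Proof.
rewrite (_ : [set _ | _] = [set x : E | forall i : 'I_n,
    (fun j : nat => [set t : measurableTypeR R | forall i : 'I_n, val i = j ->
       Num.floor (t * k.+1%:R) = z ord0 i]) i (x ord0 i)]).
  apply: (measurable_box (B := fun j : nat => [set t : measurableTypeR R |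
    forall i : 'I_n, val i = j -> Num.floor (t * k.+1%:R) = z ord0 i])) => j.
  have [jn|jn] := ltnP j n; last first.
    rewrite (_ : [set _ | _] = setT)//; apply/seteqP; split => // t _ /= i ij.
    by have := ltn_ord i; rewrite ij ltnNge jn.
  rewrite (_ : [set _ | _] = `[(z ord0 (Ordinal jn))%:~R / k.+1%:R,
      ((z ord0 (Ordinal jn)) + 1)%:~R / k.+1%:R[%classic)//.
  apply/seteqP; split => t /=; rewrite in_itv/= ler_pdivrMr ?ltr0n// ltr_pdivlMr ?ltr0n//.
    by move=> /(_ (Ordinal jn) erefl) <-; exact: floor_itv.
  move=> h i ij; rewrite (_ : i = Ordinal jn); last exact: val_inj.
  exact: floor_def.
apply/seteqP; split=> x /=.
  by move=> <- i j /val_inj ->; rewrite mxE.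
by move=> h; apply/rowP => i; rewrite mxE; exact: h.
Qed.

Lemma grid_dist k (x : E) i : `|of_grid k (grid k x) ord0 i - x ord0 i| <= k.+1%:R^-1.
Proof.
rewrite !mxE; have := floor_itv (x ord0 i * k.+1%:R).
set f := Num.floor _; have k0 : 0 < k.+1%:R :> R by rewrite ltr0n.
rewrite -ler_pdivrMr// -ltr_pdivlMr// intrD mulrDl mul1r => /andP[h1 h2].
have i0 : 0 < k.+1%:R^-1 :> R by rewrite invr_gt0.
rewrite ler_norml; move: (f%:~R / _) h1 h2 => a.
move: (_^-1) i0 => b b0 h1 h2; by apply/andP; split; lra.
Qed.

Lemma mx_norm_le (x : E) (e : R) : 0 <= e -> (forall i, `|x ord0 i| <= e) -> `|x| <= e.
Proof.
move=> e0 xe; rewrite (_ : `|x| = mx_norm x)// mx_normrE; apply: bigmax_le => // -[i j] _ /=.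
by rewrite (ord1 i).
Qed.

Lemma grid_cvg (x : E) : of_grid k (grid k x) @[k --> \oo] --> x.
Proof.
apply/cvgrPdist_le => e e0.
have [N _ HN] := near_infty_natSinv_lt (PosNum e0).
exists N => // k Nk; rewrite distrC; apply: mx_norm_le; first exact: ltW.
move=> i; rewrite mxE [X in _ + X]mxE.
exact: le_trans (grid_dist k x i) (ltW (HN _ Nk)).
Qed.

(** A continuous function is the pointwise limit of its values at grid points,
    which depend on countably many measurable cells. *)
Lemma continuous_measurable3 (f : E * E * E -> R) : continuous f ->
  measurable_fun setT f.
Proof.
move=> cf.
pose phi k (p : E * E * E) := (grid k p.1.1, grid k p.1.2, grid k p.2).
pose psi k (z : 'rV[int]_n * 'rV[int]_n * 'rV[int]_n) : E * E * E :=
  (of_grid k z.1.1, of_grid k z.1.2, of_grid k z.2).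
apply: (measurable_fun_cvg (h := fun k p => f (psi k (phi k p)))) => [k|p _].
  apply: (@measurable_countable_factor _ _ _ _ _ (phi k) (fun z => f (psi k z))) => -[[z1 z2] z3].
  rewrite (_ : [set _ | _] = ([set x | grid k x = z1] `*` [set x | grid k x = z2]) `*`
      [set x | grid k x = z3]).
    by do ?apply: measurableX; exact: measurable_grid_fiber.
  apply/seteqP; split=> -[[x y] q] /=; first by move=> [<- <- <-].
  by move=> [[<- <-] <-].
apply: (@cvg_comp _ _ _ (fun k => psi k (phi k p)) f _ (nbhs p)); last exact: cf.
rewrite /psi/=; move: p => [[x y] q].
apply: (@cvg_pair _ _ _ _ (nbhs (x, y)) (nbhs q)); last exact: grid_cvg.
by apply: (@cvg_pair _ _ _ _ (nbhs x) (nbhs y)); exact: grid_cvg.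
Qed.

Lemma continuous_measurable1 (f : E -> R) : continuous f -> measurable_fun setT f.
Proof.
move=> cf.
have m3 : measurable_fun setT (fun p : E * E * E => f p.2).
  apply: continuous_measurable3 => p.
  by apply: continuous_comp; [exact: cvg_snd|exact: cf].
rewrite (_ : f = (fun p : E * E * E => f p.2) \o (fun x => (0, 0, x)))//.
by apply: measurableT_comp => //; exact: pair1_measurable.
Qed.

Lemma continuous_sum (T : topologicalType) (I : Type) (r : seq I) (P : pred I)
    (F : I -> T -> R) : (forall i, P i -> continuous (F i)) ->
  continuous (fun x => \sum_(i <- r | P i) F i x).
Proof.
move=> cF x; elim: r => [|i r IH].
  rewrite (_ : (fun _ => _) = (fun=> 0)); first exact: cvg_cst.
  by apply/funext => y; rewrite big_nil.
rewrite (_ : (fun _ => _) = (fun x =>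
    if P i then F i x + \sum_(i <- r | P i) F i x else \sum_(i <- r | P i) F i x)).
  by have [Pi|//] := boolP (P i); apply: cvgD => //; exact: cF.
by apply/funext => y; rewrite big_cons.
Qed.

Lemma continuous_coord (i : 'I_n) : continuous (fun x : E => x ord0 i).
Proof. exact: coord_continuous. Qed.

Lemma continuous_dotp : continuous (fun z : E * E => dotp z.1 z.2).
Proof.
apply: continuous_sum => i _ z; apply: cvgM.
  by apply: (@cvg_comp _ _ _ fst (fun x : E => x ord0 i) _ (nbhs z.1)); [exact: cvg_fst|exact: continuous_coord].
by apply: (@cvg_comp _ _ _ snd (fun x : E => x ord0 i) _ (nbhs z.2)); [exact: cvg_snd|exact: continuous_coord].
Qed.

Lemma continuous_enorm : continuous (@enorm R n).
Proof.
have cd : continuous (fun x : E => dotp x x).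
  by apply: continuous_sum => i _ y; apply: continuousM; exact: continuous_coord.
by move=> x; apply: continuous_comp; [exact: cd|exact: sqrt_continuous].
Qed.

Lemma continuous_height d : continuous (@height R d n).
Proof.
have cd : continuous (fun x : E => \sum_(i < n | (d <= i)%N) x ord0 i ^+ 2).
  apply: continuous_sum => i _ y.
  apply: (@continuous_comp _ _ _ (fun x : E => x ord0 i) (fun t => t ^+ 2)).
    exact: continuous_coord.
  exact: exprn_continuous.
by move=> x; apply: continuous_comp; [exact: cd|exact: sqrt_continuous].
Qed.

Lemma sqr_coord_le_dotp (x : E) i : x ord0 i ^+ 2 <= dotp x x.
Proof.
rewrite /dotp (bigD1 i)//= -expr2 lerDl sumr_ge0// => j _.
by rewrite -expr2 sqr_ge0.
Qed.

Lemma dotp_ge0 (x : E) : 0 <= dotp x x.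
Proof. by apply: sumr_ge0 => i _; rewrite -expr2 sqr_ge0. Qed.

Lemma enorm_ge0 (x : E) : 0 <= enorm x.
Proof. exact: sqrtr_ge0. Qed.

Lemma normr_coord_le_enorm (x : E) i : `|x ord0 i| <= enorm x.
Proof. by rewrite -sqrtr_sqr ler_wsqrtr// sqr_coord_le_dotp. Qed.

Lemma sqr_enorm (x : E) : enorm x ^+ 2 = dotp x x.
Proof. by rewrite sqr_sqrtr// dotp_ge0. Qed.

Lemma normr_coord_le_height d (x : E) (i : 'I_n) : (d <= i)%N -> `|x ord0 i| <= height d x.
Proof.
move=> di; rewrite -sqrtr_sqr ler_wsqrtr// (bigD1 i)//= lerDl sumr_ge0// => j _.
by rewrite sqr_ge0.
Qed.

End measurable_continuous.

(** * Oscillatory integrals on the dual group *)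

Section shift_real.
Context d (T : measurableType d) (R : realType) (mu : {measure set T -> \bar R}).
Variable s : T -> T.
Hypothesis ms : measurable_fun setT s.
Hypothesis mus : shift_invariant mu s.

Lemma Rintegral_shift (f : T -> R) : measurable_fun setT f ->
  \int[mu]_x f (s x) = \int[mu]_x f x.
Proof.
move=> mf; have me : measurable_fun setT (EFin \o f) by exact/measurable_EFinP.
rewrite /Rintegral; congr fine.
rewrite [LHS]integralE [RHS]integralE; congr (_ - _)%E.
  rewrite -(mus (measurable_funepos me) (funepos_ge0 _)).
  by apply: eq_integral => x _; rewrite !funeposE.
rewrite -(mus (measurable_funeneg me) (funeneg_ge0 _)).
by apply: eq_integral => x _; rewrite !funenegE.
Qed.

Lemma integrable_shift (f : T -> R) : mu.-integrable setT (EFin \o f) ->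
  mu.-integrable setT (EFin \o (f \o s)).
Proof.
move=> /integrableP[mf fy]; apply/integrableP; split.
  exact: measurableT_comp mf ms.
by rewrite (mus (f := fun x => `|(f x)%:E|%E))//; exact: measurableT_comp mf.
Qed.

End shift_real.

Section oscillatory_integral.
Context {R : realType} (d : nat) {n : nat}.
Local Notation E := 'rV[R]_n.
Local Notation dual := (@dual_measure R d n).
Implicit Types (b : E -> R) (th xi : E) (j : 'I_n) (h : R).

(** The weight of the symbol estimates, comparable to the usual [sqrt (1 + enorm xi
    ^+ 2)]. *)
Definition japanese xi : R := 1 + enorm xi.

Lemma japanese_ge1 xi : 1 <= japanese xi.
Proof. by rewrite lerDl enorm_ge0. Qed.

Lemma japanese_gt0 xi : 0 < japanese xi.
Proof. by rewrite (lt_le_trans _ (japanese_ge1 xi)). Qed.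

Lemma continuous_japanese : continuous japanese.
Proof. by apply: contD; [exact: contC|exact: continuous_enorm]. Qed.

(** The translations of the dual group in direction [j]: integers in the first [d]
    coordinates, any real number in the others. *)
Definition dual_step j h := (j < d)%N -> exists z : int, h = z%:~R.

Lemma dual_shift j h : dual_step j h ->
  shift_invariant dual (fun xi => xi + h *: std_basis j).
Proof.
rewrite /dual_step => jh; apply: product_shift_invariant.
move: jh; case: (j < d)%N => [/(_ isT)[z ->]|_].
  exact: integer_shift_invariant.
exact: lebesgue_shift_invariant.
Qed.

(** The set is empty for [r < 1] because [japanese] is at least [1]; this makes a
    bound by a pure power of [r] possible although the discrete directions have no small
    balls. *)
Lemma dual_volume (r : R) : 0 < r ->
  (dual [set xi | (japanese xi <= r)%R] <= (3 ^+ n * r ^+ n)%:E)%E.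
Proof.
move=> r0; have [r1|r1] := leP 1 r; last first.
  rewrite (_ : [set _ | _] = set0) ?measure0 ?lee_fin ?mulr_ge0 ?exprn_ge0 ?(ltW r0)//.
  apply/seteqP; split => // xi /= /le_lt_trans/(_ r1).
  by rewrite ltNge japanese_ge1.
pose B (i : nat) : set (measurableTypeR R) := [set t | `|t - 0| <= r].
have mB i : measurable (B i) by exact: measurable_ball_le.
apply: (@le_trans _ _ (dual [set x : E | forall i : 'I_n, B i (x ord0 i)])).
  apply: le_measure; rewrite ?inE.
  - rewrite -[X in measurable X]setTI; apply: measurable_fun_ler => //.
    exact: continuous_measurable1 continuous_japanese.
  - exact: measurable_box.
  - move=> xi /= xir i; rewrite /B/= subr0.
    apply: le_trans (normr_coord_le_enorm xi i) _.
    by apply: le_trans xir; rewrite lerDr.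
rewrite -exprMn; apply: product_measure_box_le => //.
  by rewrite mulr_ge0// ltW.
move=> i _; rewrite /B; case: (i < d)%N.
  by under eq_set do rewrite subr0; exact: integer_ball_le.
rewrite [leLHS](_ : _ = (2 * r)%:E); last by apply: lebesgue_ball; exact: ltW.
by rewrite lee_fin ler_wpM2r ?(ltW r0)// ler_nat.
Qed.

Lemma integral_japanese_two_scale (al be r : R) : 0 < al -> al < n%:R -> n%:R < be ->
  0 < r ->
  (\int[dual]_xi (two_scale al be (japanese xi / r))%:E <=
     (3 ^+ n * r ^+ n * two_scale_const al be n)%:E)%E.
Proof.
move=> al0 aln nbe r0; apply: integral_two_scale => //.
- by rewrite mulr_ge0 ?exprn_ge0 ?(ltW r0).
- apply: measurable_funM => //.
  exact: continuous_measurable1 continuous_japanese.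
- by move=> xi; rewrite divr_ge0 ?(ltW r0)// ltW ?japanese_gt0.
move=> t t0; under eq_set do rewrite ler_pdivrMr//.
by rewrite -mulrA -exprMn [r * t]mulrC; apply: dual_volume; rewrite mulr_gt0.
Qed.

Definition cos_int b th : R := \int[dual]_xi (b xi * cos (dotp th xi)).
Definition sin_int b th : R := \int[dual]_xi (b xi * sin (dotp th xi)).

Lemma continuous_dotpr th : continuous (dotp th).
Proof.
by apply: continuous_sum => i _; apply: contM; [exact: contC|exact: continuous_coord].
Qed.

Lemma measurable_cos_dotp th (c : R) : measurable_fun setT (fun xi : E => cos (dotp th xi + c)).
Proof.
apply: continuous_measurable1; apply: (cont_comp _ (@continuous_cos R)).
by apply: contD; [exact: continuous_dotpr|exact: contC].
Qed.

Lemma measurable_EFin_int b : dual.-integrable setT (EFin \o b) ->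
  measurable_fun setT b.
Proof. by move=> ib; apply/measurable_EFinP; exact: measurable_int ib. Qed.

Lemma integrable_cos b th c : dual.-integrable setT (EFin \o b) ->
  dual.-integrable setT (EFin \o (fun xi => b xi * cos (dotp th xi + c))).
Proof.
move=> ib; have mb := measurable_EFin_int ib; apply: le_integrable ib => //.
  by apply/measurable_EFinP; apply: measurable_funM => //; exact: measurable_cos_dotp.
move=> xi _ /=; rewrite lee_fin normrM ler_piMr//.
exact: cos_max.
Qed.

Lemma integrable_cos0 b th : dual.-integrable setT (EFin \o b) ->
  dual.-integrable setT (EFin \o (fun xi => b xi * cos (dotp th xi))).
Proof.
move=> /(integrable_cos th 0); apply: eq_integrable => // xi _.
by rewrite /= addr0.
Qed.

Lemma integrable_sin0 b th : dual.-integrable setT (EFin \o b) ->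
  dual.-integrable setT (EFin \o (fun xi => b xi * sin (dotp th xi))).
Proof.
move=> /(integrable_cos th (- (pi / 2))); apply: eq_integrable => // xi _.
by rewrite /= cosBpihalf.
Qed.

Lemma dotp_shift th xi j h : dotp th (xi + h *: std_basis j) = dotp th xi + h * th ord0 j.
Proof.
rewrite /dotp -[h * _]/(h * th ord0 j).
under eq_bigr do rewrite mxE mulrDr; rewrite big_split/=; congr (_ + _).
rewrite (bigD1 j)//= big1 ?addr0; last first.
  by move=> i ij; rewrite !mxE (negbTE ij) andbF !mulr0.
by rewrite !mxE !eqxx mulr1 mulrC.
Qed.

Lemma integrable_diff_op b j h : dual_step j h -> dual.-integrable setT (EFin \o b) ->
  dual.-integrable setT (EFin \o diff_op (h *: std_basis j) b).
Proof.
move=> jh ib; have ms := integrable_shift (measurable_shift _) (dual_shift jh) ib.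
exact: (integrableB measurableT ms ib).
Qed.

(** Multiplication by [exp(i h th_j) - 1] corresponds to a difference in [xi];
    when [cos (h th_j) <= 1/2] this factor has modulus at least [1]. *)
Lemma osc_diff_op b th j h : dual_step j h -> dual.-integrable setT (EFin \o b) ->
  cos (h * th ord0 j) <= 2^-1 ->
  cos_int b th ^+ 2 + sin_int b th ^+ 2 <=
  cos_int (diff_op (h *: std_basis j) b) th ^+ 2 +
  sin_int (diff_op (h *: std_basis j) b) th ^+ 2.
Proof.
move=> jh ib; set phi := h * th ord0 j => cphi.
set v := h *: std_basis j.
have mv : measurable_fun setT (fun xi : E => xi + v) by exact: measurable_shift.
have iv := integrable_shift mv (dual_shift jh) ib.
have Sh (f : E -> R) : measurable_fun setT f ->
    \int[dual]_xi f (xi + v) = \int[dual]_xi f xi.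
  by move=> mf; apply: (Rintegral_shift (s := fun xi : E => xi + v)) => //; exact: dual_shift.
have ic := integrable_cos0 th ib; have is_ := integrable_sin0 th ib.
have mc := measurable_EFin_int ic; have msn := measurable_EFin_int is_.
have icv := integrable_cos0 th iv; have isv := integrable_sin0 th iv.
pose C := cos_int b th; pose S := sin_int b th.
have dE xi : dotp th xi = dotp th (xi + v) - phi by rewrite dotp_shift addrK.
have Cv : cos_int (fun xi => b (xi + v)) th = cos phi * C + sin phi * S.
  rewrite /C /S /cos_int /sin_int.
  rewrite -(RintegralZl (mu := dual) _ measurableT ic) -(RintegralZl (mu := dual) _ measurableT is_).
  rewrite -RintegralD//; last 2 first.
  - exact: (integrableZl measurableT (cos phi) ic).
  - exact: (integrableZl measurableT (sin phi) is_).
  rewrite -[RHS]Sh; last first.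
    by apply: measurable_funD; apply: measurable_funM.
  by apply: eq_Rintegral => xi _; rewrite /= {1}dE cosB; ring.
have Sv : sin_int (fun xi => b (xi + v)) th = cos phi * S - sin phi * C.
  rewrite /C /S /cos_int /sin_int.
  rewrite -(RintegralZl (mu := dual) _ measurableT ic) -(RintegralZl (mu := dual) _ measurableT is_).
  rewrite -RintegralB//; last 2 first.
  - exact: (integrableZl measurableT (cos phi) is_).
  - exact: (integrableZl measurableT (sin phi) ic).
  rewrite -[RHS]Sh; last first.
    by apply: measurable_funB; apply: measurable_funM.
  by apply: eq_Rintegral => xi _; rewrite /= {1}dE sinB; ring.
have -> : cos_int (diff_op v b) th = cos phi * C + sin phi * S - C.
  rewrite -Cv /C /cos_int -RintegralB//.
  by apply: eq_Rintegral => xi _; rewrite /diff_op mulrBl.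
have -> : sin_int (diff_op v b) th = cos phi * S - sin phi * C - S.
  rewrite -Sv /S /sin_int -RintegralB//.
  by apply: eq_Rintegral => xi _; rewrite /diff_op mulrBl.
have -> : (cos phi * C + sin phi * S - C) ^+ 2 + (cos phi * S - sin phi * C - S) ^+ 2 =
  (cos phi ^+ 2 + sin phi ^+ 2 + 1 - 2 * cos phi) * (C ^+ 2 + S ^+ 2) by ring.
rewrite cos2Dsin2 ler_peMl ?addr_ge0 ?sqr_ge0//; lra.
Qed.

Lemma integrable_kdiff k b j h : dual_step j h -> dual.-integrable setT (EFin \o b) ->
  dual.-integrable setT (EFin \o kdiff k (h *: std_basis j) b).
Proof.
by move=> jh; elim: k b => //= k IH b ib; apply: IH; exact: integrable_diff_op.
Qed.

Lemma osc_kdiff k b th j h : dual_step j h -> dual.-integrable setT (EFin \o b) ->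
  cos (h * th ord0 j) <= 2^-1 ->
  cos_int b th ^+ 2 + sin_int b th ^+ 2 <=
  cos_int (kdiff k (h *: std_basis j) b) th ^+ 2 +
  sin_int (kdiff k (h *: std_basis j) b) th ^+ 2.
Proof.
move=> jh ib hc; elim: k b ib => //= k IH b ib.
by apply: le_trans (osc_diff_op jh ib hc) (IH _ _); exact: integrable_diff_op.
Qed.

Lemma normr_cos_int_le b th (I : R) : dual.-integrable setT (EFin \o b) ->
  (\int[dual]_xi `|b xi|%:E <= I%:E)%E ->
  `|cos_int b th| <= I /\ `|sin_int b th| <= I.
Proof.
move=> ib bI; have mb := measurable_EFin_int ib.
have mc := measurable_EFin_int (integrable_cos0 th ib).
have ms := measurable_EFin_int (integrable_sin0 th ib).
have mab : measurable_fun setT (fun xi => `|b xi|%:E).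
  by apply/measurable_EFinP; exact: measurableT_comp.
split; rewrite -lee_fin; apply: le_trans bI.
  apply: le_trans (normr_Rintegral_le dual mc) _; apply: ge0_le_integral => //.
    by apply/measurable_EFinP; exact: measurableT_comp.
  by move=> xi _; rewrite lee_fin normrM ler_piMr// cos_max.
apply: le_trans (normr_Rintegral_le dual ms) _; apply: ge0_le_integral => //.
  by apply/measurable_EFinP; exact: measurableT_comp.
by move=> xi _; rewrite lee_fin normrM ler_piMr// sin_max.
Qed.

Lemma osc_le_kdiff k b th j h (I : R) : dual_step j h -> dual.-integrable setT (EFin \o b) ->
  cos (h * th ord0 j) <= 2^-1 ->
  (\int[dual]_xi `|kdiff k (h *: std_basis j) b xi|%:E <= I%:E)%E ->
  `|cos_int b th| <= 2 * I /\ `|sin_int b th| <= 2 * I.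
Proof.
move=> jh ib hc kI; have := osc_kdiff k jh ib hc.
have [cI sI] := normr_cos_int_le th (integrable_kdiff k jh ib) kI.
have I0 : 0 <= I by rewrite (le_trans _ cI).
have sq (x y : R) : 0 <= y -> `|x| <= y -> x ^+ 2 <= y ^+ 2.
  by move=> y0 xy; rewrite -[x ^+ 2]real_normK ?num_real// lerXn2r ?nnegrE.
have := sq _ _ I0 cI; have := sq _ _ I0 sI.
set c' := cos_int _ _; set s' := sin_int _ _ => s1 c1 le.
have := sqr_ge0 (cos_int b th); have := sqr_ge0 (sin_int b th) => s0 c0.
split; rewrite -[leRHS]ger0_norm ?mulr_ge0// -ler_sqr ?nnegrE// !real_normK ?num_real//.
  by rewrite exprMn; nra.
by rewrite exprMn; nra.
Qed.

End oscillatory_integral.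

(** * Kernels of symbols of negative order *)

Section kdiff_estimate.
Context {R : realType} {V : normedModType R}.
Implicit Types (v p : V) (f : V -> R).

Lemma normr_kdiff_le_sum k v f p :
  `|kdiff k v f p| <= 2 ^+ k * \sum_(i < k.+1) `|f (p + i%:R *: v)|.
Proof.
elim: k f => [|k IH] f.
  by rewrite big_ord1 /= scale0r addr0 mul1r.
apply: le_trans (IH _) _; rewrite exprSr -mulrA ler_wpM2l//.
apply: (@le_trans _ _ (\sum_(i < k.+1) `|f (p + i.+1%:R *: v)| +
   \sum_(i < k.+1) `|f (p + i%:R *: v)|)).
  rewrite -big_split/=; apply: ler_sum => i _; rewrite /diff_op.
  apply: le_trans (ler_normB _ _) _; rewrite lerD2r -addrA -{2}[v]scale1r -scalerDl.
  by rewrite natr1.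
rewrite mulr2n mulrDl mul1r lerD//.
  by rewrite [leRHS]big_ord_recl/= lerDr.
by rewrite [leRHS]big_ord_recr/= lerDl.
Qed.

(** Slices of jets: [phi] maps translations along [D'] to translations along
    [D]. *)
Lemma jet_comp (W : normedModType R) k (D : set V) (D' : set W) lam w f
    (phi : W -> V) (L : W -> V) : continuous phi ->
  (forall u, D' u -> D (L u)) ->
  (forall u q (h : R), D' u -> phi (h *: u + q) = h *: L u + phi q) ->
  jet k D lam w f ->
  jet k D' (lam \o phi) (w \o phi) (f \o phi).
Proof.
move=> cphi DD phiL; elim: k w f => [|k IH] w f [cf fw df].
  by split=> //; [exact: (cont_comp cphi cf)|move=> p /=; exact: fw].
split; [exact: (cont_comp cphi cf)|by move=> p /=; exact: fw|move=> u Du].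
have [d1 j1] := df (L u) (DD u Du).
have E (p : W) : (fun h : R => h^-1 *: ((f \o phi) (h *: u + p) - (f \o phi) p)) =
    (fun h : R => h^-1 *: (f (h *: L u + phi p) - f (phi p))).
  by apply/funext => h /=; rewrite phiL.
split; first by move=> p; have := d1 (phi p); rewrite /derivable -E.
have -> : 'D_u (f \o phi) = 'D_(L u) f \o phi.
  by apply/funext => p; rewrite /derive /= -E.
exact: IH j1.
Qed.

End kdiff_estimate.

Section oscillatory_estimate.
Context {R : realType} (d : nat) {n : nat}.
Local Notation E := 'rV[R]_n.
Local Notation dual := (@dual_measure R d n).
Implicit Types (b : E -> R) (th xi : E) (j : 'I_n) (h : R).

Lemma enorm_shift_le xi j h : enorm (xi + h *: std_basis j) <= enorm xi + `|h|.
Proof.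
have e0 := enorm_ge0 xi.
rewrite -[leRHS]ger0_norm ?addr_ge0// -sqrtr_sqr ler_wsqrtr//.
rewrite dotp_shift -{1}[dotp _ xi]/(dotp (xi + h *: std_basis j) xi).
have -> : dotp (xi + h *: std_basis j) xi = dotp xi xi + h * xi ord0 j.
  by rewrite -dotp_shift /dotp; apply: eq_bigr => i _; rewrite mulrC.
rewrite -sqr_enorm sqrrD mxE [X in _ + _ * (_ + X)]mxE [X in _ + _ * (_ + _ * X)]mxE !eqxx mulr1.
have := normr_coord_le_enorm xi j.
have hx : h * xi ord0 j <= `|h| * enorm xi.
  apply: le_trans (ler_norm _) _; rewrite normrM ler_wpM2l//.
  exact: normr_coord_le_enorm.
have := real_normK (num_real h); rewrite !expr2; nra.
Qed.

Lemma japanese_shift_le xi j h : japanese (xi + h *: std_basis j) <= japanese xi + `|h|.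
Proof. by rewrite /japanese -addrA lerD2l enorm_shift_le. Qed.

Lemma japanese_shift_ge xi j h : japanese xi - `|h| <= japanese (xi + h *: std_basis j).
Proof.
have := japanese_shift_le (xi + h *: std_basis j) j (- h).
by rewrite -addrA -scalerDl subrr scale0r addr0 normrN lerBlDr.
Qed.

(** Size of a difference of order [k] and step [h] of a symbol of order [- s]. *)
Definition diff_weight (s : R) (k : nat) h xi : R :=
  Num.min (japanese xi `^ (- s)) (h ^+ k * japanese xi `^ (- (s + k%:R))).

Lemma diff_weight_ge0 s k h xi : 0 <= h -> 0 <= diff_weight s k h xi.
Proof. by move=> h0; rewrite le_min powR_ge0 mulr_ge0 ?exprn_ge0 ?powR_ge0. Qed.

Lemma powRBn (x s : R) k : 0 < x -> x `^ (- (s + k%:R)) = x `^ (- s) / x ^+ k.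
Proof.
move=> x0; rewrite opprD powRD; last by rewrite (gt_eqF x0) implybT.
by rewrite [x `^ (- k%:R)]powRN powR_mulrn// ltW.
Qed.

Lemma diff_weightE s k h xi : 0 < h ->
  diff_weight s k h xi = h `^ (- s) * two_scale s (s + k%:R) (japanese xi / h).
Proof.
move=> h0; have x0 := japanese_gt0 xi.
have xh : 0 < japanese xi / h by rewrite divr_gt0.
rewrite /two_scale minr_pMr ?powR_ge0// /diff_weight powRBn// powRBn//.
have hE : h `^ (- s) * (japanese xi / h) `^ (- s) = japanese xi `^ (- s).
  by rewrite -powRM ?ltW// mulrC divfK// gt_eqF.
rewrite hE; congr Num.min; rewrite [RHS]mulrA hE mulrCA; congr (_ * _).
by rewrite expr_div_n invf_div.
Qed.

Lemma integral_diff_weight_le (s : R) k h : 0 < s -> s < n%:R -> n%:R < s + k%:R -> 0 < h ->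
  (\int[dual]_xi (diff_weight s k h xi)%:E <=
   (3 ^+ n * two_scale_const s (s + k%:R) n * Num.min (h `^ (n%:R - s)) (h ^+ k))%:E)%E.
Proof.
move=> s0 sn nk h0.
have mts r : measurable_fun setT (fun xi : E => (two_scale s (s + k%:R) (japanese xi / r))%:E).
  apply/measurable_EFinP; apply: measurableT_comp; first exact: measurable_two_scale.
  by apply: measurable_funM => //; exact: continuous_measurable1 continuous_japanese.
have C0 : 0 <= two_scale_const s (s + k%:R) n by rewrite ltW// two_scale_const_gt0.
rewrite minr_pMr ?mulr_ge0 ?exprn_ge0// EFin_min le_min; apply/andP; split.
  under eq_integral do rewrite diff_weightE// EFinM.
  rewrite ge0_integralZl_EFin ?powR_ge0//; last first.
    by move=> xi _; rewrite lee_fin two_scale_ge0.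
  apply: le_trans (lee_wpmul2l _ (integral_japanese_two_scale d s0 sn nk h0)) _.
    by rewrite lee_fin powR_ge0.
  rewrite -EFinM lee_fin powRD; last by rewrite (gt_eqF h0) implybT.
  by rewrite powR_mulrn ?(ltW h0)//; rewrite [leRHS](_ : _ =
    h `^ (- s) * (3 ^+ n * h ^+ n * two_scale_const s (s + k%:R) n))//; ring.
apply: (@le_trans _ _ (\int[dual]_xi ((h ^+ k)%:E * (two_scale s (s + k%:R) (japanese xi / 1))%:E))%E).
  apply: ge0_le_integral => //.
  - by move=> xi _; rewrite lee_fin diff_weight_ge0 ?ltW.
  - under eq_fun do rewrite diff_weightE// EFinM.
    exact: measurable_funeM.
  - exact: measurable_funeM.
  move=> xi _; rewrite -EFinM lee_fin divr1 /two_scale /diff_weight ge_min; apply/orP; right.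
  rewrite ler_wpM2l ?exprn_ge0 ?(ltW h0)// le_min lexx andbT.
  by rewrite ler_powR ?japanese_ge1// lerN2 lerDl.
rewrite ge0_integralZl_EFin ?exprn_ge0 ?(ltW h0)//; last first.
  by move=> xi _; rewrite lee_fin two_scale_ge0.
apply: le_trans (lee_wpmul2l _ (integral_japanese_two_scale d s0 sn nk ltr01)) _.
  by rewrite lee_fin exprn_ge0 ?ltW.
by rewrite -EFinM lee_fin expr1n mulr1 mulrC.
Qed.

(** The first summand comes from the region [japanese xi <= 2 k h], the second one
    from its complement, in [normr_kdiff_symbol_le] below. *)
Definition diff_const (s : R) (k : nat) : R :=
  2 ^+ k * (3 * k%:R) ^+ k + 2 `^ (s + k%:R).

(** Near the origin, at scale [k h], the difference is bounded term by term; far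
    from it, by the derivative of order [k]. *)
Lemma normr_kdiff_symbol_le (s A : R) k b j h xi : 0 < s -> (0 < k)%N -> 0 < h -> 0 <= A ->
  jet k [set std_basis j] japanese (fun xi => A * japanese xi `^ (- s)) b ->
  `|kdiff k (h *: std_basis j) b xi| <= A * diff_const s k *
     \sum_(i < k.+1) diff_weight s k h (xi + (i%:R * h) *: std_basis j).
Proof.
move=> s0 k0 h0 A0 jb; pose e : E := std_basis j.
have kr0 : 0 < k%:R :> R by rewrite ltr0n.
have W0 y : 0 <= diff_weight s k h y by rewrite diff_weight_ge0 ?ltW.
have c1 : 0 <= 2 ^+ k * (3 * k%:R) ^+ k :> R by rewrite mulr_ge0// exprn_ge0 ?mulr_ge0 ?ler0n.
have [near|far] := leP (japanese xi) (2 * k%:R * h).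
  apply: le_trans (normr_kdiff_le_sum _ _ _ _) _.
  rewrite mulr_sumr mulr_sumr; apply: ler_sum => i _; rewrite scalerA -/e.
  set y := xi + _; have y0 := japanese_gt0 y.
  have yk : japanese y <= 3 * k%:R * h.
    apply: le_trans (japanese_shift_le _ _ _) _.
    rewrite ger0_norm ?mulr_ge0 ?ler0n ?(ltW h0)//.
    have : i%:R * h <= k%:R * h by rewrite ler_pM2r// ler_nat -ltnS.
    nra.
  apply: (@le_trans _ _ (2 ^+ k * (A * japanese y `^ (- s)))).
    by rewrite ler_wpM2l// (jet_le jb).
  have wy : japanese y `^ (- s) <= (3 * k%:R) ^+ k * diff_weight s k h y.
    rewrite /diff_weight minr_pMr ?exprn_ge0 ?mulr_ge0 ?ler0n// le_min; apply/andP; split.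
      rewrite ler_peMl ?powR_ge0// exprn_ege1//.
      have : 1 <= k%:R :> R by rewrite ler1n.
      lra.
    rewrite powRBn// [leRHS](_ : _ = japanese y `^ (- s) * (3 * k%:R * h / japanese y) ^+ k).
      by rewrite ler_peMr ?powR_ge0// exprn_ege1// ler_pdivlMr// mul1r.
    rewrite expr_div_n [in RHS]exprMn.
    by move: ((3 * k%:R) ^+ k) (h ^+ k) (_^-1) => P Q Y; ring.
  rewrite mulrCA -mulrA ler_wpM2l//.
  apply: le_trans (ler_wpM2l _ wy) _; first exact: exprn_ge0.
  by rewrite mulrA ler_wpM2r// lerDl powR_ge0.
have x0 := japanese_gt0 xi.
apply: (@le_trans _ _ (h ^+ k * (A * (2 `^ (s + k%:R) * japanese xi `^ (- (s + k%:R)))))).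
  apply: (normr_kdiff_le h0 (erefl : [set e] e) jb) => t /andP[t0 tk].
  have y2 : japanese xi / 2 <= japanese (xi + t *: e).
    apply: le_trans (japanese_shift_ge _ _ _); rewrite ger0_norm//.
    nra.
  have y0 := japanese_gt0 (xi + t *: e).
  rewrite -mulrA ler_wpM2l// -powRBn//.
  rewrite !powRN ler_pdivlMr ?powR_gt0// mulrC ler_pdivrMr ?powR_gt0//.
  rewrite -powRM ?(ltW y0)//; apply: ge0_ler_powR; rewrite ?nnegrE.
  - by rewrite addr_ge0 ?ler0n// ltW.
  - exact: ltW.
  - by rewrite mulr_ge0// ltW.
  - by rewrite mulrC -ler_pdivrMr.
rewrite (_ : h ^+ k * _ = A * 2 `^ (s + k%:R) * (h ^+ k * japanese xi `^ (- (s + k%:R)))); last by ring.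
have -> : h ^+ k * japanese xi `^ (- (s + k%:R)) = diff_weight s k h xi.
  rewrite /diff_weight min_r// powRBn// mulrCA ler_piMr ?powR_ge0// -expr_div_n.
  rewrite exprn_ile1 ?divr_ge0 ?(ltW h0) ?(ltW x0)// ler_pdivrMr// mul1r.
  apply: le_trans (ltW far); rewrite ler_peMl ?(ltW h0)//.
  have : 1 <= k%:R :> R by rewrite ler1n.
  lra.
rewrite -!mulrA ler_wpM2l// ler_pM ?powR_ge0//; first by rewrite lerDr.
by rewrite big_ord_recl/= mul0r scale0r addr0 lerDl sumr_ge0.
Qed.

Lemma continuous_kdiff k v b : continuous b -> continuous (kdiff k v b).
Proof.
elim: k b => //= k IH b cb; apply: IH; apply: contD; last exact: contN.
apply: (cont_comp _ cb) => x.
by apply: (@cvgD _ _ _ (nbhs x) _ (fun y : E => y) (fun=> v)); [exact: cvg_id|exact: cvg_cst].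
Qed.

Lemma measurable_diff_weight s k h : measurable_fun setT (diff_weight s k h).
Proof.
have mp r : measurable_fun setT (fun xi : E => japanese xi `^ r).
  apply: (measurableT_comp (measurable_powR r)).
  exact: continuous_measurable1 continuous_japanese.
by apply: measurable_minr => //; exact: measurable_funM.
Qed.

Definition osc_const (s : R) (k : nat) : R :=
  diff_const s k * (k.+1%:R * (3 ^+ n * two_scale_const s (s + k%:R) n)).

Lemma diff_const_ge0 s k : 0 <= diff_const s k.
Proof.
by rewrite addr_ge0 ?powR_ge0// mulr_ge0// exprn_ge0 ?mulr_ge0 ?ler0n.
Qed.

Lemma integral_kdiff_le (s A : R) k b j h : 0 < s -> s < n%:R -> n%:R < s + k%:R ->
  (0 < k)%N -> 0 < h -> dual_step d j h -> 0 <= A ->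
  jet k [set std_basis j] japanese (fun xi => A * japanese xi `^ (- s)) b ->
  (\int[dual]_xi `|kdiff k (h *: std_basis j) b xi|%:E <=
    (A * osc_const s k * Num.min (h `^ (n%:R - s)) (h ^+ k))%:E)%E.
Proof.
move=> s0 sn nk k0 h0 jh A0 jb.
pose w (i : nat) xi := (diff_weight s k h (xi + (i%:R * h) *: std_basis j))%:E : \bar R.
have mw0 : measurable_fun setT (fun xi : E => (diff_weight s k h xi)%:E).
  by apply/measurable_EFinP; exact: measurable_diff_weight.
have mw i : measurable_fun setT (w i) by exact: (measurableT_comp mw0 (measurable_shift _)).
have w0 i xi : (0 <= w i xi)%E by rewrite lee_fin diff_weight_ge0// ltW.
have c0 : 0 <= A * diff_const s k by rewrite mulr_ge0// diff_const_ge0.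
apply: (@le_trans _ _ (\int[dual]_xi ((A * diff_const s k)%:E * \sum_(i < k.+1) w i xi))%E).
  apply: ge0_le_integral => //.
  - apply/measurable_EFinP; apply: measurableT_comp => //.
    by apply: continuous_measurable1; apply: continuous_kdiff; exact: jet_continuous jb.
  - by apply: measurable_funeM; apply: emeasurable_sum => i.
  - move=> xi _; rewrite /w sumEFin -EFinM lee_fin.
    exact: normr_kdiff_symbol_le.
rewrite ge0_integralZl_EFin//; last 2 first.
- by move=> xi _; apply: sume_ge0 => i _.
- by apply: emeasurable_sum => i.
rewrite ge0_integral_sum//.
have stepi (i : nat) : dual_step d j (i%:R * h).
  by move=> /jh[z ->]; exists (i%:Z * z); rewrite intrM.
apply: (@le_trans _ _ ((A * diff_const s k)%:E *
    \sum_(i < k.+1) \int[dual]_xi (diff_weight s k h xi)%:E)%E).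
  apply: lee_wpmul2l; first by rewrite lee_fin.
  apply: lee_sum => i _; rewrite le_eqVlt; apply/orP; left; apply/eqP.
  by apply: (dual_shift (stepi i) mw0) => xi; rewrite lee_fin diff_weight_ge0// ltW.
apply: (@le_trans _ _ ((A * diff_const s k)%:E * \sum_(i < k.+1)
   (3 ^+ n * two_scale_const s (s + k%:R) n * Num.min (h `^ (n%:R - s)) (h ^+ k))%:E)%E).
  apply: lee_wpmul2l; first by rewrite lee_fin.
  apply: lee_sum => i _; exact: integral_diff_weight_le.
rewrite sumEFin -EFinM lee_fin sumr_const card_ord -[X in _ * X <= _]mulr_natl /osc_const.
by rewrite le_eqVlt; apply/orP; left; apply/eqP; ring.
Qed.

Lemma osc_const_ge0 s k : 0 < s -> s < n%:R -> n%:R < s + k%:R -> 0 <= osc_const s k.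
Proof.
move=> s0 sn nk; rewrite mulr_ge0 ?diff_const_ge0// mulr_ge0 ?ler0n// mulr_ge0 ?exprn_ge0//.
by rewrite ltW// two_scale_const_gt0.
Qed.

(** The distance of [t] to [2 pi Z], provided that [`|t| <= 2 * pi]. *)
Definition circ_dist (t : R) : R := Num.min `|t| (Num.min `|t - 2 * pi| `|t + 2 * pi|).

Definition coord_dist (i : nat) (t : R) : R := if (i < d)%N then circ_dist t else `|t|.

(** Maximum distance on Omega between two points of the fundamental domain, as a
    function of their difference. *)
Definition Omega_delta th : R := \big[Num.max/0]_(i < n) coord_dist i (th ord0 i).

Lemma cosDn2pi (x : R) (N : nat) : cos (x + N%:R * (2 * pi)) = cos x.
Proof.
elim: N => [|N IH]; first by rewrite mul0r addr0.
have c2 y : cos (y + 2 * pi) = cos y by rewrite mulr_natl (cosD2pi y).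
by rewrite -natr1 mulrDl mul1r addrA c2.
Qed.

Lemma cosBn2pi (x : R) (N : nat) : cos (x - N%:R * (2 * pi)) = cos x.
Proof. by rewrite -[in RHS](subrK (N%:R * (2 * pi)) x) cosDn2pi. Qed.

Lemma cos_le0 (y : R) : pi / 2 <= y <= pi -> cos y <= 0.
Proof.
move=> /andP[y1 y2]; rewrite -[y](subrK pi) cosDpi oppr_le0 cos_ge0_pihalf//.
have := pi_gt0 R; lra.
Qed.

(** The frequency step resolving the oscillation at distance [coord_dist j t]:
    [h t] lies within a quarter turn of [pi], modulo [2 pi]. *)
Lemma exists_dual_step j (t : R) : ((j < d)%N -> `|t| <= 2 * pi) ->
  0 < coord_dist j t ->
  exists h, [/\ 0 < h, dual_step d j h, cos (h * t) <= 2^-1 &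
    h <= pi / coord_dist j t].
Proof.
have p0 := pi_gt0 R; rewrite /coord_dist /dual_step.
case: (j < d)%N => [/(_ isT) tp dl0|_ t0]; last first.
  exists (pi / `|t|); split=> //; first by rewrite divr_gt0.
  have -> : cos (pi / `|t| * t) = -1.
    have [tn|tn] := lerP 0 t; first by rewrite ger0_norm// divfK ?cospi// -normr_gt0.
    rewrite ltr0_norm// invrN mulrN mulNr divfK ?lt_eqF//.
    by rewrite cosN cospi.
  by rewrite (@le_trans _ _ 0)// ?lerN10// invr_ge0.
set dl := circ_dist t in dl0 *.
have dlp : dl <= pi.
  rewrite /dl /circ_dist !ge_min; move: tp; rewrite !ler_norml => /andP[h1 h2].
  have [h3|h3] := leP t (- pi); first by apply/orP; right; apply/orP; right; apply/andP; split; lra.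
  have [h4|h4] := leP pi t; first by apply/orP; right; apply/orP; left; apply/andP; split; lra.
  by apply/orP; left; apply/andP; split; lra.
pose N := Num.trunc (pi / dl).
have /andP[N1 N2] : N%:R <= pi / dl < N.+1%:R by apply: truncn_itv; rewrite divr_ge0// ltW.
have N0 : (0 < N)%N.
  by rewrite -ltnS -(ltr_nat R) (le_lt_trans _ N2)// ler_pdivlMr// mul1r.
have Nr : 1 <= N%:R :> R by rewrite ler1n.
exists N%:R; split => //; first by rewrite ltr0n.
  by move=> _; exists N%:Z.
rewrite (@le_trans _ _ 0) ?invr_ge0//.
have -> : cos (N%:R * t) = cos (N%:R * dl).
  rewrite /dl /circ_dist.
  have ca (r : R) : cos (N%:R * `|r|) = cos (N%:R * r).
    by case: ger0P => // _; rewrite mulrN cosN.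
  rewrite /Num.min; case: ifP => _; last case: ifP => _; rewrite ca//.
    by rewrite mulrBr cosBn2pi.
  by rewrite mulrDr cosDn2pi.
apply: cos_le0; move: N1 N2; rewrite ler_pdivlMr// -natr1 ltr_pdivrMr// => N1 N2.
apply/andP; split => //; nra.
Qed.

Lemma Omega_delta_argmax th : 0 < Omega_delta th ->
  exists2 j : 'I_n, 0 < coord_dist j (th ord0 j) & Omega_delta th <= coord_dist j (th ord0 j).
Proof.
move=> d0; apply: contrapT => nex.
suff : Omega_delta th < Omega_delta th by rewrite ltxx.
rewrite {1}/Omega_delta; apply: bigmax_lt => // j _.
rewrite ltNge; apply/negP => le; apply: nex; exists j => //.
exact: lt_le_trans d0 le.
Qed.

Definition kernel_const (s : R) : R := 2 * (osc_const s n.+1 * pi ^+ n.+1).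

(** Kernel estimate: a symbol of order [- s] has a kernel with the singularity
    [delta ^ (s - n)] at the diagonal and the decay [delta ^ (- n - 1)] at
    infinity. *)
Lemma osc_bound (s A : R) b th : 0 < s -> s < n%:R -> 0 <= A ->
  (forall j, jet n.+1 [set std_basis j] japanese (fun xi => A * japanese xi `^ (- s)) b) ->
  dual.-integrable setT (EFin \o b) ->
  (forall i : 'I_n, (i < d)%N -> `|th ord0 i| <= 2 * pi) ->
  0 < Omega_delta th ->
  `|cos_int d b th| <= kernel_const s * A * two_scale (n%:R - s) n.+1%:R (Omega_delta th) /\
  `|sin_int d b th| <= kernel_const s * A * two_scale (n%:R - s) n.+1%:R (Omega_delta th).
Proof.
move=> s0 sn A0 jb ib thp dl0; have [j cj0 dlj] := Omega_delta_argmax dl0.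
have [h [h0 hj hc hle]] := exists_dual_step (thp j) cj0.
have nk : n%:R < s + n.+1%:R by rewrite -natr1; lra.
have := integral_kdiff_le s0 sn nk (ltn0Sn n) h0 hj A0 (jb j).
move=> /(osc_le_kdiff hj ib hc).
set I := A * _ * _; suff le : 2 * I <= kernel_const s * A * two_scale (n%:R - s) n.+1%:R (Omega_delta th).
  by move=> [c1 c2]; split; [exact: le_trans c1 le|exact: le_trans c2 le].
have p1 : 1 <= pi :> R by rewrite (le_trans _ (pi_ge2 R))// ler1n.
have p0 := pi_gt0 R.
have hd : h <= pi / Omega_delta th.
  by apply: le_trans hle _; rewrite ler_pM2l// lef_pV2 ?posrE.
rewrite /I /kernel_const.
rewrite [leRHS](_ : _ = 2 * (A * osc_const s n.+1 * (pi ^+ n.+1 * two_scale (n%:R - s) n.+1%:R (Omega_delta th)))); last by ring.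
have oc := osc_const_ge0 s0 sn nk.
rewrite ler_wpM2l// ler_wpM2l ?(mulr_ge0 A0 oc)//.
rewrite /two_scale minr_pMr ?exprn_ge0 ?(ltW p0)// le_min !ge_min; apply/andP; split; apply/orP.
  left; apply: le_trans (_ : (pi / Omega_delta th) `^ (n%:R - s) <= _).
    by rewrite ge0_ler_powR ?nnegrE ?subr_ge0 ?(ltW sn) ?(ltW h0)// divr_ge0 ?ltW.
  rewrite powRM ?invr_ge0 ?(ltW p0) ?(ltW dl0)// -powR_inv1 ?(ltW dl0)// -powRrM mulN1r.
  rewrite ler_wpM2r ?powR_ge0// -powR_mulrn ?(ltW p0)// ler_powR//.
  by rewrite -natr1; lra.
right; apply: le_trans (_ : (pi / Omega_delta th) ^+ n.+1 <= _).
  by rewrite lerXn2r ?nnegrE ?(ltW h0)// divr_ge0 ?ltW.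
by rewrite expr_div_n powRN powR_mulrn// ltW.
Qed.

End oscillatory_estimate.

(** * Schur bounds for kernels controlled by the distance *)

Lemma product_ae (R : realType)
    (mu : nat -> {sigma_finite_measure set (measurableTypeR R) -> \bar R}) n
    (I : nat -> set (measurableTypeR R)) : (forall i, measurable (I i)) ->
  (forall i : 'I_n, mu i (~` I i) = 0%E) ->
  {ae product_measure n mu, forall x : 'rV[R]_n, forall i : 'I_n, I i (x ord0 i)}.
Proof.
move=> mI I0; apply: filter_forall => j.
pose N (i : nat) : set (measurableTypeR R) := if i == j then ~` I i else setT.
have mN i : measurable (N i) by rewrite /N; case: ifP => // _; exact: measurableC.
exists [set x : 'rV[R]_n | forall i : 'I_n, N i (x ord0 i)]; split.
- exact: measurable_box.
- by rewrite product_measure_box// (bigD1 j)//= /N eqxx I0 mul0e.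
- by move=> x /= xj i; rewrite /N; case: eqP => // /val_inj ->.
Qed.

Section Omega_geometry.
Context {R : realType} (d : nat) {n : nat}.
Local Notation E := 'rV[R]_n.
Local Notation bR := (measurableTypeR R).
Local Notation Om := (@Omega_measure R d n).
Local Notation delta := (@Omega_delta R d n).
Implicit Types x y : E.

Lemma circ_distN (t : R) : circ_dist (- t) = circ_dist t.
Proof.
rewrite /circ_dist normrN; congr Num.min; rewrite minC; congr Num.min.
  by rewrite -normrN; congr `|_|; ring.
by rewrite -normrN; congr `|_|; ring.
Qed.

Lemma coord_distN i (t : R) : coord_dist d i (- t) = coord_dist d i t.
Proof. by rewrite /coord_dist circ_distN normrN. Qed.

Lemma Omega_deltaC x y : delta (x - y) = delta (y - x).
Proof.
rewrite /Omega_delta; apply: eq_bigr => i _; rewrite -coord_distN; congr coord_dist.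
by rewrite !mxE opprB.
Qed.

Lemma Omega_delta_ge0 x : 0 <= delta x.
Proof. exact: bigmax_ge_id. Qed.

Lemma coord_dist_le_Omega_delta x (i : 'I_n) : coord_dist d i (x ord0 i) <= delta x.
Proof. exact: (le_bigmax _ (fun i : 'I_n => coord_dist d i (x ord0 i))). Qed.

Lemma measurable_coord_dist i : measurable_fun setT (coord_dist d i : bR -> bR).
Proof.
rewrite /coord_dist; case: (i < d)%N; last exact: measurableT_comp.
have mn (g : bR -> bR) : measurable_fun setT g -> measurable_fun setT (fun t => `|g t|).
  by move=> mg; exact: measurableT_comp.
rewrite /circ_dist; apply: measurable_minr; first exact: (mn id).
apply: measurable_minr; first by apply: mn; exact: measurable_funB.
by apply: mn; exact: measurable_funD.
Qed.

Lemma measurable_bigmax (T : Type) d' (T' : measurableType d') (r : seq T) (F : T -> T' -> R) :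
  (forall i, measurable_fun setT (F i)) ->
  measurable_fun setT (fun t => \big[Num.max/0]_(i <- r) F i t).
Proof.
move=> mF; elim: r => [|i r IH].
  rewrite (_ : (fun t => \big[Num.max/0]_(i <- [::]) F i t) = cst 0)//.
  by apply/funext => t; exact: big_nil.
rewrite (_ : (fun t => _) = (fun t => Num.max (F i t) (\big[Num.max/0]_(i <- r) F i t))).
  exact: measurable_maxr.
by apply/funext => t; rewrite big_cons.
Qed.

Lemma measurable_Omega_delta : measurable_fun setT (fun z : E * E => delta (z.1 - z.2)).
Proof.
apply: measurable_bigmax => i; apply: (measurableT_comp (measurable_coord_dist i)).
rewrite (_ : (fun z : E * E => (z.1 - z.2) ord0 i) = (fun z => z.1 ord0 i - z.2 ord0 i)).
  by apply: measurable_funB; apply: (measurableT_comp (measurable_coord i)).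
by apply/funext => z; rewrite !mxE.
Qed.

Lemma measurable_Omega_delta1 x : measurable_fun setT (fun y : E => delta (x - y)).
Proof. exact: (measurableT_comp measurable_Omega_delta (pair1_measurable x)). Qed.

Definition fundamental_domain : set E := [set x | forall i : 'I_n, (i < d)%N -> 0 <= x ord0 i < 2 * pi].

Lemma fundamental_domain_ae : {ae Om, forall x, fundamental_domain x}.
Proof.
pose I (i : nat) : set bR := if (i < d)%N then `[0, 2 * pi[%classic else setT.
have mI i : measurable (I i) by rewrite /I; case: ifP => // _; exact: measurable_itv.
apply: (filterS _ (product_ae mI _)) => [x h i id|i].
  by have := h i; rewrite /I id /= in_itv.
rewrite /I; case: (i < d)%N; last by rewrite setCT measure0.
pose J : set bR := `[0, 2 * pi[%classic.
transitivity ((2 * pi : R)^-1%:E * @lebesgue_measure R (~` J `&` J))%E => //.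
by rewrite setICl measure0 mule0.
Qed.

Lemma dual_support_ae : {ae @dual_measure R d n, forall xi : E,
  forall i : 'I_n, (i < d)%N -> exists z : int, xi ord0 i = z%:~R}.
Proof.
pose I (i : nat) : set bR := if (i < d)%N then @integers R else setT.
have mI i : measurable (I i) by rewrite /I; case: ifP => // _; exact: measurable_integers.
apply: (filterS _ (product_ae mI _)) => [x h i id|i].
  by have := h i; rewrite /I id => -[z _ <-]; exists z.
rewrite /I; case: (i < d)%N; last by rewrite setCT measure0.
transitivity (@counting bR R (~` @integers R `&` @integers R)) => //.
by rewrite setICl measure0.
Qed.

(** The ball is contained in a product of intervals, or of three arcs of the circle
    that are translates of each other by the period; the factor 2 per coordinate is
    enough because the measure of the circle is normalized by [2 pi]. *)
Lemma Omega_delta_volume x (r : R) : 0 < r ->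
  (Om [set y | (delta (x - y)%R <= r)%R] <= (2 ^+ n * r ^+ n)%:E)%E.
Proof.
move=> r0; pose xc (i : nat) : R := if insub i is Some j then x ord0 (j : 'I_n) else 0.
have xcE (i : 'I_n) : xc i = x ord0 i by rewrite /xc valK.
pose B (i : nat) : set bR := [set t | coord_dist d i (xc i - t) <= r].
have mB i : measurable (B i).
  rewrite -[X in measurable X]setTI; apply: measurable_fun_ler => //.
  apply: (measurableT_comp (measurable_coord_dist i)); exact: measurable_funB.
apply: (@le_trans _ _ (Om [set y : E | forall i : 'I_n, B i (y ord0 i)])).
  apply: le_measure; rewrite ?inE.
  - rewrite -[X in measurable X]setTI; apply: measurable_fun_ler => //.
    exact: measurable_Omega_delta1.
  - exact: measurable_box.
  - move=> y /= xr i; rewrite /B/= xcE; apply: le_trans xr.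
    by have := coord_dist_le_Omega_delta (x - y) i; rewrite !mxE.
rewrite -exprMn; apply: product_measure_box_le => //; first by rewrite mulr_ge0// ltW.
have lb c : (@lebesgue_measure R [set t | (`|t - c| <= r)%R] <= (2 * r)%:E)%E.
  by rewrite lebesgue_ball// ltW.
move=> i _; have := mB i; rewrite /B /coord_dist; case: (i < d)%N => mBi; last first.
  rewrite (_ : [set _ | _] = [set t : R | `|t - xc i| <= r]); first exact: lb.
  by apply/seteqP; split => t /=; rewrite distrC.
apply: circle_measure_le => //; first by rewrite mulr_ge0// ltW.
pose U1 : set bR := [set t | `|t - xc i| <= r].
pose U2 : set bR := [set t | `|t - (xc i - 2 * pi)| <= r].
pose U3 : set bR := [set t | `|t - (xc i + 2 * pi)| <= r].
have mU1 : measurable U1 by exact: measurable_ball_le.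
have mU2 : measurable U2 by exact: measurable_ball_le.
have mU3 : measurable U3 by exact: measurable_ball_le.
apply: (@le_trans _ _ (@lebesgue_measure R (U1 `|` (U2 `|` U3)))).
  apply: le_measure; rewrite ?inE//; first by do ?apply: measurableU.
  move=> t /=; rewrite /circ_dist !ge_min => /orP[h|/orP[h|h]]; [left|right;left|right;right].
  - by rewrite /U1/= distrC.
  - by rewrite /U2/= distrC addrAC.
  - by rewrite /U3/= distrC addrAC.
apply: le_trans (measureU2 _ _ _) _ => //; first exact: measurableU.
apply: le_trans (leeD (lb _) (measureU2 _ mU2 mU3)) _.
apply: le_trans (leeD (lexx _) (leeD (lb _) (lb _))) _.
by rewrite -!EFinD lee_fin; have := r0; lra.
Qed.

Lemma Omega_delta0_null x : (0 < n)%N -> Om [set y | delta (x - y) <= 0] = 0%E.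
Proof.
move=> n0; apply/eqP; rewrite eq_le measure_ge0 andbT.
apply/lee_addgt0Pr => e e0; rewrite add0e.
pose r := Num.min 1 (e / 2 ^+ n); have p2 : 0 < 2 ^+ n :> R by rewrite exprn_gt0.
have r0 : 0 < r by rewrite lt_min ltr01 divr_gt0.
apply: (@le_trans _ _ (Om [set y | delta (x - y) <= r])).
  have m s : measurable [set y | delta (x - y) <= s].
    rewrite -[X in measurable X]setTI; apply: measurable_fun_ler => //.
    exact: measurable_Omega_delta1.
  by apply: le_measure; rewrite ?inE// => y /= /le_trans; apply; exact: ltW.
apply: le_trans (Omega_delta_volume x r0) _; rewrite lee_fin.
apply: (@le_trans _ _ (2 ^+ n * r)); last first.
  by rewrite mulrC -ler_pdivlMr// /r ge_min lexx orbT.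
rewrite ler_wpM2l ?(ltW p2)//; case: n n0 => // k _.
by rewrite exprS ler_piMr ?(ltW r0)// exprn_ile1 ?(ltW r0)// /r ge_min lexx.
Qed.

Lemma integral_Omega_delta_two_scale x al be : 0 < al -> al < n%:R -> n%:R < be ->
  (\int[Om]_y (two_scale al be (delta (x - y)))%:E <=
   (2 ^+ n * two_scale_const al be n)%:E)%E.
Proof.
move=> al0 aln nbe; apply: integral_two_scale => //.
- exact: measurable_Omega_delta1.
- by move=> y; exact: Omega_delta_ge0.
by move=> r r0; exact: Omega_delta_volume.
Qed.

(** The singularity is integrable because [al < n], the tail because [n < be]. *)
Lemma schur_of_bound (k : E * E -> R) (C al be : R) : (0 < n)%N ->
  0 < al -> al < n%:R -> n%:R < be -> 0 <= C -> measurable_fun setT k ->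
  (forall x y, fundamental_domain x -> fundamental_domain y -> 0 < delta (x - y) ->
     `|k (x, y)| <= C * two_scale al be (delta (x - y))) ->
  schur_bounded Om k (C * (2 ^+ n * two_scale_const al be n)).
Proof.
move=> n0 al0 aln nbe C0 mk kC.
have side (h : E -> R) x : measurable_fun setT h ->
    (forall y, fundamental_domain y -> 0 < delta (x - y) ->
      `|h y| <= C * two_scale al be (delta (x - y))) ->
    (\int[Om]_y `|h y|%:E <= (C * (2 ^+ n * two_scale_const al be n))%:E)%E.
  move=> mh hC.
  have mt : measurable_fun setT (fun y => (two_scale al be (delta (x - y)))%:E).
    apply/measurable_EFinP; apply: (measurableT_comp (measurable_two_scale al be)).
    exact: measurable_Omega_delta1.
  rewrite EFinM; apply: le_trans (lee_wpmul2l _ (integral_Omega_delta_two_scale x al0 aln nbe)).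
    rewrite -ge0_integralZl_EFin//; last by move=> y _; rewrite lee_fin two_scale_ge0.
    apply: ae_ge0_le_integral => //.
    - by apply/measurable_EFinP; exact: measurableT_comp.
    - by move=> y _; rewrite -EFinM lee_fin mulr_ge0// two_scale_ge0.
    - exact: measurable_funeM.
    have pos : {ae Om, forall y, 0 < delta (x - y)}.
      exists [set y | delta (x - y) <= 0]; split.
      - rewrite -[X in measurable X]setTI; apply: measurable_fun_ler => //.
        exact: measurable_Omega_delta1.
      - exact: Omega_delta0_null.
      - by move=> y /= /negP; rewrite -leNgt.
    apply: filterS2 fundamental_domain_ae pos => y Dy py _.
    by rewrite -EFinM lee_fin; exact: hC.
  by rewrite lee_fin.
split => //.
  apply: filterS fundamental_domain_ae => x Dx; apply: side => [|y Dy].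
    exact: measurableT_comp.
  exact: kC.
apply: filterS fundamental_domain_ae => y Dy; apply: (side (fun x => k (x, y)) y) => [|x Dx].
  exact: measurableT_comp.
by rewrite Omega_deltaC; exact: kC.
Qed.

End Omega_geometry.

(** * Limits of truncated kernels *)

Section good_kernels.
Context {R : realType} (d : nat) {n : nat}.
Local Notation E := 'rV[R]_n.
Local Notation bR := (measurableTypeR R).
Local Notation Om := (@Omega_measure R d n).
Local Notation delta := (@Omega_delta R d n).
Local Notation D := (@fundamental_domain R d n).
Variable s : R.
Hypotheses (n0 : (0 < n)%N) (s0 : 0 < s) (sn : s < n%:R).
Implicit Types (x y : E) (M : nat).

Local Notation ts t := (two_scale (n%:R - s) n.+1%:R t).

(** Smooth truncations [k M], [M = 0, 1, ...], of a kernel that may be singular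
    on the diagonal: they converge at a rate, with a weight to which Schur's
    test applies, they become small at infinity, and each of them is regular enough to be
    replaced by a step kernel. *)
Record good_family (k : nat -> E * E -> R) : Prop := GoodFamily {
  good_measurable : forall M, measurable_fun setT (k M);
  good_cauchy : exists2 C, 0 <= C & forall M M' x y, (M <= M')%N -> D x -> D y ->
    0 < delta (x - y) ->
    `|k M (x, y) - k M' (x, y)| <= C * M.+1%:R `^ (- s) * ts (delta (x - y));
  good_bound : forall M, exists2 C, 0 <= C & forall x y, D x -> D y ->
    0 < delta (x - y) -> `|k M (x, y)| <= C * ts (delta (x - y));
  good_vanishing : forall M (e r : R), 0 < e -> exists rho, forall x y, D x -> D y ->
    0 < delta (x - y) <= r -> rho <= height d x -> rho <= height d y ->
    `|k M (x, y)| <= e * ts (delta (x - y));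
  good_lipschitz : forall M, exists2 L, 0 <= L & forall x x' y,
    `|k M (x, y) - k M (x', y)| <= L * `|x - x'|;
  good_finite : forall M, exists2 C, 0 <= C & forall z, `|k M z| <= C }.

Lemma good_familyD k1 k2 : good_family k1 -> good_family k2 ->
  good_family (fun M z => k1 M z + k2 M z).
Proof.
move=> [m1 [C1 C10 c1] b1 v1 l1 f1] [m2 [C2 C20 c2] b2 v2 l2 f2]; split.
- by move=> M; exact: measurable_funD.
- exists (C1 + C2); first exact: addr_ge0.
  move=> M M' x y MM Dx Dy xy; rewrite !mulrDl opprD addrACA.
  by apply: le_trans (ler_normD _ _) _; apply: lerD; [exact: c1|exact: c2].
- move=> M; have [A1 A10 a1] := b1 M; have [A2 A20 a2] := b2 M.
  exists (A1 + A2); first exact: addr_ge0.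
  move=> x y Dx Dy xy; rewrite mulrDl.
  by apply: le_trans (ler_normD _ _) _; apply: lerD; [exact: a1|exact: a2].
- move=> M e r e0; have e2 : 0 < e / 2 by rewrite divr_gt0.
  have [r1 h1] := v1 M _ r e2; have [r2 h2] := v2 M _ r e2.
  exists (Num.max r1 r2) => x y Dx Dy xy; rewrite !ge_max => /andP[x1 x2] /andP[y1 y2].
  rewrite (splitr e) mulrDl.
  by apply: le_trans (ler_normD _ _) _; apply: lerD; [exact: h1|exact: h2].
- move=> M; have [A1 A10 a1] := l1 M; have [A2 A20 a2] := l2 M.
  exists (A1 + A2); first exact: addr_ge0.
  move=> x x' y; rewrite mulrDl opprD addrACA.
  by apply: le_trans (ler_normD _ _) _; apply: lerD; [exact: a1|exact: a2].
- move=> M; have [A1 A10 a1] := f1 M; have [A2 A20 a2] := f2 M.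
  exists (A1 + A2); first exact: addr_ge0.
  by move=> z; apply: le_trans (ler_normD _ _) _; apply: lerD; [exact: a1|exact: a2].
Qed.

Lemma good_familyN k : good_family k -> good_family (fun M z => - k M z).
Proof.
move=> [m1 [C1 C10 c1] b1 v1 l1 f1]; split.
- by move=> M; exact: measurable_funN.
- exists C1 => // M M' x y MM Dx Dy xy; rewrite -opprD normrN; exact: c1.
- move=> M; have [A1 A10 a1] := b1 M; exists A1 => // x y Dx Dy xy.
  by rewrite normrN; exact: a1.
- move=> M e r e0; have [rho h] := v1 M e r e0; exists rho => x y Dx Dy xy hx hy.
  by rewrite normrN; exact: h.
- move=> M; have [A1 A10 a1] := l1 M; exists A1 => // x x' y.
  by rewrite -opprD normrN; exact: a1.
- by move=> M; have [A1 A10 a1] := f1 M; exists A1 => // z; rewrite normrN.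
Qed.

Lemma rate_le (e : R) : 0 < e -> exists N, forall M, (N <= M)%N -> M.+1%:R `^ (- s) <= e.
Proof.
move=> e0; pose t := e^-1 `^ s^-1.
exists (Num.trunc t) => M NM; have t0 : 0 <= t by exact: powR_ge0.
rewrite powRN -[leRHS]invrK lef_pV2 ?posrE ?invr_gt0 ?powR_gt0 ?ltr0n//.
have -> : e^-1 = t `^ s.
  by rewrite /t -powRrM mulVf ?gt_eqF// powRr1// invr_ge0 ltW.
apply: ge0_ler_powR; rewrite ?nnegrE ?ler0n ?(ltW s0)//.
by rewrite ltW// (lt_le_trans (truncnS_gt t))// ler_nat ltnS.
Qed.

Lemma cvg_of_rate (u : nat -> R) (c : R) : 0 <= c ->
  (forall M M', (M <= M')%N -> `|u M - u M'| <= c * M.+1%:R `^ (- s)) ->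
  cvgn u /\ forall M, `|limn u - u M| <= c * M.+1%:R `^ (- s).
Proof.
move=> c0 uc; have c1 : 0 < c + 1 by rewrite ltr_wpDl.
have cu : cvgn u.
  apply/cauchy_cvgP/cauchy_ballP => e e0.
  have [N hN] := rate_le (divr_gt0 e0 (mulr_gt0 (ltr0n R 2) c1)).
  have near_N : \forall M \near \oo, `|u N - u M| < e / 2.
    exists N => // M NM; apply: le_lt_trans (uc _ _ NM) _.
    apply: (@le_lt_trans _ _ (c * (e / (2 * (c + 1))))); first by rewrite ler_wpM2l// hN.
    rewrite mulrA ltr_pdivrMr ?mulr_gt0//.
    rewrite [ltRHS](_ : _ = e * (c + 1)); last by field.
    by rewrite mulrC ltr_pM2l// ltrDl.
  exists ([set v | `|u N - v| < e / 2], [set v | `|u N - v| < e / 2]).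
    by split.
  move=> [v v'] /= [hM hM']; rewrite /ball/= [v - _](_ : _ = - (u N - v) + (u N - v')); last by ring.
  apply: le_lt_trans (ler_normD _ _) _; rewrite normrN (splitr e).
  exact: ltrD.
split => // M; apply/ler_addgt0Pr => e e0.
have [N _ hN] : \forall M' \near \oo, `|limn u - u M'| < e.
  by move/cvgrPdist_lt : cu; exact.
pose M' := maxn N M.
rewrite [X in `|X|](_ : _ = - (u M - u M') + (limn u - u M')); last by ring.
apply: le_trans (ler_normD _ _) _; rewrite normrN; apply: lerD.
  by apply: uc; rewrite leq_maxr.
by apply: ltW; apply: hN; rewrite /= leq_maxl.
Qed.

Let S : set (E * E) := [set z | D z.1 /\ D z.2 /\ 0 < delta (z.1 - z.2)].

Lemma measurable_fundamental_domain : measurable D.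
Proof.
rewrite (_ : D = [set x : E | forall i : 'I_n,
    (fun j : nat => if (j < d)%N then `[0, 2 * pi[%classic : set bR else setT) i (x ord0 i)]).
  apply: (measurable_box (B := fun j : nat => if (j < d)%N then `[0, 2 * pi[%classic : set bR else setT)) => i.
  by case: ifP.
apply/seteqP; split => x /= h i; have := h i; case: ifP => // id; rewrite /= in_itv/=; exact.
Qed.

Let measurable_S : measurable S.
Proof.
rewrite (_ : S = (D `*` D) `&` [set z | 0 < delta (z.1 - z.2)]).
  apply: measurableI; first by apply: measurableX; exact: measurable_fundamental_domain.
  rewrite -[X in measurable X]setTI; apply: measurable_fun_ltr => //.
  exact: measurable_Omega_delta.
by apply/seteqP; split => -[x y] /=; rewrite /S/=; tauto.
Qed.

(** The indicator of [S] makes the sequence converge at every point, so that the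
    limit is measurable; the complement of [S] is a null set. *)
Definition limit_kernel (k : nat -> E * E -> R) z : R := limn (fun M => \1_S z * k M z).

Section limit.
Variable k : nat -> E * E -> R.
Hypothesis gk : good_family k.

Let kS_rate : exists2 C, 0 <= C & forall z,
  cvgn (fun M => \1_S z * k M z) /\
  forall M, `|limit_kernel k z - \1_S z * k M z| <= C * ts (delta (z.1 - z.2)) * M.+1%:R `^ (- s).
Proof.
have [C C0 kC] := good_cauchy gk; exists C => // -[x y].
apply: cvg_of_rate => [|M M' MM]; first by rewrite mulr_ge0// two_scale_ge0.
rewrite -mulrBr indicE; have [/set_mem [/= Dx [Dy xy]]|_] := boolP ((x, y) \in S).
  by rewrite mul1r mulrAC; exact: kC.
by rewrite mul0r normr0 !mulr_ge0 ?two_scale_ge0 ?powR_ge0.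
Qed.

Lemma measurable_limit_kernel : measurable_fun setT (limit_kernel k).
Proof.
have [C C0 kC] := kS_rate.
apply: (measurable_fun_cvg (h := fun M z => \1_S z * k M z)) => [M|z _].
  apply: measurable_funM; last exact: good_measurable gk M.
  by apply/measurable_indicP; exact: measurable_S.
exact: (kC z).1.
Qed.

Let al0 : 0 < n%:R - s. Proof. by rewrite subr_gt0. Qed.
Let aln : n%:R - s < n%:R. Proof. by rewrite ltrBlDr ltrDl. Qed.
Let nbe : n%:R < n.+1%:R :> R. Proof. by rewrite ltr_nat. Qed.

(** The truncated kernels converge in Schur norm, hence in operator norm. *)
Lemma limit_kernel_schur : exists2 C, 0 <= C & forall M,
  schur_bounded Om (fun z => limit_kernel k z - k M z) (C * M.+1%:R `^ (- s)).
Proof.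
have [C C0 kC] := kS_rate.
exists (C * (2 ^+ n * two_scale_const (n%:R - s) n.+1%:R n)).
  by rewrite !mulr_ge0 ?exprn_ge0 ?(ltW (two_scale_const_gt0 al0 aln nbe)).
move=> M; rewrite mulrAC; apply: schur_of_bound => //.
- by rewrite mulr_ge0 ?powR_ge0.
- apply: measurable_funB; first exact: measurable_limit_kernel.
  exact: good_measurable gk M.
move=> x y Dx Dy xy; rewrite mulrAC.
have := (kC (x, y)).2 M; rewrite indicE mem_set//= mul1r; exact.
Qed.

Lemma limit_kernel_schur_bounded : exists2 B, 0 < B & schur_bounded Om (limit_kernel k) B.
Proof.
have [C C0 kC] := limit_kernel_schur; have [A A0 kA] := good_bound gk 0.
have s1 := kC 0%N.
have s2 : schur_bounded Om (k 0%N) (A * (2 ^+ n * two_scale_const (n%:R - s) n.+1%:R n)).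
  by apply: schur_of_bound => //; exact: good_measurable gk 0%N.
have := schur_boundedD s1 s2; rewrite (_ : (fun z => _) = limit_kernel k); last first.
  by apply/funext => z; rewrite subrK.
set B := _ + _ => sB; exists (B + 1); last by apply: schur_bounded_le sB; rewrite lerDl.
rewrite ltr_wpDl// addr_ge0 ?mulr_ge0 ?powR_ge0 ?exprn_ge0//.
by rewrite ltW// two_scale_const_gt0.
Qed.

Definition slab (rho : R) : set E := D `&` [set x | forall i : 'I_n, (d <= i)%N -> `|x ord0 i| <= rho].

Lemma slabE rho : slab rho = [set x : E | forall i : 'I_n, (fun j : nat =>
  if (j < d)%N then `[0, 2 * pi[%classic : set bR else [set t | `|t - 0| <= rho]) i (x ord0 i)].
Proof.
apply/seteqP; split => [x /= [h1 h2] i|x /= h]; last split => i.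
- by case: ltnP => id /=; [rewrite in_itv/= h1|rewrite subr0 h2].
- by move=> id; have := h i; rewrite id /= in_itv.
- by move=> id; have := h i; rewrite ltnNge id/= subr0.
Qed.

Lemma measurable_slab rho : measurable (slab rho).
Proof.
rewrite slabE; apply: (measurable_box (B := fun j : nat =>
  if (j < d)%N then `[0, 2 * pi[%classic : set bR else [set t | `|t - 0| <= rho])) => i.
by case: ifP => // _; exact: measurable_ball_le.
Qed.

Lemma slab_finite rho : 0 <= rho -> (Om (slab rho) < +oo)%E.
Proof.
move=> rho0; rewrite slabE; apply: (@le_lt_trans _ _ ((1 + 2 * rho) ^+ n)%:E); last exact: ltry.
have r1 : 0 <= 2 * rho by rewrite mulr_ge0.
apply: (product_measure_box_le (B := fun j : nat =>
  if (j < d)%N then `[0, 2 * pi[%classic : set bR else [set t | `|t - 0| <= rho])) => [|i|i _].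
- by rewrite addr_ge0.
- by case: ifP => // _; exact: measurable_ball_le.
case: (i < d)%N.
  by apply: le_trans (circle_measure_le1 _) _ => //; rewrite lee_fin lerDl.
rewrite [leLHS](_ : _ = (2 * rho)%:E); last exact: lebesgue_ball.
by rewrite lee_fin lerDr.
Qed.

Lemma two_scale_le_be al be be' (t : R) : al <= be' -> be' <= be -> 0 < t ->
  two_scale al be t <= two_scale al be' t.
Proof.
move=> ab bb t0; rewrite /two_scale le_min ge_min lexx/= ge_min.
have [t1|t1] := leP t 1; apply/orP; [left|right].
  rewrite !powRN lef_pV2 ?posrE ?powR_gt0//.
  by rewrite ger_powR// t0.
by rewrite ler_powR ?(ltW t1)// lerN2.
Qed.

(** Away from a large slab the kernel is small in Schur norm: near the diagonal
    by the decay of the symbol, far from it by the decay of the kernel. *)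
Lemma good_slab_schur M (e : R) : 0 < e -> exists2 rho, 0 <= rho &
  schur_bounded Om (fun z => k M z - \1_(slab rho) z.1 * (\1_(slab rho) z.2 * k M z)) e.
Proof.
(* An exponent strictly between [n] and [n + 1]: for [dl > r] the decay [dl ^ (- n - 1)]
   is smaller than [dl ^ (- be')] by the factor [r ^ (- 1 / 2)], and [r] is chosen so that
   this factor absorbs the constant [A]. *)
move=> e0; pose be' := n%:R + 2^-1 : R.
have nbe' : n%:R < be' by rewrite ltrDl invr_gt0.
pose K := 2 ^+ n * two_scale_const (n%:R - s) be' n.
have K0 : 0 < K by rewrite mulr_gt0 ?exprn_gt0 ?two_scale_const_gt0.
pose e' := e / K; have e'0 : 0 < e' by rewrite divr_gt0.
have [A A0 kA] := good_bound gk M.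
pose r := 1 + ((A + 1) / e') ^+ 2.
have A1 : 0 < A + 1 by rewrite ltr_wpDl.
have r1 : 1 <= r by rewrite lerDl sqr_ge0.
have r0 : 0 < r by rewrite (lt_le_trans _ r1).
have [rho0 krho] := good_vanishing gk M r e'0.
pose rho := `|rho0| + r.
have mI : measurable_fun setT (\1_(slab rho) : E -> R).
  by apply/measurable_indicP; exact: measurable_slab.
exists rho; first by rewrite addr_ge0// ltW.
rewrite [e](_ : _ = e' * K); last by rewrite divfK// gt_eqF.
apply: schur_of_bound => //; first exact: ltW.
  have mk := good_measurable gk M.
  apply: measurable_funB => //; apply: measurable_funM; first exact: measurableT_comp.
  by apply: measurable_funM => //; exact: measurableT_comp.
move=> x y Dx Dy xy; set dl := delta (x - y).
have t0 : 0 <= e' * two_scale (n%:R - s) be' dl by rewrite mulr_ge0 ?two_scale_ge0// ltW.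
have [xB|xB] := boolP ((x \in slab rho) && (y \in slab rho)).
  by case/andP : xB => xB yB; rewrite /= !indicE xB yB !mul1r subrr normr0.
have -> : k M (x, y) - \1_(slab rho) x * (\1_(slab rho) y * k M (x, y)) = k M (x, y).
  by rewrite !indicE; move: xB; case: (x \in _); case: (y \in _) => //= _; rewrite ?mul0r ?mulr0 subr0.
have abe : n%:R - s <= be' by rewrite ltW// (lt_trans aln).
have [dr|dr] := leP dl r.
  apply: (@le_trans _ _ (e' * ts dl)); last first.
    rewrite ler_wpM2l ?(ltW e'0)//; apply: two_scale_le_be => //.
    by rewrite /be' -[n.+1%:R]natr1 lerD2l invf_le1// ler1n.
  suff [h1 h2] : rho0 <= height d x /\ rho0 <= height d y.
    by apply: krho => //; rewrite xy.
  have far (x' y' : E) : D x' -> x' \notin slab rho -> delta (x' - y') <= r ->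
      rho0 <= height d x' /\ rho0 <= height d y'.
    move=> Dx' /negP xs' dxy.
    have [i di xi] : exists2 i : 'I_n, (d <= i)%N & rho < `|x' ord0 i|.
      apply: contrapT => h; apply: xs'; rewrite inE; split => // i di.
      by rewrite leNgt; apply/negP => hi; apply: h; exists i.
    have yi : `|x' ord0 i - y' ord0 i| <= r.
      apply: le_trans dxy; have := coord_dist_le_Omega_delta d (x' - y') i.
      by rewrite /coord_dist ltnNge di/= !mxE.
    have := ler_norm rho0; rewrite /rho in xi.
    have := lerB_dist (x' ord0 i) (y' ord0 i).
    by split; [apply: le_trans (normr_coord_le_height _ di)|apply: le_trans (normr_coord_le_height _ di)]; lra.
  move: xB; rewrite negb_and => /orP[xB|yB].
    exact: far.
  by have [] := far y x Dy yB; rewrite ?(Omega_deltaC d y x).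
apply: le_trans (kA _ _ Dx Dy xy) _.
have dl1 : 1 < dl by rewrite (le_lt_trans r1).
have dl0 : 0 < dl by rewrite (lt_trans _ dl1).
apply: (@le_trans _ _ (A * dl `^ (- n.+1%:R))).
  by rewrite ler_wpM2l// /two_scale ge_min lexx orbT.
have half : 0 < dl `^ 2^-1 by rewrite powR_gt0.
have hA : A <= e' * dl `^ 2^-1.
  rewrite -ler_pdivrMl// mulrC.
  have : ((A + 1) / e') ^+ 2 <= (dl `^ 2^-1) ^+ 2.
    rewrite -powR_mulrn ?powR_ge0// -powRrM mulVf// powRr1 ?(ltW dl0)//.
    by apply: le_trans (ltW dr); rewrite lerDr.
  have q0 : 0 <= (A + 1) / e' by apply: divr_ge0; exact: ltW.
  rewrite ler_sqr ?nnegrE ?powR_ge0//.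
  by apply: le_trans; rewrite ler_pM2r ?invr_gt0// lerDl.
apply: (@le_trans _ _ (e' * dl `^ (- be'))); last first.
  rewrite ler_wpM2l ?(ltW e'0)// /two_scale le_min lexx andbT.
  by rewrite ler_powR ?(ltW dl1)// lerN2.
apply: le_trans (ler_wpM2r _ hA) _; first exact: powR_ge0.
rewrite -mulrA ler_wpM2l ?(ltW e'0)// -powRD; last by rewrite (gt_eqF dl0) implybT.
by rewrite ler_powR ?(ltW dl1)// /be' -[n.+1%:R]natr1; lra.
Qed.

Lemma finite_grid_slab rho N : finite_set (grid N @` slab rho).
Proof.
pose P := Num.trunc ((2 * pi + `|rho| + 1) * N.+1%:R).
pose f (g : {ffun 'I_n -> 'I_(P.+1 + P.+1)}) : 'rV[int]_n := \row_i ((g i)%:Z - P.+1%:Z).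
apply: (@sub_finite_set _ _ (f @` setT)); last exact: finite_image.
move=> _ [x [Dx xr] <-].
have N0 : 0 < N.+1%:R :> R by rewrite ltr0n.
have b i : (absz (Num.floor (x ord0 i * N.+1%:R)) <= P)%N.
  have xi : `|x ord0 i| <= 2 * pi + `|rho|.
    have [id|id] := ltnP i d.
      have /andP[h1 h2] := Dx i id; rewrite ger0_norm//.
      by rewrite (le_trans (ltW h2))// lerDl.
    by rewrite (le_trans (xr i id))// ler_wpDl ?ler_norm// mulr_ge0// pi_ge0.
  have F := floor_itv (x ord0 i * N.+1%:R); set z := Num.floor _ in F *.
  have h : `|z%:~R| <= (2 * pi + `|rho| + 1) * N.+1%:R :> R.
    have : `|x ord0 i * N.+1%:R| <= (2 * pi + `|rho|) * N.+1%:R.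
      by rewrite normrM (gtr0_norm N0) ler_pM2r.
    move: F; rewrite intrD !ler_norml => /andP[h1 h2] /andP[h3 h4].
    have : 1 <= N.+1%:R :> R by rewrite ler1n.
    by move=> h5; apply/andP; split; lra.
  rewrite -ltnS -(ltr_nat R); apply: le_lt_trans (truncnS_gt _).
  by rewrite natr_absz intr_norm.
have lt i : (absz (Num.floor (x ord0 i * N.+1%:R) + P.+1%:Z)%R < P.+1 + P.+1)%N.
  by have := b i; lia.
exists [ffun i => Ordinal (lt i)] => //.
by apply/rowP => i; rewrite !mxE ffunE /=; have := b i; lia.
Qed.

Lemma measurable_of_grid N : measurable_fun setT (fun x : E => of_grid N (grid N x) : E).
Proof.
exact: (@measurable_countable_factor _ _ _ _ _ (grid N) (of_grid N) (measurable_grid_fiber N)).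
Qed.

(** Rounding the first variable of the truncated kernel to a fine grid gives a
    step kernel; the kernel being Lipschitz, the error is uniformly small. *)
Lemma good_step_kernel M rho (e : R) : 0 <= rho -> 0 < e ->
  exists2 k' : E * E -> R, measurable_fun setT k' /\ step_kernel Om k' &
    schur_bounded Om (fun z => \1_(slab rho) z.1 * (\1_(slab rho) z.2 * k M z) - k' z) e.
Proof.
move=> rho0 e0; have [L L0 kL] := good_lipschitz gk M.
have [C C0 kC] := good_finite gk M; have mk := good_measurable gk M.
have mB := measurable_slab rho; have Boo := slab_finite rho0.
have [b Bb] : exists b, Om (slab rho) = b%:E.
  by exists (fine (Om (slab rho))); rewrite fineK// ge0_fin_numE.
have b0 : 0 <= b by rewrite -lee_fin -Bb.
have mI : measurable_fun setT (\1_(slab rho) : E -> R) by apply/measurable_indicP.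
have Lb : 0 < L * b + 1 by rewrite ltr_wpDl// mulr_ge0.
have [N _ hN] := near_infty_natSinv_lt (PosNum (divr_gt0 e0 Lb)).
have /= {}hN := hN N (leqnn N).
pose r x := of_grid N (grid N x) : E.
have rx x : `|x - r x| <= N.+1%:R^-1.
  apply: mx_norm_le => // i; rewrite mxE [X in _ + X]mxE distrC.
  exact: grid_dist.
pose k' (z : E * E) := \1_(slab rho) z.1 * (\1_(slab rho) z.2 * k M (r z.1, z.2)).
have mr : measurable_fun setT (fun z : E * E => (r z.1, z.2)).
  apply: measurable_fun_pair => //.
  exact: (measurableT_comp (measurable_of_grid N) measurable_fst).
have mI1 : measurable_fun setT (fun z : E * E => \1_(slab rho) z.1 : R).
  exact: measurableT_comp.
have mI2 : measurable_fun setT (fun z : E * E => \1_(slab rho) z.2 : R).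
  exact: measurableT_comp.
have mk' : measurable_fun setT k'.
  apply: measurable_funM => //; apply: measurable_funM => //.
  exact: measurableT_comp mk mr.
exists k'.
  split => //; have [l lE] := (finite_seqP _).1 (finite_grid_slab rho N).
  exists (size l), (fun x => index (grid N x) l), (slab rho),
    (fun q y => \1_(slab rho) y * k M (of_grid N (nth 0 l q), y)).
  have inl x : slab rho x -> grid N x \in l.
    by move=> xB; have : (grid N @` slab rho) (grid N x) by [exists x]; rewrite lE.
  split => // [x xB|q|x y].
  - by rewrite index_mem inl.
  - have mg : measurable_fun setT (fun y : E => \1_(slab rho) y * k M (of_grid N (nth 0 l q), y)).
      by apply: measurable_funM => //; exact: (measurableT_comp mk (pair1_measurable _)).
    split => //; apply: (@le_lt_trans _ _ (\int[Om]_y ((C ^+ 2)%:E * (\1_(slab rho) y)%:E))%E).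
      apply: ge0_le_integral => //.
      + by move=> y _; rewrite lee_fin sqr_ge0.
      + exact: measurable_sqr.
      + by apply: measurable_funeM; exact/measurable_EFinP.
      + move=> y _; rewrite -EFinM lee_fin indicE; case: (y \in _); last first.
          by rewrite mul0r mulr0 expr0n.
        rewrite mul1r mulr1 -[leLHS]real_normK ?num_real// lerXn2r ?nnegrE//.
    rewrite ge0_integralZl_EFin ?sqr_ge0//; last exact/measurable_EFinP.
    rewrite integral_indic// setIT; apply: lte_mul_pinfty => //.
    by rewrite lee_fin sqr_ge0.
  rewrite /k' /= !indicE; have [/set_mem xB|xB] := boolP (x \in slab rho); last by rewrite !mul0r.
  by rewrite /r nth_index// inl.
have kk' z : `|\1_(slab rho) z.1 * (\1_(slab rho) z.2 * k M z) - k' z| <=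
    L * N.+1%:R^-1 * (\1_(slab rho) z.1 * \1_(slab rho) z.2).
  case: z => x y; rewrite /k' /= -!mulrBr !indicE.
  case: (x \in _); last by rewrite !mul0r normr0 mulr0.
  case: (y \in _); last by rewrite !(mul0r, mulr0) normr0.
  rewrite !mul1r mulr1; apply: le_trans (kL _ _ _) _.
  exact: ler_wpM2l.
have bound (h : E -> R) : measurable_fun setT h ->
   (forall y, `|h y| <= L * N.+1%:R^-1 * \1_(slab rho) y) -> (\int[Om]_y `|h y|%:E <= e%:E)%E.
  move=> mh hB.
  apply: (@le_trans _ _ (\int[Om]_y ((L * N.+1%:R^-1)%:E * (\1_(slab rho) y)%:E))%E).
    apply: ge0_le_integral => //.
    - by apply/measurable_EFinP; exact: measurableT_comp.
    - by apply: measurable_funeM; exact/measurable_EFinP.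
    - by move=> y _; rewrite -EFinM lee_fin.
  rewrite ge0_integralZl_EFin ?mulr_ge0//; last exact/measurable_EFinP.
  have -> : (\int[Om]_y (\1_(slab rho) y)%:E)%E = b%:E by rewrite integral_indic// setIT -Bb.
  rewrite -EFinM lee_fin mulrAC.
  apply: le_trans (ler_wpM2l _ (ltW hN)) _; first exact: mulr_ge0.
  by rewrite mulrCA ler_piMr ?(ltW e0)// ler_pdivrMr// mul1r lerDl ler01.
pose g (z : E * E) := \1_(slab rho) z.1 * (\1_(slab rho) z.2 * k M z) - k' z.
have md : measurable_fun setT g.
  by apply: measurable_funB => //; apply: measurable_funM => //; exact: measurable_funM.
have L1 : 0 <= L * N.+1%:R^-1 by rewrite mulr_ge0.
have i1 x : (0 : R) <= \1_(slab rho) x <= (1 : R) by rewrite indicE ler0n lern1 leq_b1.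
split; first exact: md.
- apply: aeW => x; apply: (bound (fun y => g (x, y))) => [|y].
    exact: (measurableT_comp md (pair1_measurable _)).
  apply: le_trans (kk' (x, y)) _; have /andP[x0 x1] := i1 x; have /andP[y0 y1] := i1 y.
  by apply: ler_wpM2l => //=; rewrite -[leRHS]mul1r; exact: ler_wpM2r.
- apply: aeW => y; apply: (bound (fun x => g (x, y))) => [|x].
    exact: (measurableT_comp md (pair2_measurable _)).
  apply: le_trans (kk' (x, y)) _; have /andP[x0 x1] := i1 x; have /andP[y0 y1] := i1 y.
  by apply: ler_wpM2l => //=; rewrite -[leRHS]mulr1; exact: ler_wpM2l.
Qed.

Lemma limit_kernel_ultra_compact (U : set_system nat) : UltraFilter U ->
  ultra_compact Om U (limit_kernel k).
Proof.
move=> UU; apply: (schur_limit_ultra_compact UU); first exact: measurable_limit_kernel.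
move=> e e0; have e3 : 0 < e / 3 by rewrite divr_gt0.
have [C C0 kC] := limit_kernel_schur.
have C1 : 0 < C + 1 by rewrite ltr_wpDl.
have [M hM] := rate_le (divr_gt0 e3 C1).
have [rho rho0 k2] := good_slab_schur M e3.
have [k' mk' k3] := good_step_kernel M rho0 e3.
exists k' => //.
have k1 : schur_bounded Om (fun z => limit_kernel k z - k M z) (e / 3).
  apply: schur_bounded_le (kC M); apply: le_trans (ler_wpM2l C0 (hM M (leqnn M))) _.
  by rewrite mulrA ler_pdivrMr// mulrC ler_wpM2l ?(ltW e3)// lerDl.
have := schur_boundedD (schur_boundedD k1 k2) k3.
rewrite [X in schur_bounded _ _ X](_ : _ = e); last by field.
rewrite [X in schur_bounded _ X](_ : _ = (fun z => limit_kernel k z - k' z))//.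
by apply/funext => z; ring.
Qed.

End limit.
End good_kernels.

(** * Frequency cutoffs *)

Section affine_derivative.
Context {R : realType} {V : normedModType R}.
Implicit Types (v p : V) (f : V -> R).

(** Along the line through [p] in direction [v], the map [g \o f] is [g] composed
    with an affine function of one variable. *)
Lemma is_derive_affine_comp f (g : R -> R) (g' c : R) v p :
  (forall h : R, f (h *: v + p) = h * c + f p) -> is_derive (f p) 1 g g' ->
  is_derive p v (g \o f) (c * g').
Proof.
move=> fh dg; pose G (h : R) := g (h * c + f p).
have dG : is_derive (0 : R) 1 G (c * g').
  have di : is_derive (0 : R) (1 : R) (fun h : R => h * c + f p) c.
    by apply: is_derive_eq; rewrite /GRing.scale/= mulr0 mulr1 add0r addr0.
  have dg0 : is_derive (0 * c + f p) 1 g g' by rewrite mul0r add0r.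
  by rewrite mulrC; exact: (@is_derive1_comp R g (fun h => h * c + f p) 0).
have E : (fun h : R => h^-1 *: ((g \o f) (h *: v + p) - (g \o f) p)) =
    (fun h => h^-1 *: (G (h *: (1 : R) + 0) - G 0)).
  apply/funext => h; rewrite /G /= fh addr0 mul0r add0r.
  by congr (_ *: (g (_ * _ + _) - _)); rewrite /GRing.scale/= mulr1.
by case: dG => d1 d2; split; rewrite /derivable /derive E.
Qed.

Lemma is_derive_affine f (c : R) v p :
  (forall h : R, f (h *: v + p) = h * c + f p) -> is_derive p v f c.
Proof.
move=> fh; rewrite -[c]mulr1; apply: (@is_derive_affine_comp f id) => //.
Qed.

Lemma is_derive_inv f (df : R) v p : f p != 0 -> is_derive p v f df ->
  is_derive p v (fun y => (f y)^-1) (- (f p) ^- 2 * df).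
Proof.
by move=> f0 [d1 <-]; split; [exact: derivableV|rewrite deriveV].
Qed.

Lemma is_derive_mul f g (df dg : R) v p : is_derive p v f df -> is_derive p v g dg ->
  is_derive p v (fun y => f y * g y) (f p * dg + g p * df).
Proof. exact: is_deriveM. Qed.

Lemma is_derive_sub f g (df dg : R) v p : is_derive p v f df -> is_derive p v g dg ->
  is_derive p v (fun y => f y - g y) (df - dg).
Proof. exact: is_deriveB. Qed.

Lemma is_derive_scale f (df c : R) v p : is_derive p v f df ->
  is_derive p v (fun y => c * f y) (c * df).
Proof. exact: is_deriveZ. Qed.

Lemma derive_fun f (g : V -> R) v : (forall p, is_derive p v f (g p)) ->
  (forall p, derivable f p v) /\ 'D_v f = g.
Proof. by move=> d; split=> [p|]; [|apply/funext => p]; have [] := d p. Qed.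

End affine_derivative.

Section cutoff.
Context {R : realType} {n : nat}.
Local Notation E := 'rV[R]_n.
Implicit Types (xi p : E) (M s : R) (k q : nat) (j : 'I_n).
Local Notation jap := (@japanese R n).
Local Notation jet1 k j := (jet k [set @std_basis R n j] jap).

Definition resolvent M xi : R := (M ^+ 2 + dotp xi xi)^-1.

(** A rational cutoff at frequencies of size [M]. Its derivatives are polynomials in
    the coordinates and in the resolvent, from which estimates uniform in [M] follow. *)
Definition cutoff M q xi : R := (M ^+ 2 * resolvent M xi) ^+ q.

Lemma coord_shift j i (h : R) xi :
  (h *: std_basis j + xi) ord0 i = h * (i == j)%:R + xi ord0 i.
Proof. by rewrite !mxE eqxx. Qed.

Lemma jet_coord k j : jet1 k j jap (fun xi => xi ord0 j).
Proof.
have le xi : `|xi ord0 j| <= jap xi.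
  by rewrite (le_trans (normr_coord_le_enorm xi j))// lerDr.
case: k => [|k]; split=> //; try exact: continuous_coord.
move=> v ->; have d xi : is_derive xi (std_basis j) (fun xi : E => xi ord0 j) 1.
  by apply: is_derive_affine => h; rewrite coord_shift eqxx.
have [d1 ->] := derive_fun d; split => //.
apply: jet_cst => p; first exact: japanese_gt0.
by rewrite normr1 divff// gt_eqF// japanese_gt0.
Qed.

Lemma is_derive_dotp j p :
  is_derive p (std_basis j) (fun xi : E => dotp xi xi) (2 * p ord0 j).
Proof.
have E0 : (fun xi : E => dotp xi xi) = \sum_(i < n) (fun xi : E => xi ord0 i ^+ 2).
  apply/funext => xi; rewrite fct_sumE; apply: eq_bigr => i _; by rewrite expr2.
have di i : is_derive p (std_basis j) (fun xi : E => xi ord0 i ^+ 2)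
    (2 * p ord0 i * (i == j)%:R).
  have d1 : is_derive p (std_basis j) (fun xi : E => xi ord0 i) (i == j)%:R.
    by apply: is_derive_affine => h; exact: coord_shift.
  rewrite (_ : 2 * _ * _ = p ord0 i * (i == j)%:R + p ord0 i * (i == j)%:R); last by ring.
  rewrite (_ : (fun xi : E => xi ord0 i ^+ 2) = (fun xi => xi ord0 i * xi ord0 i)) //.
  exact: is_derive_mul.
rewrite E0; apply: is_derive_eq.
rewrite (bigD1 j)//= eqxx mulr1 big1 ?addr0// => i /negbTE ->; by rewrite mulr0.
Qed.

Section resolvent_estimates.
Variable M : R.
Hypothesis M1 : 1 <= M.

Let den_gt0 xi : 0 < M ^+ 2 + dotp xi xi.
Proof. by rewrite ltr_wpDr ?dotp_ge0// exprn_gt0// (lt_le_trans _ M1). Qed.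

Lemma resolvent_gt0 xi : 0 < resolvent M xi.
Proof. by rewrite invr_gt0. Qed.

Lemma resolvent_le xi : resolvent M xi * jap xi ^+ 2 <= 2.
Proof.
rewrite mulrC ler_pdivrMr// /japanese -sqr_enorm.
have := sqr_ge0 (1 - enorm xi).
have : 1 <= M ^+ 2 by rewrite exprn_ege1.
by set e := enorm xi; nra.
Qed.

Lemma resolvent_le_M xi : M ^+ 2 * resolvent M xi <= 1.
Proof. by rewrite ler_pdivrMr// mul1r lerDl dotp_ge0. Qed.

Lemma continuous_resolvent : continuous (resolvent M).
Proof.
have cd : continuous (fun xi : E => M ^+ 2 + dotp xi xi).
  apply: contD; first exact: contC.
  by apply: continuous_sum => i _; apply: contM; exact: continuous_coord.
move=> xi; have nz : M ^+ 2 + dotp xi xi != 0 by rewrite gt_eqF.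
exact: (cvgV nz (cd xi)).
Qed.

Lemma is_derive_resolvent j p : is_derive p (std_basis j) (resolvent M)
  (- 2 * (p ord0 j * resolvent M p) * resolvent M p).
Proof.
have d : is_derive p (std_basis j) (fun xi : E => M ^+ 2 + dotp xi xi) (2 * p ord0 j).
  have d1 := is_derive_dotp j p.
  have : is_derive p (std_basis j) ((fun=> M ^+ 2) + (fun xi : E => dotp xi xi)) (0 + 2 * p ord0 j).
    exact: is_deriveD.
  by rewrite add0r.
have nz : M ^+ 2 + dotp p p != 0 by rewrite gt_eqF.
have := is_derive_inv (f := fun xi => M ^+ 2 + dotp xi xi) nz d; rewrite /resolvent.
rewrite (_ : - _ * (2 * _) = - 2 * (p ord0 j * (M ^+ 2 + dotp p p)^-1) * (M ^+ 2 + dotp p p)^-1) //.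
by rewrite -exprVn; set r := _^-1; ring.
Qed.

End resolvent_estimates.

(** By induction on [k], because the derivative of the resolvent is [- 2 xi_j] times
    its square; the constant does not depend on [M]. *)
Lemma jet_resolvent k : exists2 c, 0 <= c & forall M j, 1 <= M ->
  jet1 k j (fun xi => c * resolvent M xi) (resolvent M).
Proof.
elim: k => [|k [c c0 IH]].
  exists 1 => // M j M1; split=> //; first exact: continuous_resolvent.
  by move=> p; rewrite mul1r ger0_norm// ltW// resolvent_gt0.
pose K := `|-2 : R| * (2 ^+ k * (2 ^+ k * (c * c))).
have K0 : 0 <= K.
  apply: mulr_ge0 => //; apply: mulr_ge0; first exact: exprn_ge0.
  by apply: mulr_ge0; [exact: exprn_ge0|exact: mulr_ge0].
have C0 : 0 <= K * 2 by exact: mulr_ge0.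
exists (1 + K * 2); first exact: addr_ge0.
move=> M j M1; split; first exact: continuous_resolvent.
  move=> p; rewrite ger0_norm ?(ltW (resolvent_gt0 M1 p))//.
  by rewrite ler_peMl ?(ltW (resolvent_gt0 M1 p))// lerDl.
move=> v ->; have d p := is_derive_resolvent M1 j p.
split; first by move=> p; have [] := d p.
rewrite (_ : 'D__ _ = (fun p => (-2) * ((p ord0 j * resolvent M p) * resolvent M p))); last first.
  by apply/funext => p; have [_ ->] := d p; rewrite -mulrA.
have := jetZ (-2) (jetM (jetM (jet_coord k j) (IH M j M1)) (IH M j M1)).
apply: jet_mono => p; first exact: japanese_gt0.
have r0 := resolvent_gt0 M1 p; have j0 := japanese_gt0 p; have := resolvent_le M1 p.
rewrite ler_pdivlMr//; set r := resolvent M p; set l := jap p => rl.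
rewrite (_ : _ * _ * l = K * ((r * l ^+ 2) * r)); last by rewrite /K; ring.
apply: (@le_trans _ _ (K * (2 * r))); first by apply: ler_wpM2l => //; rewrite ler_pM2r.
by rewrite [K * _]mulrA ler_pM2r// lerDr.
Qed.

(** The function [1 - M ^ 2 * resolvent M xi] is the quotient of [enorm xi ^ 2] by
    [M ^ 2 + enorm xi ^ 2]: it is at most [1] and at most [(enorm xi / M) ^ 2], hence at
    most any power in between. A small exponent [s] yields a rate of convergence as [M]
    grows, for a loss of [s] orders. *)
Lemma jet_one_sub_resolvent k s : 0 <= s <= 2 -> exists2 c, 0 <= c & forall M j, 1 <= M ->
  jet1 k j (fun xi => c * (jap xi / M) `^ s) (fun xi => 1 - M ^+ 2 * resolvent M xi).
Proof.
move=> /andP[s0 s2].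
have key M xi : 1 <= M -> (jap xi) ^+ 2 * (M ^+ 2 * resolvent M xi * resolvent M xi) <= 4 * (jap xi / M) `^ s /\
    1 - M ^+ 2 * resolvent M xi <= (jap xi / M) `^ s.
  move=> M1; have M0 : 0 < M by rewrite (lt_le_trans _ M1).
  have r0 := resolvent_gt0 M1 xi; have j0 := japanese_gt0 xi; have rl := resolvent_le M1 xi.
  have rM := resolvent_le_M M1 xi.
  have t0 : 0 < jap xi / M by rewrite divr_gt0.
  have [t1|t1] := lerP 1 (jap xi / M).
    have : 1 <= (jap xi / M) `^ s by rewrite -[leLHS](powRr0 (jap xi / M)) ler_powR.
    have a0 : 0 <= M ^+ 2 * resolvent M xi.
      by apply: mulr_ge0; rewrite ?exprn_ge0 ?(ltW M0) ?(ltW r0).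
    have b0 : 0 <= resolvent M xi * jap xi ^+ 2.
      by apply: mulr_ge0; rewrite ?exprn_ge0 ?(ltW j0) ?(ltW r0).
    move: rl rM a0 b0 => + + + + p1; set p := _ `^ s in p1 *.
    rewrite [_ ^+ 2 * (_ * _)](_ : _ = (M ^+ 2 * resolvent M xi) * (resolvent M xi * jap xi ^+ 2)); last by ring.
    by set a := _ * resolvent _ _; set b := resolvent _ _ * _ => *; split; nra.
  have tt : (jap xi / M) ^+ 2 <= (jap xi / M) `^ s.
    by rewrite -powR_mulrn ?(ltW t0)// ger_powR// t0 ltW.
  have e1 : jap xi ^+ 2 = M ^+ 2 * (jap xi / M) ^+ 2.
    by rewrite expr_div_n mulrCA mulfV ?mulr1// sqrf_eq0 gt_eqF.
  have t2 : 0 <= (jap xi / M) ^+ 2 by rewrite sqr_ge0.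
  have M2r0 : 0 <= M ^+ 2 * resolvent M xi by apply: mulr_ge0; rewrite ?exprn_ge0 ?(ltW M0) ?(ltW r0).
  split.
    rewrite e1 [leLHS](_ : _ = (M ^+ 2 * resolvent M xi) ^+ 2 * (jap xi / M) ^+ 2); last by ring.
    have : (M ^+ 2 * resolvent M xi) ^+ 2 <= 1 by rewrite expr_le1.
    by move: tt t2; set a := _ ^+ 2; set b := _ `^ _; set e := (_ * _) ^+ 2; nra.
  apply: le_trans tt; rewrite -[1](@mulfV _ (M ^+ 2 + dotp xi xi)); last first.
    by rewrite gt_eqF// -invr_gt0.
  rewrite -/(resolvent M xi) -mulrBl addrAC subrr add0r -sqr_enorm.
  apply: (@le_trans _ _ (jap xi ^+ 2 * resolvent M xi)).
    by rewrite ler_pM2r// ler_sqr ?nnegrE ?(ltW j0) ?enorm_ge0// lerDr.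
  by rewrite e1; move: M2r0 rM t2; set r := resolvent _ _; set t := (_ / _) ^+ 2; nra.
have pos M xi : 1 <= M -> 0 <= 1 - M ^+ 2 * resolvent M xi.
  by move=> M1; rewrite subr_ge0 resolvent_le_M.
have cont M : 1 <= M -> continuous (fun xi => 1 - M ^+ 2 * resolvent M xi).
  move=> M1; apply: contD; first exact: contC.
  by apply: contN; apply: contM; [exact: contC|exact: continuous_resolvent].
case: k => [|k].
  exists 1 => // M j M1; split => //; first exact: cont.
  by move=> p; rewrite ger0_norm ?pos// mul1r; have [] := key M p M1.
have [c c0 jc] := jet_resolvent k.
pose C := 2 * (2 ^+ k * (2 ^+ k * (c * c))) * 4.
have C0 : 0 <= C by do 5?[apply: mulr_ge0 => //].
exists (1 + C); first by rewrite addr_ge0.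
move=> M j M1; have M0 : 0 < M by rewrite (lt_le_trans _ M1).
split; first exact: cont.
  move=> p; rewrite ger0_norm ?pos//; have [_ le] := key M p M1.
  by apply: le_trans le _; rewrite ler_peMl ?powR_ge0// lerDl.
move=> v ->.
have d p : is_derive p (std_basis j) (fun xi => 1 - M ^+ 2 * resolvent M xi)
   ((2 * M ^+ 2) * ((p ord0 j * resolvent M p) * resolvent M p)).
  have := is_derive_sub (is_derive_cst (1 : R) p (std_basis j))
    (is_derive_scale (M ^+ 2) (is_derive_resolvent M1 j p)).
  by rewrite [0 - _](_ : _ = (2 * M ^+ 2) * ((p ord0 j * resolvent M p) * resolvent M p)) //; ring.
split; first by move=> p; have [] := d p.
rewrite (_ : 'D__ _ = (fun p => (2 * M ^+ 2) * ((p ord0 j * resolvent M p) * resolvent M p))); last first.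
  by apply/funext => p; have [_ ->] := d p.
have := jetZ (2 * M ^+ 2) (jetM (jetM (jet_coord k j) (jc M j M1)) (jc M j M1)).
apply: jet_mono => p; first exact: japanese_gt0.
have j0 := japanese_gt0 p; have [le _] := key M p M1.
rewrite ler_pdivlMr// ger0_norm; last by rewrite mulr_ge0// exprn_ge0// ltW.
set r := resolvent M p in le *; set l := jap p in j0 le *; set t := _ `^ s in le *.
have t0 : 0 <= t by exact: powR_ge0.
rewrite [leLHS](_ : _ = (2 * (2 ^+ k * (2 ^+ k * (c * c)))) * (l ^+ 2 * (M ^+ 2 * r * r))); last by ring.
apply: (@le_trans _ _ ((2 * (2 ^+ k * (2 ^+ k * (c * c)))) * (4 * t))).
  by apply: ler_wpM2l => //; do 4?[apply: mulr_ge0 => //]; rewrite exprn_ge0.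
by rewrite [_ * (4 * t)]mulrA -/C ler_wpM2r// lerDr.
Qed.

Lemma jet_cutoff k q : exists2 c, 0 <= c & forall M j, 1 <= M ->
  jet1 k j (fun xi => c * (M ^+ 2 * resolvent M xi) ^+ q) (cutoff M q).
Proof.
have [c c0 jc] := jet_resolvent k.
exists ((2 ^+ k * c) ^+ q); first by rewrite exprn_ge0// mulr_ge0// exprn_ge0.
move=> M j M1; have := jetX q (fun p => japanese_gt0 p) (jetZ (M ^+ 2) (jc M j M1)).
apply: jet_mono => p; first exact: japanese_gt0.
rewrite ger0_norm ?sqr_ge0// -!exprMn [X in X ^+ q <= _](_ : _ = 2 ^+ k * c * (M ^+ 2 * resolvent M p)) //.
by ring.
Qed.

(** Telescoping: [1 - r ^ (q + 1) = (1 - r) + r (1 - r ^ q)]. *)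
Lemma jet_one_sub_cutoff k q s : 0 <= s <= 2 -> exists2 c, 0 <= c & forall M j, 1 <= M ->
  jet1 k j (fun xi => c * (jap xi / M) `^ s) (fun xi => 1 - cutoff M q xi).
Proof.
move=> s2; have [c1 c10 j1] := jet_one_sub_resolvent k s2.
elim: q => [|q [c c0 IH]].
  exists 0 => // M j M1; rewrite (_ : (fun _ => 1 - _) = (fun=> 0)); last first.
    by apply/funext => xi; rewrite /cutoff expr0 subrr.
  apply: jet_cst => p; first exact: japanese_gt0.
  by rewrite normr0 mul0r.
have [cu cu0 ju] := jet_cutoff k 1.
exists (c1 + 2 ^+ k * (cu * c)).
  by rewrite addr_ge0// mulr_ge0 ?exprn_ge0// mulr_ge0.
move=> M j M1.
rewrite (_ : (fun xi => 1 - cutoff M q.+1 xi) = (fun xi => (1 - M ^+ 2 * resolvent M xi) + cutoff M 1 xi * (1 - cutoff M q xi))); last first.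
  apply/funext => xi; rewrite /cutoff exprS expr1; ring.
have := jetD (j1 M j M1) (jetM (ju M j M1) (IH M j M1)).
apply: jet_mono => p; first exact: japanese_gt0.
rewrite [leRHS]mulrDl lerD2l -[leRHS]mulrA ler_wpM2l ?exprn_ge0// expr1 -[leLHS]mulrA -[leRHS]mulrA ler_wpM2l//.
have : 0 <= c * (jap p / M) `^ s by rewrite mulr_ge0// powR_ge0.
have := resolvent_le_M M1 p; set r := _ * resolvent _ _; set t := c * _; nra.
Qed.

Lemma cutoff_ge0 M q xi : 1 <= M -> 0 <= cutoff M q xi.
Proof.
by move=> M1; rewrite exprn_ge0// mulr_ge0 ?sqr_ge0// ltW// resolvent_gt0.
Qed.

Lemma cutoff_le1 M q xi : 1 <= M -> cutoff M q xi <= 1.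
Proof.
move=> M1; rewrite exprn_ile1 ?resolvent_le_M//.
by rewrite mulr_ge0 ?sqr_ge0// ltW// resolvent_gt0.
Qed.

Lemma continuous_cutoff M q : 1 <= M -> continuous (cutoff M q).
Proof.
move=> M1.
apply: (@cont_comp _ _ _ (fun t : R => t ^+ q) (fun xi => M ^+ 2 * resolvent M xi)).
  by apply: contM; [exact: contC|exact: continuous_resolvent].
exact: exprn_continuous.
Qed.

(** Beyond the scale [M] the cutoff decays as fast as prescribed. *)
Lemma cutoff_decay M q xi : 1 <= M ->
  (M ^+ 2 * resolvent M xi) ^+ q <= (2 * M ^+ 2) ^+ q * jap xi `^ (- (2 * q)%:R).
Proof.
move=> M1; have j0 := japanese_gt0 xi; have r0 := resolvent_gt0 M1 xi.
rewrite powRN powR_mulrn ?(ltW j0)// exprM -exprVn -exprMn lerXn2r ?nnegrE//.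
- by rewrite mulr_ge0 ?sqr_ge0// ltW.
- by apply: mulr_ge0; rewrite ?invr_ge0 ?sqr_ge0// mulr_ge0// sqr_ge0.
rewrite ler_pdivlMr ?exprn_gt0// -mulrA [leRHS]mulrC.
apply: ler_wpM2l; first exact: sqr_ge0.
exact: resolvent_le.
Qed.

End cutoff.

(** * Iterated derivatives of smooth functions *)

Section mixed_derivatives.
Context {R : realType} {V : normedModType R}.
Implicit Types (u v p : V) (f : V -> R).

Lemma diff_opC u v f p : diff_op u (diff_op v f) p = diff_op v (diff_op u f) p.
Proof. rewrite /diff_op -!addrA [u + v]addrC; ring. Qed.

(** The second difference in the directions [h u] and [h v] is [h ^ 2] times a
    mixed derivative at an intermediate point. *)
Lemma second_difference u v f p (h : R) : 0 < h ->
  (forall q, derivable f q u) -> (forall q, derivable ('D_u f) q v) ->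
  exists c c', [/\ 0 <= c <= h, 0 <= c' <= h &
    diff_op (h *: u) (diff_op (h *: v) f) p = h ^+ 2 * 'D_v ('D_u f) (p + c *: u + c' *: v)].
Proof.
move=> h0 du duv; have [d1 e1] := derive_diff_op (h *: v) du.
have [c ch E1] := diff_op_mvt p h0 d1.
have [c' ch' E2] := diff_op_mvt (p + c *: u) h0 duv.
exists c, c'; split=> //; rewrite E1.
have /= -> := congr1 (@^~ (p + c *: u)) e1.
by rewrite E2 mulrA.
Qed.

Lemma near_point u v p (A : V -> R) (e : R) : continuous A -> 0 < e ->
  exists2 h, 0 < h & forall h' c c', h' <= h -> 0 <= c <= h' -> 0 <= c' <= h' ->
    `|A p - A (p + c *: u + c' *: v)| < e.
Proof.
move=> cA e0; have : \forall q \near p, `|A p - A q| < e.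
  by have /cvgrPdist_lt := cA p; exact.
move=> /nbhs_ballP[r /= r0 hr].
pose K := `|u| + `|v| + 1; have K0 : 0 < K by rewrite ltr_wpDl// addr_ge0.
exists (r / (2 * K)); first by rewrite divr_gt0// mulr_gt0.
move=> h' c c' h'r /andP[c0 ch] /andP[c0' ch']; apply: hr.
rewrite -ball_normE /ball_/= -addrA opprD addrA subrr sub0r normrN.
apply: le_lt_trans (ler_normD _ _) _; rewrite !normrZ (ger0_norm c0) (ger0_norm c0').
have h'0 : 0 <= h' by exact: le_trans ch.
apply: (@le_lt_trans _ _ (h' * `|u| + h' * `|v|)); first by rewrite lerD// ler_wpM2r.
rewrite -mulrDr; apply: (@le_lt_trans _ _ (r / (2 * K) * K)).
  apply: (@le_trans _ _ (h' * K)); first by rewrite ler_wpM2l// lerDl.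
  by rewrite ler_wpM2r// ltW.
rewrite invfM mulrA -mulrA mulVf ?gt_eqF// mulr1; lra.
Qed.

(** Schwarz's theorem: both mixed derivatives are limits of the same second
    difference quotients. *)
Lemma derive_mixedC u v f : (forall q, derivable f q u) -> (forall q, derivable f q v) ->
  (forall q, derivable ('D_u f) q v) -> (forall q, derivable ('D_v f) q u) ->
  continuous ('D_v ('D_u f)) -> continuous ('D_u ('D_v f)) ->
  'D_v ('D_u f) = 'D_u ('D_v f).
Proof.
move=> du dv duv dvu cA cB; apply/funext => p; apply/eqP; rewrite -subr_eq0 -normr_le0.
apply/ler_addgt0Pr => e e0; rewrite add0r.
have e2 : 0 < e / 2 by rewrite divr_gt0.
have [h1 h10 H1] := near_point u v p cA e2.
have [h2 h20 H2] := near_point v u p cB e2.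
pose h := Num.min h1 h2; have h0 : 0 < h by rewrite lt_min h10.
have [c [c' [ch ch' E1]]] := second_difference p h0 du duv.
have [k [k' [kh kh' E2]]] := second_difference p h0 dv dvu.
rewrite diff_opC E2 in E1.
have hn0 : h ^+ 2 != 0 by apply: expf_neq0; rewrite gt_eqF.
have E := mulfI hn0 E1.
have hh1 : h <= h1 by rewrite ge_min lexx.
have hh2 : h <= h2 by rewrite ge_min lexx orbT.
have := H1 _ _ _ hh1 ch ch'; have := H2 _ _ _ hh2 kh kh'; rewrite E.
move: ('D_v _ p) ('D_u _ p) ('D_v _ _) => a b x b1 a1.
rewrite (_ : a - b = (a - x) - (b - x)); last by ring.
apply: le_trans (ler_normB _ _) _; rewrite [leRHS](splitr e).
by apply: lerD; apply/ltW.
Qed.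

End mixed_derivatives.

Section smooth_functions.
Context {R : realType} {V : normedModType R}.
Implicit Types (u v p : V) (f : V -> R[i]) (s : seq V).

Lemma normr_Re_le (z : R[i]) : `|complex.Re z| <= Normc.normc z.
Proof. by case: z => x y /=; rewrite -sqrtr_sqr ler_wsqrtr// lerDl sqr_ge0. Qed.

Lemma normr_Im_le (z : R[i]) : `|complex.Im z| <= Normc.normc z.
Proof. by case: z => x y /=; rewrite -sqrtr_sqr ler_wsqrtr// lerDr sqr_ge0. Qed.

Lemma smooth_word f s : smooth f -> smooth (foldr cderive f s).
Proof. by move=> sf t; rewrite -foldr_cat; exact: sf. Qed.

Lemma cderiveC u v f : smooth f -> cderive u (cderive v f) = cderive v (cderive u f).
Proof.
move=> sf; have [_ _ d0] := sf [::]; have [_ _ du] := sf [:: u]; have [_ _ dv] := sf [:: v].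
have [cr1 ci1 _] := sf [:: u; v]; have [cr2 ci2 _] := sf [:: v; u].
have Er : 'D_u ('D_v (@complex.Re R \o f)) = 'D_v ('D_u (@complex.Re R \o f)).
  exact: (derive_mixedC (fun q => (d0 v q).1) (fun q => (d0 u q).1)
    (fun q => (dv u q).1) (fun q => (du v q).1) cr1 cr2).
have Ei : 'D_u ('D_v (@complex.Im R \o f)) = 'D_v ('D_u (@complex.Im R \o f)).
  exact: (derive_mixedC (fun q => (d0 v q).2) (fun q => (d0 u q).2)
    (fun q => (dv u q).2) (fun q => (du v q).2) ci1 ci2).
transitivity (fun p => Complex ('D_u ('D_v (@complex.Re R \o f)) p) ('D_u ('D_v (@complex.Im R \o f)) p)).
  by [].
exact: (f_equal2 (fun A B => fun p => Complex (A p) (B p)) Er Ei).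
Qed.

Lemma cderive_word u s f : smooth f ->
  cderive u (foldr cderive f s) = foldr cderive (cderive u f) s.
Proof.
move=> sf; elim: s => //= v s IH.
by rewrite -IH; exact: cderiveC (smooth_word s sf).
Qed.

Lemma word_perm n (e : 'I_n -> V) f (s t : seq 'I_n) : smooth f -> perm_eq s t ->
  foldr cderive f (map e s) = foldr cderive f (map e t).
Proof.
move=> sf st; pose F (s : seq 'I_n) := foldr cderive f (map e s).
suff H : forall s1 s2 s3 : seq 'I_n, F (s1 ++ s2 ++ s3) = F (s2 ++ s1 ++ s3) by exact: (catCA_perm_subst H st).
rewrite /F.
move=> s1 s2 s3; rewrite !map_cat !foldr_cat.
have := smooth_word (map e s3) sf; move: (foldr _ f _) => g sg.
elim: s1 => //= i s1 IH; rewrite IH.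
exact: cderive_word (smooth_word (map e s1) sg).
Qed.

(** By Schwarz's theorem only the number of occurrences of each direction matters:
    estimates in terms of multi-indices are estimates for words, which suit inductions
    on the number of derivatives. *)
Lemma mderive_word n (e : 'I_n -> V) f (s : seq 'I_n) : smooth f ->
  foldr cderive f (map e s) = mderive e (fun i => count_mem i s) f.
Proof.
move=> sf; rewrite /mderive.
have -> : foldr (fun i => iter (count_mem i s) (cderive (e i))) f (enum 'I_n) =
    foldr cderive f (map e (flatten [seq nseq (count_mem i s) i | i <- enum 'I_n])).
  elim: (enum 'I_n) => //= i r ->; rewrite map_cat foldr_cat map_nseq.
  by elim: (count_mem i s) => //= l ->.
apply: word_perm => //; rewrite perm_sym; apply/allP => i _ /=.
rewrite count_flatten -map_comp sumnE big_map big_enum/= (bigD1 i)//= big1 ?addn0.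
  by rewrite count_nseq/= eqxx mul1n.
by move=> j ji; rewrite count_nseq/= (negbTE ji) mul0n.
Qed.

Lemma mlength_count n (s : seq 'I_n) : mlength (fun i => count_mem i s) = size s.
Proof.
rewrite /mlength; elim: s => [|j s IH] /=; first by rewrite big1.
by rewrite big_split/= IH (bigD1 j)//= eqxx big1// => i ij; rewrite eq_sym (negbTE ij).
Qed.

Lemma mderive0 n (e : 'I_n -> V) f : mderive e (fun=> 0%N) f = f.
Proof. by rewrite /mderive; elim: (enum 'I_n). Qed.

Lemma mlength0 n : @mlength n (fun=> 0%N) = 0%N.
Proof. by rewrite /mlength big1. Qed.

(** By induction on [k], splitting off the last direction of a word, which is the
    first to be differentiated. *)
Lemma smooth_jet k n (e : 'I_n -> V) (lam w : V -> R) f : smooth f ->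
  (forall p, 0 < lam p) ->
  (forall s : seq 'I_n, (size s <= k)%N -> forall p,
     Normc.normc (foldr cderive f (map e s) p) <= w p / lam p ^+ size s) ->
  jet k (range e) lam w (@complex.Re R \o f) /\ jet k (range e) lam w (@complex.Im R \o f).
Proof.
move=> sf lam0; elim: k f sf w => [|k IH] f sf w fw.
  have [cr ci _] := sf [::]; split; split => // p.
    by have := fw [::] isT p; rewrite /= divr1; apply: le_trans; exact: normr_Re_le.
  by have := fw [::] isT p; rewrite /= divr1; apply: le_trans; exact: normr_Im_le.
have [cr ci df] := sf [::].
have step i : jet k (range e) lam (fun p => w p / lam p) ('D_(e i) (@complex.Re R \o f)) /\
    jet k (range e) lam (fun p => w p / lam p) ('D_(e i) (@complex.Im R \o f)).
  apply: (IH (cderive (e i) f)); first exact: (smooth_word [:: e i] sf).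
  move=> s sk p; have := fw (rcons s i); rewrite size_rcons => /(_ sk p).
  by rewrite map_rcons foldr_rcons exprS invfM mulrA.
split; split => //.
- move=> p; have := fw [::] isT p; rewrite /= divr1; apply: le_trans; exact: normr_Re_le.
- move=> v [i _ <-]; have [j1 _] := step i.
  by split; [move=> p; have [] := df (e i) p|exact: j1].
- move=> p; have := fw [::] isT p; rewrite /= divr1; apply: le_trans; exact: normr_Im_le.
- move=> v [i _ <-]; have [_ j1] := step i.
  by split; [move=> p; have [] := df (e i) p|exact: j1].
Qed.

End smooth_functions.

(** There are finitely many words of each length. *)
Lemma uniform_word_bound (R : realType) n k (P : seq 'I_n -> R -> Prop) :
  (forall s C C', C <= C' -> P s C -> P s C') ->
  (forall s, (size s <= k)%N -> exists C, P s C) ->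
  exists2 C, 0 <= C & forall s, (size s <= k)%N -> P s C.
Proof.
move=> Pm Ps.
have /choice[C hC] : forall s, exists C, (size s <= k)%N -> P s C.
  move=> s; have [sk|] := boolP (size s <= k)%N; last by exists 0.
  by have [C ?] := Ps s sk; exists C.
exists (\big[Num.max/0]_(l < k.+1) \big[Num.max/0]_(t : l.-tuple 'I_n) C t).
  exact: bigmax_ge_id.
move=> s sk; apply: Pm (hC s sk).
rewrite -ltnS in sk; apply: le_trans (le_bigmax _ _ (Ordinal sk)).
exact: (le_bigmax _ (fun t : (size s).-tuple 'I_n => C t) (in_tuple s)).
Qed.

Lemma ereal_sup_ltyP (R : realType) (T : Type) (A : set T) (f : T -> R) :
  (ereal_sup [set (f x)%:E | x in A] < +oo)%E -> exists C, forall x, A x -> f x <= C.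
Proof.
move=> supy; have [|] := pselect (exists x, A x); last first.
  by move=> A0; exists 0 => x Ax; exfalso; apply: A0; exists x.
move=> [x0 Ax0]; have ub x : A x -> ((f x)%:E <= ereal_sup [set (f x)%:E | x in A])%E.
  by move=> Ax; apply: ereal_sup_ubound; exists x.
move: supy ub; case: (ereal_sup _) => [r| |]// _ ub; last by have := ub _ Ax0.
by exists r => x /ub; rewrite lee_fin.
Qed.

(** * Integrals of decaying symbols, Lipschitz estimates and trigonometric factors *)

Section japanese_integrals.
Context {R : realType} (d : nat) {n : nat}.
Local Notation E := 'rV[R]_n.
Local Notation dual := (@dual_measure R d n).
Local Notation jap := (@japanese R n).

Definition japanese_const (be : R) : R := 3 ^+ n * two_scale_const (n%:R / 2) be n.

Lemma japanese_const_ge0 be : (0 < n)%N -> n%:R < be -> 0 <= japanese_const be.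
Proof.
move=> n0 nbe; apply: mulr_ge0; first exact: exprn_ge0.
have n0' : 0 < n%:R :> R by rewrite ltr0n.
by apply/ltW/two_scale_const_gt0; [rewrite divr_gt0|lra|].
Qed.

(** The exponent [n / 2] in [japanese_const] is an arbitrary one below [n]: the
    singularity at [0] of the two-scale profile is not reached, since [japanese] is at
    least [1]. *)
Lemma integrable_decay (be C : R) (b : E -> R) : (0 < n)%N -> n%:R < be -> 0 <= C ->
  measurable_fun setT b -> (forall xi, `|b xi| <= C * jap xi `^ (- be)) ->
  dual.-integrable setT (EFin \o b) /\
  (\int[dual]_xi `|b xi|%:E <= (C * japanese_const be)%:E)%E.
Proof.
move=> n0 nbe C0 mb bC; have n0' : 0 < n%:R :> R by rewrite ltr0n.
have le : (\int[dual]_xi `|b xi|%:E <= (C * japanese_const be)%:E)%E.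
  have m1 : measurable_fun setT (fun xi => two_scale (n%:R / 2) be (jap xi / 1)).
    apply: (measurableT_comp (measurable_two_scale _ _)).
    by apply: measurable_funM => //; apply: continuous_measurable1; exact: continuous_japanese.
  apply: (@le_trans _ _ (\int[dual]_xi (C%:E * (two_scale (n%:R / 2) be (jap xi / 1))%:E))%E).
    apply: ge0_le_integral => //.
    - by apply/measurable_EFinP; exact: measurableT_comp.
    - by apply: measurable_funeM; apply/measurable_EFinP.
    move=> xi _; rewrite -EFinM lee_fin divr1; apply: le_trans (bC xi) _.
    rewrite ler_wpM2l// /two_scale le_min lexx andbT ler_powR ?japanese_ge1//.
    by rewrite lerN2; lra.
  rewrite ge0_integralZl_EFin//; last 2 first.
  - by move=> xi _; rewrite lee_fin two_scale_ge0.
  - by apply/measurable_EFinP.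
  rewrite EFinM; apply: lee_wpmul2l; first by rewrite lee_fin.
  have al0 : 0 < n%:R / 2 :> R by rewrite divr_gt0.
  have aln : n%:R / 2 < n%:R :> R by lra.
  have := integral_japanese_two_scale d al0 aln nbe (ltr01 : 0 < 1 :> R).
  by rewrite expr1n mulr1.
split => //; apply/integrableP; split; first by apply/measurable_EFinP.
by apply: le_lt_trans le _; rewrite ltry.
Qed.

End japanese_integrals.

Section coordinatewise.
Context {R : realType} {n : nat}.
Local Notation E := 'rV[R]_n.

Lemma jet_diff_le (V : normedModType R) (D : set V) (g : V -> R) (L : R) v p (t : R) :
  D v -> jet 1 D (fun=> 1) (fun=> L) g -> `|g (p + t *: v) - g p| <= `|t| * L.
Proof.
move=> Dv [cg gw /(_ v Dv)[dg [_ dL _]]].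
have pos q h : 0 < h -> `|g (q + h *: v) - g q| <= h * L.
  move=> h0; have [c _ E] := diff_op_mvt q h0 dg.
  rewrite -/(diff_op (h *: v) g q) E normrM (gtr0_norm h0) ler_pM2l//.
  by have := dL (q + c *: v); rewrite divr1.
have [t0|t0|->] := ltrgt0P t; first by apply: pos.
  have := pos (p + t *: v) (- t); rewrite oppr_gt0 => /(_ t0).
  by rewrite scaleNr addrK distrC.
by rewrite scale0r addr0 subrr normr0 mul0r.
Qed.

(** Change one coordinate at a time. *)
Lemma jet_lipschitz (g : E -> R) (L : R) (x x' : E) : 0 <= L ->
  jet 1 (range std_basis) (fun=> 1) (fun=> L) g -> `|g x - g x'| <= n%:R * L * `|x - x'|.
Proof.
move=> L0 jg; pose z (k : nat) : E := \row_i (if (i < k)%N then x ord0 i else x' ord0 i).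
have zn : z n = x by apply/rowP => i; rewrite !mxE ltn_ord.
have z0 : z 0%N = x' by apply/rowP => i; rewrite !mxE.
have zS (k : 'I_n) : z k.+1 = z k + (x - x') ord0 k *: std_basis k.
  apply/rowP => i; rewrite !mxE eqxx ltnS /= eq_sym.
  case: (ltngtP i k) => [ik|ik|/val_inj ->]; rewrite ?eqxx.
  - by rewrite -val_eqE/= gtn_eqF// mulr0 addr0.
  - by rewrite -val_eqE/= ltn_eqF// mulr0 addr0.
  - by rewrite mulr1 addrC subrK.
rewrite -{1}zn -{1}z0 -(telescope_sumr (fun k => g (z k)) (leq0n n)) big_mkord.
apply: le_trans (ler_norm_sum _ _ _) _.
apply: (@le_trans _ _ (\sum_(k < n) `|x - x'| * L)).
  apply: ler_sum => k _; rewrite zS.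
  apply: le_trans (jet_diff_le _ _ _ jg) _; first by exists k.
  rewrite ler_wpM2r// [leRHS]mx_normrE.
  exact: (le_bigmax _ (fun ij => `|(x - x') ij.1 ij.2|) (ord0, k)).
rewrite sumr_const card_ord -[leLHS]mulr_natl.
by rewrite [leRHS](_ : _ = n%:R * (`|x - x'| * L)) //; ring.
Qed.

Lemma enorm_le (x : E) (r : R) : 0 <= r -> (forall i, `|x ord0 i| <= r) -> enorm x <= n%:R * r.
Proof.
move=> r0 xr; rewrite -[leRHS]ger0_norm ?mulr_ge0// -sqrtr_sqr ler_wsqrtr//.
apply: (@le_trans _ _ (\sum_(i < n) r ^+ 2)).
  apply: ler_sum => i _; rewrite -expr2 -[x _ _ ^+ 2]real_normK ?num_real//.
  by rewrite lerXn2r ?nnegrE.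
rewrite sumr_const card_ord -[leLHS]mulr_natl exprMn.
apply: ler_wpM2r; first exact: sqr_ge0.
by rewrite -natrX ler_nat; case: (n) => // k; rewrite expnS expn1 leq_pmulr.
Qed.

(** In each coordinate of the torus one of the periods [0], [2 pi] and [- 2 pi]
    realizes the minimum in [coord_dist]; the factor [n] compares the Euclidean norm
    with the maximum norm. *)
Lemma Omega_dist_le d (x y : E) : Omega_dist d x y <= n%:R * Omega_delta d (x - y).
Proof.
have /choice[k hk] : forall i : 'I_n, exists k : int,
    `|(x - y) ord0 i + (if (i < d)%N then k%:~R * (2 * pi) else 0)| <= Omega_delta d (x - y).
  move=> i; have := coord_dist_le_Omega_delta d (x - y) i.
  rewrite /coord_dist; case: ifP => [_|_ h]; last by exists 0; rewrite addr0.
  rewrite /circ_dist !ge_min => /or3P[h|h|h].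
  - by exists 0; rewrite mul0r addr0.
  - by exists (-1); rewrite mulrN1z mulN1r.
  - by exists 1; rewrite mul1r.
apply: (@le_trans _ _ (enorm (x - y + period d k))).
  apply: ge_inf; last by exists k.
  by exists 0 => _ [k' _ <-]; exact: enorm_ge0.
apply: enorm_le; first exact: Omega_delta_ge0.
by move=> i; have := hk i; rewrite !mxE.
Qed.

End coordinatewise.

Section trigonometric.
Context {R : realType} (d : nat) {n : nat}.
Local Notation E := 'rV[R]_n.
Local Notation dual := (@dual_measure R d n).

(** Cosine and sine, the real and imaginary parts of the oscillating factor, treated
    at the same time. *)
Definition trig (c : bool) : R -> R := if c then sin else cos.
Definition trig' (c : bool) : R -> R := if c then cos else fun t => - sin t.

Lemma continuous_trig c : continuous (trig c).
Proof. by case: c; [exact: continuous_sin|exact: continuous_cos]. Qed.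

Lemma continuous_trig' c : continuous (trig' c).
Proof. by case: c; [exact: continuous_cos|apply: contN; exact: continuous_sin]. Qed.

Lemma trig_max c t : `|trig c t| <= 1.
Proof. by case: c; [exact: sin_max|exact: cos_max]. Qed.

Lemma trig'_max c t : `|trig' c t| <= 1.
Proof. by case: c; rewrite /trig' ?normrN; [exact: cos_max|exact: sin_max]. Qed.

Lemma is_derive_trig c (t : R) : is_derive t 1 (trig c) (trig' c t).
Proof. by case: c; [exact: is_derive_sin|exact: is_derive_cos]. Qed.

Lemma is_derive_trig' c (t : R) : is_derive t 1 (trig' c) (- trig c t).
Proof.
case: c; first exact: is_derive_cos.
exact: (is_deriveN (is_derive_sin t)).
Qed.

Definition osc_int c (b : E -> R) (th : E) : R := \int[dual]_xi (b xi * trig c (dotp th xi)).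

Lemma osc_intE c b th : osc_int c b th = if c then sin_int d b th else cos_int d b th.
Proof. by case: c. Qed.

Lemma integrable_trig c b th : dual.-integrable setT (EFin \o b) ->
  dual.-integrable setT (EFin \o (fun xi => b xi * trig c (dotp th xi))).
Proof. by case: c; [exact: integrable_sin0|exact: integrable_cos0]. Qed.

Lemma normr_osc_int_le c b th (I : R) : dual.-integrable setT (EFin \o b) ->
  (\int[dual]_xi `|b xi|%:E <= I%:E)%E -> `|osc_int c b th| <= I.
Proof. by move=> ib bI; have [] := normr_cos_int_le th ib bI; rewrite osc_intE; case: c. Qed.

Lemma osc_intB c b b' th : dual.-integrable setT (EFin \o b) ->
  dual.-integrable setT (EFin \o b') ->
  osc_int c b th - osc_int c b' th = osc_int c (fun xi => b xi - b' xi) th.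
Proof.
move=> ib ib'; rewrite /osc_int -RintegralB//; last 2 first.
- exact: integrable_trig.
- exact: integrable_trig.
by apply: eq_Rintegral => xi _; rewrite mulrBl.
Qed.

Lemma dotp_shiftl (th xi : E) j (h : R) :
  dotp (h *: std_basis j + th) xi = h * xi ord0 j + dotp th xi.
Proof.
rewrite /dotp; under eq_bigr do rewrite mxE mulrDl; rewrite big_split/=; congr (_ + _).
rewrite (bigD1 j)//= big1 ?addr0; last first.
  by move=> i ij; rewrite !mxE (negbTE ij) andbF mulr0 mul0r.
by rewrite !mxE !eqxx mulr1.
Qed.

Lemma jet_trig c (y xi : E) :
  jet 1 (range std_basis) (fun=> 1) (fun=> japanese xi) (fun x : E => trig c (dotp (x - y) xi)).
Proof.
have cd : continuous (fun x : E => dotp (x - y) xi).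
  apply: continuous_sum => i _; apply: contM; last exact: contC.
  rewrite (_ : (fun _ => _) = (fun x : E => x ord0 i - y ord0 i)); last first.
    by apply/funext => x; rewrite !mxE.
  by apply: contD; [exact: continuous_coord|exact: contC].
have ct : continuous (fun x : E => trig c (dotp (x - y) xi)).
  exact: cont_comp cd (@continuous_trig c).
split => // [p|_ [j _ <-]]; first exact: le_trans (trig_max _ _) (japanese_ge1 _).
have dt p : is_derive p (std_basis j) (fun x : E => trig c (dotp (x - y) xi))
    (xi ord0 j * trig' c (dotp (p - y) xi)).
  apply: (is_derive_affine_comp (f := fun x : E => dotp (x - y) xi)).
    by move=> h; rewrite -addrA dotp_shiftl.
  exact: is_derive_trig.
have [d1 ->] := derive_fun dt; split => //; split => //.
  apply: contM; first exact: contC.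
  exact: cont_comp cd (@continuous_trig' c).
move=> p; rewrite divr1 normrM -[leRHS]mulr1 ler_pM ?trig'_max//.
by apply: le_trans (normr_coord_le_enorm xi j) _; rewrite lerDr.
Qed.

End trigonometric.

(** * Amplitudes and the kernels of their truncations *)

Section continuous_pairs.
Context {T T1 T2 : topologicalType}.

Lemma cont_pair (f : T -> T1) (g : T -> T2) : continuous f -> continuous g ->
  continuous (fun x => (f x, g x)).
Proof.
move=> cf cg x; apply: (@cvg_pair _ _ _ (nbhs x) (nbhs (f x)) (nbhs (g x))).
  exact: cf.
exact: cg.
Qed.

Lemma cont_fst : continuous (@fst T1 T2).
Proof. by move=> x; exact: cvg_fst. Qed.

Lemma cont_snd : continuous (@snd T1 T2).
Proof. by move=> x; exact: cvg_snd. Qed.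

Lemma cont_then (f : T -> T1) (g : T1 -> T2) : continuous f -> continuous g ->
  continuous (fun x => g (f x)).
Proof. by move=> cf cg x; apply: (@continuous_comp _ _ _ f g); [exact: cf|exact: cg]. Qed.

Lemma cont_cst (c : T1) : continuous (fun _ : T => c).
Proof. by move=> x; exact: cvg_cst. Qed.

Lemma cont_id : continuous (fun x : T => x).
Proof. by move=> x; exact: cvg_id. Qed.

End continuous_pairs.

Section real_symbols.
Context {R : realType} (d : nat) {n : nat}.
Local Notation E := 'rV[R]_n.
Local Notation dual := (@dual_measure R d n).
Local Notation jap := (@japanese R n).
Implicit Types (m : R) (f : E * E * E -> R) (x y xi : E).

Definition jap3 (p : E * E * E) : R := jap p.2.

Lemma continuous_phase : continuous (fun p : E * E * E => dotp (p.1.1 - p.1.2) p.2).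
Proof.
apply: (@cont_then _ _ _ (fun p : E * E * E => (p.1.1 - p.1.2, p.2)) (fun z => dotp z.1 z.2)).
  apply: cont_pair; last exact: cont_snd.
  move=> p; apply: cvgB; first exact: (cont_then cont_fst cont_fst).
  exact: (cont_then cont_fst cont_snd).
exact: continuous_dotp.
Qed.

(** The properties of the real and imaginary parts of an amplitude that the
    kernel estimates use. *)
Record real_symbol m f : Prop := RealSymbol {
  symbol_jet_xi : exists2 C, 0 <= C &
    jet n.+1 (range dxi) jap3 (fun p => C * jap3 p `^ m) f;
  symbol_jet_x : exists2 C, 0 <= C &
    jet n.+1 (range dx) (fun=> 1) (fun p => C * jap3 p `^ m) f;
  symbol_vanishing : forall e r, 0 < e -> 0 < r -> exists rho, forall x y,
    rho <= height d x -> rho <= height d y -> Omega_dist d x y < r -> forall j,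
    jet n.+1 [set std_basis j] jap (fun xi => e * jap xi `^ (- m)) (fun xi => f (x, y, xi)) }.

Lemma powR_weight_le (t m N C : R) k : 0 < t -> t `^ (k%:R - m) * N <= C ->
  N <= C * t `^ m / t ^+ k.
Proof.
move=> t0 h; have p0 : 0 < t `^ (k%:R - m) by rewrite powR_gt0.
rewrite -(ler_pM2l p0); apply: le_trans h _.
rewrite [leRHS](_ : _ = C * (t `^ (k%:R - m) * t `^ m / t ^+ k)); last by ring.
rewrite -powRD; last by rewrite (gt_eqF t0) implybT.
by rewrite subrK powR_mulrn ?(ltW t0)// divff ?mulr1// expf_neq0// gt_eqF.
Qed.

Lemma symbol_bounds m a : symbol_class d m a ->
  exists2 C, 0 <= C & forall s : seq 'I_n, (size s <= n.+1)%N -> forall p,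
    Normc.normc (foldr cderive a (map dxi s) p) <= C * jap3 p `^ m / jap3 p ^+ size s /\
    Normc.normc (foldr cderive a (map dx s) p) <= C * jap3 p `^ m.
Proof.
move=> [sa _ _ ab].
apply: uniform_word_bound => [s C C' CC' h p|s sn].
  have [h1 h2] := h p; have j0 := japanese_gt0 p.2; split.
    apply: le_trans h1 _; rewrite ler_wpM2r ?invr_ge0 ?exprn_ge0 ?(ltW j0)//.
    by rewrite ler_wpM2r ?powR_ge0.
  by apply: le_trans h2 _; rewrite ler_wpM2r ?powR_ge0.
have z n' : (@mlength n (fun=> 0%N) <= n')%N by rewrite mlength0.
have sn' : (mlength (fun i => count_mem i s) <= n.+1)%N by rewrite mlength_count.
have [C1 h1] := ereal_sup_ltyP (ab _ _ _ (z _) (z _) sn').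
have [C2 h2] := ereal_sup_ltyP (ab _ _ _ sn' (z _) (z _)).
exists (Num.max C1 C2) => p; have j0 := japanese_gt0 p.2; split.
  rewrite mderive_word//; apply: powR_weight_le => //.
  have := h1 p I; rewrite !mderive0 mlength_count => h; apply: le_trans h _.
  by rewrite le_max lexx.
rewrite mderive_word// -[leRHS]divr1 -(expr0 (jap3 p)); apply: powR_weight_le => //.
have := h2 p I; rewrite !mderive0 mlength0 => h; apply: le_trans h _.
by rewrite le_max lexx orbT.
Qed.

Lemma slice_xiP x y : continuous (fun xi : E => (x, y, xi)) /\
  forall u xi (h : R), (x, y, h *: u + xi) = h *: (0, 0, u) + (x, y, xi) :> E * E * E.
Proof.
split=> [|u xi h]; first by apply: cont_pair; [exact: cont_cst|exact: cont_id].
transitivity (h *: (0 : E) + x, h *: (0 : E) + y, h *: u + xi); last by [].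
by rewrite !scaler0 !add0r.
Qed.

Lemma slice_xP y xi : continuous (fun x : E => (x, y, xi)) /\
  forall u x (h : R), (h *: u + x, y, xi) = h *: (u, 0, 0) + (x, y, xi) :> E * E * E.
Proof.
split=> [|u x h].
  apply: cont_pair; last exact: cont_cst.
  by apply: cont_pair; [exact: cont_id|exact: cont_cst].
transitivity (h *: u + x, h *: (0 : E) + y, h *: (0 : E) + xi); last by [].
by rewrite !scaler0 !add0r.
Qed.

Lemma jet_slice_xi k w f x y j : jet k (range dxi) jap3 w f ->
  jet k [set std_basis j] jap (fun xi => w (x, y, xi)) (fun xi => f (x, y, xi)).
Proof.
have [c1 c2] := slice_xiP x y => jf.
apply: (jet_comp (D := range dxi) (phi := fun xi : E => (x, y, xi)) (L := fun u => (0, 0, u)) c1 _ _ jf).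
  by move=> _ ->; exists j.
by move=> u q h _; exact: c2.
Qed.

Lemma jet_slice_x k w f y xi : jet k (range dx) (fun=> 1) w f ->
  jet k (range std_basis) (fun=> 1) (fun x => w (x, y, xi)) (fun x => f (x, y, xi)).
Proof.
have [c1 c2] := slice_xP y xi => jf.
apply: (jet_comp (D := range dx) (phi := fun x : E => (x, y, xi)) (L := fun u => (u, 0, 0)) c1 _ _ jf).
  by move=> _ [j _ <-]; exists j.
by move=> u q h _; exact: c2.
Qed.

Lemma symbol_real m a : symbol_class d m a -> vanishes_at_infinity d (symbol_size m a) ->
  real_symbol m (@complex.Re R \o a) /\ real_symbol m (@complex.Im R \o a).
Proof.
move=> sa va; have [C C0 hC] := symbol_bounds sa; have [sma _ _ _] := sa.
have j3 p : 0 < jap3 p by exact: japanese_gt0.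
have [jr ji] : jet n.+1 (range dxi) jap3 (fun p => C * jap3 p `^ m) (@complex.Re R \o a) /\
    jet n.+1 (range dxi) jap3 (fun p => C * jap3 p `^ m) (@complex.Im R \o a).
  by apply: smooth_jet => // s sn p; have [] := hC s sn p.
have [jxr jxi] : jet n.+1 (range dx) (fun=> 1) (fun p => C * jap3 p `^ m) (@complex.Re R \o a) /\
    jet n.+1 (range dx) (fun=> 1) (fun p => C * jap3 p `^ m) (@complex.Im R \o a).
  by apply: smooth_jet => // s sn p; rewrite expr1n divr1; have [] := hC s sn p.
have van e r : 0 < e -> 0 < r -> exists rho, forall x y,
    rho <= height d x -> rho <= height d y -> Omega_dist d x y < r -> forall j,
    jet n.+1 [set std_basis j] jap (fun xi => e * jap xi `^ (- m)) (fun xi => complex.Re (a (x, y, xi))) /\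
    jet n.+1 [set std_basis j] jap (fun xi => e * jap xi `^ (- m)) (fun xi => complex.Im (a (x, y, xi))).
  move=> e0 r0; have /= := va r r0 => vr.
  have e0' : nbhs (0%E : \bar R) [set z | (z < e%:E)%E].
    by apply: open_nbhs_nbhs; split; [exact: open_ereal_lt_ereal|rewrite /= lte_fin].
  have [rho [_ hrho]] := vr _ e0'; exists (rho + 1) => x y hx hy xy j.
  have sz : (symbol_size m a x y < e%:E)%E.
    apply: le_lt_trans (hrho (rho + 1) _); last by rewrite ltrDl.
    by apply: ereal_sup_ubound; exists (x, y).
  (* The decay hypothesis concerns the single slice over [(x, y)]; elsewhere the weight
     is the one of the symbol class. *)
  pose w (p : E * E * E) : R := if p.1 == (x, y) then e * jap3 p `^ (- m) else C * jap3 p `^ m.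
  have [wr wi] : jet n.+1 (range dxi) jap3 w (@complex.Re R \o a) /\
      jet n.+1 (range dxi) jap3 w (@complex.Im R \o a).
    apply: smooth_jet => // s sn p; rewrite /w; case: eqP => [p1|_]; last by have [] := hC s sn p.
    apply: powR_weight_le => //; rewrite opprK mderive_word//.
    rewrite -lee_fin; apply: le_trans (ltW sz); apply: ereal_sup_ubound.
    exists (p.2, fun i => count_mem i s); rewrite /= mlength_count//.
    by rewrite -p1; case: (p).
  have wE : (fun xi => w (x, y, xi)) = (fun xi => e * jap xi `^ (- m)).
    by apply/funext => xi; rewrite /w eqxx.
  have := jet_slice_xi x y j wi; have := jet_slice_xi x y j wr.
  by rewrite wE.
split; split; try (by exists C).
- move=> e r e0 r0; have [rho h] := van e r e0 r0; exists rho => x y hx hy xy j.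
  by have [] := h x y hx hy xy j.
- move=> e r e0 r0; have [rho h] := van e r e0 r0; exists rho => x y hx hy xy j.
  by have [] := h x y hx hy xy j.
Qed.

End real_symbols.

Section symbol_kernels.
Context {R : realType} (d : nat) {n : nat}.
Local Notation E := 'rV[R]_n.
Local Notation dual := (@dual_measure R d n).
Local Notation jap := (@japanese R n).
Local Notation delta := (@Omega_delta R d n).
Local Notation D := (@fundamental_domain R d n).
Variables (m s : R) (q : nat).
Hypotheses (n0 : (0 < n)%N) (m0 : m < 0) (s0 : 0 < s) (s2 : s <= 2) (sn : s < n%:R)
  (sm : s + s <= - m) (qn : (n.+2 <= 2 * q)%N) (qm : s - m <= (2 * q)%:R).
Implicit Types (f : E * E * E -> R) (x y xi : E) (M : nat).

Definition truncated f M (z : E * E) xi : R := f (z.1, z.2, xi) * cutoff M.+1%:R q xi.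

(** The real and imaginary parts of the kernel of a truncated real amplitude. *)
Definition symbol_kernel c f M (z : E * E) : R := osc_int d c (truncated f M z) (z.1 - z.2).

Let M1 M : 1 <= M.+1%:R :> R. Proof. by rewrite ler1n. Qed.

Let jap_le xi (t t' : R) : t <= t' -> jap xi `^ t <= jap xi `^ t'.
Proof. by move=> tt; rewrite ler_powR// japanese_ge1. Qed.

Section one_symbol.
Variable f : E * E * E -> R.
Hypothesis sf : real_symbol d m f.

Lemma continuous_symbol : continuous f.
Proof. by have [C _ j] := symbol_jet_xi sf; exact: jet_continuous j. Qed.

Lemma continuous_truncated M : continuous (fun p : E * E * E => truncated f M p.1 p.2).
Proof.
apply: contM; last by apply: (cont_comp cont_snd); exact: continuous_cutoff.
rewrite (_ : (fun _ => _) = f); first exact: continuous_symbol.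
by apply/funext => -[[]].
Qed.

Lemma truncated_bound M : exists2 C, 0 <= C & forall z,
  dual.-integrable setT (EFin \o truncated f M z) /\
  (\int[dual]_xi `|truncated f M z xi|%:E <= C%:E)%E.
Proof.
have [C C0 jf] := symbol_jet_xi sf; have [cM cM0 jc] := @jet_cutoff R n 0 q.
pose K := C * ((2 * M.+1%:R ^+ 2) ^+ q).
have K0 : 0 <= K by rewrite mulr_ge0// exprn_ge0// mulr_ge0// sqr_ge0.
have nn : n%:R < n.+1%:R :> R by rewrite ltr_nat.
exists (K * @japanese_const R n n.+1%:R).
  by apply: mulr_ge0 => //; exact: japanese_const_ge0.
move=> z; apply: integrable_decay => //.
  apply: continuous_measurable1; apply: contM; last exact: continuous_cutoff.
  exact: (cont_then (slice_xiP z.1 z.2).1 continuous_symbol).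
move=> xi; rewrite normrM (ger0_norm (cutoff_ge0 _ _ (M1 M))).
have fz : `|f (z.1, z.2, xi)| <= C.
  apply: le_trans (jet_le jf _) _; rewrite ler_piMr// -(powRr0 (jap xi)) /jap3/=.
  exact/jap_le/ltW.
apply: (@le_trans _ _ (C * ((2 * M.+1%:R ^+ 2) ^+ q * jap xi `^ (- (2 * q)%:R)))).
  by apply: ler_pM (cutoff_decay _ _ (M1 M)) => //; exact: cutoff_ge0.
rewrite mulrA ler_wpM2l//; apply: jap_le; rewrite lerN2 ler_nat; exact: ltnW.
Qed.

Lemma integrable_truncated M z : dual.-integrable setT (EFin \o truncated f M z).
Proof. by have [C _ h] := truncated_bound M; have [] := h z. Qed.

Let jet_f : exists2 C, 0 <= C & forall x y j,
  jet n.+1 [set std_basis j] jap (fun xi => C * jap xi `^ (- s - s)) (fun xi => f (x, y, xi)).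
Proof.
have [C C0 jf] := symbol_jet_xi sf; exists C => // x y j.
have := jet_slice_xi x y j jf; apply: jet_mono => xi; first exact: japanese_gt0.
by rewrite ler_wpM2l//; apply: jap_le; rewrite -opprD lerNr.
Qed.

Let jap_ss xi : jap xi `^ (- s - s) * jap xi `^ s = jap xi `^ (- s).
Proof. by rewrite -powRD ?subrK// (gt_eqF (japanese_gt0 xi)) implybT. Qed.

Let delta_le2pi x y : D x -> D y -> forall i : 'I_n, (i < d)%N -> `|(x - y) ord0 i| <= 2 * pi.
Proof.
move=> Dx Dy i id; have /andP[x1 x2] := Dx i id; have /andP[y1 y2] := Dy i id.
by rewrite !mxE ler_norml; apply/andP; split; lra.
Qed.

Let osc_le c A b x y : 0 <= A -> dual.-integrable setT (EFin \o b) ->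
  (forall j, jet n.+1 [set std_basis j] jap (fun xi => A * jap xi `^ (- s)) b) ->
  D x -> D y -> 0 < delta (x - y) ->
  `|osc_int d c b (x - y)| <= kernel_const (n := n) s * A * two_scale (n%:R - s) n.+1%:R (delta (x - y)).
Proof.
move=> A0 ib jb Dx Dy xy; have [] := osc_bound s0 sn A0 jb ib (delta_le2pi Dx Dy) xy.
by rewrite osc_intE; case: c.
Qed.

Let kc0 : 0 <= kernel_const (n := n) s.
Proof.
apply: mulr_ge0 => //; apply: mulr_ge0; last by rewrite exprn_ge0// pi_ge0.
apply: osc_const_ge0 => //.
have -> : n.+1%:R = n%:R + 1 :> R by rewrite natr1.
by have := s0; lra.
Qed.

Lemma measurable_symbol_kernel c M : measurable_fun setT (symbol_kernel c f M).
Proof.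
apply: (@measurable_Rintegral_snd _ _ _ dual _ _ (fun p : E * E * E =>
  truncated f M p.1 p.2 * trig c (dotp (p.1.1 - p.1.2) p.2))).
apply: continuous_measurable3; apply: contM; first exact: continuous_truncated.
apply: cont_comp; last exact: continuous_trig.
exact: continuous_phase.
Qed.

(** The difference of two cutoffs grows with order [s], with a factor [M ^ (- s)];
    multiplied by a symbol of order [m <= - 2 s], it is a symbol of order [- s]. *)
Lemma symbol_kernel_cauchy c : exists2 C, 0 <= C & forall M M' x y, (M <= M')%N -> D x -> D y ->
  0 < delta (x - y) ->
  `|symbol_kernel c f M (x, y) - symbol_kernel c f M' (x, y)| <=
     C * M.+1%:R `^ (- s) * two_scale (n%:R - s) n.+1%:R (delta (x - y)).
Proof.
have [C C0 jf] := jet_f; have s02 : 0 <= s <= 2 by rewrite (ltW s0).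
have [c1 c10 jc] := @jet_one_sub_cutoff R n n.+1 q s s02.
pose K := 2 ^+ n.+1 * (C * (c1 + c1)).
have K0 : 0 <= K by apply: mulr_ge0; [exact: exprn_ge0|apply: mulr_ge0 => //; exact: addr_ge0].
exists (kernel_const (n := n) s * K); first exact: mulr_ge0.
move=> M M' x y MM Dx Dy xy; rewrite /symbol_kernel osc_intB; try exact: integrable_truncated.
have -> : kernel_const (n := n) s * K * M.+1%:R `^ (- s) = kernel_const (n := n) s * (K * M.+1%:R `^ (- s)).
  exact/esym/mulrA.
apply: osc_le => //; first by rewrite mulr_ge0// powR_ge0.
  exact: (integrableB measurableT (integrable_truncated M _) (integrable_truncated M' _)).
move=> j; rewrite (_ : (fun _ => _ - _) = (fun xi => f (x, y, xi) *
    ((1 - cutoff M'.+1%:R q xi) - (1 - cutoff M.+1%:R q xi)))); last first.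
  by apply/funext => xi; rewrite /truncated/=; ring.
have := jetM (jf x y j) (jetB (jc _ j (M1 M')) (jc _ j (M1 M))).
apply: jet_mono => xi; first exact: japanese_gt0.
have pM (N : nat) : (jap xi / N.+1%:R) `^ s = jap xi `^ s * N.+1%:R `^ (- s).
  by rewrite powRM ?(ltW (japanese_gt0 xi)) ?invr_ge0// -(powR_inv1 (ler0n R N.+1)) -powRrM mulN1r.
have MM' : M'.+1%:R `^ (- s) <= M.+1%:R `^ (- s) :> R.
  rewrite !powRN lef_pV2 ?posrE ?powR_gt0//.
  by apply: ge0_ler_powR; rewrite ?nnegrE ?(ltW s0)// ler_nat.
rewrite !pM -jap_ss; set u := jap xi `^ _; set v := jap xi `^ s.
have u0 : 0 <= u by exact: powR_ge0.
have v0 : 0 <= v by exact: powR_ge0.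
set t := M.+1%:R `^ _ in MM' *.
rewrite [leRHS](_ : _ = 2 ^+ n.+1 * (C * u * (c1 * (v * t) + c1 * (v * t)))); last by rewrite /K; ring.
apply: ler_wpM2l; first exact: exprn_ge0.
apply: ler_wpM2l; first exact: mulr_ge0.
by rewrite lerD2r ler_wpM2l// ler_wpM2l.
Qed.

Lemma symbol_kernel_bound c M : exists2 C, 0 <= C & forall x y, D x -> D y ->
  0 < delta (x - y) ->
  `|symbol_kernel c f M (x, y)| <= C * two_scale (n%:R - s) n.+1%:R (delta (x - y)).
Proof.
have [C C0 jf] := jet_f; have [c1 c10 jc] := @jet_cutoff R n n.+1 q.
pose K := 2 ^+ n.+1 * (C * c1).
have K0 : 0 <= K by apply: mulr_ge0; [exact: exprn_ge0|exact: mulr_ge0].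
exists (kernel_const (n := n) s * K); first exact: mulr_ge0.
move=> x y Dx Dy xy; apply: osc_le => //; first exact: integrable_truncated.
move=> j; have := jetM (jf x y j) (jc _ j (M1 M)).
apply: jet_mono => xi; first exact: japanese_gt0.
rewrite [leRHS](_ : _ = 2 ^+ n.+1 * (C * jap xi `^ (- s) * c1)); last by rewrite /K; ring.
apply: ler_wpM2l; first exact: exprn_ge0.
have r1 := resolvent_le_M (M1 M) xi; have r0 := resolvent_gt0 (M1 M) xi.
have r2 : 0 <= M.+1%:R ^+ 2 * resolvent M.+1%:R xi by rewrite mulr_ge0 ?sqr_ge0// ltW.
apply: ler_pM; rewrite ?mulr_ge0 ?powR_ge0 ?exprn_ge0//.
  by rewrite ler_wpM2l//; apply: jap_le; rewrite gerBl ltW.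
by rewrite ler_piMr// exprn_ile1.
Qed.

(** At infinity the amplitude is small relative to the growing weight [japanese ^ (-
    m)]. The cutoff, of order [- 2 q <= m - s], turns it into a small symbol of order [-
    s], with a constant that depends on [M]. *)
Lemma symbol_kernel_vanishing c M (e r : R) : 0 < e -> exists rho, forall x y, D x -> D y ->
  0 < delta (x - y) <= r -> rho <= height d x -> rho <= height d y ->
  `|symbol_kernel c f M (x, y)| <= e * two_scale (n%:R - s) n.+1%:R (delta (x - y)).
Proof.
move=> e0; have [c1 c10 jc] := @jet_cutoff R n n.+1 q.
pose K := kernel_const (n := n) s * (2 ^+ n.+1 * (c1 * (2 * M.+1%:R ^+ 2) ^+ q)).
have cM0 : 0 <= c1 * (2 * M.+1%:R ^+ 2) ^+ q by rewrite mulr_ge0// exprn_ge0// mulr_ge0// sqr_ge0.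
have K0 : 0 <= K.
  by apply: mulr_ge0; [exact: kc0|apply: mulr_ge0; [exact: exprn_ge0|]].
have K1 : 0 < K + 1 by rewrite ltr_wpDl.
have e1 : 0 < e / (K + 1) by rewrite divr_gt0.
have r1 : 0 < n%:R * `|r| + 1 by rewrite ltr_wpDl// mulr_ge0.
have [rho h] := symbol_vanishing sf e1 r1.
exists rho => x y Dx Dy /andP[xy xyr] hx hy.
have dist : Omega_dist d x y < n%:R * `|r| + 1.
  apply: le_lt_trans (Omega_dist_le d x y) _; rewrite ltr_pwDr// ler_wpM2l//.
  exact: le_trans (ler_norm r).
have A0 : 0 <= 2 ^+ n.+1 * (e / (K + 1) * (c1 * (2 * M.+1%:R ^+ 2) ^+ q)).
  by apply: mulr_ge0; [exact: exprn_ge0|apply: mulr_ge0 => //; exact: ltW].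
apply: le_trans (osc_le c A0 (integrable_truncated M (x, y)) _ Dx Dy xy) _.
  move=> j; have := jetM (h x y hx hy dist j) (jc _ j (M1 M)).
  apply: jet_mono => xi; first exact: japanese_gt0.
  rewrite -[leRHS]mulrA; apply: ler_wpM2l; first exact: exprn_ge0.
  have le := cutoff_decay q xi (M1 M).
  apply: (@le_trans _ _ (e / (K + 1) * jap xi `^ (- m) * (c1 * ((2 * M.+1%:R ^+ 2) ^+ q * jap xi `^ (- (2 * q)%:R))))).
    apply: ler_wpM2l; first by apply: mulr_ge0; [exact: ltW|exact: powR_ge0].
    exact: ler_wpM2l.
  rewrite [leLHS](_ : _ = e / (K + 1) * (c1 * (2 * M.+1%:R ^+ 2) ^+ q) * (jap xi `^ (- m) * jap xi `^ (- (2 * q)%:R))); last by ring.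
  apply: ler_wpM2l; first by apply: mulr_ge0 => //; exact: ltW.
  rewrite -powRD; last by rewrite (gt_eqF (japanese_gt0 xi)) implybT.
  by apply: jap_le; have := qm; set t := (2 * q)%:R; lra.
apply: ler_wpM2r; first exact: two_scale_ge0.
rewrite [leLHS](_ : _ = e * (K / (K + 1))); last by rewrite /K; ring.
by rewrite ler_piMr ?(ltW e0)// ler_pdivrMr// mul1r lerDl.
Qed.

(** A derivative in [x] costs one power of the frequency, which the cutoff absorbs.
    *)
Lemma symbol_kernel_lipschitz c M : exists2 L, 0 <= L & forall x x' y,
  `|symbol_kernel c f M (x, y) - symbol_kernel c f M (x', y)| <= L * `|x - x'|.
Proof.
have [C C0 jf] := symbol_jet_x sf.
pose K := n%:R * (2 * C) * (2 * M.+1%:R ^+ 2) ^+ q.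
have K0 : 0 <= K.
  apply: mulr_ge0; first by rewrite mulr_ge0// mulr_ge0.
  by rewrite exprn_ge0// mulr_ge0// sqr_ge0.
have nn : n%:R < n.+1%:R :> R by rewrite ltr_nat.
have J0 : 0 <= @japanese_const R n n.+1%:R by exact: japanese_const_ge0.
exists (K * @japanese_const R n n.+1%:R); first exact: mulr_ge0.
move=> x x' y; pose g (xi x : E) := f (x, y, xi) * trig c (dotp (x - y) xi).
have gl xi : `|g xi x - g xi x'| <= n%:R * (2 * C) * jap xi * `|x - x'|.
  have jg : jet 1 (range std_basis) (fun=> 1) (fun=> 2 * C * jap xi) (g xi).
    have := jetM (jet_leq (ltn0Sn n) (jet_slice_x y xi jf)) (jet_trig c y xi).
    apply: jet_mono => // p; rewrite expr1 -mulrA ler_wpM2l// ler_wpM2r ?(ltW (japanese_gt0 xi))//.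
    by rewrite ler_piMr// -(powRr0 (jap xi)); apply/jap_le/ltW.
  have := jet_lipschitz x x' _ jg; rewrite -[n%:R * _ * jap xi]mulrA; apply.
  by rewrite mulr_ge0 ?(ltW (japanese_gt0 xi))// mulr_ge0.
have ig z : dual.-integrable setT (EFin \o (fun xi => truncated f M z xi * trig c (dotp (z.1 - z.2) xi))).
  by apply: integrable_trig; exact: integrable_truncated.
rewrite /symbol_kernel /osc_int -(RintegralB measurableT (ig (x, y)) (ig (x', y))).
pose b xi := (g xi x - g xi x') * cutoff M.+1%:R q xi.
have bE : (fun xi => truncated f M (x, y) xi * trig c (dotp (x - y) xi) -
    truncated f M (x', y) xi * trig c (dotp (x' - y) xi)) = b.
  by apply/funext => xi; rewrite /truncated /b /g/=; ring.
have mb : measurable_fun setT b.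
  rewrite -bE; exact: (measurable_EFin_int (integrableB measurableT (ig (x, y)) (ig (x', y)))).
have : (\int[dual]_xi `|b xi|%:E <= (K * `|x - x'| * @japanese_const R n n.+1%:R)%:E)%E.
  have [|xi|//] := @integrable_decay _ d n n.+1%:R (K * `|x - x'|) b n0 nn _ mb; first exact: mulr_ge0.
  rewrite normrM (ger0_norm (cutoff_ge0 _ _ (M1 M))).
  apply: (@le_trans _ _ (n%:R * (2 * C) * jap xi * `|x - x'| *
     ((2 * M.+1%:R ^+ 2) ^+ q * jap xi `^ (- (2 * q)%:R)))).
    by apply: ler_pM (cutoff_decay _ _ (M1 M)) => //; exact: cutoff_ge0.
  rewrite [leLHS](_ : _ = K * `|x - x'| * (jap xi * jap xi `^ (- (2 * q)%:R))); last by rewrite /K; ring.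
  rewrite ler_wpM2l ?mulr_ge0// -{1}(powRr1 (ltW (japanese_gt0 xi))) -powRD; last first.
    by rewrite (gt_eqF (japanese_gt0 xi)) implybT.
  apply: jap_le; have : n.+2%:R <= (2 * q)%:R :> R by rewrite ler_nat.
  by rewrite -[n.+2%:R]natr1; lra.
rewrite mulrAC => le; rewrite -lee_fin; apply: le_trans le.
have := normr_Rintegral_le dual mb; rewrite -bE; exact.
Qed.

Lemma symbol_kernel_finite c M : exists2 C, 0 <= C & forall z, `|symbol_kernel c f M z| <= C.
Proof.
have [C C0 h] := truncated_bound M; exists C => // z; have [h1 h2] := h z.
exact: normr_osc_int_le.
Qed.

Lemma symbol_good_family c : good_family d s (symbol_kernel c f).
Proof.
split.
- exact: measurable_symbol_kernel.
- exact: symbol_kernel_cauchy.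
- exact: symbol_kernel_bound.
- exact: symbol_kernel_vanishing.
- exact: symbol_kernel_lipschitz.
- exact: symbol_kernel_finite.
Qed.

End one_symbol.
End symbol_kernels.

(** * Integration by parts on Omega *)

Section Omega_decay.
Context {R : realType} (d : nat) {n : nat}.
Local Notation E := 'rV[R]_n.
Local Notation bR := (measurableTypeR R).
Local Notation Om := (@Omega_measure R d n).
Local Notation dual := (@dual_measure R d n).
Implicit Types x y xi : E.

(** An integrable weight on Omega, which rapidly decreasing functions are
    compared with. *)
Definition tail x : R := (1 + height d x) `^ (- n.+1%:R).

Lemma height_ge0 x : 0 <= height d x.
Proof. exact: sqrtr_ge0. Qed.

Lemma tail_ge0 x : 0 <= tail x.
Proof. exact: powR_ge0. Qed.

Lemma measurable_tail : measurable_fun setT tail.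
Proof.
apply: (measurableT_comp (measurable_powR _)).
apply: continuous_measurable1; apply: contD; first exact: contC.
exact: continuous_height.
Qed.

Lemma Omega_height_volume (r : R) : 0 < r ->
  (Om [set x | (1 + height d x <= r)%R] <= (2 ^+ n * r ^+ n)%:E)%E.
Proof.
move=> r0; have [r1|r1] := leP 1 r; last first.
  rewrite (_ : [set _ | _] = set0) ?measure0 ?lee_fin ?mulr_ge0 ?exprn_ge0 ?(ltW r0)//.
  apply/seteqP; split => // x /= /le_lt_trans/(_ r1).
  by rewrite ltNge lerDl height_ge0.
pose B (i : nat) : set bR := if (i < d)%N then setT else [set t | `|t - 0| <= r].
have mB i : measurable (B i) by rewrite /B; case: ifP => // _; exact: measurable_ball_le.
apply: (@le_trans _ _ (Om [set x : E | forall i : 'I_n, B i (x ord0 i)])).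
  apply: le_measure; rewrite ?inE.
  - rewrite -[X in measurable X]setTI; apply: measurable_fun_ler => //.
    apply: continuous_measurable1; apply: contD; first exact: contC.
    exact: continuous_height.
  - exact: measurable_box.
  - move=> x /= xr i; rewrite /B; case: ltnP => //= di; rewrite subr0.
    apply: le_trans (normr_coord_le_height x di) _.
    by apply: le_trans xr; rewrite lerDr.
rewrite -exprMn; apply: product_measure_box_le => //.
  by rewrite mulr_ge0// ltW.
move=> i _; rewrite /B; case: (i < d)%N.
  apply: (@le_trans _ _ 1%:E); first exact: circle_measure_le1.
  by rewrite lee_fin; lra.
by rewrite [leLHS](_ : _ = (2 * r)%:E)//; apply: lebesgue_ball; exact: ltW.
Qed.

Definition tail_const : R := 2 ^+ n * two_scale_const (n%:R / 2) n.+1%:R n.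

Lemma tail_const_ge0 : (0 < n)%N -> 0 <= tail_const.
Proof.
move=> n0; apply: mulr_ge0; first exact: exprn_ge0.
have n0' : 0 < n%:R :> R by rewrite ltr0n.
by apply/ltW/two_scale_const_gt0; [rewrite divr_gt0|lra|rewrite ltr_nat].
Qed.

Lemma integral_tail : (0 < n)%N -> (\int[Om]_x (tail x)%:E <= tail_const%:E)%E.
Proof.
move=> n0; have n0' : 0 < n%:R :> R by rewrite ltr0n.
have m1 : measurable_fun setT (fun x => 1 + height d x : bR).
  apply: continuous_measurable1; apply: contD; first exact: contC.
  exact: continuous_height.
apply: (@le_trans _ _ (\int[Om]_x (two_scale (n%:R / 2) n.+1%:R (1 + height d x))%:E)%E).
  apply: ge0_le_integral => //.
  - by move=> x _; rewrite lee_fin tail_ge0.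
  - by apply/measurable_EFinP; exact: measurable_tail.
  - by apply/measurable_EFinP; exact: (measurableT_comp (measurable_two_scale _ _)).
  move=> x _; rewrite lee_fin /two_scale le_min lexx andbT ler_powR ?lerDl ?height_ge0//.
  have : n%:R <= n.+1%:R :> R by rewrite ler_nat.
  by rewrite lerN2; lra.
apply: integral_two_scale => //.
- by rewrite divr_gt0.
- by rewrite gtr_pMr// invf_lt1 ?ltr1n.
- by rewrite ltr_nat.
- by move=> x; rewrite addr_ge0// height_ge0.
- exact: Omega_height_volume.
Qed.

Lemma height_shift_ge x i (h : R) : 0 <= h -> height d x <= height d (x + h *: std_basis i) + h.
Proof.
move=> h0; have e0 := height_ge0 (x + h *: std_basis i).
set z := x + _ in e0 *; have zE j : z ord0 j = x ord0 j + h * (j == i)%:R.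
  by rewrite !mxE eqxx.
rewrite -[leRHS]ger0_norm ?addr_ge0// -sqrtr_sqr ler_wsqrtr//.
rewrite sqrrD sqr_sqrtr; last by apply: sumr_ge0 => j _; exact: sqr_ge0.
have [di|di] := leqP d i.
  rewrite (bigD1 i)//= [X in _ <= X + _ + _](bigD1 i)//=.
  rewrite [X in _ <= _ + X + _ + _](eq_bigr (fun j : 'I_n => x ord0 j ^+ 2)); last first.
    by move=> j /andP[_ /negbTE ji]; rewrite zE ji mulr0 addr0.
  have := normr_coord_le_height z di.
  rewrite zE eqxx mulr1; set S := \sum_(j < n | _) _; set H := height d z in e0 *.
  rewrite ler_norml => /andP[ge _]; have : 0 <= h * (H + (x ord0 i + h)).
    by apply: mulr_ge0 => //; lra.
  by rewrite mulr2n; nra.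
rewrite [X in _ <= X + _ + _](eq_bigr (fun j : 'I_n => x ord0 j ^+ 2)); last first.
  move=> j dj; rewrite zE (_ : j == i = false) ?mulr0 ?addr0//.
  by apply/negbTE/eqP => ji; move: dj; rewrite ji leqNgt di.
rewrite -addrA lerDl; apply: addr_ge0; last exact: sqr_ge0.
by rewrite mulrn_wge0// mulr_ge0.
Qed.

Lemma tail_shift_le x i (h : R) : 0 <= h <= 1 ->
  tail (x + h *: std_basis i) <= 2 `^ n.+1%:R * tail x.
Proof.
move=> /andP[h0 h1]; have hx := height_shift_ge x i h0.
have := height_ge0 x; have := height_ge0 (x + h *: std_basis i).
rewrite /tail; set a := height d x in hx *; set b := height d _ in hx * => b0 a0.
rewrite !powRN -[X in X / _]invrK -invfM lef_pV2 ?posrE ?powR_gt0 ?mulr_gt0 ?invr_gt0 ?powR_gt0 ?ltr_wpDr//.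
rewrite ler_pdivrMl ?powR_gt0// -powRM ?addr_ge0//.
by apply: ge0_ler_powR; rewrite ?nnegrE ?mulr_ge0 ?addr_ge0//; lra.
Qed.

Lemma integrable_tail (C : R) (f : E -> R) : (0 < n)%N -> measurable_fun setT f ->
  (forall x, `|f x| <= C * tail x) -> Om.-integrable setT (EFin \o f).
Proof.
move=> n0 mf fC.
have it : Om.-integrable setT (EFin \o (fun x => C * tail x)).
  have it0 : Om.-integrable setT (EFin \o tail); last exact: (integrableZl measurableT C it0).
  apply/integrableP; split; first by apply/measurable_EFinP; exact: measurable_tail.
  apply: le_lt_trans (ltry tail_const); apply: le_trans (integral_tail n0).
  rewrite le_eqVlt; apply/orP; left; apply/eqP; apply: eq_integral => x _ /=.
  by rewrite ger0_norm ?tail_ge0.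
apply: le_integrable it => //; first by apply/measurable_EFinP.
by move=> x _ /=; rewrite lee_fin (le_trans (fC x))// ler_norm.
Qed.

(** Translations in a direction of the torus preserve integrals of periodic
    functions only. *)
Lemma Omega_shift (i : 'I_n) (h : R) (f : E -> R) : 0 <= h <= 1 -> measurable_fun setT f ->
  ((i < d)%N -> forall x, f (x + (2 * pi) *: std_basis i) = f x) ->
  \int[Om]_x f (x + h *: std_basis i) = \int[Om]_x f x.
Proof.
move=> h1 mf fp; have me : measurable_fun setT (EFin \o f) by exact/measurable_EFinP.
have inv (g : E -> \bar R) : measurable_fun setT g -> (forall x, 0 <= g x)%E ->
    ((i < d)%N -> forall x, g (x + (2 * pi) *: std_basis i) = g x) ->
    (\int[Om]_x g (x + h *: std_basis i)%R = \int[Om]_x g x)%E.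
  rewrite /Omega_measure => mg g0; case: ltnP => [id /(_ isT) gp|di _].
    apply: (product_shift_periodic (P := 2 * pi)) => //; rewrite id.
    apply: circle_shift_periodic; have := pi_ge2 R; move: h1; lra.
  apply: product_shift_invariant => //; rewrite ltnNge di/=.
  exact: lebesgue_shift_invariant.
rewrite /Rintegral; congr fine.
rewrite [LHS]integralE [RHS]integralE; congr (_ - _)%E.
  rewrite -(inv _ (measurable_funepos me) (funepos_ge0 _)).
    by apply: eq_integral => x _; rewrite !funeposE.
  by move=> id x; rewrite !funeposE /= fp.
rewrite -(inv _ (measurable_funeneg me) (funeneg_ge0 _)).
  by apply: eq_integral => x _; rewrite !funenegE.
by move=> id x; rewrite !funenegE /= fp.
Qed.

(** The integral of a partial derivative vanishes: it is the limit of the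
    integrals of difference quotients, which vanish by translation invariance. *)
Lemma integral_derive0 (i : 'I_n) (C : R) (f : E -> R) : (0 < n)%N -> 0 <= C ->
  ((i < d)%N -> forall x, f (x + (2 * pi) *: std_basis i) = f x) ->
  continuous f -> (forall x, derivable f x (std_basis i)) ->
  continuous ('D_(std_basis i) f) ->
  (forall x, `|f x| <= C * tail x) -> (forall x, `|'D_(std_basis i) f x| <= C * tail x) ->
  \int[Om]_x 'D_(std_basis i) f x = 0.
Proof.
move=> n0 C0 fp cf df cdf fC dfC; set e := std_basis i in df cdf dfC *.
have mf := continuous_measurable1 cf; have md := continuous_measurable1 cdf.
pose phi (k : nat) x : R := k.+1%:R * (f (x + k.+1%:R^-1 *: e) - f x).
have k1 (k : nat) : 0 < (k.+1%:R^-1 : R) <= 1.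
  by rewrite invr_gt0 ltr0n/= invf_le1 ?ler1n.
have k1' (k : nat) : 0 <= (k.+1%:R^-1 : R) <= 1 by have /andP[/ltW -> ->] := k1 k.
have phiE k x : exists2 c, 0 <= c <= k.+1%:R^-1 & phi k x = 'D_e f (x + c *: e).
  have /andP[k0 _] := k1 k; have [c ch E1] := diff_op_mvt x k0 df; exists c => //.
  by rewrite /phi -/(diff_op (k.+1%:R^-1 *: e) f x) E1 mulrA divff ?mul1r// pnatr_eq0.
have mphi k : measurable_fun setT (phi k).
  apply: measurable_funM => //; apply: measurable_funB => //.
  exact: (measurableT_comp mf (measurable_shift _)).
have ifn := integrable_tail n0 mf fC.
have phi0 k : (\int[Om]_x (phi k x)%:E = 0)%E.
  have ish : Om.-integrable setT (EFin \o (fun x => f (x + k.+1%:R^-1 *: e))).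
    apply: (@integrable_tail (C * 2 `^ n.+1%:R)) => //.
      exact: (measurableT_comp mf (measurable_shift _)).
    move=> x; apply: le_trans (fC _) _; rewrite -mulrA ler_wpM2l//.
    exact: tail_shift_le.
  have ib := integrableB measurableT ish ifn.
  have ip := integrableZl measurableT k.+1%:R ib.
  have fi : (\int[Om]_x (phi k x)%:E)%E \is a fin_num by exact: integrable_fin_num ip.
  rewrite -(fineK fi) -/(Rintegral Om setT (phi k)).
  rewrite (RintegralZl (mu := Om) (f := fun x => f (x + k.+1%:R^-1 *: e) - f x) _ measurableT ib).
  by rewrite (RintegralB measurableT ish ifn) Omega_shift// subrr mulr0.
have [||||| _ _] := @dominated_convergence _ _ _ Om setT measurableT (fun k x => (phi k x)%:E)
   (fun x => ('D_e f x)%:E) (fun x => (C * 2 `^ n.+1%:R * tail x)%:E).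
- by move=> k; apply/measurable_EFinP.
- by apply/measurable_EFinP.
- apply: filterE => x _; apply: cvg_EFin; first exact: nearW.
  apply/cvgrPdist_lt => r r0; have [h h0 hr] := near_point e e x cdf r0.
  near=> k; rewrite /=; have [c ck ->] := phiE k x.
  have := hr (k.+1%:R^-1) c 0; rewrite scale0r addr0; apply => //.
    near: k; have := near_infty_natSinv_lt (PosNum h0).
    by apply: filterS => k /= /ltW.
  by rewrite lexx; have /andP[/ltW] := k1 k.
- apply: (@integrable_tail (C * 2 `^ n.+1%:R)) => //.
    by apply: measurable_funM => //; exact: measurable_tail.
  by move=> x; rewrite ger0_norm// mulr_ge0 ?tail_ge0// mulr_ge0// powR_ge0.
- apply: filterE => x k _; rewrite /= lee_fin; have [c /andP[c0 ck] ->] := phiE k x.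
  apply: le_trans (dfC _) _; rewrite -mulrA ler_wpM2l//; apply: tail_shift_le.
  by rewrite c0; have /andP[_] := k1 k; exact: le_trans.
rewrite (_ : [sequence _]_k = (fun=> 0%E)); last by apply/funext => k; exact: phi0.
move=> /(cvg_lim (@ereal_hausdorff R)); rewrite lim_cst; last exact: ereal_hausdorff.
by move=> E0; rewrite /Rintegral -[X in fine X]E0.
Unshelve. all: by end_near. Qed.

End Omega_decay.

(** * The operator 1 - Delta and Green's formula *)

Section bessel.
Context {R : realType} {n : nat}.

(** The operator [1 - Delta] in the directions [e]. *)
Definition bessel (V : normedModType R) (e : 'I_n -> V) (f : V -> R) : V -> R :=
  fun p => f p - \sum_i 'D_(e i) ('D_(e i) f) p.

Section jets.
Variables (V : normedModType R) (e : 'I_n -> V).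
Implicit Types (f w : V -> R).

Lemma jet_sum (r : seq 'I_n) k (D : set V) lam w (f : 'I_n -> V -> R) :
  (forall p, 0 < lam p) -> (forall i, jet k D lam w (f i)) ->
  jet k D lam (fun p => (size r)%:R * w p) (fun p => \sum_(i <- r) f i p).
Proof.
move=> lam0 jf; elim: r => [|i r IH].
  rewrite (_ : (fun p => \sum_(i <- [::]) f i p) = (fun=> 0)).
    by apply: jet_cst => // p; rewrite normr0 mul0r.
  by apply/funext => p; rewrite big_nil.
rewrite (_ : (fun p => \sum_(i <- i :: r) f i p) = (fun p => f i p + \sum_(i <- r) f i p)).
  by have := jetD (jf i) IH; apply: jet_mono => // p; rewrite /= -[(size r).+1%:R]natr1; lra.
by apply/funext => p; rewrite big_cons.
Qed.

Lemma jet_bessel k w f : jet k.+2 (range e) (fun=> 1) w f ->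
  jet k (range e) (fun=> 1) (fun p => n.+1%:R * w p) (bessel e f).
Proof.
move=> jf; have j2 i : jet k (range e) (fun=> 1) w ('D_(e i) ('D_(e i) f)).
  have [_ _ /(_ (e i))[|_ [_ _ /(_ (e i))[|_]]]] := jf; try by exists i.
  by apply: jet_mono => // p; rewrite !divr1.
have := jetB (jetS (jetS jf)) (jet_sum (enum 'I_n) (fun p => ltr01) j2).
rewrite (_ : (fun p => _ - \sum_(i <- enum 'I_n) _) = bessel e f); last first.
  by apply/funext => p; rewrite /bessel big_enum.
apply: jet_mono => // p; rewrite -[n.+1%:R]natr1 size_enum_ord; lra.
Qed.

Lemma jet_bessel_iter N k w f : jet (N.*2 + k) (range e) (fun=> 1) w f ->
  jet k (range e) (fun=> 1) (fun p => n.+1%:R ^+ N * w p) (iter N (bessel e) f).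
Proof.
elim: N k => [|N IH] k jf.
  by apply: jet_mono jf => // p; rewrite mul1r.
rewrite exprS; have := IH k.+2; rewrite addnS addnS => /(_ jf) /jet_bessel.
by apply: jet_mono => // p; rewrite mulrA.
Qed.

Lemma derive_translate (v u : V) f : (forall p, f (p + v) = f p) ->
  forall p, 'D_u f (p + v) = 'D_u f p.
Proof.
move=> fv p; rewrite /derive.
rewrite (_ : (fun h : R => h^-1 *: (f (h *: u + (p + v)) - f (p + v))) =
  (fun h : R => h^-1 *: (f (h *: u + p) - f p)))//.
by apply/funext => h; rewrite addrA !fv.
Qed.

Lemma bessel_translate N (v : V) f : (forall p, f (p + v) = f p) ->
  forall p, iter N (bessel e) f (p + v) = iter N (bessel e) f p.
Proof.
move=> fv; elim: N => [|N IH] p; first exact: fv.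
rewrite !iterS; move: (iter N _ f) IH => g IH; rewrite /bessel IH.
have E i : 'D_(e i) ('D_(e i) g) (p + v) = 'D_(e i) ('D_(e i) g) p.
  exact: (derive_translate _ (derive_translate _ IH)).
exact: (congr1 (fun t => g p - t) (eq_bigr _ (fun i _ => E i))).
Qed.

Lemma Re_bessel_iter N (w : V -> R[i]) p :
  complex.Re (iter N (fun (f : V -> R[i]) q => f q - laplacian e f q) w p) =
    iter N (bessel e) (@complex.Re R \o w) p /\
  complex.Im (iter N (fun (f : V -> R[i]) q => f q - laplacian e f q) w p) =
    iter N (bessel e) (@complex.Im R \o w) p.
Proof.
have Re_sum (F : 'I_n -> R[i]) : complex.Re (\sum_i F i) = \sum_i complex.Re (F i).
  by apply: (big_morph (@complex.Re R)) => // -[a b] [a' b'].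
have Im_sum (F : 'I_n -> R[i]) : complex.Im (\sum_i F i) = \sum_i complex.Im (F i).
  by apply: (big_morph (@complex.Im R)) => // -[a b] [a' b'].
have ReB (x y : R[i]) : complex.Re (x - y) = complex.Re x - complex.Re y by case: x y => [? ?] [].
have ImB (x y : R[i]) : complex.Im (x - y) = complex.Im x - complex.Im y by case: x y => [? ?] [].
elim: N p => //= N IH p; rewrite /bessel /laplacian ReB ImB Re_sum Im_sum.
set g := iter N _ w in IH *.
have -> : iter N (bessel e) (@complex.Re R \o w) = @complex.Re R \o g.
  by apply/funext => q /=; have [-> _] := IH q.
have -> : iter N (bessel e) (@complex.Im R \o w) = @complex.Im R \o g.
  by apply/funext => q /=; have [_ ->] := IH q.
by [].
Qed.

End jets.

Lemma derive_slice (V W : normedModType R) (phi : W -> V) (f : V -> R) (v : V) (u : W) :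
  (forall q (h : R), phi (h *: u + q) = h *: v + phi q) ->
  'D_u (f \o phi) = 'D_v f \o phi.
Proof.
move=> phiL; apply/funext => q; rewrite /derive /=.
rewrite (_ : (fun h : R => h^-1 *: (f (phi (h *: u + q)) - f (phi q))) =
  (fun h : R => h^-1 *: (f (h *: v + phi q) - f (phi q))))//.
by apply/funext => h; rewrite phiL.
Qed.

Lemma bessel_slice (V W : normedModType R) (phi : W -> V) (e : 'I_n -> V) (e' : 'I_n -> W) N f :
  (forall i q (h : R), phi (h *: e' i + q) = h *: e i + phi q) ->
  iter N (bessel e') (f \o phi) = iter N (bessel e) f \o phi.
Proof.
move=> phiL; elim: N => [//|N IH]; rewrite !iterS IH; move: (iter N _ f) => g.
have E i : 'D_(e' i) ('D_(e' i) (g \o phi)) = 'D_(e i) ('D_(e i) g) \o phi.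
  by rewrite (derive_slice g (phiL i)); exact: derive_slice.
apply/funext => q; apply: (congr1 (fun t => g (phi q) - t)).
by apply: eq_bigr => i _; exact: (congr1 (@^~ q) (E i)).
Qed.

End bessel.

Lemma Rintegral_bigsum d (T : measurableType d) (R : realType) (mu : {measure set T -> \bar R})
    (I : Type) (r : seq I) (h : I -> T -> R) :
  (forall i, mu.-integrable setT (EFin \o h i)) ->
  mu.-integrable setT (EFin \o (fun x => \sum_(i <- r) h i x)) /\
  \int[mu]_x (\sum_(i <- r) h i x) = \sum_(i <- r) \int[mu]_x h i x.
Proof.
move=> ih; elim: r => [|i r [IH1 IH2]].
  rewrite (_ : (fun x => \sum_(i <- [::]) h i x) = (fun=> 0)); last first.
    by apply/funext => x; rewrite big_nil.
  split; first exact: integrable0.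
  rewrite big_nil /Rintegral (_ : (fun=> _) = cst 0%E)// integral0//.
rewrite (_ : (fun x => \sum_(i <- i :: r) h i x) = (fun x => h i x + \sum_(i <- r) h i x)); last first.
  by apply/funext => x; rewrite big_cons.
rewrite big_cons -IH2; split; first exact: (integrableD measurableT (ih i) IH1).
exact: (RintegralD measurableT (ih i) IH1).
Qed.

Section integration_by_parts.
Context {R : realType} (d : nat) {n : nat}.
Local Notation E := 'rV[R]_n.
Local Notation Om := (@Omega_measure R d n).
Implicit Types x y xi : E.
Hypothesis n0 : (0 < n)%N.

Lemma trig_period c (t : R) (z : int) : trig c (t + 2 * pi * z%:~R) = trig c t.
Proof.
have cosz (t' : R) : cos (t' + 2 * pi * z%:~R) = cos t'.
  by rewrite mulrC; case: z => k; rewrite ?NegzE ?mulrNz ?mulNr; [exact: cosDn2pi|exact: cosBn2pi].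
case: c; last exact: cosz.
by rewrite /trig -!cosBpihalf addrAC cosz.
Qed.

Lemma trig'_period c (t : R) (z : int) : trig' c (t + 2 * pi * z%:~R) = trig' c t.
Proof.
by case: c; [exact: (trig_period false)|congr (- _); exact: (trig_period true)].
Qed.

(** Green's formula on Omega; for a frequency [xi] in the dual group the
    trigonometric factor is periodic, so there are no boundary terms. *)
Lemma bessel_parts y xi c (C : R) (g : E -> R) : 0 <= C ->
  jet 2 (range std_basis) (fun=> 1) (fun x => C * tail d x) g ->
  (forall i : 'I_n, (i < d)%N -> forall x, g (x + (2 * pi) *: std_basis i) = g x) ->
  (forall i : 'I_n, (i < d)%N -> exists z : int, xi ord0 i = z%:~R) ->
  \int[Om]_x (bessel std_basis g x * trig c (dotp (x - y) xi)) =
  (1 + dotp xi xi) * \int[Om]_x (g x * trig c (dotp (x - y) xi)).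
Proof.
move=> C0 jg gp xiz.
have [_ _ jg1] := jg.
pose tau x := trig c (dotp (x - y) xi); pose tau' x := trig' c (dotp (x - y) xi).
have cd : continuous (fun x : E => dotp (x - y) xi).
  apply: continuous_sum => i _; apply: contM; last exact: contC.
  rewrite (_ : (fun _ => _) = (fun x : E => x ord0 i - y ord0 i)); last first.
    by apply/funext => x; rewrite !mxE.
  by apply: contD; [exact: continuous_coord|exact: contC].
have ct : continuous tau by exact: cont_comp cd (@continuous_trig R c).
have ct' : continuous tau' by exact: cont_comp cd (@continuous_trig' R c).
have dph i p (h : R) : dotp (h *: std_basis i + p - y) xi = h * xi ord0 i + dotp (p - y) xi.
  by rewrite -addrA dotp_shiftl.
have dt i p : is_derive p (std_basis i) tau (xi ord0 i * tau' p).
  by apply: (is_derive_affine_comp (f := fun x : E => dotp (x - y) xi) (dph i p)); exact: is_derive_trig.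
have dt' i p : is_derive p (std_basis i) tau' (xi ord0 i * - tau p).
  by apply: (is_derive_affine_comp (f := fun x : E => dotp (x - y) xi) (dph i p)); exact: is_derive_trig'.
have tp (i : 'I_n) : (i < d)%N -> forall x, tau (x + (2 * pi) *: std_basis i) = tau x /\
    tau' (x + (2 * pi) *: std_basis i) = tau' x.
  move=> id x; have [z zE] := xiz i id.
  by rewrite /tau /tau' [x + _]addrC !dph zE addrC trig_period trig'_period.
have cg := jet_continuous jg; have gC := jet_le jg.
have cgi (i : 'I_n) := (jg1 (std_basis i) (ex_intro2 _ _ i I erefl)).
have igt (f : E -> R) : continuous f -> (forall x, `|f x| <= C * tail d x) ->
    Om.-integrable setT (EFin \o (fun x => f x * tau x)).
  move=> cf fC; apply: (integrable_tail (d := d) (C := C)) => //.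
    by apply: continuous_measurable1; exact: contM.
  move=> x; rewrite normrM; apply: le_trans (fC x).
  by rewrite ler_piMr// trig_max.
pose D2 i := 'D_(std_basis i) ('D_(std_basis i) g).
have hD2 (i : 'I_n) : [/\ continuous (D2 i), (forall x, `|D2 i x| <= C * tail d x) &
    forall x, is_derive x (std_basis i) ('D_(std_basis i) g) (D2 i x)].
  have [_ [_ _ /(_ (std_basis i) (ex_intro2 _ _ i I erefl))[dd [cD DC _]]]] := cgi i.
  split; first exact: cD.
    by move=> x; have := DC x; rewrite !divr1.
  by move=> x; exact: (derivableP (dd x)).
have part (i : 'I_n) : \int[Om]_x (D2 i x * tau x) = - xi ord0 i ^+ 2 * \int[Om]_x (g x * tau x).
  have [dg [cdg dgC _]] := cgi i; have [cD DC dD] := hD2 i.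
  set e := std_basis i in dg cdg dgC dD *; set k := xi ord0 i.
  have dgC' x : `|'D_e g x| <= C * tail d x by have := dgC x; rewrite divr1.
  (* The derivative of [H] along [e] is the integrand of the difference of the two
     sides. *)
  pose H x := 'D_e g x * tau x - g x * (k * tau' x).
  have dH x : is_derive x e H (D2 i x * tau x + k ^+ 2 * (g x * tau x)).
    have := is_derive_sub (is_derive_mul (dD x) (dt i x))
      (is_derive_mul (derivableP (dg x)) (is_derive_scale k (dt' i x))).
    rewrite -/e -/k (_ : _ - _ = D2 i x * tau x + k ^+ 2 * (g x * tau x)) //; ring.
  have [dH1 dH2] := derive_fun dH.
  have K0 : 0 <= C * (1 + `|k| + k ^+ 2).
    by apply: mulr_ge0 => //; rewrite addr_ge0 ?sqr_ge0// addr_ge0.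
  have t1 x : `|tau x| <= 1 by exact: trig_max.
  have t1' x : `|tau' x| <= 1 by exact: trig'_max.
  have z : \int[Om]_x 'D_e H x = 0.
    apply: (integral_derive0 n0 K0) => //.
    - move=> id x; have [e1 e2] := tp i id x; rewrite /H e1 e2 (gp i id).
      by rewrite (derive_translate _ (gp i id)).
    - apply: contD; first exact: contM.
      by apply: contN; apply: contM => //; apply: contM => //; exact: contC.
    - rewrite dH2; apply: contD; first exact: contM.
      by apply: contM; [exact: contC|exact: contM].
    - move=> x; rewrite /H; apply: le_trans (ler_normB _ _) _; rewrite !normrM.
      have := tail_ge0 d x; set t := tail d x => tt; have k2 := sqr_ge0 k.
      apply: (@le_trans _ _ (C * t * 1 + C * t * (`|k| * 1))).
        apply: lerD; first exact: ler_pM.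
        apply: ler_pM; [exact: normr_ge0|exact: mulr_ge0|exact: gC|].
        exact: ler_wpM2l.
      by have : 0 <= C * t * k ^+ 2; [apply: mulr_ge0 => //; exact: mulr_ge0|]; lra.
    - move=> x; rewrite [X in `|X|](_ : _ = D2 i x * tau x + k ^+ 2 * (g x * tau x)); last first.
        exact: (congr1 (@^~ x) dH2).
      have k2 := sqr_ge0 k; apply: le_trans (ler_normD _ _) _.
      have := tail_ge0 d x; set t := tail d x => tt.
      apply: (@le_trans _ _ (C * t * 1 + k ^+ 2 * (C * t * 1))).
        apply: lerD; first by rewrite normrM; exact: ler_pM.
        rewrite normrM (ger0_norm k2) normrM.
        by apply: ler_wpM2l => //; apply: ler_pM => //; exact: gC.
      have : 0 <= C * t * `|k| by apply: mulr_ge0 => //; exact: mulr_ge0.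
      lra.
  have i1 := igt _ cD DC; have i2 := igt _ cg gC.
  have i3 := integrableZl measurableT (k ^+ 2) i2.
  have : \int[Om]_x (D2 i x * tau x + k ^+ 2 * (g x * tau x)) = 0.
    by rewrite -z; apply: eq_Rintegral => x _; exact: (congr1 (@^~ x) (esym dH2)).
  rewrite (RintegralD measurableT i1 i3).
  by rewrite (RintegralZl (mu := Om) _ measurableT i2) mulNr => /eqP; rewrite addr_eq0 => /eqP.
have ih (i : 'I_n) : Om.-integrable setT (EFin \o (fun x => D2 i x * tau x)).
  by have [cD DC _] := hD2 i; exact: igt.
have [is_ Es] := Rintegral_bigsum (index_enum 'I_n) ih.
rewrite (_ : (fun x => bessel std_basis g x * trig c (dotp (x - y) xi)) =
    (fun x => g x * tau x - \sum_i D2 i x * tau x)); last first.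
  by apply/funext => x; rewrite /bessel mulrBl mulr_suml.
rewrite (RintegralB measurableT (igt _ cg gC) is_) Es.
rewrite (eq_bigr (fun i => - xi ord0 i ^+ 2 * \int[Om]_x (g x * tau x))); last by move=> i _; exact: part.
rewrite -mulr_suml mulrDl mul1r; congr (_ + _); rewrite -mulNr; congr (_ * _).
by rewrite -sumrN /dotp; apply: eq_bigr => i _; rewrite opprK expr2.
Qed.

Lemma bessel_iter_parts N y xi c (C : R) (g : E -> R) : 0 <= C ->
  jet N.*2 (range std_basis) (fun=> 1) (fun x => C * tail d x) g ->
  (forall i : 'I_n, (i < d)%N -> forall x, g (x + (2 * pi) *: std_basis i) = g x) ->
  (forall i : 'I_n, (i < d)%N -> exists z : int, xi ord0 i = z%:~R) ->
  \int[Om]_x (iter N (bessel std_basis) g x * trig c (dotp (x - y) xi)) =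
  (1 + dotp xi xi) ^+ N * \int[Om]_x (g x * trig c (dotp (x - y) xi)).
Proof.
move=> C0 jg gp xiz; elim: N jg => [|N IH] jg; first by rewrite expr0 mul1r.
have jg2 : jet (N.*2 + 2) (range std_basis) (fun=> 1) (fun x => C * tail d x) g.
  by rewrite addnS addn1.
rewrite iterS (@bessel_parts y xi c (n.+1%:R ^+ N * C)) => //.
- by rewrite IH ?exprS ?mulrA//; apply: jet_leq jg2; rewrite leq_addr.
- by rewrite mulr_ge0// exprn_ge0.
- by have := jet_bessel_iter jg2; apply: jet_mono => // x; rewrite mulrA.
- by move=> i id; apply: bessel_translate; exact: gp.
Qed.

End integration_by_parts.

(** * Fubini's theorem for real integrals *)

Section real_Fubini.
Context d1 d2 (T1 : measurableType d1) (T2 : measurableType d2) (R : realType).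
Variables (m1 : {sigma_finite_measure set T1 -> \bar R})
  (m2 : {sigma_finite_measure set T2 -> \bar R}).
Variable f : T1 * T2 -> R.
Hypothesis ifn : (m1 \x m2)%E.-integrable setT (EFin \o f).

Lemma Rintegral_prod12 :
  m1.-integrable setT (EFin \o (fun x => \int[m2]_y f (x, y))) /\
  \int[(m1 \x m2)%E]_z f z = \int[m1]_x \int[m2]_y f (x, y).
Proof.
have iF := integrable_fubini_F ifn.
have mF : measurable_fun setT (fun x => fine (fubini_F m2 (EFin \o f) x)).
  by apply: measurableT_comp => //; exact: measurable_int iF.
split.
  apply: le_integrable iF => //; first by apply/measurable_EFinP.
  move=> x _; rewrite /= -/(fubini_F m2 (EFin \o f) x).
  by rewrite /Rintegral -/(fubini_F m2 (EFin \o f) x); case: (fubini_F _ _ _) => [r| |] //=; rewrite leey.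
rewrite /Rintegral; congr fine; rewrite -(integral12_prod_meas1 ifn).
apply: ae_eq_integral => //; first exact: measurable_int iF.
  by apply/measurable_EFinP.
by apply: filterS (integrable_ae measurableT iF) => x fx _; rewrite fineK// fx.
Qed.

Lemma Rintegral_prod21 :
  \int[(m1 \x m2)%E]_z f z = \int[m2]_y \int[m1]_x f (x, y).
Proof.
have mG0 := measurable_fubini_G ifn.
have mG : measurable_fun setT (fun y => fine (fubini_G m1 (EFin \o f) y)).
  exact: measurableT_comp.
rewrite /Rintegral; congr fine; rewrite -(integral21_prod_meas1 ifn).
apply: ae_eq_integral => //; first by apply/measurable_EFinP.
apply: filterS (ae_integrable2 ifn) => y iy _.
by rewrite fineK//; exact: (integrable_fin_num measurableT iy).
Qed.

End real_Fubini.

Section product_sigma_finite.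
Context d1 d2 (T1 : measurableType d1) (T2 : measurableType d2) (R : realType).
Variables (m1 : {sigma_finite_measure set T1 -> \bar R})
  (m2 : {sigma_finite_measure set T2 -> \bar R}).

(** A named copy of [m1 \x m2], so that products with a third measure elaborate
    as products of sigma-finite measures. *)
Definition sigma_finite_prod : set (T1 * T2) -> \bar R := (m1 \x m2)%E.

HB.instance Definition _ := Measure.on sigma_finite_prod.

HB.instance Definition _ := Measure_isSigmaFinite.Build _ _ _ sigma_finite_prod
  (sigma_finite_product m1 m2).

End product_sigma_finite.

Section triple_integrals.
Context {R : realType} (d : nat) {n : nat}.
Local Notation E := 'rV[R]_n.
Local Notation Om := (@Omega_measure R d n).
Local Notation dual := (@dual_measure R d n).
Implicit Types (x y xi : E).
Hypothesis n0 : (0 < n)%N.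

Definition Omega2 : {sigma_finite_measure set (E * E)%type -> \bar R} :=
  sigma_finite_prod Om Om.

Local Notation Om2 := Omega2.
Local Notation mu3 := (Om2 \x dual)%E.

Definition tail2 (z : E * E) : R := tail d z.1 * tail d z.2.

Lemma tail2_ge0 z : 0 <= tail2 z.
Proof. by rewrite mulr_ge0 ?tail_ge0. Qed.

Lemma measurable_tail2 : measurable_fun setT tail2.
Proof.
by apply: measurable_funM; apply: (measurableT_comp (@measurable_tail R d n)).
Qed.

Let tc0 : 0 <= @tail_const R n. Proof. exact: tail_const_ge0. Qed.

Lemma integral_tail2 : (\int[Om2]_z (tail2 z)%:E <= (@tail_const R n ^+ 2)%:E)%E.
Proof.
have mt := @measurable_tail R d n.
rewrite (@fubini_tonelli1 _ _ _ _ _ Om Om (fun z => (tail2 z)%:E)); last 2 first.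
- by apply/measurable_EFinP; exact: measurable_tail2.
- by move=> z; rewrite lee_fin tail2_ge0.
apply: (@le_trans _ _ (\int[Om]_x ((@tail_const R n)%:E * (tail d x)%:E))%E).
  apply: ge0_le_integral => //.
  - by move=> x _; apply: integral_ge0 => y _; rewrite lee_fin tail2_ge0.
  - apply: (@measurable_fun_fubini_tonelli_F _ _ _ _ _ _ (fun z => (tail2 z)%:E)).
      by apply/measurable_EFinP; exact: measurable_tail2.
    by move=> z; rewrite lee_fin tail2_ge0.
  - by apply: measurable_funeM; apply/measurable_EFinP.
  move=> x _; rewrite /fubini_F /tail2 /=.
  rewrite (_ : \int[Om]_y _ = \int[Om]_y ((tail d x)%:E * (tail d y)%:E))%E//.
  rewrite ge0_integralZl_EFin ?tail_ge0//; last 2 first.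
  - by move=> y _; rewrite lee_fin tail_ge0.
  - by apply/measurable_EFinP.
  rewrite muleC; apply: lee_wpmul2r; first by rewrite lee_fin tail_ge0.
  exact: integral_tail.
rewrite ge0_integralZl_EFin//; last 2 first.
- by move=> y _; rewrite lee_fin tail_ge0.
- by apply/measurable_EFinP.
rewrite [leRHS](_ : _ = ((@tail_const R n)%:E * (@tail_const R n)%:E)%E); last by rewrite -EFinM expr2.
apply: lee_wpmul2l; first by rewrite lee_fin.
exact: integral_tail.
Qed.

Lemma integrable_tail2 (C : R) (f : E * E -> R) : measurable_fun setT f ->
  (forall z, `|f z| <= C * tail2 z) -> Om2.-integrable setT (EFin \o f).
Proof.
move=> mf fC.
have it0 : Om2.-integrable setT (EFin \o tail2).
  apply/integrableP; split; first by apply/measurable_EFinP; exact: measurable_tail2.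
  apply: le_lt_trans (ltry (@tail_const R n ^+ 2)); apply: le_trans integral_tail2.
  rewrite le_eqVlt; apply/orP; left; apply/eqP; apply: eq_integral => x _ /=.
  by rewrite ger0_norm ?tail2_ge0.
have it := integrableZl measurableT C it0.
apply: le_integrable it => //; first by apply/measurable_EFinP.
by move=> x _ /=; rewrite lee_fin (le_trans (fC x))// ler_norm.
Qed.

(** The integrands that occur below decay in [x] and [y], and in [xi] with a weight.
    *)
Definition dominated (w : E -> R) (G : E * E * E -> R) : Prop :=
  measurable_fun setT G /\ forall p, `|G p| <= tail2 p.1 * w p.2.

Lemma dominated_integrable (w : E -> R) (I : R) G : measurable_fun setT w ->
  (forall xi, 0 <= w xi) -> (\int[dual]_xi (w xi)%:E <= I%:E)%E -> dominated w G ->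
  mu3.-integrable setT (EFin \o G) /\ `|\int[mu3]_p G p| <= @tail_const R n ^+ 2 * I.
Proof.
move=> mw w0 wI [mG Gw].
have I0 : 0 <= I by rewrite -lee_fin; apply: le_trans wI; apply: integral_ge0 => xi _; rewrite lee_fin.
have mW : measurable_fun setT (fun p : E * E * E => tail2 p.1 * w p.2).
  apply: measurable_funM; first exact: (measurableT_comp measurable_tail2).
  exact: (measurableT_comp mw).
have W0 (p : E * E * E) : 0 <= tail2 p.1 * w p.2 by rewrite mulr_ge0 ?tail2_ge0.
have le : (\int[mu3]_p `|G p|%:E <= (@tail_const R n ^+ 2 * I)%:E)%E.
  apply: (@le_trans _ _ (\int[mu3]_p (tail2 p.1 * w p.2)%:E)%E).
    apply: ge0_le_integral => //.
    - by apply/measurable_EFinP; exact: measurableT_comp.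
    - by apply/measurable_EFinP.
    - by move=> p _; rewrite lee_fin.
  rewrite (@fubini_tonelli1 _ _ _ _ _ Om2 dual (fun p => (tail2 p.1 * w p.2)%:E)); last 2 first.
  - by apply/measurable_EFinP.
  - by move=> z; rewrite lee_fin W0.
  apply: (@le_trans _ _ (\int[Om2]_z (I%:E * (tail2 z)%:E))%E).
    apply: ge0_le_integral => //.
    - by move=> x _; apply: integral_ge0 => y _; rewrite lee_fin W0.
    - apply: (@measurable_fun_fubini_tonelli_F _ _ _ _ _ _ (fun p => (tail2 p.1 * w p.2)%:E)).
        by apply/measurable_EFinP.
      by move=> z; rewrite lee_fin W0.
    - by apply: measurable_funeM; apply/measurable_EFinP; exact: measurable_tail2.
    move=> z _; rewrite /fubini_F /=.
    rewrite (_ : \int[dual]_y _ = \int[dual]_y ((tail2 z)%:E * (w y)%:E))%E//.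
    rewrite ge0_integralZl_EFin ?tail2_ge0//; last 2 first.
    - by move=> y _; rewrite lee_fin.
    - by apply/measurable_EFinP.
    by rewrite muleC; apply: lee_wpmul2r => //; rewrite lee_fin tail2_ge0.
  rewrite ge0_integralZl_EFin//; last 2 first.
  - by move=> y _; rewrite lee_fin tail2_ge0.
  - by apply/measurable_EFinP; exact: measurable_tail2.
  rewrite mulrC EFinM; apply: lee_wpmul2l; first by rewrite lee_fin.
  exact: integral_tail2.
split.
  apply/integrableP; split; first by apply/measurable_EFinP.
  by apply: le_lt_trans le _; rewrite ltry.
rewrite -lee_fin; apply: le_trans le; exact: normr_Rintegral_le.
Qed.

Lemma measurable_slice_xi (G : E * E * E -> R) xi : measurable_fun setT G ->
  measurable_fun setT (fun z => G (z, xi)).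
Proof. by move=> mG; exact: (measurableT_comp mG (pair2_measurable xi)). Qed.

Lemma measurable_slice_x (G : E * E * E -> R) y xi : measurable_fun setT G ->
  measurable_fun setT (fun x => G (x, y, xi)).
Proof.
by move=> mG; exact: (measurableT_comp (measurable_slice_xi xi mG) (pair2_measurable y)).
Qed.

(** Integrate in [x] first: the frequencies outside of the dual group form a null
    set. *)
Lemma triple_integral_eq (w : E -> R) (I : R) G G' : measurable_fun setT w ->
  (forall xi, 0 <= w xi) -> (\int[dual]_xi (w xi)%:E <= I%:E)%E ->
  dominated w G -> dominated w G' ->
  (forall xi, (forall i : 'I_n, (i < d)%N -> exists z : int, xi ord0 i = z%:~R) ->
     forall y, \int[Om]_x G (x, y, xi) = \int[Om]_x G' (x, y, xi)) ->
  \int[mu3]_p G p = \int[mu3]_p G' p.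
Proof.
move=> mw w0 wI dG dG' GG'.
have [iG _] := dominated_integrable mw w0 wI dG.
have [iG' _] := dominated_integrable mw w0 wI dG'.
have i2 H xi : dominated w H -> Om2.-integrable setT (EFin \o (fun z => H (z, xi))).
  move=> [mH Hw]; apply: (@integrable_tail2 (w xi)); first exact: measurable_slice_xi.
  by move=> z; rewrite mulrC; exact: (Hw (z, xi)).
have E1 H xi : dominated w H -> \int[Om2]_z H (z, xi) = \int[Om]_y \int[Om]_x H (x, y, xi).
  by move=> dH; exact: (Rintegral_prod21 (m1 := Om) (m2 := Om) (i2 H xi dH)).
rewrite (Rintegral_prod21 (m1 := Om2) (m2 := dual) iG).
rewrite (Rintegral_prod21 (m1 := Om2) (m2 := dual) iG').
have mR H : dominated w H -> measurable_fun setT (fun xi => \int[Om2]_z H (z, xi)).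
  move=> dH; have [iH _] := dominated_integrable mw w0 wI dH.
  apply: measurableT_comp => //; exact: (measurable_fubini_G iH).
rewrite /Rintegral; congr fine; apply: ae_eq_integral => //.
- by apply/measurable_EFinP; exact: mR dG.
- by apply/measurable_EFinP; exact: mR dG'.
apply: filterS (dual_support_ae d (n := n)) => xi hxi _; congr EFin.
rewrite -/(Rintegral Om2 setT (fun z => G (z, xi))) -/(Rintegral Om2 setT (fun z => G' (z, xi))).
rewrite (E1 G xi dG) (E1 G' xi dG'); apply: eq_Rintegral => y _; exact: GG'.
Qed.

End triple_integrals.

(** * The distribution kernel as a limit of regularized integrals *)

Section regularized_integrals.
Context {R : realType} (d : nat) {n : nat}.
Local Notation E := 'rV[R]_n.
Local Notation Om := (@Omega_measure R d n).
Local Notation dual := (@dual_measure R d n).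
Local Notation mu3 := (@Omega2 R d n \x dual)%E.
Local Notation jap := (@japanese R n).
Local Notation phase p := (dotp (p.1.1 - p.1.2) p.2).
Implicit Types (x y xi : E) (p : E * E * E).
Variables (m s : R) (q N : nat).
Hypotheses (n0 : (0 < n)%N) (s0 : 0 < s) (s2 : s <= 2) (sm : s + s <= - m)
  (nq : (n.+1 <= 2 * q)%N) (nN : (n <= N.*2)%N).

Lemma cvg_rate (u : nat -> R) (l C : R) : 0 <= C ->
  (forall M, `|u M - l| <= C * M.+1%:R `^ (- s)) -> u @ \oo --> l.
Proof.
move=> C0 h; apply/cvgrPdist_le => e e0.
have C1 : 0 < C + 1 by rewrite ltr_wpDl.
have [N0 hN] := rate_le s0 (divr_gt0 e0 C1); exists N0 => // M NM.
rewrite /= distrC; apply: le_trans (h M) _.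
apply: (@le_trans _ _ (C * (e / (C + 1)))); first by rewrite ler_wpM2l// hN.
by rewrite mulrCA ler_piMr ?(ltW e0)// ler_pdivrMr// mul1r lerDl.
Qed.

Lemma powR_sum xi (t t' : R) : jap xi `^ (t + t') = jap xi `^ t * jap xi `^ t'.
Proof. by rewrite powRD// (gt_eqF (japanese_gt0 xi)) implybT. Qed.

Lemma bessel_weight_le xi : (1 + enorm xi ^+ 2) ^- N <= 2 ^+ N * jap xi `^ (- N.*2%:R).
Proof.
have j0 := japanese_gt0 xi; have e2 := sqr_ge0 (enorm xi).
have p0 : 0 < 1 + enorm xi ^+ 2 by rewrite ltr_wpDr.
rewrite powRN powR_mulrn ?(ltW j0)// -[2 ^+ N]invrK -invfM lef_pV2 ?posrE ?mulr_gt0 ?invr_gt0 ?exprn_gt0//.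
rewrite ler_pdivrMl ?exprn_gt0// -mul2n exprM -exprMn lerXn2r ?nnegrE ?sqr_ge0// ?mulr_ge0 ?(ltW p0)//.
rewrite /japanese; have := sqr_ge0 (1 - enorm xi); set e := enorm xi; nra.
Qed.

Variables (F : E * E * E -> R) (C : R).
Hypotheses (C0 : 0 <= C)
  (jF : jet N.*2 (range dx) (fun=> 1) (fun p => C * jap p.2 `^ m * tail2 d p.1) F)
  (Fp : forall i : 'I_n, (i < d)%N -> forall p, F (p + (2 * pi) *: dx i) = F p).

Local Notation P := (iter N (bessel dx) F).

Let jP : jet 0 (range dx) (fun=> 1) (fun p => n.+1%:R ^+ N * (C * jap p.2 `^ m * tail2 d p.1)) P.
Proof. by apply: jet_bessel_iter; rewrite addn0. Qed.

Let M1 (M : nat) : 1 <= M.+1%:R :> R. Proof. by rewrite ler1n. Qed.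

Let cont3 c : continuous (fun p => trig c (phase p)).
Proof. exact: (cont_comp (@continuous_phase R n) (@continuous_trig R c)). Qed.

Let cont_cut M : continuous (fun p : E * E * E => cutoff M.+1%:R q p.2).
Proof. by apply: (cont_comp (@cont_snd (E * E)%type E)); exact: continuous_cutoff. Qed.

Let contB : continuous (fun p : E * E * E => (1 + enorm p.2 ^+ 2) ^- N).
Proof.
move=> p; have nz : (1 + enorm p.2 ^+ 2) ^+ N != 0.
  by apply: expf_neq0; rewrite gt_eqF// ltr_wpDr// sqr_ge0.
apply: (cvgV nz).
have c1 : continuous (fun p : E * E * E => 1 + enorm p.2 ^+ 2).
  apply: contD; first exact: contC.
  have ce : continuous (fun p : E * E * E => enorm p.2).
    exact: (cont_comp (@cont_snd (E * E)%type E) (@continuous_enorm R n)).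
  rewrite (_ : (fun p => enorm p.2 ^+ 2) = (fun p : E * E * E => enorm p.2 * enorm p.2)).
    exact: contM.
  by apply/funext => p'; rewrite expr2.
exact: (cont_comp c1 (@exprn_continuous R N)).
Qed.

(* The transferred integrand has order [m - 2 N = - be - s] in [xi]. Since [be > n], it
   stays integrable after the loss of [s] orders to a factor [1 - cutoff]. *)
Let be := N.*2%:R - m - s.

Let nbe : n%:R < be.
Proof.
have : n%:R <= N.*2%:R :> R by rewrite ler_nat.
by have := sm; have := s0; rewrite /be; move: (N.*2%:R : R) (n%:R : R) => a b *; lra.
Qed.

Let weightP xi : jap xi `^ m * (1 + enorm xi ^+ 2) ^- N <= 2 ^+ N * jap xi `^ (- be - s).
Proof.
apply: le_trans (ler_wpM2l (powR_ge0 _ _) (bessel_weight_le xi)) _.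
rewrite mulrCA -powR_sum ler_wpM2l ?exprn_ge0// /be.
rewrite (_ : m - N.*2%:R = - (N.*2%:R - m - s) - s)//; ring.
Qed.

Definition regularized c M p : R := F p * cutoff M.+1%:R q p.2 * trig c (phase p).

(** The integrand of [amplitude_kernel], real or imaginary part of the exponential
    apart, in which [(1 - Delta) ^ N] acts on [F]. *)
Definition transferred c p : R := trig c (phase p) * ((1 + enorm p.2 ^+ 2) ^- N * P p).

Let cw (K t : R) : 0 <= K -> n%:R < t -> [/\ measurable_fun setT (fun xi => K * jap xi `^ (- t)),
  forall xi, 0 <= K * jap xi `^ (- t) &
  (\int[dual]_xi (K * jap xi `^ (- t))%:E <= (K * @japanese_const R n t)%:E)%E].
Proof.
move=> K0 nt; have mK : measurable_fun setT (fun xi => K * jap xi `^ (- t)).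
  apply: measurable_funM => //; apply: (measurableT_comp (measurable_powR _)).
  exact: continuous_measurable1 (@continuous_japanese R n).
have p0 xi : 0 <= K * jap xi `^ (- t) by rewrite mulr_ge0 ?powR_ge0.
split => //; have [|_] := @integrable_decay R d n t K (fun xi => K * jap xi `^ (- t)) n0 nt K0 mK.
  by move=> xi; rewrite ger0_norm.
by under eq_integral do rewrite ger0_norm//.
Qed.

Let K1 : R := n.+1%:R ^+ N * C.
Let K10 : 0 <= K1. Proof. by rewrite mulr_ge0// exprn_ge0. Qed.

Let P_le p : `|P p| <= K1 * jap p.2 `^ m * tail2 d p.1.
Proof. by have := jet_le jP p; rewrite -!mulrA. Qed.

Let B0 p : 0 <= (1 + enorm p.2 ^+ 2) ^- N.
Proof. by rewrite invr_ge0 exprn_ge0// addr_ge0// sqr_ge0. Qed.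

Let t20 (z : E * E) : 0 <= tail2 d z. Proof. exact: tail2_ge0. Qed.

Let transferred_le (chi : E -> R) c p (K t : R) : 0 <= chi p.2 <= K * jap p.2 `^ t ->
  `|transferred c p * chi p.2| <= tail2 d p.1 * (K1 * 2 ^+ N * K * jap p.2 `^ (t - s - be)).
Proof.
move=> /andP[x0 xK]; rewrite !normrM (ger0_norm x0) (ger0_norm (B0 p)).
have := weightP p.2; set B := _ ^- N => wB; have B0' : 0 <= B by exact: (B0 p).
have K0 : 0 <= K * jap p.2 `^ t by exact: le_trans xK.
apply: (@le_trans _ _ (1 * (B * (K1 * jap p.2 `^ m * tail2 d p.1)) * (K * jap p.2 `^ t))).
  apply: ler_pM => //; first by rewrite !mulr_ge0.
  by apply: ler_pM; [exact: normr_ge0|exact: mulr_ge0|exact: trig_max|exact: ler_wpM2l].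
rewrite [leLHS](_ : _ = tail2 d p.1 * (K1 * (K * jap p.2 `^ t) * (jap p.2 `^ m * B))); last by ring.
apply: ler_wpM2l; first exact: t20.
apply: (@le_trans _ _ (K1 * (K * jap p.2 `^ t) * (2 ^+ N * jap p.2 `^ (- be - s)))).
  by apply: ler_wpM2l => //; exact: mulr_ge0.
rewrite (_ : t - s - be = t + (- be - s)); last by ring.
rewrite powR_sum le_eqVlt; apply/orP; left; apply/eqP; ring.
Qed.

Lemma measurable_transferred c : measurable_fun setT (transferred c).
Proof.
apply: continuous_measurable3; apply: contM; first exact: cont3.
by apply: contM; [exact: contB|exact: jet_continuous jP].
Qed.

Lemma transferred_integrable c : mu3.-integrable setT (EFin \o transferred c).
Proof.
have K20 : 0 <= K1 * 2 ^+ N * 1 by rewrite !mulr_ge0 ?exprn_ge0.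
have nbs : n%:R < be + s by rewrite ltr_wpDr// ltW.
have [h1 h2 h3] := cw K20 nbs.
have [] // := dominated_integrable n0 h1 h2 h3 (G := transferred c).
split; first exact: measurable_transferred.
move=> p; have := @transferred_le (fun=> 1) c p 1 0.
by rewrite powRr0 mulr1 lexx ler01 => /(_ isT); rewrite mulr1 sub0r -opprD [s + be]addrC.
Qed.

Let cut01 M xi : 0 <= cutoff M.+1%:R q xi <= 1.
Proof. by rewrite cutoff_ge0 ?cutoff_le1. Qed.

Lemma regularized_dominated c M : exists2 K, 0 <= K &
  dominated d (fun xi => K * jap xi `^ (- n.+1%:R)) (regularized c M).
Proof.
exists (C * (2 * M.+1%:R ^+ 2) ^+ q); first by rewrite mulr_ge0// exprn_ge0// mulr_ge0// sqr_ge0.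
split.
  apply: continuous_measurable3; apply: contM; last exact: cont3.
  by apply: contM; [exact: jet_continuous jF|exact: cont_cut].
move=> p; rewrite !normrM (ger0_norm (cutoff_ge0 q p.2 (M1 M))).
have Fl := jet_le jF p.
apply: (@le_trans _ _ ((C * jap p.2 `^ m * tail2 d p.1) *
   ((2 * M.+1%:R ^+ 2) ^+ q * jap p.2 `^ (- (2 * q)%:R)) * 1)).
  apply: ler_pM; rewrite ?trig_max ?mulr_ge0//; first by have /andP[] := cut01 M p.2.
  by apply: ler_pM (cutoff_decay q p.2 (M1 M)) => //; have /andP[] := cut01 M p.2.
set D := (2 * _) ^+ q; have D0 : 0 <= D by rewrite exprn_ge0// mulr_ge0// sqr_ge0.
rewrite [leLHS](_ : _ = tail2 d p.1 * (C * D * (jap p.2 `^ m * jap p.2 `^ (- (2 * q)%:R)))); last by ring.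
rewrite ler_wpM2l// ler_wpM2l ?mulr_ge0// -powR_sum ler_powR ?japanese_ge1//.
have : n.+1%:R <= (2 * q)%:R :> R by rewrite ler_nat.
by have := sm; have := s0; move: ((2 * q)%:R : R) (n.+1%:R : R) => a b *; lra.
Qed.

Lemma regularized_integrable c M : mu3.-integrable setT (EFin \o regularized c M).
Proof.
have [K K0 dK] := regularized_dominated c M.
have nn : n%:R < n.+1%:R :> R by rewrite ltr_nat.
by have [h1 h2 h3] := cw K0 nn; have [] := dominated_integrable n0 h1 h2 h3 dK.
Qed.

(** Integration by parts in [x], at fixed [y] and [xi]: the integrals are absolutely
    convergent thanks to the cutoff, which does not depend on [x]. *)
Let by_parts c M : \int[mu3]_p regularized c M p =
  \int[mu3]_p (transferred c p * cutoff M.+1%:R q p.2).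
Proof.
have [K K0 [mG GK]] := regularized_dominated c M.
have nn : n%:R < n.+1%:R :> R by rewrite ltr_nat.
pose K2 := K1 * 2 ^+ N * (2 * M.+1%:R ^+ 2) ^+ q.
have K20 : 0 <= K2.
  by apply: mulr_ge0; [rewrite mulr_ge0// exprn_ge0|rewrite exprn_ge0// mulr_ge0// sqr_ge0].
have KK0 : 0 <= K + K2 by exact: addr_ge0.
have [h1 h2 h3] := cw KK0 nn.
apply: (triple_integral_eq n0 h1 h2 h3).
- split => // p; apply: le_trans (GK p) _; rewrite ler_wpM2l// ler_wpM2r ?powR_ge0//.
  by rewrite lerDl.
- split.
    apply: measurable_funM; first exact: measurable_transferred.
    by apply: continuous_measurable3; exact: cont_cut.
  move=> p; apply: le_trans.
    apply: (@transferred_le (cutoff M.+1%:R q) c p ((2 * M.+1%:R ^+ 2) ^+ q) (- (2 * q)%:R)).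
    by have /andP[-> _] := cut01 M p.2; apply: le_trans (cutoff_decay q p.2 (M1 M)).
  rewrite ler_wpM2l// -/K2; apply: ler_pM => //; first exact: powR_ge0.
    by rewrite lerDr.
  rewrite ler_powR ?japanese_ge1//.
  have : n.+1%:R <= (2 * q)%:R :> R by rewrite ler_nat.
  by have := nbe; have := s0; have := ler0n R n; move: ((2 * q)%:R : R) (n.+1%:R : R) (n%:R : R) be => a b e f *; lra.
move=> xi hxi y; have [c1 c2] := slice_xP y xi.
have jy : jet N.*2 (range std_basis) (fun=> 1) (fun x => (C * jap xi `^ m * tail d y) * tail d x)
    (fun x => F (x, y, xi)).
  have := jet_slice_x y xi jF; apply: jet_mono => // x; rewrite /tail2/=.
  by rewrite -!mulrA [tail d x * _]mulrC.
have Cy : 0 <= C * jap xi `^ m * tail d y by rewrite !mulr_ge0 ?powR_ge0// tail_ge0.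
have Fpy (i : 'I_n) : (i < d)%N -> forall x, F (x + (2 * pi) *: std_basis i, y, xi) = F (x, y, xi).
  move=> id x; rewrite addrC c2 addrC; exact: Fp.
have parts := bessel_iter_parts n0 y c Cy jy Fpy hxi.
have Pslice : (fun x => P (x, y, xi)) = iter N (bessel std_basis) (fun x => F (x, y, xi)).
  have Q := @bessel_slice R n _ _ (fun x : E => (x, y, xi)) dx std_basis N F
    (fun i z h => c2 (std_basis i) z h).
  exact: (esym Q).
have i1 : Om.-integrable setT (EFin \o (fun x => F (x, y, xi) * trig c (dotp (x - y) xi))).
  apply: (integrable_tail (C := C * jap xi `^ m * tail d y) n0).
    apply: (@measurable_slice_x _ n (fun p => F p * trig c (phase p)) y xi).
    by apply: continuous_measurable3; apply: contM; [exact: jet_continuous jF|exact: cont3].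
  by move=> x; rewrite normrM; apply: le_trans (jet_le jy x); rewrite ler_piMr// trig_max.
have i2 : Om.-integrable setT (EFin \o (fun x => P (x, y, xi) * trig c (dotp (x - y) xi))).
  apply: (integrable_tail (C := K1 * jap xi `^ m * tail d y) n0).
    apply: (@measurable_slice_x _ n (fun p => P p * trig c (phase p)) y xi).
    by apply: continuous_measurable3; apply: contM; [exact: jet_continuous jP|exact: cont3].
  move=> x; rewrite normrM; apply: (@le_trans _ _ `|P (x, y, xi)|).
    by rewrite ler_piMr// trig_max.
  by apply: le_trans (P_le _) _; rewrite /tail2 /= -!mulrA [tail d x * _]mulrC.
set chi := cutoff M.+1%:R q xi; set B := (1 + enorm xi ^+ 2) ^- N.
transitivity (chi * \int[Om]_x (F (x, y, xi) * trig c (dotp (x - y) xi))).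
  rewrite -(RintegralZl (mu := Om) _ measurableT i1).
  by apply: eq_Rintegral => x _; rewrite /regularized /= -/chi; ring.
transitivity (chi * B * \int[Om]_x (P (x, y, xi) * trig c (dotp (x - y) xi))); last first.
  rewrite -(RintegralZl (mu := Om) _ measurableT i2).
  by apply: eq_Rintegral => x _; rewrite /transferred /= -/chi -/B; ring.
have -> : \int[Om]_x (P (x, y, xi) * trig c (dotp (x - y) xi)) =
    (1 + dotp xi xi) ^+ N * \int[Om]_x (F (x, y, xi) * trig c (dotp (x - y) xi)).
  by rewrite -parts; apply: eq_Rintegral => x _; rewrite -Pslice.
rewrite mulrA -[chi * B * _]mulrA /B -sqr_enorm mulVf ?mulr1//.
by apply: expf_neq0; rewrite gt_eqF// ltr_wpDr// sqr_ge0.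
Qed.

(** The regularized integrals converge to the absolutely convergent integral that
    defines the distribution kernel. *)
Lemma regularized_cvg c :
  (fun M => \int[mu3]_p regularized c M p) @ \oo --> \int[mu3]_p transferred c p.
Proof.
have s02 : 0 <= s <= 2 by rewrite (ltW s0).
have [k k0 hk] := @jet_one_sub_cutoff R n 0 q s s02.
pose i0 : 'I_n := Ordinal n0.
have omc M xi : 0 <= 1 - cutoff M.+1%:R q xi <= k * M.+1%:R `^ (- s) * jap xi `^ s.
  have /andP[c1 c2] := cut01 M xi; rewrite subr_ge0 c2/=.
  have := jet_le (hk _ i0 (M1 M)) xi; rewrite ger0_norm ?subr_ge0// => le.
  apply: le_trans le _; rewrite powRM ?(ltW (japanese_gt0 xi)) ?invr_ge0//.
  rewrite -(powR_inv1 (ler0n R M.+1)) -powRrM mulN1r -mulrA ler_wpM2l//.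
  by rewrite mulrC.
pose K := K1 * 2 ^+ N * k.
have K0 : 0 <= K by rewrite !mulr_ge0// exprn_ge0.
have J0 : 0 <= @japanese_const R n be by exact: japanese_const_ge0.
apply: (@cvg_rate _ _ (@tail_const R n ^+ 2 * (K * @japanese_const R n be))).
  by rewrite mulr_ge0 ?sqr_ge0// mulr_ge0.
move=> M; rewrite by_parts.
have KM0 : 0 <= K * M.+1%:R `^ (- s) by rewrite mulr_ge0// powR_ge0.
have [h1 h2 h3] := cw KM0 nbe.
pose G p := transferred c p * (1 - cutoff M.+1%:R q p.2).
have dG : dominated d (fun xi => K * M.+1%:R `^ (- s) * jap xi `^ (- be)) G.
  split.
    apply: measurable_funM; first exact: measurable_transferred.
    by apply: measurable_funB => //; apply: continuous_measurable3; exact: cont_cut.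
  move=> p; have := @transferred_le (fun xi => 1 - cutoff M.+1%:R q xi) c p _ _ (omc M p.2).
  rewrite subrr sub0r [X in _ * (X * _)](_ : _ = K * M.+1%:R `^ (- s))//.
  by rewrite /K; ring.
have [iG] := dominated_integrable n0 h1 h2 h3 dG.
rewrite [_ * M.+1%:R `^ _ * _]mulrAC !mulrA => le; apply: le_trans le.
have iT := transferred_integrable c.
have iB : mu3.-integrable setT (EFin \o (fun p => transferred c p * cutoff M.+1%:R q p.2)).
  have := integrableB measurableT iT iG.
  by apply: eq_integrable => // p _ /=; rewrite /G -EFinB; congr EFin; ring.
rewrite -(RintegralB measurableT iB iT) -normrN le_eqVlt; apply/orP; left; apply/eqP.
rewrite -mulN1r -(RintegralZl (mu := mu3)) //; last exact: (integrableB measurableT iB iT).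
congr (`|_|); apply: eq_Rintegral => p _; rewrite /G; ring.
Qed.

End regularized_integrals.

(** * Pairings of integral operators with test functions *)

Section pairing.
Context {R : realType} (d : nat) {n : nat}.
Local Notation E := 'rV[R]_n.
Local Notation Om := (@Omega_measure R d n).
Local Notation Om2 := (@Omega2 R d n).
Implicit Types (K phi : E * E -> R) (f g : E -> R) (x y : E).
Hypothesis n0 : (0 < n)%N.

Lemma tail_le1 x : tail d x <= 1.
Proof.
by rewrite -(powRr0 (1 + height d x)) ler_powR ?lerDl ?height_ge0// oppr_le0.
Qed.

Lemma pairing_integrable K phi (B C : R) : 0 <= B -> 0 <= C -> schur_bounded Om K B ->
  measurable_fun setT phi -> (forall z, `|phi z| <= C * tail d z.1) ->
  Om2.-integrable setT (EFin \o (fun z => K z * phi z)) /\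
  `|\int[Om2]_z (K z * phi z)| <= C * B * @tail_const R n.
Proof.
move=> B0 C0 [mK KB _] mphi phiC.
have mKp : measurable_fun setT (fun z => K z * phi z) by exact: measurable_funM.
have maK : measurable_fun setT (fun z => `|K z * phi z|%:E).
  by apply/measurable_EFinP; exact: measurableT_comp.
have le : (\int[Om2]_z `|K z * phi z|%:E <= (C * B * @tail_const R n)%:E)%E.
  rewrite (@fubini_tonelli1 _ _ _ _ _ Om Om (fun z => `|K z * phi z|%:E)) //.
  apply: (@le_trans _ _ (\int[Om]_x ((C * B)%:E * (tail d x)%:E))%E).
    apply: ae_ge0_le_integral => //.
    - by move=> x _; apply: integral_ge0.
    - exact: (@measurable_fun_fubini_tonelli_F _ _ _ _ _ _ (fun z => `|K z * phi z|%:E)).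
    - by move=> x _; rewrite -EFinM lee_fin !mulr_ge0// tail_ge0.
    - by apply: measurable_funeM; apply/measurable_EFinP; exact: measurable_tail.
    apply: filterS KB => x KBx _; rewrite /fubini_F/=.
    have mKx : measurable_fun setT (fun y => K (x, y)) by exact: (measurableT_comp mK (pair1_measurable x)).
    apply: (@le_trans _ _ (\int[Om]_y ((C * tail d x)%:E * `|K (x, y)|%:E))%E).
      apply: ge0_le_integral => //.
      - by apply/measurable_EFinP; apply: measurableT_comp => //; exact: (measurableT_comp mKp (pair1_measurable x)).
      - by apply: measurable_funeM; apply/measurable_EFinP; exact: measurableT_comp.
      by move=> y _; rewrite -EFinM lee_fin normrM mulrC ler_wpM2r//; exact: (phiC (x, y)).
    rewrite ge0_integralZl_EFin//; last 2 first.
    - by apply/measurable_EFinP; exact: measurableT_comp.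
    - by rewrite mulr_ge0// tail_ge0.
    rewrite [leRHS](_ : _ = (C * tail d x)%:E * B%:E)%E; last first.
      by rewrite -!EFinM; congr EFin; ring.
    apply: lee_wpmul2l => //.
    by rewrite lee_fin mulr_ge0// tail_ge0.
  rewrite ge0_integralZl_EFin//; last 3 first.
  - by move=> x _; rewrite lee_fin tail_ge0.
  - by apply/measurable_EFinP; exact: measurable_tail.
  - exact: mulr_ge0.
  rewrite [leRHS](_ : _ = (C * B)%:E * (@tail_const R n)%:E)%E; last by rewrite -EFinM.
  apply: lee_wpmul2l; first by rewrite lee_fin mulr_ge0.
  exact: integral_tail.
split.
  apply/integrableP; split; first by apply/measurable_EFinP.
  by apply: le_lt_trans le _; rewrite ltry.
by rewrite -lee_fin; apply: le_trans le; exact: normr_Rintegral_le.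
Qed.

(** Fubini's theorem applies because the kernel is integrable in each variable, [f]
    is bounded and [g] integrable. *)
Lemma pairing_kernel_op K (B Cf Cg : R) f g : 0 <= B -> 0 <= Cf -> 0 <= Cg ->
  schur_bounded Om K B -> measurable_fun setT f -> measurable_fun setT g ->
  (forall x, `|f x| <= Cf) -> (forall x, `|g x| <= Cg * tail d x) ->
  Om.-integrable setT (EFin \o (fun x => kernel_op Om K f x * g x)) /\
  \int[Om]_x (kernel_op Om K f x * g x) = \int[Om2]_z (K z * (g z.1 * f z.2)).
Proof.
move=> B0 Cf0 Cg0 sK mf mg fC gC; have [mK KB _] := sK.
have mphi : measurable_fun setT (fun z : E * E => g z.1 * f z.2).
  by apply: measurable_funM; [exact: (measurableT_comp mg)|exact: (measurableT_comp mf)].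
have phiC (z : E * E) : `|g z.1 * f z.2| <= Cg * Cf * tail d z.1.
  by rewrite normrM mulrAC ler_pM.
have CC : 0 <= Cg * Cf by exact: mulr_ge0.
have [iKp _] := pairing_integrable B0 CC sK mphi phiC.
have [iG EG] := Rintegral_prod12 (m1 := Om) (m2 := Om) iKp.
have ae : {ae Om, forall x, \int[Om]_y (K (x, y) * (g x * f y)) = kernel_op Om K f x * g x}.
  apply: filterS KB => x KBx.
  have mKx : measurable_fun setT (fun y => K (x, y)) by exact: (measurableT_comp mK (pair1_measurable x)).
  have iK : Om.-integrable setT (EFin \o (fun y => K (x, y) * f y)).
    have iK0 : Om.-integrable setT (EFin \o (fun y => Cf * K (x, y))).
      apply: (integrableZl measurableT Cf (f := fun y => (K (x, y))%:E)).
      apply/integrableP; split; first by apply/measurable_EFinP.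
      by apply: le_lt_trans KBx _; rewrite ltry.
    apply: le_integrable iK0 => //; first by apply/measurable_EFinP; exact: measurable_funM.
    move=> y _; rewrite /= lee_fin !normrM mulrC ler_wpM2r//.
    by rewrite (ger0_norm Cf0).
  rewrite /kernel_op mulrC -(RintegralZl (mu := Om) _ measurableT iK).
  by apply: eq_Rintegral => y _; ring.
have mH : measurable_fun setT (fun x => (kernel_op Om K f x * g x)%:E).
  by apply/measurable_EFinP; apply: measurable_funM => //; exact: measurable_kernel_op.
have mG := measurable_int _ iG.
split.
  apply/integrableP; split => //.
  have /integrableP[_] := iG; congr (_ < _)%E; apply: ae_eq_integral => //.
  - exact: measurableT_comp.
  - exact: measurableT_comp.
  - by apply: filterS ae => x Ex _; rewrite /= Ex.
rewrite -[RHS]/(\int[(Om \x Om)%E]_z (K z * (g z.1 * f z.2))) EG /Rintegral; congr fine.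
by apply: ae_eq_integral => //; apply: filterS ae => x Ex _; rewrite -Ex.
Qed.

End pairing.

Section test_functions.
Context {R : realType} (d : nat) {n : nat}.
Local Notation E := 'rV[R]_n.
Implicit Types (x y : E) (p : E * E * E).

(** The derivatives of [g] along [D] vanish. *)
Lemma jet_invariant k (V : normedModType R) (D : set V) (lam w g : V -> R) :
  (forall p : V, 0 < lam p) -> continuous g -> (forall p : V, `|g p| <= w p) ->
  (forall v (h : R) (p : V), D v -> g (h *: v + p) = g p) -> jet k D lam w g.
Proof.
move=> lam0 cg gw gD; case: k => [|k]; split => // v Dv.
have dg (p : V) : is_derive p v g 0.
  by apply: is_derive_affine => h; rewrite mulr0 add0r; exact: gD.
have [d1 ->] := derive_fun dg; split => //; apply: jet_cst => // p.
by rewrite normr0 divr_ge0 ?(ltW (lam0 p))// (le_trans _ (gw p)).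
Qed.

Lemma jet_pull_x k (w f : E -> R) : jet k (range std_basis) (fun=> 1) w f ->
  jet k (range dx) (fun=> 1) (fun p => w p.1.1) (fun p => f p.1.1).
Proof.
move=> jf; apply: (jet_comp (D := range std_basis) (phi := fun p : E * E * E => p.1.1) (L := fun u : E * E * E => u.1.1) _ _ _ jf).
- exact: (cont_then (@cont_fst (E * E)%type E) (@cont_fst E E)).
- by move=> _ [i _ <-]; exists i.
- by move=> u p h _.
Qed.

Lemma jet_pull_y k (w f : E -> R) : continuous f -> (forall x, `|f x| <= w x) ->
  jet k (range dx) (fun=> 1) (fun p => w p.1.2) (fun p => f p.1.2).
Proof.
move=> cf fw; apply: jet_invariant => //.
  exact: (cont_then (cont_then (@cont_fst (E * E)%type E) (@cont_snd E E)) cf).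
by move=> _ h p [i _ <-] /=; rewrite scaler0 add0r.
Qed.

Lemma schwartz_jet k (v : E -> R[i]) : schwartz d v -> exists2 C, 0 <= C &
  jet k (range std_basis) (fun=> 1) (fun x => C * tail d x) (@complex.Re R \o v) /\
  jet k (range std_basis) (fun=> 1) (fun x => C * tail d x) (@complex.Im R \o v).
Proof.
move=> [sv _ vb]; have [C C0 hC] : exists2 C, 0 <= C & forall s : seq 'I_n, (size s <= k)%N ->
    forall x, Normc.normc (foldr cderive v (map std_basis s) x) <= C * tail d x.
  apply: uniform_word_bound => [s C C' CC' h x|s _].
    by apply: le_trans (h x) _; rewrite ler_wpM2r// tail_ge0.
  have [C h] := ereal_sup_ltyP (vb n.+1 (fun i => count_mem i s)).
  exists C => x; have h0 : 0 < 1 + height d x by rewrite ltr_pwDl// height_ge0.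
  rewrite mderive_word// /tail powRN powR_mulrn ?(ltW h0)// ler_pdivlMr ?exprn_gt0// mulrC.
  exact: h.
exists C => //; apply: smooth_jet => // s sk x.
by rewrite expr1n divr1; exact: hC.
Qed.

End test_functions.

(** * Pairings of the limit kernels *)

Section amplitude_operator.
Context {R : realType} (d : nat) {n : nat}.
Local Notation E := 'rV[R]_n.
Local Notation Om := (@Omega_measure R d n).
Local Notation Om2 := (@Omega2 R d n).
Local Notation dual := (@dual_measure R d n).
Local Notation mu3 := (Om2 \x dual)%E.
Local Notation jap := (@japanese R n).
Local Notation rp f := (@complex.Re R \o f).
Local Notation ip f := (@complex.Im R \o f).
Implicit Types (x y xi : E) (p : E * E * E) (u v : E -> R[i]).

(** The integral operator of the complex kernel [k1 + i k2]. *)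
Definition complex_kernel_op (k1 k2 : E * E -> R) u x : R[i] :=
  Complex (kernel_op Om k1 (rp u) x - kernel_op Om k2 (ip u) x)
          (kernel_op Om k1 (ip u) x + kernel_op Om k2 (rp u) x).

Variables (m s : R) (q N : nat).
Hypotheses (n0 : (0 < n)%N) (m0 : m < 0) (s0 : 0 < s) (s2 : s <= 2) (sn : s < n%:R)
  (sm : s + s <= - m) (qn : (n.+2 <= 2 * q)%N) (qm : s - m <= (2 * q)%:R)
  (nN : (n <= N.*2)%N) (Nn : (N.*2 <= n.+1)%N).

Let nq : (n.+1 <= 2 * q)%N. Proof. exact: ltnW. Qed.

(** The real part of [(a1 + i a2) (cos + i sin)]. *)
Definition re_kernels (a : E * E * E -> R[i]) M z : R :=
  symbol_kernel d q false (rp a) M z + - symbol_kernel d q true (ip a) M z.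

Definition im_kernels (a : E * E * E -> R[i]) M z : R :=
  symbol_kernel d q true (rp a) M z + symbol_kernel d q false (ip a) M z.

Section one_factor.
Variable f : E * E * E -> R.
Hypothesis sf : real_symbol d m f.

Lemma symbol_test_jet (phi : E * E -> R) (K : R) : 0 <= K ->
  jet N.*2 (range dx) (fun=> 1) (fun p => K * tail2 d p.1) (fun p => phi p.1) ->
  exists2 C, 0 <= C & jet N.*2 (range dx) (fun=> 1)
    (fun p => C * jap p.2 `^ m * tail2 d p.1) (fun p => f p * phi p.1).
Proof.
move=> K0 jphi; have [C C0 jf] := symbol_jet_x sf.
exists (2 ^+ N.*2 * (C * K)); first by rewrite mulr_ge0 ?exprn_ge0// mulr_ge0.
have := jetM (jet_leq Nn jf) jphi; apply: jet_mono => // p.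
by rewrite le_eqVlt; apply/orP; left; apply/eqP; rewrite /jap3; ring.
Qed.

(** Integrating in the frequency first turns the regularized integral into the
    pairing with the truncated kernel. *)
Lemma regularized_pairing c M (phi : E * E -> R) (K : R) : 0 <= K ->
  jet N.*2 (range dx) (fun=> 1) (fun p => K * tail2 d p.1) (fun p => phi p.1) ->
  Om2.-integrable setT (EFin \o (fun z => symbol_kernel d q c f M z * phi z)) /\
  \int[mu3]_p regularized q (fun p => f p * phi p.1) c M p =
    \int[Om2]_z (symbol_kernel d q c f M z * phi z).
Proof.
move=> K0 jphi; have [C C0 jF] := symbol_test_jet K0 jphi.
have ireg := regularized_integrable n0 s0 sm nq C0 jF c M.
have [iK EK] := Rintegral_prod12 (m1 := Om2) (m2 := dual) ireg.
have E1 : (fun z => \int[dual]_xi regularized q (fun p => f p * phi p.1) c M (z, xi)) =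
    (fun z => symbol_kernel d q c f M z * phi z).
  apply/funext => z; rewrite mulrC /symbol_kernel /osc_int.
  have it := integrable_trig c (z.1 - z.2) (integrable_truncated n0 m0 qn sf M z).
  rewrite -(RintegralZl (mu := dual) _ measurableT it).
  apply: eq_Rintegral => xi _; rewrite /regularized /truncated /= -surjective_pairing; ring.
by rewrite E1 in iK; rewrite EK E1.
Qed.

End one_factor.

Section limits.
Variables (k : nat -> E * E -> R).
Hypothesis gk : good_family d s k.

Lemma limit_pairing_cvg (phi : E * E -> R) (C : R) : 0 <= C -> measurable_fun setT phi ->
  (forall z, `|phi z| <= C * tail d z.1) ->
  (fun M => \int[Om2]_z (k M z * phi z)) @ \oo --> \int[Om2]_z (limit_kernel d k z * phi z).
Proof.
move=> C0 mphi phiC; have [A A0 kA] := limit_kernel_schur n0 s0 sn gk.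
have [B B0 kB] := limit_kernel_schur_bounded n0 s0 sn gk.
have [iL _] := pairing_integrable n0 (ltW B0) C0 kB mphi phiC.
apply: (@cvg_rate R s s0 _ _ (C * A * @tail_const R n)).
  by apply: mulr_ge0; [exact: mulr_ge0|exact: tail_const_ge0].
move=> M; have AM : 0 <= A * M.+1%:R `^ (- s) by rewrite mulr_ge0// powR_ge0.
have [iD leD] := pairing_integrable n0 AM C0 (kA M) mphi phiC.
have ik : Om2.-integrable setT (EFin \o (fun z => k M z * phi z)).
  have := integrableB measurableT iL iD.
  by apply: eq_integrable => // z _ /=; rewrite -EFinB; congr EFin; ring.
rewrite distrC -(RintegralB measurableT iL ik).
rewrite (_ : (fun z => limit_kernel d k z * phi z - k M z * phi z) =
  (fun z => (limit_kernel d k z - k M z) * phi z)); last by apply/funext => z; rewrite mulrBl.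
apply: le_trans leD _; rewrite le_eqVlt; apply/orP; left; apply/eqP; ring.
Qed.

End limits.

Variable a : E * E * E -> R[i].
Hypotheses (sa : symbol_class d m a) (va : vanishes_at_infinity d (symbol_size m a)).

Let s1 : real_symbol d m (rp a). Proof. by have [] := symbol_real sa va. Qed.
Let s2' : real_symbol d m (ip a). Proof. by have [] := symbol_real sa va. Qed.

Lemma good_re_kernels : good_family d s (re_kernels a).
Proof.
by apply: good_familyD; [|apply: good_familyN]; apply: (symbol_good_family (m := m)).
Qed.

Lemma good_im_kernels : good_family d s (im_kernels a).
Proof. by apply: good_familyD; apply: (symbol_good_family (m := m)). Qed.

Local Notation K1 := (limit_kernel d (re_kernels a)).
Local Notation K2 := (limit_kernel d (im_kernels a)).

Section test.
Variables (phi1 phi2 : E * E -> R) (C : R).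
Hypotheses (C0 : 0 <= C)
  (j1 : jet N.*2 (range dx) (fun=> 1) (fun p => C * tail2 d p.1) (fun p => phi1 p.1))
  (j2 : jet N.*2 (range dx) (fun=> 1) (fun p => C * tail2 d p.1) (fun p => phi2 p.1))
  (mphi1 : measurable_fun setT phi1) (mphi2 : measurable_fun setT phi2)
  (phi_per : forall i : 'I_n, (i < d)%N -> forall p,
     phi1 (p + (2 * pi) *: dx i).1 = phi1 p.1 /\ phi2 (p + (2 * pi) *: dx i).1 = phi2 p.1).

Let F1 p := complex.Re (a p) * phi1 p.1 - complex.Im (a p) * phi2 p.1.
Let F2 p := complex.Re (a p) * phi2 p.1 + complex.Im (a p) * phi1 p.1.

Let phi_le phi : jet N.*2 (range dx) (fun=> 1) (fun p => C * tail2 d p.1) (fun p => phi p.1) ->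
  forall z, `|phi z| <= C * tail d z.1.
Proof.
move=> j z; apply: le_trans (jet_le j (z, 0)) _; rewrite ler_wpM2l//.
by rewrite ler_piMr ?tail_ge0// tail_le1.
Qed.

Let per (i : 'I_n) p : (i < d)%N -> a (p + (2 * pi) *: dx i) = a p.
Proof. by move=> id; have [_ pa _ _] := sa; exact: pa. Qed.

Let cvgF c : (fun M => \int[mu3]_p regularized q F1 c M p) @ \oo --> \int[mu3]_p transferred N F1 c p /\
  (fun M => \int[mu3]_p regularized q F2 c M p) @ \oo --> \int[mu3]_p transferred N F2 c p.
Proof.
have [C1 C10 J1] := symbol_test_jet s1 C0 j1; have [C2 C20 J2] := symbol_test_jet s2' C0 j2.
have [C3 C30 J3] := symbol_test_jet s1 C0 j2; have [C4 C40 J4] := symbol_test_jet s2' C0 j1.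
split.
  apply: (regularized_cvg n0 s0 s2 sm nq nN (addr_ge0 C10 C20)).
    by have := jetB J1 J2; apply: jet_mono => // p; rewrite -!mulrDl.
  by move=> i id p; rewrite /F1 per//; have [-> ->] := phi_per id p.
apply: (regularized_cvg n0 s0 s2 sm nq nN (addr_ge0 C30 C40)).
  by have := jetD J3 J4; apply: jet_mono => // p; rewrite -!mulrDl.
by move=> i id p; rewrite /F2 per//; have [-> ->] := phi_per id p.
Qed.

(** At each stage of the regularization the two sides agree, by Fubini's theorem. *)
Lemma kernel_pairing :
  \int[mu3]_p transferred N F1 false p - \int[mu3]_p transferred N F2 true p =
    \int[Om2]_z (K1 z * phi1 z) - \int[Om2]_z (K2 z * phi2 z) /\
  \int[mu3]_p transferred N F1 true p + \int[mu3]_p transferred N F2 false p =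
    \int[Om2]_z (K1 z * phi2 z) + \int[Om2]_z (K2 z * phi1 z).
Proof.
have reg c M phi (f : E * E * E -> R) : real_symbol d m f ->
    jet N.*2 (range dx) (fun=> 1) (fun p => C * tail2 d p.1) (fun p => phi p.1) ->
    mu3.-integrable setT (EFin \o regularized q (fun p => f p * phi p.1) c M).
  move=> sf j; have [C1 C10 J1] := symbol_test_jet sf C0 j.
  exact: (regularized_integrable n0 s0 sm nq C10 J1 c M).
have E1 c M : \int[mu3]_p regularized q F1 c M p =
    \int[Om2]_z (symbol_kernel d q c (rp a) M z * phi1 z) -
    \int[Om2]_z (symbol_kernel d q c (ip a) M z * phi2 z).
  have [_ <-] := regularized_pairing s1 c M C0 j1; have [_ <-] := regularized_pairing s2' c M C0 j2.
  rewrite -(RintegralB measurableT (reg c M _ _ s1 j1) (reg c M _ _ s2' j2)).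
  by apply: eq_Rintegral => p _; rewrite /regularized /F1 /=; ring.
have E2 c M : \int[mu3]_p regularized q F2 c M p =
    \int[Om2]_z (symbol_kernel d q c (rp a) M z * phi2 z) +
    \int[Om2]_z (symbol_kernel d q c (ip a) M z * phi1 z).
  have [_ <-] := regularized_pairing s1 c M C0 j2; have [_ <-] := regularized_pairing s2' c M C0 j1.
  rewrite -(RintegralD measurableT (reg c M _ _ s1 j2) (reg c M _ _ s2' j1)).
  by apply: eq_Rintegral => p _; rewrite /regularized /F2 /=; ring.
have Ere M phi : jet N.*2 (range dx) (fun=> 1) (fun p => C * tail2 d p.1) (fun p => phi p.1) ->
    \int[Om2]_z (re_kernels a M z * phi z) =
    \int[Om2]_z (symbol_kernel d q false (rp a) M z * phi z) -
    \int[Om2]_z (symbol_kernel d q true (ip a) M z * phi z).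
  move=> j; have [i1 _] := regularized_pairing s1 false M C0 j.
  have [i2 _] := regularized_pairing s2' true M C0 j.
  rewrite -(RintegralB measurableT i1 i2); apply: eq_Rintegral => z _; rewrite /re_kernels; ring.
have Eim M phi : jet N.*2 (range dx) (fun=> 1) (fun p => C * tail2 d p.1) (fun p => phi p.1) ->
    \int[Om2]_z (im_kernels a M z * phi z) =
    \int[Om2]_z (symbol_kernel d q true (rp a) M z * phi z) +
    \int[Om2]_z (symbol_kernel d q false (ip a) M z * phi z).
  move=> j; have [i1 _] := regularized_pairing s1 true M C0 j.
  have [i2 _] := regularized_pairing s2' false M C0 j.
  rewrite -(RintegralD measurableT i1 i2); apply: eq_Rintegral => z _; rewrite /im_kernels; ring.
have lim_re phi : jet N.*2 (range dx) (fun=> 1) (fun p => C * tail2 d p.1) (fun p => phi p.1) ->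
    measurable_fun setT phi ->
    (fun M => \int[Om2]_z (re_kernels a M z * phi z)) @ \oo --> \int[Om2]_z (K1 z * phi z).
  by move=> j mphi; apply: (limit_pairing_cvg good_re_kernels C0 mphi); exact: phi_le.
have lim_im phi : jet N.*2 (range dx) (fun=> 1) (fun p => C * tail2 d p.1) (fun p => phi p.1) ->
    measurable_fun setT phi ->
    (fun M => \int[Om2]_z (im_kernels a M z * phi z)) @ \oo --> \int[Om2]_z (K2 z * phi z).
  by move=> j mphi; apply: (limit_pairing_cvg good_im_kernels C0 mphi); exact: phi_le.
have eqlim (u w : nat -> R) (l l' : R) : u @ \oo --> l -> w @ \oo --> l' -> u = w -> l = l'.
  by move=> ul wl uw; rewrite uw in ul; exact: (cvg_unique (@Rhausdorff R) ul wl).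
split.
  apply: (eqlim _ _ _ _ (cvgB (cvgF false).1 (cvgF true).2) (cvgB (lim_re _ j1 mphi1) (lim_im _ j2 mphi2))).
  by apply/funext => M; rewrite !fctE E1 E2 Ere// Eim//; ring.
apply: (eqlim _ _ _ _ (cvgD (cvgF true).1 (cvgF false).2) (cvgD (lim_re _ j2 mphi2) (lim_im _ j1 mphi1))).
by apply/funext => M; rewrite !fctE E1 E2 Ere// Eim//; ring.
Qed.

End test.

End amplitude_operator.

(** * The amplitude of the limit operator *)

Section amplitude_identity.
Context {R : realType} (d : nat) {n : nat}.
Local Notation E := 'rV[R]_n.
Local Notation Om := (@Omega_measure R d n).
Local Notation Om2 := (@Omega2 R d n).
Local Notation dual := (@dual_measure R d n).
Local Notation mu3 := (Om2 \x dual)%E.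
Local Notation rp f := (@complex.Re R \o f).
Local Notation ip f := (@complex.Im R \o f).
Implicit Types (x y xi : E) (p : E * E * E) (u v : E -> R[i]).

Section bilinear.
Variables (K : E * E -> R) (B Cu Cv : R) (u1 u2 v1 v2 : E -> R).
Hypotheses (n0 : (0 < n)%N) (B0 : 0 <= B) (Cu0 : 0 <= Cu) (Cv0 : 0 <= Cv)
  (sK : schur_bounded Om K B)
  (mu1 : measurable_fun setT u1) (mu2 : measurable_fun setT u2)
  (mv1 : measurable_fun setT v1) (mv2 : measurable_fun setT v2)
  (u1C : forall x, `|u1 x| <= Cu) (u2C : forall x, `|u2 x| <= Cu)
  (v1C : forall x, `|v1 x| <= Cv * tail d x) (v2C : forall x, `|v2 x| <= Cv * tail d x).

Let prod_integrable (f g : E -> R) : measurable_fun setT f -> measurable_fun setT g ->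
  (forall x, `|f x| <= Cu) -> (forall x, `|g x| <= Cv * tail d x) ->
  Om2.-integrable setT (EFin \o (fun z => K z * (g z.1 * f z.2))).
Proof.
move=> mf mg fC gC; have CC : 0 <= Cv * Cu by exact: mulr_ge0.
have [] // := pairing_integrable n0 B0 CC sK (phi := fun z => g z.1 * f z.2).
  by apply: measurable_funM; [exact: (measurableT_comp mg)|exact: (measurableT_comp mf)].
by move=> z; rewrite normrM mulrAC ler_pM.
Qed.

Lemma pairing_re :
  Om.-integrable setT (EFin \o (fun x => kernel_op Om K u1 x * v1 x - kernel_op Om K u2 x * v2 x)) /\
  \int[Om]_x (kernel_op Om K u1 x * v1 x - kernel_op Om K u2 x * v2 x) =
    \int[Om2]_z (K z * (v1 z.1 * u1 z.2 - v2 z.1 * u2 z.2)).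
Proof.
have [i1 e1] := pairing_kernel_op n0 B0 Cu0 Cv0 sK mu1 mv1 u1C v1C.
have [i2 e2] := pairing_kernel_op n0 B0 Cu0 Cv0 sK mu2 mv2 u2C v2C.
split; first exact: (integrableB measurableT i1 i2).
rewrite (RintegralB measurableT i1 i2) e1 e2 -(RintegralB measurableT); last 2 first.
- exact: prod_integrable.
- exact: prod_integrable.
by apply: eq_Rintegral => z _; rewrite mulrBr.
Qed.

Lemma pairing_im :
  Om.-integrable setT (EFin \o (fun x => kernel_op Om K u2 x * v1 x + kernel_op Om K u1 x * v2 x)) /\
  \int[Om]_x (kernel_op Om K u2 x * v1 x + kernel_op Om K u1 x * v2 x) =
    \int[Om2]_z (K z * (v1 z.1 * u2 z.2 + v2 z.1 * u1 z.2)).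
Proof.
have [i1 e1] := pairing_kernel_op n0 B0 Cu0 Cv0 sK mu2 mv1 u2C v1C.
have [i2 e2] := pairing_kernel_op n0 B0 Cu0 Cv0 sK mu1 mv2 u1C v2C.
split; first exact: (integrableD measurableT i1 i2).
rewrite (RintegralD measurableT i1 i2) e1 e2 -(RintegralD measurableT); last 2 first.
- exact: prod_integrable.
- exact: prod_integrable.
by apply: eq_Rintegral => z _; rewrite mulrDr.
Qed.

End bilinear.

Variables (m s : R) (q : nat) (a : E * E * E -> R[i]).
Hypotheses (n0 : (0 < n)%N) (m0 : m < 0) (s0 : 0 < s) (s2 : s <= 2) (sn : s < n%:R)
  (sm : s + s <= - m) (qn : (n.+2 <= 2 * q)%N) (qm : s - m <= (2 * q)%:R)
  (sa : symbol_class d m a) (va : vanishes_at_infinity d (symbol_size m a)).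

Local Notation N := (uphalf n).
Local Notation K1 := (limit_kernel d (re_kernels d q a)).
Local Notation K2 := (limit_kernel d (im_kernels d q a)).

Let ReM (z w : R[i]) : complex.Re (z * w) = complex.Re z * complex.Re w - complex.Im z * complex.Im w.
Proof. by case: z w => [? ?] []. Qed.

Let ImM (z w : R[i]) : complex.Im (z * w) = complex.Re z * complex.Im w + complex.Im z * complex.Re w.
Proof. by case: z w => [? ?] []. Qed.

Lemma jet_tensor k (Cv Cu : R) (f g : E -> R) : 0 <= Cv ->
  jet k (range std_basis) (fun=> 1) (fun x => Cv * tail d x) g ->
  jet k (range std_basis) (fun=> 1) (fun x => Cu * tail d x) f ->
  jet k (range dx) (fun=> 1) (fun p => 2 ^+ k * (Cv * Cu) * tail2 d p.1)
    (fun p => g p.1.1 * f p.1.2).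
Proof.
move=> Cv0 jg jf.
have := jetM (jet_pull_x jg) (jet_pull_y k (jet_continuous jf) (jet_le jf)).
apply: jet_mono => // p; rewrite /tail2 le_eqVlt; apply/orP; left; apply/eqP; ring.
Qed.

(** Both sides are written with the real kernels [K1] and [K2] and the real and
    imaginary parts of [v (x) u (y)]; then [kernel_pairing] identifies them. *)
Lemma kernel_op_has_amplitude : has_amplitude d a (complex_kernel_op d K1 K2).
Proof.
move=> u v su sv.
have N2 : (n <= N.*2)%N by have := odd_double_half n; rewrite uphalf_half; case: (odd n); lia.
have N3 : (N.*2 <= n.+1)%N by have := odd_double_half n; rewrite uphalf_half; case: (odd n); lia.
have [Cu Cu0 [ju1 ju2]] := schwartz_jet N.*2 su.
have [Cv Cv0 [jv1 jv2]] := schwartz_jet N.*2 sv.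
pose u1 := rp u; pose u2 := ip u; pose v1 := rp v; pose v2 := ip v.
pose phi1 (z : E * E) := v1 z.1 * u1 z.2 - v2 z.1 * u2 z.2.
pose phi2 (z : E * E) := v1 z.1 * u2 z.2 + v2 z.1 * u1 z.2.
have m1 := continuous_measurable1 (jet_continuous ju1).
have m2 := continuous_measurable1 (jet_continuous ju2).
have m3 := continuous_measurable1 (jet_continuous jv1).
have m4 := continuous_measurable1 (jet_continuous jv2).
have mprod (f g : E -> R) : measurable_fun setT f -> measurable_fun setT g ->
    measurable_fun setT (fun z : E * E => g z.1 * f z.2).
  by move=> mf mg; apply: measurable_funM; [exact: (measurableT_comp mg)|exact: (measurableT_comp mf)].
have mp1 : measurable_fun setT phi1 by apply: measurable_funB; exact: mprod.
have mp2 : measurable_fun setT phi2 by apply: measurable_funD; exact: mprod.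
pose C := 2 ^+ N.*2 * (Cv * Cu) + 2 ^+ N.*2 * (Cv * Cu).
have C0 : 0 <= C by apply: addr_ge0; rewrite !mulr_ge0 ?exprn_ge0.
have j1 : jet N.*2 (range dx) (fun=> 1) (fun p => C * tail2 d p.1) (fun p => phi1 p.1).
  by have := jetB (jet_tensor Cv0 jv1 ju1) (jet_tensor Cv0 jv2 ju2); apply: jet_mono => // p; rewrite -mulrDl.
have j2 : jet N.*2 (range dx) (fun=> 1) (fun p => C * tail2 d p.1) (fun p => phi2 p.1).
  by have := jetD (jet_tensor Cv0 jv1 ju2) (jet_tensor Cv0 jv2 ju1); apply: jet_mono => // p; rewrite -mulrDl.
have per (i : 'I_n) : (i < d)%N -> forall p,
    phi1 (p + (2 * pi) *: dx i).1 = phi1 p.1 /\ phi2 (p + (2 * pi) *: dx i).1 = phi2 p.1.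
  move=> id p; have [_ pv _] := sv; have vp := pv i id p.1.1.
  have E1 : (p + (2 * pi) *: dx i).1.1 = p.1.1 + (2 * pi) *: std_basis i by [].
  have E2 : (p + (2 * pi) *: dx i).1.2 = p.1.2 by rewrite /= scaler0 addr0.
  by rewrite /phi1 /phi2 E1 E2 /v1 /v2 /= vp.
have [P1 P2] := kernel_pairing n0 m0 s0 s2 sn sm qn qm N2 N3 sa va C0 j1 j2 mp1 mp2 per.
pose F1 p := complex.Re (a p) * phi1 p.1 - complex.Im (a p) * phi2 p.1.
pose F2 p := complex.Re (a p) * phi2 p.1 + complex.Im (a p) * phi1 p.1.
have [sr si] := symbol_real sa va.
have iF1 c : mu3.-integrable setT (EFin \o transferred N F1 c).
  have [c1 c10 J1] := symbol_test_jet N3 sr C0 j1; have [c2 c20 J2] := symbol_test_jet N3 si C0 j2.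
  apply: (transferred_integrable n0 s0 sm N2 (addr_ge0 c10 c20)).
  by have := jetB J1 J2; apply: jet_mono => // p; rewrite -!mulrDl.
have iF2 c : mu3.-integrable setT (EFin \o transferred N F2 c).
  have [c1 c10 J1] := symbol_test_jet N3 sr C0 j2; have [c2 c20 J2] := symbol_test_jet N3 si C0 j1.
  apply: (transferred_integrable n0 s0 sm N2 (addr_ge0 c10 c20)).
  by have := jetD J1 J2; apply: jet_mono => // p; rewrite -!mulrDl.
have bound (f : E -> R) : (forall x, `|f x| <= Cu * tail d x) -> forall x, `|f x| <= Cu.
  by move=> fC x; apply: le_trans (fC x) _; rewrite ler_piMr// tail_le1.
have [B1 B10 sB1] := limit_kernel_schur_bounded n0 s0 sn (good_re_kernels n0 m0 s0 s2 sn sm qn qm sa va).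
have [B2 B20 sB2] := limit_kernel_schur_bounded n0 s0 sn (good_im_kernels n0 m0 s0 s2 sn sm qn qm sa va).
have bu1 := bound _ (jet_le ju1); have bu2 := bound _ (jet_le ju2).
have bv1 := jet_le jv1; have bv2 := jet_le jv2.
have [ir1 er1] := pairing_re n0 (ltW B10) Cu0 Cv0 sB1 m1 m2 m3 m4 bu1 bu2 bv1 bv2.
have [ir2 er2] := pairing_re n0 (ltW B20) Cu0 Cv0 sB2 m1 m2 m3 m4 bu1 bu2 bv1 bv2.
have [ii1 ei1] := pairing_im n0 (ltW B10) Cu0 Cv0 sB1 m1 m2 m3 m4 bu1 bu2 bv1 bv2.
have [ii2 ei2] := pairing_im n0 (ltW B20) Cu0 Cv0 sB2 m1 m2 m3 m4 bu1 bu2 bv1 bv2.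
have Rew : rp (fun p => a p * (v p.1.1 * u p.1.2)) = F1.
  by apply/funext => p; rewrite /F1 /phi1 /phi2 /= !ReM !ImM.
have Imw : ip (fun p => a p * (v p.1.1 * u p.1.2)) = F2.
  by apply/funext => p; rewrite /F2 /phi1 /phi2 /= !ImM !ReM.
transitivity (Complex (\int[Om2]_z (K1 z * phi1 z) - \int[Om2]_z (K2 z * phi2 z))
                      (\int[Om2]_z (K1 z * phi2 z) + \int[Om2]_z (K2 z * phi1 z))).
  rewrite /cintegral; congr (Complex _ _).
    rewrite -er1 -ei2 -(RintegralB measurableT ir1 ii2).
    by apply: eq_Rintegral => x _; rewrite ReM /=; ring.
  rewrite -ei1 -er2 -(RintegralD measurableT ii1 ir2).
  by apply: eq_Rintegral => x _; rewrite ImM /=; ring.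
rewrite -P1 -P2 /amplitude_kernel /cintegral.
have BE p : (((1 + enorm p.2 ^+ 2) ^- N)%:C : R[i])%C = Complex ((1 + enorm p.2 ^+ 2) ^- N) 0 by [].
congr (Complex _ _).
  rewrite -(RintegralB measurableT (iF1 false) (iF2 true)).
  apply: eq_Rintegral => p _; rewrite !ReM !ImM /=.
  have [-> ->] := Re_bessel_iter dx N (fun p => a p * (v p.1.1 * u p.1.2)) p.
  by rewrite Rew Imw /transferred /=; ring.
rewrite -(RintegralD measurableT (iF1 true) (iF2 false)).
apply: eq_Rintegral => p _; rewrite !ImM !ReM /=.
have [-> ->] := Re_bessel_iter dx N (fun p => a p * (v p.1.1 * u p.1.2)) p.
by rewrite Rew Imw /transferred /=; ring.
Qed.

End amplitude_identity.

(** * Boundedness and compactness on the space of square-integrable functions *)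

Section square_norm.
Context {R : realType} (d : nat) {n : nat}.
Local Notation E := 'rV[R]_n.
Local Notation Om := (@Omega_measure R d n).
Local Notation rp f := (@complex.Re R \o f).
Local Notation ip f := (@complex.Im R \o f).
Implicit Types (u v : E -> R[i]).

Definition csqint u : \bar R := (sqint Om (rp u) + sqint Om (ip u))%E.

Lemma csqint_ge0 u : (0 <= csqint u)%E.
Proof. by rewrite adde_ge0 ?sqint_ge0. Qed.

Lemma Lnorm2 (h : E -> R) : Lnorm Om 2%:E (fun x => (h x)%:E) = (sqint Om h `^ 2^-1)%E.
Proof.
rewrite unlock /=; congr (_ `^ _)%E; apply: eq_integral => x _.
by rewrite powR_mulrn// real_normK ?num_real.
Qed.

Lemma L2P u : L2 d u <-> [/\ measurable_fun setT (rp u), measurable_fun setT (ip u),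
  (sqint Om (rp u) < +oo)%E & (sqint Om (ip u) < +oo)%E].
Proof.
have LP (h : E -> R) : h \in Lfun Om 2%:E <-> measurable_fun setT h /\ (sqint Om h < +oo)%E.
  have nE : ('N[Om]_2%:E[EFin \o h])%E = (sqint Om h `^ 2^-1)%E by exact: Lnorm2.
  split.
    move=> hL; have mh := sub_Lfun_mfun hL; have fh := sub_Lfun_finLfun hL.
    rewrite !inE in mh fh; split; first exact: mh.
    have fy : (sqint Om h `^ 2^-1 < +oo)%E by rewrite -nE; exact: fh.
    by apply: lty_poweRy fy; rewrite invr_eq0.
  move=> [mh hy]; apply/andP; rewrite !inE; split; first exact: mh.
  suff: ('N[Om]_2%:E[EFin \o h] < +oo)%E by [].
  by rewrite nE; exact: poweR_lty.
by split=> [[/LP[? ?] /LP[? ?]]|[? ? ? ?]] //; split; apply/LP.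
Qed.

Lemma L2normE u : measurable_fun setT (rp u) -> measurable_fun setT (ip u) ->
  L2norm d u = (csqint u `^ 2^-1)%E.
Proof.
move=> mr mi; rewrite /L2norm (@Lnorm2 (fun x => Normc.normc (u x))); congr (_ `^ _)%E.
rewrite /csqint /sqint -ge0_integralD//.
- apply: eq_integral => x _; rewrite /=; case: (u x) => a b /=.
  by rewrite sqr_sqrtr ?addr_ge0 ?sqr_ge0.
- by move=> x _; rewrite lee_fin sqr_ge0.
- exact: measurable_sqr.
- by move=> x _; rewrite lee_fin sqr_ge0.
- exact: measurable_sqr.
Qed.

Lemma poweR_half_le (x y : \bar R) (c : R) : (0 <= x)%E -> (0 <= y)%E -> 0 <= c ->
  (x <= (c ^+ 2)%:E * y)%E -> (x `^ 2^-1 <= c%:E * y `^ 2^-1)%E.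
Proof.
move=> x0 y0 c0 xy; have in0 (z : \bar R) : (0 <= z)%E -> z \in `[0%E, +oo%E].
  by move=> z0; rewrite in_itv/= z0 leey.
have cy : (0 <= (c ^+ 2)%:E * y)%E by rewrite mule_ge0// lee_fin sqr_ge0.
have h0 : 0 <= 2^-1 :> R by rewrite invr_ge0.
have := gt0_ler_poweR h0 (in0 _ x0) (in0 _ cy) xy.
rewrite poweRM//; last by rewrite lee_fin sqr_ge0.
rewrite poweR_EFin (_ : (c ^+ 2) `^ 2^-1 = c)//.
by rewrite -powR_mulrn// -powRrM mulfV ?powRr1// pnatr_eq0.
Qed.

Lemma poweR_half_inv (x : \bar R) (c : R) : (0 <= x)%E -> (x `^ 2^-1 <= c%:E)%E ->
  (x <= (c ^+ 2)%:E)%E.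
Proof.
move=> x0 xc; have c0 : 0 <= c by rewrite -lee_fin; apply: le_trans xc; exact: poweR_ge0.
have in0 (z : \bar R) : (0 <= z)%E -> z \in `[0%E, +oo%E].
  by move=> z0; rewrite in_itv/= z0 leey.
have h2 : 0 <= 2 :> R by [].
have := gt0_ler_poweR h2 (in0 _ (poweR_ge0 _ _)) (in0 c%:E _) xc.
rewrite lee_fin => /(_ c0); rewrite -poweRrM mulVf ?pnatr_eq0// poweRe1//.
by rewrite poweR_EFin powR_mulrn.
Qed.

Lemma csqint_lty u : L2 d u -> (csqint u < +oo)%E.
Proof. by move=> /L2P[_ _ r i]; rewrite lte_add_pinfty. Qed.

End square_norm.

Section compactness.
Context {R : realType} (d : nat) {n : nat}.
Local Notation E := 'rV[R]_n.
Local Notation Om := (@Omega_measure R d n).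
Local Notation rp f := (@complex.Re R \o f).
Local Notation ip f := (@complex.Im R \o f).
Variables (k1 k2 : E * E -> R) (B : R).
Hypotheses (B0 : 0 < B) (s1 : schur_bounded Om k1 B) (s2 : schur_bounded Om k2 B).
Local Notation T := (complex_kernel_op d k1 k2).
Implicit Types (u v : E -> R[i]) (f g : E -> R).

Let mk1 : measurable_fun setT k1. Proof. by have [] := s1. Qed.
Let mk2 : measurable_fun setT k2. Proof. by have [] := s2. Qed.

Lemma measurable_kernel_op_parts u : L2 d u ->
  measurable_fun setT (rp (T u)) /\ measurable_fun setT (ip (T u)).
Proof.
move=> /L2P[mr mi _ _]; split.
  by apply: measurable_funB; exact: measurable_kernel_op.
by apply: measurable_funD; exact: measurable_kernel_op.
Qed.

Lemma csqint_kernel_op u : L2 d u -> (csqint d (T u) <= ((2 * B) ^+ 2)%:E * csqint d u)%E.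
Proof.
move=> /L2P[mr mi ri ii].
have [_ a1] := schur_test B0 s1 mr ri; have [_ a2] := schur_test B0 s1 mi ii.
have [_ b1] := schur_test B0 s2 mr ri; have [_ b2] := schur_test B0 s2 mi ii.
have p1 := sqintB Om (measurable_kernel_op Om mk1 mr) (measurable_kernel_op Om mk2 mi).
have p2 := sqintD Om (measurable_kernel_op Om mk1 mi) (measurable_kernel_op Om mk2 mr).
apply: (le_trans (leeD p1 p2)).
rewrite /csqint; move: ri ii a1 a2 b1 b2; have := sqint_ge0 Om (rp u); have := sqint_ge0 Om (ip u).
case: (sqint Om (rp u)) => [r| |]//; case: (sqint Om (ip u)) => [i| |]// r0 i0 _ _.
have f0 f := sqint_ge0 Om f.
have := f0 (kernel_op Om k1 (rp u)); have := f0 (kernel_op Om k1 (ip u)).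
have := f0 (kernel_op Om k2 (rp u)); have := f0 (kernel_op Om k2 (ip u)).
case: (sqint _ _) => [e1| |]//; case: (sqint _ _) => [e2| |]//; case: (sqint _ _) => [e3| |]//;
  case: (sqint _ _) => [e4| |]//.
rewrite -!EFinM -!EFinD !lee_fin.
move=> x1 x2 x3 x4 h4 h3 h2 h1; rewrite exprMn; set b := B ^+ 2 in h1 h2 h3 h4 *.
rewrite mulrDr; move: h1 h2 h3 h4; move: (b * r) (b * i) (mulrA (2 ^+ 2) b r) (mulrA (2 ^+ 2) b i).
by move=> br bi <- <- *; lra.
Qed.

Lemma L2_kernel_op u : L2 d u -> L2 d (T u).
Proof.
move=> Lu; have [mr mi] := measurable_kernel_op_parts Lu.
have := csqint_kernel_op Lu; have := csqint_lty Lu => cy le.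
have {le cy} : (csqint d (T u) < +oo)%E.
  by apply: le_lt_trans le _; rewrite lte_mul_pinfty// ?lee_fin ?sqr_ge0.
have := sqint_ge0 Om (rp (T u)); have := sqint_ge0 Om (ip (T u)); rewrite /csqint.
move=> i0 r0 cy; apply/L2P; split => //.
  by apply: le_lt_trans cy; rewrite leeDl.
by apply: le_lt_trans cy; rewrite leeDr.
Qed.

Lemma kernel_op_ae (k : E * E -> R) f g : measurable_fun setT k ->
  measurable_fun setT f -> measurable_fun setT g ->
  {ae Om, forall x, f x = g x} -> kernel_op Om k f = kernel_op Om k g.
Proof.
move=> mk mf mg fg; apply/funext => x; rewrite /kernel_op /Rintegral; congr fine.
have mx : measurable_fun setT (fun y => k (x, y)) by exact: (measurableT_comp mk (pair1_measurable x)).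
apply: ae_eq_integral => //.
- by apply/measurable_EFinP; exact: measurable_funM.
- by apply/measurable_EFinP; exact: measurable_funM.
- by apply: filterS fg => y -> _.
Qed.

Lemma kernel_op_linear (k : E * E -> R) (al be : R) f g h : schur_bounded Om k B ->
  measurable_fun setT f -> measurable_fun setT g -> measurable_fun setT h ->
  (sqint Om f < +oo)%E -> (sqint Om g < +oo)%E -> (sqint Om h < +oo)%E ->
  {ae Om, forall x, kernel_op Om k (fun y => al * f y + be * g y + h y) x =
     al * kernel_op Om k f x + be * kernel_op Om k g x + kernel_op Om k h x}.
Proof.
move=> sk mf mg mh fy gy hy.
have [i1 _] := schur_test B0 sk mf fy; have [i2 _] := schur_test B0 sk mg gy.
have [i3 _] := schur_test B0 sk mh hy.
apply: filterS3 i1 i2 i3 => x j1 j2 j3; rewrite /kernel_op.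
have z1 := integrableZl measurableT al j1; have z2 := integrableZl measurableT be j2.
have z3 := integrableD measurableT z1 z2.
transitivity (\int[Om]_y ((al * (k (x, y) * f y) + be * (k (x, y) * g y)) + k (x, y) * h y)).
  by apply: eq_Rintegral => y _; ring.
rewrite (RintegralD measurableT z3 j3) (RintegralD measurableT z1 z2).
rewrite (RintegralZl (mu := Om) _ measurableT j1).
by rewrite (RintegralZl (mu := Om) _ measurableT j2).
Qed.

Lemma kernel_op_bounded : bounded_operator d T.
Proof.
split.
- exact: L2_kernel_op.
- move=> u v /L2P[mr mi _ _] /L2P[mr' mi' _ _] uv; apply: filterE => x.
  have rr : {ae Om, forall x, rp u x = rp v x} by apply: filterS uv => y /= ->.
  have ii : {ae Om, forall x, ip u x = ip v x} by apply: filterS uv => y /= ->.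
  rewrite /complex_kernel_op (kernel_op_ae mk1 mr mr' rr) (kernel_op_ae mk2 mi mi' ii).
  by rewrite (kernel_op_ae mk1 mi mi' ii) (kernel_op_ae mk2 mr mr' rr).
- move=> c u v /L2P[mr mi fr fi] /L2P[mr' mi' fr' fi'].
  case: c => c1 c2.
  have l1 := kernel_op_linear c1 (- c2) s1 mr mi mr' fr fi fr'.
  have l2 := kernel_op_linear c1 c2 s2 mi mr mi' fi fr fi'.
  have l3 := kernel_op_linear c1 c2 s1 mi mr mi' fi fr fi'.
  have l4 := kernel_op_linear c1 (- c2) s2 mr mi mr' fr fi fr'.
  apply: filterS2 (filterI l1 l2) (filterI l3 l4) => x /= [e1 e2] [e3 e4].
  have reE : rp (fun z => Complex c1 c2 * u z + v z) =
      (fun y => c1 * rp u y + - c2 * ip u y + rp v y).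
    by apply/funext => y /=; case: (u y) (v y) => u1 u2 [v1 v2] /=; ring.
  have imE : ip (fun z => Complex c1 c2 * u z + v z) =
      (fun y => c1 * ip u y + c2 * rp u y + ip v y).
    by apply/funext => y /=; case: (u y) (v y) => u1 u2 [v1 v2] /=; ring.
  rewrite /complex_kernel_op reE imE e1 e2 e3 e4.
  by congr (Complex _ _); ring.
- exists (2 * B) => u Lu; have [mr mi] := measurable_kernel_op_parts Lu.
  have /L2P[mr' mi' _ _] := Lu.
  rewrite !L2normE//; apply: poweR_half_le; rewrite ?csqint_ge0//.
    by apply: mulr_ge0 => //; exact: ltW.
  exact: csqint_kernel_op.
Qed.

End compactness.

Section compact_kernel_operator.
Context {R : realType} (d : nat) {n : nat}.
Local Notation E := 'rV[R]_n.
Local Notation Om := (@Omega_measure R d n).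
Local Notation rp f := (@complex.Re R \o f).
Local Notation ip f := (@complex.Im R \o f).
Variables (k1 k2 : E * E -> R) (B : R).
Hypotheses (B0 : 0 < B) (s1 : schur_bounded Om k1 B) (s2 : schur_bounded Om k2 B).
Local Notation T := (complex_kernel_op d k1 k2).

Let mk1 : measurable_fun setT k1. Proof. by have [] := s1. Qed.
Let mk2 : measurable_fun setT k2. Proof. by have [] := s2. Qed.

Lemma sqint_kernel_opB k f g : schur_bounded Om k B ->
  measurable_fun setT f -> measurable_fun setT g ->
  (sqint Om f < +oo)%E -> (sqint Om g < +oo)%E ->
  sqint Om (fun x => kernel_op Om k f x - kernel_op Om k g x) =
  sqint Om (kernel_op Om k (fun y => f y - g y)).
Proof.
move=> sk mf mg fy gy; have [mk _ _] := sk.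
have [i1 _] := schur_test B0 sk mf fy; have [i2 _] := schur_test B0 sk mg gy.
have mo h : measurable_fun setT h -> measurable_fun setT (kernel_op Om k h).
  exact: measurable_kernel_op.
have E1 : {ae Om, forall x, kernel_op Om k f x - kernel_op Om k g x =
    kernel_op Om k (fun y => f y - g y) x}.
  apply: filterS2 i1 i2 => x j1 j2; rewrite /kernel_op -(RintegralB measurableT j1 j2).
  by apply: eq_Rintegral => y _; rewrite /= mulrBr.
have mfg : measurable_fun setT (fun y => f y - g y) by exact: measurable_funB.
have m1 : measurable_fun setT (fun x => kernel_op Om k f x - kernel_op Om k g x).
  by apply: measurable_funB; exact: mo.
have m2 := mo _ mfg.
apply/eqP; rewrite eq_le; apply/andP; split; apply: le_sqint => //.
  by apply: filterS E1 => x ->.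
by apply: filterS E1 => x ->.
Qed.

Lemma sqintB_le (f1 f2 g1 g2 : E -> R) (e : R) : measurable_fun setT f1 -> measurable_fun setT f2 ->
  measurable_fun setT g1 -> measurable_fun setT g2 ->
  (sqint Om (fun x => f1 x - f2 x)%R <= e%:E)%E -> (sqint Om (fun x => g1 x - g2 x)%R <= e%:E)%E ->
  (sqint Om (fun x => (f1 x - g1 x) - (f2 x - g2 x))%R <= (4 * e)%:E)%E /\
  (sqint Om (fun x => (f1 x + g1 x) - (f2 x + g2 x))%R <= (4 * e)%:E)%E.
Proof.
move=> mf1 mf2 mg1 mg2 fe ge.
have mf : measurable_fun setT (fun x => f1 x - f2 x) by exact: measurable_funB.
have mg : measurable_fun setT (fun x => g1 x - g2 x) by exact: measurable_funB.
have le4 : (2%:E * sqint Om (fun x => f1 x - f2 x)%R + 2%:E * sqint Om (fun x => g1 x - g2 x)%R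
    <= (4 * e)%:E)%E.
  rewrite (_ : 4 * e = 2 * e + 2 * e); last by ring.
  by rewrite (EFinD (2 * e) (2 * e)) (EFinM 2 e); apply: leeD; apply: lee_wpmul2l.
split.
  apply: le_trans le4; rewrite (_ : (fun x => _) = (fun x => (f1 x - f2 x) - (g1 x - g2 x))).
    exact: sqintB.
  by apply/funext => x; ring.
apply: le_trans le4; rewrite (_ : (fun x => _) = (fun x => (f1 x - f2 x) + (g1 x - g2 x))).
  exact: sqintD.
by apply/funext => x; ring.
Qed.

Variable U : set_system nat.
Context {UU : UltraFilter U}.
Hypotheses (Uoo : \oo `<=` U) (c1 : ultra_compact Om U k1) (c2 : ultra_compact Om U k2).

(** Along [U] the images of a bounded sequence are Cauchy, at every precision; a
    diagonal subsequence has the rate that [riesz_fischer] requires. *)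
Lemma kernel_op_subsequence (u : nat -> E -> R[i]) : (forall k, L2 d (u k)) ->
  (exists C : R, forall k, (L2norm d (u k) <= C%:E)%E) ->
  exists s : nat -> nat, {homo s : i j / (i < j)%N} /\ forall k l, (k <= l)%N ->
    (sqint Om (fun x => complex.Re (T (u (s k)) x) - complex.Re (T (u (s l)) x))%R <= (4^-1 ^+ k)%:E)%E /\
    (sqint Om (fun x => complex.Im (T (u (s k)) x) - complex.Im (T (u (s l)) x))%R <= (4^-1 ^+ k)%:E)%E.
Proof.
move=> Lu [C uC].
have mr i : measurable_fun setT (rp (u i)) by have /L2P[] := Lu i.
have mi i : measurable_fun setT (ip (u i)) by have /L2P[] := Lu i.
have ry i : (sqint Om (rp (u i)) < +oo)%E by have /L2P[] := Lu i.
have iy i : (sqint Om (ip (u i)) < +oo)%E by have /L2P[] := Lu i.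
have cC i : (csqint d (u i) <= (C ^+ 2)%:E)%E.
  by apply: poweR_half_inv; rewrite ?csqint_ge0// -L2normE//; exact: uC.
have rC i : (sqint Om (rp (u i)) <= (C ^+ 2)%:E)%E.
  by apply: le_trans (cC i); rewrite leeDl// sqint_ge0.
have iC i : (sqint Om (ip (u i)) <= (C ^+ 2)%:E)%E.
  by apply: le_trans (cC i); rewrite leeDr// sqint_ge0.
pose e k : R := 4^-1 ^+ k / 4.
have e0 k : 0 < e k by rewrite divr_gt0// exprn_gt0// invr_gt0.
have Uset k : exists A, U A /\ forall i j, A i -> A j ->
  [/\ (sqint Om (fun x => kernel_op Om k1 (rp (u i)) x - kernel_op Om k1 (rp (u j)) x)%R <= (e k)%:E)%E,
      (sqint Om (fun x => kernel_op Om k1 (ip (u i)) x - kernel_op Om k1 (ip (u j)) x)%R <= (e k)%:E)%E,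
      (sqint Om (fun x => kernel_op Om k2 (rp (u i)) x - kernel_op Om k2 (rp (u j)) x)%R <= (e k)%:E)%E &
      (sqint Om (fun x => kernel_op Om k2 (ip (u i)) x - kernel_op Om k2 (ip (u j)) x)%R <= (e k)%:E)%E].
  have [A1 UA1 h1] := c1 mr rC (e0 k); have [A2 UA2 h2] := c1 mi iC (e0 k).
  have [A3 UA3 h3] := c2 mr rC (e0 k); have [A4 UA4 h4] := c2 mi iC (e0 k).
  exists ((A1 `&` A2) `&` (A3 `&` A4)); split; first by apply: filterI; exact: filterI.
  move=> i j [[a1 a2] [a3 a4]] [[b1 b2] [b3 b4]].
  by split; rewrite sqint_kernel_opB//; [exact: h1|exact: h2|exact: h3|exact: h4].
pose A k := projT1 (cid (Uset k)).
have UA k : U (A k) := (projT2 (cid (Uset k))).1.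
have [s [shomo sA]] := ultra_subsequence UU Uoo UA.
exists s; split=> // k l kl.
have [h1 h2 h3 h4] := (projT2 (cid (Uset k))).2 (s k) (s l) (sA k k (leqnn k)) (sA k l kl).
have mo (h : E * E -> R) f : measurable_fun setT h -> measurable_fun setT f ->
    measurable_fun setT (kernel_op Om h f) by exact: measurable_kernel_op.
have m1r i := mo _ _ mk1 (mr i); have m1i i := mo _ _ mk1 (mi i).
have m2r i := mo _ _ mk2 (mr i); have m2i i := mo _ _ mk2 (mi i).
have -> : 4^-1 ^+ k = 4 * e k :> R by rewrite /e; field.
split; first exact: (sqintB_le (m1r _) (m1r _) (m2i _) (m2i _) h1 h4).1.
exact: (sqintB_le (m1i _) (m1i _) (m2r _) (m2r _) h2 h3).2.
Qed.

Lemma kernel_op_compact : compact_operator d T.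
Proof.
split; first exact: (kernel_op_bounded B0).
move=> u Lu uC; have [s [shomo sC]] := kernel_op_subsequence Lu uC.
have LT k := L2_kernel_op B0 s1 s2 (Lu (s k)).
have mr k : measurable_fun setT (rp (T (u (s k)))) by have /L2P[] := LT k.
have mi k : measurable_fun setT (ip (T (u (s k)))) by have /L2P[] := LT k.
have [wr mwr wrC] := riesz_fischer mr (fun k l kl => (sC k l kl).1).
have [wi mwi wiC] := riesz_fischer mi (fun k l kl => (sC k l kl).2).
have fin (h w : E -> R) : measurable_fun setT h -> measurable_fun setT w -> (sqint Om h < +oo)%E ->
    (sqint Om (fun x => h x - w x)%R <= (4^-1 ^+ 0)%:E)%E -> (sqint Om w < +oo)%E.
  move=> mh mw hy hw; have mhw : measurable_fun setT (fun x => h x - w x) by exact: measurable_funB.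
  have := sqintB Om mh mhw; rewrite (_ : (fun x => h x - (h x - w x)) = w); last first.
    by apply/funext => x; ring.
  move=> /le_lt_trans; apply; apply: lte_add_pinfty; apply: lte_mul_pinfty => //.
  by apply: le_lt_trans hw _; exact: ltry.
exists s, (fun x => Complex (wr x) (wi x)); split => //.
  apply/L2P; have /L2P[_ _ ry iy] := LT 0%N.
  by split=> //; [exact: (fin _ _ (mr 0%N) _ _ (wrC 0%N))|exact: (fin _ _ (mi 0%N) _ _ (wiC 0%N))].
pose v k x := T (u (s k)) x - Complex (wr x) (wi x).
have vr k : rp (v k) = (fun x => rp (T (u (s k))) x - wr x).
  by apply/funext => x; rewrite /v /=; case: (T (u (s k)) x).
have vi k : ip (v k) = (fun x => ip (T (u (s k))) x - wi x).
  by apply/funext => x; rewrite /v /=; case: (T (u (s k)) x).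
have mvr k : measurable_fun setT (rp (v k)) by rewrite vr; exact: measurable_funB.
have mvi k : measurable_fun setT (ip (v k)) by rewrite vi; exact: measurable_funB.
have vC k : (L2norm d (v k) <= (2 * 2^-1 ^+ k)%:E)%E.
  rewrite L2normE// -[leRHS]mule1 -(poweR1r (2^-1 : R)).
  apply: poweR_half_le; rewrite ?csqint_ge0 ?mule1//.
  apply: (@le_trans _ _ ((4^-1 ^+ k)%:E + (4^-1 ^+ k)%:E)%E).
    by apply: leeD; [rewrite vr; exact: wrC|rewrite vi; exact: wiC].
  rewrite -EFinD lee_fin exprMn -exprM mulnC exprM.
  have -> : 2^-1 ^+ 2 = 4^-1 :> R by field.
  have : 0 <= 4^-1 ^+ k :> R by rewrite exprn_ge0// invr_ge0.
  by move: (4^-1 ^+ k) => a a0; lra.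
apply: (@squeeze_cvge _ _ _ _ (fun=> 0%E) _ (fun k => (2 * 2^-1 ^+ k)%:E)).
- by apply: nearW => k; rewrite vC andbT; exact: Lnorm_ge0.
- exact: cvg_cst.
apply: cvg_EFin; first exact: nearW.
apply: (@cvg_geometric R 2 2^-1).
by rewrite ger0_norm ?invr_ge0// invf_lt1// ltr1n.
Qed.

End compact_kernel_operator.

(** * The compactness theorem *)

Theorem theorem2p5 (R : realType) (d n : nat) (m : R)
    (a : 'rV[R]_n * 'rV[R]_n * 'rV[R]_n -> R[i]) :
  (1 <= d < n)%N ->
  m < 0 ->
  symbol_class d m a ->
  vanishes_at_infinity d (symbol_size m a) ->
  exists T : ('rV[R]_n -> R[i]) -> 'rV[R]_n -> R[i],
    has_amplitude d a T /\ compact_operator d T.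
Proof.
move=> /andP[d1 dn] m0 sa va; have n1 : (1 < n)%N by exact: leq_ltn_trans dn.
have n0 : (0 < n)%N by exact: ltnW.
(* As [2 s <= - m], one half of the order [- 2 s] serves the kernel estimates and
   the other one the rate of convergence of the cutoffs; [q] is large enough for the
   cutoff to absorb [n + 2] powers of the frequency, and the growth of order [- m]
   that the hypothesis at infinity allows. *)
pose s := Num.min (- m) 1 / 2; pose q := (n + Num.trunc (- m)).+2.
have [smm s1] : Num.min (- m) 1 <= - m /\ Num.min (- m) 1 <= 1 by rewrite !ge_min !lexx orbT.
have s0' : 0 < Num.min (- m) 1 by rewrite lt_min oppr_gt0 m0 ltr01.
have s0 : 0 < s by rewrite divr_gt0.
have n1R : 1 < n%:R :> R by rewrite ltr1n.
have sn : s < n%:R by move: s1; rewrite /s; move: (Num.min _ _) s0' => t; lra.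
have s2 : s <= 2 by move: s1; rewrite /s; move: (Num.min _ _) s0' => t; lra.
have sm : s + s <= - m by rewrite /s -splitr.
have qn : (n.+2 <= 2 * q)%N by rewrite /q; lia.
have qm : s - m <= (2 * q)%:R.
  have := truncnS_gt (- m); move: (Num.trunc (- m)) @q qn => t q qn mt.
  rewrite /q mul2n -addnn natrD; have h : t.+1%:R + 1 <= (n + t).+2%:R :> R.
    by rewrite natr1 ler_nat; lia.
  have h1 : 1 <= (n + t).+2%:R :> R by rewrite ler1n.
  by move: h h1 mt s2; move: ((n + t).+2%:R : R) (t.+1%:R : R) => x y; lra.
have g1 := good_re_kernels n0 m0 s0 s2 sn sm qn qm sa va.
have g2 := good_im_kernels n0 m0 s0 s2 sn sm qn qm sa va.
have [B1 B10 b1] := limit_kernel_schur_bounded n0 s0 sn g1.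
have [B2 B20 b2] := limit_kernel_schur_bounded n0 s0 sn g2.
have le1 : B1 <= Num.max B1 B2 by rewrite le_max lexx.
have le2 : B2 <= Num.max B1 B2 by rewrite le_max lexx orbT.
have [U [UU Uoo]] := ultraFilterLemma (F := \oo) _.
exists (complex_kernel_op d (limit_kernel d (re_kernels d q a)) (limit_kernel d (im_kernels d q a))).
split; first exact: kernel_op_has_amplitude n0 m0 s0 s2 sn sm qn qm sa va.
apply: (kernel_op_compact (lt_le_trans B10 le1) (schur_bounded_le le1 b1) (schur_bounded_le le2 b2) Uoo).
  exact: (limit_kernel_ultra_compact n0 s0 sn g1 UU).
exact: (limit_kernel_ultra_compact n0 s0 sn g2 UU).
Qed.
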